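(* Let $T,\varepsilon,\gamma>0$ be fixed, and let $\vartheta$, $F$, the data and the solutions $x^{(N)}$ ($N\ge1$) of the microscopic traffic model with $\zeta=\vartheta$ be as in the context, with interpolants $\rho^N,e_1^N,e_2^N$ as defined there. Then the following convergences hold as $N\to\infty$, up to a (nonrelabelled) subsequence: (a) $x_0^{(N)}\to\underline x$ and $x_N^{(N)}\to\overline x$ uniformly in $[0,T]$; (b) $\rho^N(0)\overset{*}{\rightharpoonup}\rho^0$ and $e_1^N(0)\overset{*}{\rightharpoonup}e_1^0$ weakly$^*$ in $L^\infty(\mathbb{R})$; (c) $\rho^N\overset{*}{\rightharpoonup}\rho$ and $e_k^N\overset{*}{\rightharpoonup}e_k$ weakly$^*$ in $L^\infty((0,T)\times\mathbb{R})$, for $k=1,2$; (d) $\frac{e_1^N}{\vartheta(\rho^N)}\,dt\,dx\overset{*}{\rightharpoonup}\lambda$ weakly$^*$ in $\mathcal{M}([0,T]\times\mathbb{R})$, for some limit objects $\underline x,\overline x,\rho^0,e_1^0,\rho,e_1,e_2,\lambda$. Moreover, $\rho^0$ and $e_1^0$ are nonnegative and have compact support, $\|\rho^0\|_{L^\infty(\mathbb{R})}\le\bar\rho$, and the limit quadruple $(\rho,e_1,e_2,\lambda)$ is a measure solution (in the sense defined in the context) to the macroscopic traffic model with initial data $(\rho^0,e_1^0)$. Finally, the (essential) supports of the four limit objects $\rho,e_1,e_2,\lambda$ are contained in the set $$\bigcup_{t\in[0,T]}\{t\}\times[\underline x(t),\overline x(t)].$$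
   Context: Notation: $a\vee b=\max\{a,b\}$; $\mathrm{int}$ is the interior; $\mathbf 1_A$ is the indicator function of $A$; $C^{0,1}$ denotes Lipschitz functions; $\mathcal{M}([0,T]\times\mathbb{R})$ is the set of Radon measures on $[0,T]\times\mathbb{R}$ and a superscript $^+$ denotes nonnegative elements. Assumptions on the nonlinearities (independent of $N$). $\vartheta\in C^0([0,\infty))$ is nonnegative, there is $\bar\rho>0$ with $\vartheta(r)=0$ if and only if $r\ge\bar\rho$, and $\vartheta$ is Lipschitz continuous near $\bar\rho$. $F\in C^0([0,T]\times\mathbb{R})$ is positive, and $x\mapsto F(t,x)$ is Lipschitz continuous in $\mathbb{R}$ uniformly with respect to $t\in[0,T]$. The alertness function $\zeta$ of the model is taken equal to $\vartheta$. Data for each $N\ge1$. Initial positions $x_0^{0(N)}<\dots<x_N^{0(N)}$ with $\rho_i^{0(N)}:=\frac{1}{N(x_{i+1}^{0(N)}-x_i^{0(N)})}\le\bar\rho$ for $i=0,\dots,N-1$; $\Sigma^{0(N)}:=\{i\in\{0,\dots,N-1\}:\rho_i^{0(N)}=\bar\rho\}$; initial velocities $v_i^{0(N)}\ge0$ for $i\in\{0,\dots,N-1\}\setminus\Sigma^{0(N)}$ (written $i\notin\Sigma^{0(N)}$); a given leader trajectory $x_N^{(N)}\in C^1([0,T])$, nondecreasing, with $x_N^{(N)}(0)=x_N^{0(N)}$ and $\dot x_N^{(N)}(t)>0$ for all $t\in(0,T]$. There are constants $s,S,C_0>0$ independent of $N$ such that $$s\le x_0^{0(N)}\le x_N^{(N)}(T)\le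 S,\qquad\sup_{i\notin\Sigma^{0(N)}}v_i^{0(N)}\le C_0,\qquad\sup_{t\in[0,T]}\dot x_N^{(N)}(t)\le C_0.$$ Microscopic solutions. For each $N$, $x^{(N)}=(x_0^{(N)},\dots,x_{N-1}^{(N)})\in C^{0,1}([0,T];\mathbb{R}^N)$ is a solution of the microscopic traffic model with $\zeta=\vartheta$; that is, with $\rho_i^{(N)}(t):=\frac{1}{N(x_{i+1}^{(N)}(t)-x_i^{(N)}(t))}$, for every $i=0,\dots,N-1$ (superscripts $(N)$ omitted): (1) $x_i(0)=x_i^0$; (2) $x_i$ is nondecreasing in $[0,T]$; (3) $x_i(t)<x_{i+1}(t)$ and $\rho_i(t)\le\bar\rho$ for all $t\in[0,T]$; (4) $x_i$ is $C^2$ in the relatively open set $\{t\in[0,T]:\rho_i(t)<\bar\rho\}$, where $\varepsilon\vartheta(\rho_i(t))\ddot x_i(t)+\gamma\dot x_i(t)=\vartheta(\rho_i(t))F(t,x_i(t))$; (5) $x_i$ is $C^1$ in $\mathrm{int}\{t\in[0,T]:\rho_i(t)=\bar\rho\}$, where $\gamma\dot x_i(t)=\vartheta(\rho_i(t))F(t,x_i(t))$; (6) $\dot x_i(0)=v_i^0$ if $i\notin\Sigma^0$. In addition, $x^{(N)}$ satisfies, for a.e. $t\in(0,T)$ and $i=0,\dots,N-1$, $$\dot x_i^{(N)}(t)\le\widetilde v_i^{0(N)}\vee\Big(\tfrac{\bar\vartheta}{\gamma}\max_{[0,T]\times[x_0^{0(N)},x_N^{(N)}(T)]}F\Big),$$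 where $\widetilde v_i^{0(N)}=v_i^{0(N)}$ if $i\notin\Sigma^{0(N)}$, $\widetilde v_i^{0(N)}=0$ if $i\in\Sigma^{0(N)}$, and $\bar\vartheta=\max_{[0,\bar\rho]}\vartheta$. (Such solutions exist; under these assumptions they belong to $C^1([0,T];\mathbb{R}^N)\cap C^2((0,T];\mathbb{R}^N)$ and satisfy $\rho_i^{(N)}(t)<\bar\rho$ for $t\in(0,T]$, so the quantities below are well defined.) Interpolants. For $(t,x)\in[0,T]\times\mathbb{R}$ (superscripts $(N)$ omitted on the right): $$\rho^N(t,x):=\sum_{i=0}^{N-1}\rho_i(t)\mathbf 1_{[x_i(t),x_{i+1}(t))}(x),\qquad e_1^N(t,x):=\sum_{i=0}^{N-1}\rho_i(t)\dot x_i(t)\mathbf 1_{[x_i(t),x_{i+1}(t))}(x),$$ $$e_2^N(t,x):=\sum_{i=0}^{N-1}\rho_i(t)\dot x_i(t)\Big(\dot x_i(t)+\frac{\dot x_{i+1}(t)-\dot x_i(t)}{x_{i+1}(t)-x_i(t)}(x-x_i(t))\Big)\mathbf 1_{[x_i(t),x_{i+1}(t))}(x).$$ Measure solution. Given $(\rho^0,e_1^0)\in(L^\infty(\mathbb{R})^+)^2$ with compact support, $(\rho,e_1,e_2,\lambda)$ is a measure solution to the macroscopic traffic model with initial data $(\rho^0,e_1^0)$ if: (i) $\rho,e_1,e_2\in L^\infty((0,T)\times\mathbb{R})^+$ and $\lambda\in\mathcal{M}([0,T]\times\mathbb{R})^+$; (ii) $\|\rho\|_{L^\infty((0,T)\times\mathbb{R})}\le\bar\rho$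 and the (essential) supports of $\rho,e_1,e_2,\lambda$ are compact; (iii) for all $\varphi\in C^1([0,T]\times\mathbb{R})$ with $\varphi(T)\equiv0$, $$\int_0^T\!\!\int_{\mathbb{R}}(\rho\,\partial_t\varphi+e_1\,\partial_x\varphi)\,dx\,dt=-\int_{\mathbb{R}}\rho^0\varphi(0)\,dx,$$ $$\varepsilon\int_0^T\!\!\int_{\mathbb{R}}(e_1\,\partial_t\varphi+e_2\,\partial_x\varphi)\,dx\,dt-\gamma\int_{[0,T]\times\mathbb{R}}\varphi\,d\lambda=-\varepsilon\int_{\mathbb{R}}e_1^0\varphi(0)\,dx-\int_0^T\!\!\int_{\mathbb{R}}\rho F\varphi\,dx\,dt.$$ *)

(* Defs.v *)
From HB Require Import structures.
From mathcomp Require Import all_boot all_order all_algebra.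
From mathcomp Require Import all_classical all_reals all_analysis.

Set Implicit Arguments.
Unset Strict Implicit.
Unset Printing Implicit Defensive.
Import Order.TTheory GRing.Theory Num.Theory.
Import numFieldNormedType.Exports.

Local Open Scope classical_set_scope.
Local Open Scope ring_scope.

Section calculus_on_sets.
Context {R : realType}.
Implicit Types (A B : set R) (f : R -> R) (t : R).

(* Derivatives relative to a set: one-sided at the end points of an interval
   and independent of the values of f outside A. *)
Definition derivable_in A f t : Prop :=
  cvg ((s - t)^-1 * (f s - f t) @[s --> within A t^']).

Definition deriv_in A f t : R :=
  lim ((s - t)^-1 * (f s - f t) @[s --> within A t^']).

(* f is C^1 in B, a relatively open subset of A. *)
Definition C1_in A f B : Prop :=
  (forall t, B t -> derivable_in A f t) /\
  {within B, continuous (deriv_in A f)}.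

Definition C2_in A f B : Prop := C1_in A f B /\ C1_in A (deriv_in A f) B.

End calculus_on_sets.

Section function_and_measure_spaces.
Local Open Scope ereal_scope.
Context {R : realType}.

Section Linfty.
Context d (T : measurableType d) (mu : {measure set T -> \bar R}).
Implicit Types (D : set T) (f : T -> R).

(* The norm of L^oo(D) is that of L^oo for the extension by 0. *)
Definition Linfty_norm D f : \bar R := 'N[mu]_+oo [EFin \o (f \_ D)].

Definition mem_Linfty D f : Prop :=
  measurable_fun D f /\ Linfty_norm D f < +oo.

Definition ae_ge0 D f : Prop := {ae mu, forall p, D p -> (0 <= f p)%R}.

Definition cvg_weakstar_Linfty D (u : nat -> T -> R) f : Prop :=
  [/\ forall n, mem_Linfty D (u n),
      mem_Linfty D f
    & forall g : T -> R, mu.-integrable D (EFin \o g) ->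
      (\int[mu]_(p in D) (u n p * g p) @[n --> \oo] -->
       \int[mu]_(p in D) (f p * g p))%R].

End Linfty.

(* Essential support, relative to the filter [ae] of sets of full measure, of a
   function on D. It is a closed subset of the ambient space T, not of D: the
   compactness of the support of an element of L^oo(]0, T[ x R) is that of a
   subset of [0, T] x R. *)
Definition ess_supp (T : topologicalType) (ae : set_system T) (D : set T)
    (f : T -> R) : set T :=
  [set p | forall U, open U -> U p ->
    ~ (\forall q \near ae, D q -> U q -> f q = 0%R)].

Definition planar_measure : Type :=
  {measure set (measurableTypeR R * measurableTypeR R) -> \bar R}.

Definition leb : {measure set (measurableTypeR R) -> \bar R} :=
  @lebesgue_measure R.

Definition leb2 : planar_measure := leb \x leb.

(* Nonnegative Radon measures on a closed set X of the plane, as locally finite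
   Borel measures on the plane that vanish outside X. *)
Definition radon_on (X : set (R * R)) (lam : planar_measure) : Prop :=
  lam (~` X) = 0 /\ (forall K : set (R * R), compact K -> lam K < +oo).

Definition measure_supp (lam : planar_measure) : set (R * R) :=
  [set p | forall U : set (R * R), open U -> U p -> lam U != 0].

(* Weak* convergence of h n dt dx to lam in the space of Radon measures on X,
   in duality with continuous functions on X with compact support. *)
Definition cvg_weakstar_density (X : set (R * R)) (h : nat -> R * R -> R)
    (lam : planar_measure) : Prop :=
  [/\ forall n (K : set (R * R)), compact K -> K `<=` X ->
        leb2.-integrable K (EFin \o h n),
      radon_on X lam
    & forall psi : R * R -> R, {within X, continuous psi} ->
      (exists K : set (R * R), [/\ compact K, K `<=` X &
         forall p, X p -> ~ K p -> psi p = 0%R]) ->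
      (\int[leb2]_(p in X) (psi p * h n p) @[n --> \oo] -->
       \int[lam]_(p in X) psi p)%R].

End function_and_measure_spaces.

Section traffic.
Context {R : realType}.
Implicit Types (T eps gam rhobar t : R) (theta : R -> R) (F : R * R -> R).

Definition strip T : set (R * R) := `[0, T] `*` setT.
Definition open_strip T : set (R * R) := `]0, T[ `*` setT.

Record nonlinearity_assumptions T theta rhobar F : Prop := {
  theta_continuous : {within `[0, +oo[, continuous theta} ;
  theta_ge0 : forall r, 0 <= r -> 0 <= theta r ;
  rhobar_gt0 : 0 < rhobar ;
  theta_eq0 : forall r, 0 <= r -> (theta r = 0 <-> rhobar <= r) ;
  theta_lipschitz : exists2 e : R, 0 < e &
    [lipschitz theta r | r in (ball rhobar e `&` `[0, +oo[)] ;
  F_continuous : {within strip T, continuous F} ;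
  F_gt0 : forall p, strip T p -> 0 < F p ;
  F_lipschitz : exists L : R, forall t, `[0, T]%classic t ->
    forall y z, `|F (t, y) - F (t, z)| <= L * `|y - z| }.

Section microscopic.
Implicit Types (N i : nat) (x : nat -> R -> R).

Definition density N (y : nat -> R) i : R := (N%:R * (y i.+1 - y i))^-1.

Definition rho_ N x i t : R := density N (x ^~ t) i.

Definition Sigma0 rhobar N (x0 : nat -> R) : set nat :=
  [set i | (i < N)%N /\ density N x0 i = rhobar].

Definition vel T (f : R -> R) : R -> R := deriv_in `[0, T] f.

Record data_assumptions T rhobar N (x0 v0 : nat -> R) (xN : R -> R) : Prop := {
  x0_increasing : forall i, (i < N)%N -> x0 i < x0 i.+1 ;
  density0_le : forall i, (i < N)%N -> density N x0 i <= rhobar ;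
  v0_ge0 : forall i, (i < N)%N -> ~ Sigma0 rhobar N x0 i -> 0 <= v0 i ;
  leader_C1 : C1_in `[0, T] xN `[0, T] ;
  leader_nondecreasing : {in `[0, T] &, {homo xN : t u / t <= u}} ;
  leader_init : xN 0 = x0 N ;
  leader_vel_gt0 : forall t, `]0, T]%classic t -> 0 < vel T xN t }.

Record data_bounds T rhobar (s S C0 : R) N (x0 v0 : nat -> R)
    (xN : R -> R) : Prop := {
  s_le : s <= x0 0%N ;
  x0_le_xN : x0 0%N <= xN T ;
  le_S : xN T <= S ;
  v0_le : forall i, (i < N)%N -> ~ Sigma0 rhobar N x0 i -> v0 i <= C0 ;
  leader_vel_le : forall t, `[0, T]%classic t -> vel T xN t <= C0 }.

(* x 0, ..., x N.-1 are the unknowns and x N is the leader. *)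
Record microscopic_solution T eps gam theta rhobar F N (x0 v0 : nat -> R)
    x : Prop := {
  sol_lipschitz : forall i, (i < N)%N -> [lipschitz x i t | t in `[0, T]] ;
  sol_init : forall i, (i < N)%N -> x i 0 = x0 i ;
  sol_nondecreasing : forall i, (i < N)%N ->
    {in `[0, T] &, {homo x i : t u / t <= u}} ;
  sol_ordered : forall i t, (i < N)%N -> `[0, T]%classic t ->
    x i t < x i.+1 t /\ rho_ N x i t <= rhobar ;
  sol_free_C2 : forall i, (i < N)%N ->
    C2_in `[0, T] (x i) [set t | `[0, T]%classic t /\ rho_ N x i t < rhobar] ;
  sol_free_ode : forall i t, (i < N)%N -> `[0, T]%classic t ->
    rho_ N x i t < rhobar ->
    eps * theta (rho_ N x i t) * vel T (vel T (x i)) t + gam * vel T (x i) t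
      = theta (rho_ N x i t) * F (t, x i t) ;
  sol_jam_C1 : forall i, (i < N)%N ->
    C1_in `[0, T] (x i)
      ([set t | `[0, T]%classic t /\ rho_ N x i t = rhobar]°) ;
  sol_jam_ode : forall i t, (i < N)%N ->
    ([set t | `[0, T]%classic t /\ rho_ N x i t = rhobar]°) t ->
    gam * vel T (x i) t = theta (rho_ N x i t) * F (t, x i t) ;
  sol_init_vel : forall i, (i < N)%N -> ~ Sigma0 rhobar N x0 i ->
    vel T (x i) 0 = v0 i }.

Definition vtilde0 rhobar N (x0 v0 : nat -> R) i : R :=
  if `[< Sigma0 rhobar N x0 i >] then 0 else v0 i.

(* The two suprema are maxima of continuous functions on compact sets. *)
Definition velocity_bound T gam theta rhobar F N (x0 v0 : nat -> R) x : Prop :=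
  {ae leb, forall t, `]0, T[%classic t -> forall i, (i < N)%N ->
    vel T (x i) t <=
      Num.max (vtilde0 rhobar N x0 v0 i)
        (sup [set theta r | r in `[0, rhobar]] / gam *
         sup [set F p | p in `[0, T] `*` `[x0 0%N, x N T]])}.

Definition cell x i t : set R := `[x i t, x i.+1 t[.

Definition rhoN N x (p : R * R) : R :=
  \sum_(i < N) rho_ N x i p.1 * \1_(cell x i p.1) p.2.

Definition e1N T N x (p : R * R) : R :=
  \sum_(i < N) rho_ N x i p.1 * vel T (x i) p.1 * \1_(cell x i p.1) p.2.

Definition e2N T N x (p : R * R) : R :=
  \sum_(i < N) rho_ N x i p.1 * vel T (x i) p.1 *
    (vel T (x i) p.1 +
     (vel T (x i.+1) p.1 - vel T (x i) p.1) / (x i.+1 p.1 - x i p.1) *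
       (p.2 - x i p.1)) *
    \1_(cell x i p.1) p.2.

End microscopic.

Section macroscopic.
Implicit Types (phi rho : R * R -> R).

Definition dt T phi (p : R * R) : R :=
  deriv_in `[0, T] (fun s => phi (s, p.2)) p.1.
Definition dx phi (p : R * R) : R := derive1 (fun y => phi (p.1, y)) p.2.

(* C^1([0, T] x R), with regularity up to the boundary. *)
Definition C1_strip T phi : Prop :=
  [/\ {within strip T, continuous phi},
      forall p, strip T p -> derivable_in `[0, T] (fun s => phi (s, p.2)) p.1,
      forall p, strip T p -> derivable (fun y => phi (p.1, y)) p.2 1,
      {within strip T, continuous (dt T phi)}
    & {within strip T, continuous (dx phi)}].

Definition macroscopic_data (rho0 e10 : R -> R) : Prop :=
  [/\ mem_Linfty leb setT rho0 /\ mem_Linfty leb setT e10,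
      ae_ge0 leb setT rho0 /\ ae_ge0 leb setT e10,
      compact (ess_supp (almost_everywhere leb) setT rho0)
    & compact (ess_supp (almost_everywhere leb) setT e10)].

Definition supp_on T (f : R * R -> R) : set (R * R) :=
  ess_supp (almost_everywhere leb2) (open_strip T) f.

Definition mass_equation T (rho0 : R -> R) rho (e1 : R * R -> R) : Prop :=
  forall phi, C1_strip T phi -> (forall y, phi (T, y) = 0) ->
  \int[leb2]_(p in open_strip T) (rho p * dt T phi p + e1 p * dx phi p)
  = - \int[leb]_y (rho0 y * phi (0, y)).

Definition momentum_equation T eps gam F (e10 : R -> R) rho (e1 e2 : R * R -> R)
    (lam : planar_measure) : Prop :=
  forall phi, C1_strip T phi -> (forall y, phi (T, y) = 0) ->
  eps * \int[leb2]_(p in open_strip T) (e1 p * dt T phi p + e2 p * dx phi p)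
    - gam * \int[lam]_(p in strip T) phi p
  = - (eps * \int[leb]_y (e10 y * phi (0, y)))
    - \int[leb2]_(p in open_strip T) (rho p * F p * phi p).

Record measure_solution T eps gam rhobar F (rho0 e10 : R -> R)
    rho (e1 e2 : R * R -> R)    (lam : planar_measure) : Prop := {
  rho_Linfty : mem_Linfty leb2 (open_strip T) rho ;
  e1_Linfty : mem_Linfty leb2 (open_strip T) e1 ;
  e2_Linfty : mem_Linfty leb2 (open_strip T) e2 ;
  rho_ge0 : ae_ge0 leb2 (open_strip T) rho ;
  e1_ge0 : ae_ge0 leb2 (open_strip T) e1 ;
  e2_ge0 : ae_ge0 leb2 (open_strip T) e2 ;
  lam_radon : radon_on (strip T) lam ;
  rho_le : (Linfty_norm leb2 (open_strip T) rho <= rhobar%:E)%E ;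
  rho_supp : compact (supp_on T rho) ;
  e1_supp : compact (supp_on T e1) ;
  e2_supp : compact (supp_on T e2) ;
  lam_supp : compact (measure_supp lam) ;
  mass_eq : mass_equation T rho0 rho e1 ;
  momentum_eq : momentum_equation T eps gam F e10 rho e1 e2 lam }.

End macroscopic.
End traffic.

(* Main.v *)
(* Theta is Lipschitz near rhobar, so a free vehicle with velocity v and gap y to
   the jammed distance satisfies v' <= M - c v / y and y' >= - v: then
   v - c ln y - M t is nonincreasing, y cannot vanish and jams occur only at
   t = 0.  Hence the velocities are continuous on [0, T] and bounded by a
   constant W, and integrating the equation of motion bounds the integrals of
   v_i / theta(rho_i) uniformly in i and N.
   A diagonal extraction on countably many numbers (masses of dyadic cells and
   of products of rational half-lines) yields the limits: the densities
   dominated by a constant are found by Radon-Nikodym, and lambda, whose mass is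
   only bounded, is the image of Lebesgue measure under a quantile map.
   The limit equations come from differentiating N^-1 sum_i phi(t, x_i) and
   N^-1 sum_i eps v_i phi(t, midpoint_i): phi is almost constant on most cells,
   and the error on the singular term is controlled by telescoping. *)
Require Import Defs.
From HB Require Import structures.
From mathcomp Require Import all_boot all_order all_algebra.
From mathcomp Require Import all_classical all_reals all_analysis.
From mathcomp Require Import measurable_realfun zify ring lra.

Set Implicit Arguments.
Unset Strict Implicit.
Unset Printing Implicit Defensive.
Import Order.TTheory GRing.Theory Num.Theory.
Import numFieldNormedType.Exports.

Local Open Scope classical_set_scope.
Local Open Scope ring_scope.

(** * Calculus on the real line *)

Section calculus.
Context {R : realType}.

(** Two obstacles shape the estimates. A single cell need not become small as N grows: only the sum
    of the gaps is bounded, by S - s. And the derivatives of a test function are merely continuous.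
    Both are met by the affine modulus eta + K |y - z|, available on compact sets for every eta > 0:
    averaged over the cells it costs eta + K (S - s) / N, so N tends to infinity for fixed eta, and
    eta to 0 afterwards. The singular term gam v_i / theta(rho_i) is bounded in L^1 only; for it the
    same modulus requires the sum over i of the integrals of (v_i / theta(rho_i)) (x_(i+1) - x_i) to
    be bounded independently of N. This comes from differentiating eps v_i (x_(i+1) - x_i), which
    involves the acceleration of the follower alone; that of the leader need not exist. At t = 0 the
    equation of a jammed vehicle degenerates. There the gap is at most W t, which turns the damping
    into one of order v / t and forces v = O(t). Some constants of this analysis depend on N, but it
    only serves regularity: the bounds kept for the limit do not. *)

Lemma within_continuousP (V W : pseudoMetricNormedZmodType R) (A : set V)
    (f : V -> W) :
  {within A, continuous f} <->
  (forall x, A x -> forall e, 0 < e -> exists2 d : R, 0 < d &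
     forall y, A y -> `|x - y| < d -> `|f x - f y| < e).
Proof.
rewrite subspace_continuousP; split=> H x Ax.
  move=> e e0; have /cvgrPdist_lt /(_ e e0) := H x Ax.
  rewrite /prop_near1 /= /within /=.
  move=> /nbhs_ballP[d d0 Hd]; exists d => // y Ay xy.
  by apply: Hd => //; rewrite -ball_normE.
apply/cvgrPdist_lt => e e0; have [d d0 Hd] := H x Ax e e0.
rewrite /prop_near1 /= /within /=; apply/nbhs_ballP; exists d => // y.
by rewrite -ball_normE /= => xy Ay; exact: Hd.
Qed.

Lemma dnbhs_shift (t : R) : t^' = (fun h => h + t) @ 0^'.
Proof.
apply/seteqP; split=> P.
  rewrite /dnbhs /within /= => /nbhs_ballP[e e0 He].
  apply/nbhs_ballP; exists e => // h; rewrite -ball_normE /= sub0r normrN => hh h0.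
  apply: He; last by rewrite addrC -subr_eq0 addrAC subrr add0r.
  by rewrite -ball_normE /= opprD addrCA subrr addr0 normrN.
rewrite /nbhs /= /dnbhs /within /= => /nbhs_ballP[e e0 He].
apply/nbhs_ballP; exists e => // s; rewrite -ball_normE /= => hh h0.
have := He (s - t); rewrite subrK -ball_normE /= sub0r opprB; apply => //.
by rewrite subr_eq0.
Qed.

Lemma within_dnbhs_nbhs (A : set R) (t : R) : nbhs t A ->
  within A t^' = t^'.
Proof.
move=> At; apply/seteqP; split=> P; rewrite /dnbhs /within /=.
  by move=> H; apply: filterS2 At H => s As H st; exact: H.
by move=> H; apply: filterS H => s H st _; exact: H.
Qed.

Lemma diff_quotient_shift (f : R -> R) (t : R) :
  ((s - t)^-1 * (f s - f t) @[s --> t^'] =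
   h^-1 *: (f (h + t) - f t) @[h --> 0^'])%classic.
Proof.
rewrite dnbhs_shift -fmap_comp.
set g := (_ \o _).
suff -> : g = (fun h : R => h^-1 *: (f (h + t) - f t)) by [].
by apply/funext => h; rewrite /g /= addrK.
Qed.

Lemma deriv_in_derive1 (A : set R) (f : R -> R) (t : R) : nbhs t A ->
  deriv_in A f t = derive1 f t.
Proof.
by move=> At; rewrite /deriv_in (within_dnbhs_nbhs At) diff_quotient_shift.
Qed.

Lemma derivable_in_derivable (A : set R) (f : R -> R) (t : R) : nbhs t A ->
  derivable_in A f t -> derivable f t 1.
Proof.
move=> At; rewrite /derivable_in /derivable.
rewrite (within_dnbhs_nbhs At).
rewrite diff_quotient_shift.
suff -> : (fun h : R => h^-1 *: (f (h + t) - f t)) =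
          (fun h : R => h^-1 *: ((f \o shift t) (h *: 1) - f t)) by [].
by apply/funext => h /=; rewrite /= scaler1.
Qed.

Lemma is_derive_deriv_in (A : set R) (f : R -> R) t : nbhs t A ->
  derivable_in A f t -> is_derive t 1 f (deriv_in A f t).
Proof.
move=> At /(derivable_in_derivable At) d.
by rewrite (deriv_in_derive1 f At) derive1E; exact: derivableP.
Qed.

Lemma is_derive_continuous (f : R -> R) (df t : R) : is_derive t 1 f df ->
  {for t, continuous f}.
Proof.
by move=> [d _]; apply/differentiable_continuous/derivable1_diffP.
Qed.

Lemma is_derive_within_continuous (f df : R -> R) (A : set R) :
  (forall t : R, A t -> is_derive t 1 f (df t)) -> {within A, continuous f}.
Proof.
move=> H; apply: continuous_in_subspaceT => t; rewrite inE => /H.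
exact: is_derive_continuous.
Qed.

Lemma le_of_derive_le0 (f df : R -> R) (a b : R) : a <= b ->
  (forall t : R, a <= t <= b -> is_derive t 1 f (df t)) ->
  (forall t : R, a <= t <= b -> df t <= 0) -> f b <= f a.
Proof.
move=> ab Hd H0.
have [||c] := @MVT_segment R f df a b ab.
- by move=> x; rewrite in_itv /= => /andP[ax xb]; apply: Hd; rewrite !ltW.
- by apply: (@is_derive_within_continuous f df) => t /=; rewrite in_itv /=; exact: Hd.
rewrite in_itv /= => /H0 c0 E; rewrite -subr_le0 E; apply: mulr_le0_ge0; [exact: c0|rewrite subr_ge0; exact: ab].
Qed.

(** The infimum of the zeros: near a point where it is positive, [y] stays positive by continuity,
    so the infimum is itself a zero. *)
Lemma first_zero (y : R -> R) a b : a < b -> {within `[a, b], continuous y} ->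
  (forall t : R, a <= t <= b -> 0 <= y t) -> 0 < y a -> y b = 0 ->
  exists c, [/\ a < c <= b, y c = 0 & forall t, a <= t < c -> 0 < y t].
Proof.
move=> ab /within_continuousP yc y0 ya yb.
pose Z := [set t | a <= t <= b /\ y t = 0].
have Zb : Z b by split => //; rewrite lexx ltW.
have Zinf : has_inf Z by split; [exists b | exists a => t [/andP[]]].
pose c := inf Z.
have cb : c <= b by apply: ge_inf => //; case: Zinf.
have ac : a <= c by apply: lb_le_inf; [exists b | move=> t [/andP[]]].
have yc0 : y c = 0.
  apply/eqP/negPn/negP => yne.
  have ypos : 0 < y c by rewrite lt_neqAle eq_sym yne y0// ac.
  have cin : `[a, b]%classic c by rewrite /= in_itv /= ac.
  have [d d0 Hd] := yc c cin (y c) ypos.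
  have [z Zz zc] : exists2 z, Z z & z < c + d by apply: inf_adherent.
  have cz : c <= z by apply: ge_inf => //; case: Zinf.
  case: (Zz) => zab yz.
  have := Hd z; rewrite /= in_itv /= zab yz subr0 (gtr0_norm ypos) => /(_ isT).
  by rewrite ltxx ler0_norm ?subr_le0// opprB ltrBlDl => /(_ zc).
exists c; split=> //.
  rewrite cb andbT lt_neqAle ac andbT; apply/eqP => E.
  by move: ya; rewrite E yc0 ltxx.
move=> t /andP[at_ tc]; rewrite lt_neqAle y0 ?at_ ?(le_trans (ltW tc))// andbT.
apply/eqP => /esym yt; have tb := lt_le_trans tc cb; move: tc; rewrite ltNge => /negP; apply.
apply: ge_inf; first by case: Zinf.
by split => //; rewrite at_ ltW.
Qed.

(* The function v - c ln y - M t is nonincreasing, whereas - c ln y tends to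
   + oo as y tends to 0. *)
Lemma damped_gap_gt0 (y v u dv : R -> R) (a b c M : R) : a < b -> 0 < c ->
  {within `[a, b], continuous y} ->
  (forall t : R, a < t < b -> 0 < y t) ->
  (forall t : R, a < t < b -> 0 <= v t) ->
  (forall t : R, a < t < b -> 0 <= u t) ->
  (forall t : R, a < t < b -> is_derive t 1 y (u t - v t)) ->
  (forall t : R, a < t < b -> is_derive t 1 v (dv t)) ->
  (forall t : R, a < t < b -> dv t <= M - c * (v t / y t)) ->
  0 < y b.
Proof.
move=> ab c0 yc y0 v0 u0 dy dvP dvle.
pose m := (a + b) / 2.
have am : a < m by rewrite /m; lra.
have mb : m < b by rewrite /m; lra.
pose K := v m - c * ln (y m) + `|M| * (b - m).
pose dl := expR (- K / c).
have ydl t : m <= t < b -> dl <= y t.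
  move=> /andP[mt tb].
  pose g := fun t => v t - c * ln (y t) - M * t.
  have gle : g t <= g m.
    apply: (@le_of_derive_le0 g (fun t => dv t - c * ((u t - v t) / y t) - M)) => //.
      move=> s /andP[ms st].
      have sab : a < s < b by rewrite (lt_le_trans am) // (le_lt_trans st).
      have ys := y0 s sab.
      have d1 := dvP s sab; have d2 := dy s sab.
      have d3 : is_derive (y s) 1 (@ln R) (y s)^-1 by exact: is_derive1_ln.
      have d4 := is_derive1_comp d3 d2.
      rewrite /g; apply: is_derive_eq.
      by rewrite /GRing.scale /= !mulr1 [(y s)^-1 * _]mulrC; ring.
    move=> s /andP[ms st].
    have sab : a < s < b by rewrite (lt_le_trans am) // (le_lt_trans st).
    have ys := y0 s sab; have := dvle s sab; have us := u0 s sab.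
    (* The contribution of [u] has the good sign: a forward motion of the vehicle ahead only opens
       the gap. *)
    have : 0 <= c * (u s / y s) by rewrite mulr_ge0 ?(ltW c0) ?divr_ge0 ?(ltW ys).
    by rewrite mulrBl; lra.
  have tab : a < t < b by rewrite (lt_le_trans am).
  have yt := y0 t tab.
  have : - c * ln (y t) <= K.
    have := v0 t tab; move: gle; rewrite /g /K.
    have : M * (t - m) <= `|M| * (b - m).
      apply: (@le_trans _ _ (`|M| * (t - m))).
        by rewrite ler_wpM2r ?subr_ge0 // ler_norm.
      by rewrite ler_wpM2l // lerD2r ltW.
    by lra.
  rewrite mulNr lerNl => H.
  rewrite /dl -(lnK (x := y t)) ?posrE // ler_expR ler_pdivrMr// mulrC; lra.
rewrite lt_neqAle; apply/andP; split; last first.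
  rewrite leNgt; apply/negP => yb.
  have bin : `[a, b]%classic b by rewrite /= in_itv /= lexx ltW.
  have [d d0 Hd] := (within_continuousP _ _).1 yc b bin (- y b) ltac:(lra).
  pose t := Num.max m (b - d / 2).
  have tm : m <= t by rewrite /t le_max lexx.
  have tb : t < b by rewrite /t gt_max mb /=; lra.
  have td : b - d < t by rewrite /t lt_max; apply/orP; right; lra.
  have := Hd t; rewrite /= in_itv /= (ltW tb) andbT (le_trans (ltW am) tm) => /(_ isT).
  rewrite gtr0_norm ?subr_gt0// => /(_ ltac:(lra)).
  have := y0 t; rewrite tb andbT (lt_le_trans am tm) => /(_ isT) yt.
  by rewrite ltr0_norm; lra.
apply/eqP => yb.
have dl0 : 0 < dl by exact: expR_gt0.
have bin : `[a, b]%classic b by rewrite /= in_itv /= lexx ltW.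
have [d d0 Hd] := (within_continuousP _ _).1 yc b bin dl dl0.
pose t := Num.max m (b - d / 2).
have tm : m <= t by rewrite /t le_max lexx.
have tb : t < b by rewrite /t gt_max mb /=; lra.
have td : b - d < t by rewrite /t lt_max; apply/orP; right; lra.
have := Hd t; rewrite /= in_itv /= (ltW tb) andbT (le_trans (ltW am) tm) => /(_ isT).
rewrite gtr0_norm ?subr_gt0// => /(_ ltac:(lra)).
have := ydl t; rewrite tb tm => /(_ isT) dlt.
by rewrite -yb sub0r normrN gtr0_norm; lra.
Qed.

(* v - M t is nonincreasing; if it were equal to dl > 0 at some t0, then
   v + c dl ln t - M t would be nonincreasing on ]0, t0], although it tends to
   - oo at 0. *)
Lemma singular_damping_le (v dv : R -> R) (b c M W : R) : 0 < c -> 0 <= M ->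
  (forall t : R, 0 < t < b -> 0 <= v t <= W) ->
  (forall t : R, 0 < t < b -> is_derive t 1 v (dv t)) ->
  (forall t : R, 0 < t < b -> dv t <= M - c * (v t / t)) ->
  forall t : R, 0 < t < b -> v t <= M * t.
Proof.
move=> c0 M0 vW dvP dvle t0 t0b; rewrite leNgt; apply/negP => vt0.
case/andP: (t0b) => t00 t0b'.
pose dl := v t0 - M * t0.
have dl0 : 0 < dl by rewrite /dl; lra.
have vdl t : 0 < t <= t0 -> dl <= v t.
  move=> /andP[tp tt0].
  suff : v t0 - M * t0 <= v t - M * t.
    have : 0 <= M * t by rewrite mulr_ge0// ltW.
    by rewrite /dl; lra.
  apply: (@le_of_derive_le0 (fun t => v t - M * t) (fun t => dv t - M)) => //.
    move=> s /andP[ts st]; have sb : 0 < s < b by lra.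
    have d1 := dvP s sb; apply: is_derive_eq.
    by rewrite /GRing.scale /= !mulr1; ring.
  move=> s /andP[ts st]; have sb : 0 < s < b by lra.
  have := dvle s sb; have /andP[vs _] := vW s sb.
  have : 0 <= c * (v s / s) by rewrite mulr_ge0 ?(ltW c0) ?divr_ge0//; lra.
  by lra.
have key t : 0 < t <= t0 ->
    v t0 + c * dl * ln t0 - M * t0 <= v t + c * dl * ln t - M * t.
  move=> /andP[tp tt0].
  apply: (@le_of_derive_le0 (fun t => v t + c * dl * ln t - M * t)
    (fun t => dv t + c * dl * t^-1 - M)) => //.
    move=> s /andP[ts st]; have sb : 0 < s < b by lra.
    have d1 := dvP s sb.
    have d3 : is_derive s 1 (@ln R) s^-1 by apply: is_derive1_ln; lra.
    by apply: is_derive_eq; rewrite /GRing.scale /= !mulr1.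
  move=> s /andP[ts st]; have sb : 0 < s < b by lra.
  have := dvle s sb; have st0 : 0 < s <= t0 by lra.
  have := vdl s st0 => vs.
  have : c * dl * s^-1 <= c * (v s / s).
    rewrite -mulrA ler_wpM2l ?(ltW c0)// ler_wpM2r// invr_ge0; lra.
  by lra.
(* Once ln t is below [K], the bound [v t <= W] puts the right-hand side of [key] at least 1 below
   its left-hand side. *)
pose K := (v t0 + c * dl * ln t0 - M * t0 - W - 1) / (c * dl).
pose t := Num.min t0 (expR K).
have tp : 0 < t by rewrite /t lt_min t00 expR_gt0.
have tt0 : t <= t0 by rewrite /t ge_min lexx.
have := key t; rewrite tp tt0 => /(_ isT).
have /andP[_ vt] := vW t ltac:(lra).
have lt : ln t <= K.
  by rewrite -(expRK K) ler_ln ?posrE ?expR_gt0// /t ge_min lexx orbT.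
have cd0 : 0 < c * dl by rewrite mulr_gt0.
have : c * dl * ln t <= c * dl * K by rewrite ler_pM2l.
rewrite /K mulrCA divff ?mulr1; last by rewrite gt_eqF.
have : 0 <= M * t by rewrite mulr_ge0// ltW.
by lra.
Qed.

End calculus.
(** * Regularity of microscopic solutions *)

Section microscopic_regularity.
Context {R : realType}.
Implicit Types (T eps gam rhobar t : R) (theta : R -> R) (F : R * R -> R).

Lemma lipschitz_bound (f : R -> R) (A : set R) :
  [lipschitz f x | x in A] ->
  exists2 K : R, 0 < K & forall a b, A a -> A b -> `|f a - f b| <= K * `|a - b|.
Proof.
move=> [K0 [_ H]]; exists (`|K0| + 1); first by rewrite ltr_wpDl.
move=> a b Aa Ab; apply: (H (`|K0| + 1) _ (a, b)) => //=.
by rewrite (le_lt_trans (ler_norm _))// ltrDl.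
Qed.

Lemma lipschitz_within_continuous (f : R -> R) (A : set R) :
  [lipschitz f x | x in A] -> {within A, continuous f}.
Proof.
move=> /lipschitz_bound[K K0 HK]; apply/within_continuousP => a Aa e e0.
exists (e / K); first by rewrite divr_gt0.
move=> b Ab ab; rewrite (le_lt_trans (HK a b Aa Ab))// mulrC -ltr_pdivlMr//.
Qed.

Lemma nbhs_itv (T t : R) : 0 < t < T -> nbhs t `[0, T]%classic.
Proof.
move=> t0T; have : t \in `]0, T[ by rewrite in_itv.
move=> /near_in_itvoo; apply: filterS => u /=.
by rewrite !in_itv /= => /andP[u0 uT]; rewrite !ltW.
Qed.

Lemma le_on_closure (f : R -> R) (T B : R) : 0 < T ->
  {within `[0, T], continuous f} ->
  (forall t, 0 < t < T -> f t <= B) -> forall t, 0 <= t <= T -> f t <= B.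
Proof.
move=> T0 /within_continuousP fc fB t t0T; rewrite leNgt; apply/negP => Bf.
have tin : `[0, T]%classic t by rewrite /= in_itv.
have [d d0 Hd] := fc t tin (f t - B) ltac:(rewrite subr_gt0; exact: Bf).
pose n := Num.min 1 (d / T).
have n0 : 0 < n by rewrite lt_min ltr01 divr_gt0.
have n1 : n <= 1 by rewrite ge_min lexx.
have nT : n * T <= d by rewrite -ler_pdivlMr// ge_min lexx orbT.
(* The convex combination of [t] and T / 2 with weight [n] on the latter: it is interior, and within
   [d] of [t], even when [t] is an end point. *)
pose u := t + n * T / 2 - n * t.
have nT0 : 0 < n * T by rewrite mulr_gt0.
have [u0 ut] : 0 < u < T /\ `|t - u| < d.
  case/andP: t0T => t0 tT.
  have nt0 : 0 <= n * t by rewrite mulr_ge0// ltW.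
  have ntT : n * t <= n * T by rewrite ler_wpM2l// ltW.
  have nt1 : n * t <= t by rewrite ler_piMl.
  have nTt : n * (T - t) <= T - t by rewrite ler_piMl// subr_ge0.
  rewrite mulrBr in nTt.
  by split; rewrite /u ?ltr_norml; lra.
have := Hd u; rewrite /= in_itv /= => /(_ _ ut).
case/andP: (u0) => ua ub; rewrite !ltW// => /(_ isT).
have := fB u u0; rewrite ltr_norml; lra.
Qed.

Lemma ge_on_closure (f : R -> R) (T B : R) : 0 < T ->
  {within `[0, T], continuous f} ->
  (forall t, 0 < t < T -> B <= f t) -> forall t, 0 <= t <= T -> B <= f t.
Proof.
move=> T0 fc fB t t0T; rewrite -lerN2.
apply: (@le_on_closure (fun t => - f t) T (- B) T0) => //.
  move/within_continuousP : fc => fc; apply/within_continuousP => a Aa e e0.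
  have [d d0 Hd] := fc a Aa e e0; exists d => // b Ab ab.
  by rewrite -opprD normrN; exact: Hd.
by move=> u u0; rewrite lerN2 fB.
Qed.

Lemma ae_exists_itv (P : R -> Prop) (a b : R) : a < b ->
  {ae leb, forall t, P t} -> exists2 t, a < t < b & P t.
Proof.
move=> ab [A [mA A0 HA]]; apply: contrapT => H.
have sub : `]a, b[%classic `<=` A.
  move=> t /=; rewrite in_itv /= => tab; apply: HA => /= Pt.
  by apply: H; exists t.
have : (lebesgue_measure (`]a, b[%classic : set R) <= leb A)%E.
  by apply: le_measure; rewrite ?inE.
rewrite A0 lebesgue_measure_itv /= lte_fin ab -EFinD lee_fin; lra.
Qed.

Lemma derive_ge0 (f : R -> R) (df T t : R) : 0 < t < T ->
  {in `[0, T] &, {homo f : a b / a <= b}} -> is_derive t 1 f df -> 0 <= df.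
Proof.
move=> t0T fh [fd <-].
rewrite -derive1E /derive1; apply: limr_ge.
  rewrite /derivable in fd; move: fd.
  by under eq_fun do rewrite scaler1.
apply/nbhs_ballP; pose d := Num.min t (T - t).
have d0 : 0 < d by rewrite /d lt_min; lra.
exists d => //= h; rewrite -ball_normE /= sub0r normrN => hd h0.
have : - t < h < T - t.
  by move: hd; rewrite /d lt_min !ltr_norml => /andP[]; lra.
move=> hT; rewrite /GRing.scale /=.
have [hp|hn] := ltP 0 h.
  apply: mulr_ge0; first by rewrite invr_ge0 ltW.
  by rewrite subr_ge0; apply: fh; rewrite ?in_itv /=; lra.
have {}hn : h < 0 by rewrite lt_neqAle h0.
apply: mulr_le0; first by rewrite invr_le0 ltW.
by rewrite subr_le0; apply: fh; rewrite ?in_itv /=; lra.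
Qed.

Section nonlinearities.
Context (T rhobar : R) (theta : R -> R) (F : R * R -> R)
  (nonlin : nonlinearity_assumptions T theta rhobar F).

Lemma theta_gt0 (r : R) : 0 <= r < rhobar -> 0 < theta r.
Proof.
move=> /andP[r0 rr]; rewrite lt_neqAle (theta_ge0 nonlin)// andbT.
apply/eqP => /esym /(theta_eq0 nonlin r0).
by rewrite leNgt rr.
Qed.

Lemma theta_bounded : exists2 Th : R, 0 < Th &
  forall r, 0 <= r <= rhobar -> theta r <= Th.
Proof.
have r0 := rhobar_gt0 nonlin.
have [|c _ Hc] := @EVT_max R theta 0 rhobar (ltW r0).
  apply: continuous_subspaceW (theta_continuous nonlin).
  by move=> t /=; rewrite !in_itv /= andbT => /andP[].
exists (`|theta c| + 1); first by rewrite ltr_wpDl.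
move=> r rr; apply: (@le_trans _ _ (theta c)); first by apply: Hc; rewrite in_itv.
by rewrite (le_trans (ler_norm _))// lerDl.
Qed.

(** Within distance [e] of [rhobar], where theta vanishes, the Lipschitz constant serves; farther
    away, theta <= Th <= (Th / e) (rhobar - r). *)
Lemma theta_linear_bound : exists2 L : R, 0 < L &
  forall r, 0 <= r <= rhobar -> theta r <= L * (rhobar - r).
Proof.
have r0 := rhobar_gt0 nonlin.
have [Th Th0 HTh] := theta_bounded.
have [e e0 /lipschitz_bound[K K0 HK]] := theta_lipschitz nonlin.
have tr : theta rhobar = 0 by apply/(theta_eq0 nonlin) => //; exact: ltW.
exists (K + Th / e); first by rewrite addr_gt0// divr_gt0.
move=> r /andP[rp rr].
have [re|re] := ltP (rhobar - r) e.
  have := HK r rhobar; rewrite tr subr0 => H.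
  apply: (@le_trans _ _ (K * (rhobar - r))); last first.
    by rewrite ler_wpM2r ?subr_ge0// lerDl ltW// divr_gt0.
  rewrite (le_trans (ler_norm _))//.
  have -> : rhobar - r = `|r - rhobar|.
    by rewrite distrC ger0_norm// subr_ge0.
  apply: H; split=> /=.
  - by rewrite -ball_normE /= ger0_norm// subr_ge0.
  - by rewrite in_itv /= rp.
  - exact: ballxx.
  - by rewrite in_itv /= andbT ltW.
apply: (@le_trans _ _ (Th / e * (rhobar - r))).
  rewrite (le_trans (HTh r _)) ?rp//.
  by rewrite mulrAC ler_pdivlMr// ler_wpM2l// ltW.
by rewrite ler_wpM2r ?subr_ge0// lerDr ltW.
Qed.

(** A maximum in time on the line y = s, then the Lipschitz bound in space, which is uniform in
    time. *)
Lemma F_bounded (s S : R) : 0 <= T -> exists2 M : R, 0 < M &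
  forall t y, 0 <= t <= T -> s <= y <= S -> F (t, y) <= M.
Proof.
move=> T0; have [L HL] := F_lipschitz nonlin.
have [|c _ Hc] := @EVT_max R (fun t => F (t, s)) 0 T T0.
  have /within_continuousP Fc := F_continuous nonlin.
  apply/within_continuousP => t tT e e0.
  have [d d0 Hd] := Fc (t, s) (conj tT I) e e0.
  exists d => // u uT tu; apply: Hd; first by split.
  by rewrite prod_normE /= subrr normr0 gt_max tu d0.
exists (`|F (c, s)| + `|L| * `|S - s| + 1).
  by rewrite ltr_wpDl// addr_ge0// mulr_ge0.
move=> t y tT /andP[sy yS].
have tin : `[0, T]%classic t by rewrite /= in_itv.
have h1 := HL t tin y s.
have h2 := Hc t; rewrite in_itv /= tT in h2; have {}h2 := h2 isT.
have h3 : L * `|y - s| <= `|L| * `|S - s|.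
  apply: (@le_trans _ _ (`|L| * `|y - s|)).
    by rewrite ler_wpM2r// ler_norm.
  rewrite ler_wpM2l// !ger0_norm ?subr_ge0//; [lra|exact: le_trans sy yS].
have h4 := ler_norm (F (t, y) - F (t, s)); have h5 := ler_norm (F (c, s)).
lra.
Qed.

End nonlinearities.
End microscopic_regularity.
Section regular_traffic.
Context {R : realType}.
Implicit Types (t : R) (theta : R -> R) (F : R * R -> R).

(** All that the limit passage retains of a solution: jams survive only in the inequality
    [rt_rho_le] at t = 0, velocities are continuous up to t = 0, and [W] does not depend on N. The
    equation is solved for the acceleration, for i < N only: the leader is merely C^1. *)
Record regular_traffic (T eps gam rhobar : R) theta F (s S W : R) (N : nat)
    (x : nat -> R -> R) : Prop := {
  rt_range : forall i t, (i <= N)%N -> 0 <= t <= T -> s <= x i t <= S ;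
  rt_cont : forall i, (i <= N)%N -> {within `[0, T], continuous (x i)} ;
  rt_lt : forall i t, (i < N)%N -> 0 <= t <= T -> x i t < x i.+1 t ;
  rt_rho_le : forall i t, (i < N)%N -> 0 <= t <= T -> rho_ N x i t <= rhobar ;
  rt_rho_lt : forall i t, (i < N)%N -> 0 < t <= T -> rho_ N x i t < rhobar ;
  rt_derive : forall i t, (i <= N)%N -> 0 < t < T ->
    is_derive t 1 (x i) (vel T (x i) t) ;
  rt_vel_cont : forall i, (i <= N)%N ->
    {within `[0, T], continuous (vel T (x i))} ;
  rt_vel : forall i t, (i <= N)%N -> 0 <= t <= T -> 0 <= vel T (x i) t <= W ;
  rt_acc : forall i t, (i < N)%N -> 0 < t < T ->
    is_derive t 1 (vel T (x i))
      ((F (t, x i t) - gam * (vel T (x i) t / theta (rho_ N x i t))) / eps) }.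

Let ode_solve (e th a g v f : R) : e != 0 -> th != 0 ->
  e * th * a + g * v = th * f -> a = (f - g * (v / th)) / e.
Proof.
move=> e0 th0 E; have -> : f = (e * th * a + g * v) / th.
  by rewrite E mulrAC divff// mul1r.
by field; rewrite e0 th0.
Qed.

Section one_solution.
Context (T eps gam rhobar s S C0 M Th L : R) (theta : R -> R) (F : R * R -> R)
  (N : nat) (x0 v0 : nat -> R) (x : nat -> R -> R)
  (T_gt0 : 0 < T) (eps_gt0 : 0 < eps) (gam_gt0 : 0 < gam) (C0_gt0 : 0 < C0)
  (M_gt0 : 0 < M) (Th_gt0 : 0 < Th) (L_gt0 : 0 < L) (N_gt0 : (0 < N)%N)
  (nonlin : nonlinearity_assumptions T theta rhobar F)
  (F_le : forall t y, 0 <= t <= T -> s <= y <= S -> F (t, y) <= M)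
  (theta_le : forall r, 0 <= r <= rhobar -> theta r <= Th)
  (theta_lin : forall r, 0 <= r <= rhobar -> theta r <= L * (rhobar - r))
  (data : data_assumptions T rhobar N x0 v0 (x N))
  (bounds : data_bounds T rhobar s S C0 N x0 v0 (x N))
  (sol : microscopic_solution T eps gam theta rhobar F N x0 v0 x)
  (vbound : velocity_bound T gam theta rhobar F N x0 v0 x).

Let inT t : 0 <= t <= T -> `[0, T]%classic t.
Proof. by rewrite /= in_itv. Qed.

Let NR0 : 0 < N%:R :> R. Proof. by rewrite ltr0n. Qed.
Let r0 : 0 < rhobar. Proof. exact: rhobar_gt0 nonlin. Qed.

Lemma micro_lt i t : (i < N)%N -> 0 <= t <= T -> x i t < x i.+1 t.
Proof. by move=> iN /inT tT; have [] := sol_ordered sol iN tT. Qed.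

Lemma micro_le i j t : (i <= j <= N)%N -> 0 <= t <= T -> x i t <= x j t.
Proof.
move=> /andP[ij jN] tT; elim: j ij jN => [|j IH]; first by rewrite leqn0 => /eqP ->.
rewrite leq_eqVlt => /predU1P[-> //|]; rewrite ltnS => ij jN.
by rewrite (le_trans (IH ij (ltnW jN)))// ltW// micro_lt.
Qed.

Lemma micro_range i t : (i <= N)%N -> 0 <= t <= T -> s <= x i t <= S.
Proof.
move=> iN tT; case/andP: (tT) => t0 t1; apply/andP; split.
  rewrite (le_trans _ (@micro_le 0%N i t _ tT)) ?iN//.
  rewrite (le_trans (s_le bounds))// -(sol_init sol N_gt0).
  by apply: (sol_nondecreasing sol N_gt0); rewrite ?in_itv /= ?lexx ?t0 ?t1// ltW.
rewrite (le_trans (@micro_le i N t _ tT)) ?iN ?leqnn//.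
rewrite (le_trans _ (le_S bounds))//.
by apply: (leader_nondecreasing data); rewrite ?in_itv /= ?lexx ?t0 ?t1// ltW.
Qed.

(** The distance between vehicles at density [rhobar]; [gap] is the excess over it and vanishes
    exactly in a jam. *)
Let dmin : R := (N%:R * rhobar)^-1.
Let gap i t : R := x i.+1 t - x i t - dmin.

Lemma rho_gap i t : (i < N)%N -> 0 <= t <= T ->
  0 < rho_ N x i t /\ rhobar - rho_ N x i t = rho_ N x i t * (N%:R * rhobar * gap i t).
Proof.
move=> iN tT; have d0 : 0 < x i.+1 t - x i t by rewrite subr_gt0 micro_lt.
rewrite /rho_ /density /gap /dmin; split.
  by rewrite invr_gt0 mulr_gt0.
by field; rewrite !gt_eqF.
Qed.

Lemma gap_ge0 i t : (i < N)%N -> 0 <= t <= T -> 0 <= gap i t.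
Proof.
move=> iN tT; have [rp E] := rho_gap iN tT.
have [_ h] := sol_ordered sol iN (inT tT).
move: h; rewrite -subr_ge0 E pmulr_rge0// pmulr_rge0// mulr_gt0//.
Qed.

Lemma rho_lt_gap i t : (i < N)%N -> 0 <= t <= T ->
  (rho_ N x i t < rhobar) = (0 < gap i t).
Proof.
move=> iN tT; have [rp E] := rho_gap iN tT.
by rewrite -subr_gt0 E pmulr_rgt0// pmulr_rgt0// mulr_gt0.
Qed.

(** theta(rho) <= L (rhobar - rho) = L rho N rhobar gap, and rho <= rhobar. This constant grows with
    N, but it enters qualitative statements only. *)
Let Cg : R := L * N%:R * rhobar ^+ 2.

Let Cg_gt0 : 0 < Cg. Proof. by rewrite /Cg !mulr_gt0// exprn_gt0. Qed.

Lemma theta_rho_gap i t : (i < N)%N -> 0 <= t <= T ->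
  theta (rho_ N x i t) <= Cg * gap i t.
Proof.
move=> iN tT; have [rp E] := rho_gap iN tT; have g0 := gap_ge0 iN tT.
have [_ h] := sol_ordered sol iN (inT tT).
rewrite (le_trans (theta_lin _))//; first by rewrite (ltW rp).
have h2 : rho_ N x i t * (N%:R * rhobar * gap i t) <=
          rhobar * (N%:R * rhobar * gap i t).
  by rewrite ler_wpM2r// !mulr_ge0// ltW.
rewrite E; have := ler_wpM2l (ltW L_gt0) h2.
by rewrite /Cg expr2; set g := gap i t; lra.
Qed.

Lemma micro_cont i : (i <= N)%N -> {within `[0, T], continuous (x i)}.
Proof.
rewrite leq_eqVlt => /predU1P[->|iN]; last first.
  exact: lipschitz_within_continuous (sol_lipschitz sol iN).
have [Hd _] := leader_C1 data.
apply/within_continuousP => t tT e e0.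
have : {within `[0, T], continuous (x N)}.
  apply/subspace_continuousP => u uT.
  have /cvg_ex[l Hl] := Hd u uT.
  apply/cvgrPdist_lt => e' e'0.
  have /cvgrPdist_lt /(_ 1 ltr01) := Hl.
  rewrite /prop_near1 /= /within /= => /nbhs_ballP[d d0 Hd'].
  apply/nbhs_ballP; exists (Num.min d (e' / (`|l| + 1))).
    by rewrite /= lt_min d0 /= divr_gt0// ltr_wpDl.
  move=> w; rewrite -ball_normE /= lt_min => /andP[wd we] wT.
  have [<-|uw] := eqVneq u w; first by rewrite subrr normr0.
  have wu : w - u != 0 by rewrite subr_eq0 eq_sym.
  have := Hd' w; rewrite -ball_normE /= => /(_ wd).
  rewrite eq_sym => /(_ uw wT) => h.
  (* The relative derivative [l] bounds the difference quotients near [u] by [|l| + 1], whence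
     continuity of the leader. *)
  have : `|(w - u)^-1 * (x N w - x N u)| <= `|l| + 1.
    have := ler_normD (l) ((w - u)^-1 * (x N w - x N u) - l).
    rewrite addrC subrK => /le_trans; apply; rewrite lerD2l ltW//.
    by rewrite distrC.
  rewrite normrM normfV ler_pdivrMl ?normr_gt0// => h2.
  rewrite distrC (le_lt_trans h2)// -ltr_pdivlMr; last by rewrite ltr_wpDl.
  by rewrite distrC.
by move=> /within_continuousP/(_ t tT e e0).
Qed.

Let gap_cont i : (i < N)%N -> {within `[0, T], continuous (gap i)}.
Proof.
move=> iN; apply: within_continuousB; last first.
  by apply: continuous_subspaceT => ?; exact: cvg_cst.
by apply: within_continuousB; apply: micro_cont => //; exact: ltnW.
Qed.

(** The property handed down from the leader to each follower. Strict positivity is what dissolves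
    an initial jam behind the vehicle. *)
Definition moving i := forall t, 0 < t < T ->
  is_derive t 1 (x i) (vel T (x i) t) /\ 0 < vel T (x i) t.

Lemma leader_moving : moving N.
Proof.
move=> t t0T; split; last first.
  apply: (leader_vel_gt0 data); rewrite /= in_itv /=.
  by case/andP: t0T => -> /ltW.
have [Hd _] := leader_C1 data.
apply: is_derive_deriv_in; first exact: nbhs_itv.
by apply: Hd; rewrite /= in_itv /=; case/andP: t0T => /ltW -> /ltW.
Qed.

Section one_vehicle.
Context (i : nat) (iN : (i < N)%N) (mov : moving i.+1).

Lemma free_derive t : 0 < t < T -> 0 < gap i t ->
  [/\ is_derive t 1 (x i) (vel T (x i) t),
      0 <= vel T (x i) t,
      is_derive t 1 (vel T (x i)) (vel T (vel T (x i)) t)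
    & vel T (vel T (x i)) t =
      (F (t, x i t) - gam * (vel T (x i) t / theta (rho_ N x i t))) / eps].
Proof.
move=> t0T g0; have tT : 0 <= t <= T by case/andP: t0T => /ltW -> /ltW.
have rl : rho_ N x i t < rhobar by rewrite rho_lt_gap.
have [[H1 _] [H2 _]] := sol_free_C2 sol iN.
have D1 : is_derive t 1 (x i) (vel T (x i) t).
  by apply: is_derive_deriv_in; [exact: nbhs_itv | apply: H1; split => //; exact: inT].
split; [exact: D1| | |].
- exact: derive_ge0 t0T (sol_nondecreasing sol iN) D1.
- by apply: is_derive_deriv_in; [exact: nbhs_itv | apply: H2; split => //; exact: inT].
- have := sol_free_ode sol iN (inT tT) rl.
  have rp := (rho_gap iN tT).1.
  have th0 : 0 < theta (rho_ N x i t) by apply: (theta_gt0 nonlin); rewrite ltW.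
  by move=> /(ode_solve (lt0r_neq0 eps_gt0) (lt0r_neq0 th0)).
Qed.

(** Since v >= 0, replacing theta(rho) by its upper bound [Cg * gap] can only weaken the damping,
    which becomes explicit in the gap, as [damped_gap_gt0] requires. *)
Lemma acc_le t : 0 < t < T -> 0 < gap i t ->
  vel T (vel T (x i)) t <=
  M / eps - gam / (eps * Cg) * (vel T (x i) t / gap i t).
Proof.
move=> t0T g0; have [_ v0' _ ->] := free_derive t0T g0.
have tT : 0 <= t <= T by case/andP: t0T => /ltW -> /ltW.
rewrite mulrBl lerB//; first by rewrite ler_pM2r ?invr_gt0// F_le// micro_range// ltnW.
have rl : rho_ N x i t < rhobar by rewrite rho_lt_gap.
have rp := (rho_gap iN tT).1.
have th0 : 0 < theta (rho_ N x i t) by apply: (theta_gt0 nonlin); rewrite ltW.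
have -> : gam / (eps * Cg) * (vel T (x i) t / gap i t) =
  gam * (vel T (x i) t / (Cg * gap i t)) / eps.
  by field; rewrite !gt_eqF.
rewrite ler_pM2r ?invr_gt0// ler_pM2l// ler_wpM2l// lef_pV2 ?posrE ?mulr_gt0//.
exact: theta_rho_gap.
Qed.

Let gap_derive t : 0 < t < T -> 0 < gap i t ->
  is_derive t 1 (gap i) (vel T (x i.+1) t - vel T (x i) t).
Proof.
move=> t0T g0; have [D1 _ _ _] := free_derive t0T g0; have [D2 _] := mov t0T.
by rewrite /gap; apply: is_derive_eq; rewrite subr0.
Qed.

(** Once free, a vehicle remains free: up to a first later zero of the gap the free equation holds,
    and [damped_gap_gt0] forbids that zero. *)
Let gap_forward t u : 0 <= t -> t < u <= T -> 0 < gap i t -> 0 < gap i u.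
Proof.
move=> t0 /andP[tu uT] gt; rewrite lt_neqAle gap_ge0 ?andbT//; last first.
  by rewrite uT (le_trans t0)// ltW.
apply/eqP => /esym gu.
have sub : `[t, u] `<=` `[0, T].
  by move=> w /=; rewrite !in_itv /= => /andP[tw wu]; rewrite (le_trans t0)// (le_trans wu).
have [||c [/andP[tc cu] gc gpos]] := @first_zero R (gap i) t u tu _ _ gt gu.
- exact: continuous_subspaceW sub (gap_cont iN).
- by move=> w /andP[tw wu]; rewrite gap_ge0// (le_trans t0)// (le_trans wu).
have wT w : t < w < c -> 0 < w < T.
  by move=> /andP[tw wc]; rewrite (le_lt_trans t0)//= (lt_le_trans wc)// (le_trans cu).
have gw w : t < w < c -> 0 < gap i w by move=> /andP[tw wc]; rewrite gpos// ltW.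
have : 0 < gap i c; last by rewrite gc ltxx.
apply: (@damped_gap_gt0 R (gap i) (vel T (x i)) (vel T (x i.+1))
  (vel T (vel T (x i))) t c (gam / (eps * Cg)) (M / eps) tc).
- by rewrite divr_gt0// mulr_gt0.
- apply: continuous_subspaceW (gap_cont iN); apply: subset_trans sub.
  by move=> w /=; rewrite !in_itv /= => /andP[-> wc] /=; rewrite (le_trans wc).
- exact: gw.
- by move=> w wtc; have [_ vw _ _] := free_derive (wT w wtc) (gw w wtc).
- by move=> w wtc; have [_ /ltW vw] := mov (wT w wtc).
- by move=> w wtc; exact: gap_derive (wT w wtc) (gw w wtc).
- by move=> w wtc; have [_ _ D _] := free_derive (wT w wtc) (gw w wtc).
- by move=> w wtc; exact: acc_le (wT w wtc) (gw w wtc).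
Qed.

(* During an initial jam the follower would be at rest and the vehicle ahead
   would move away. *)
Lemma gap_gt0 t : 0 < t <= T -> 0 < gap i t.
Proof.
move=> /andP[t0 tT]; rewrite lt_neqAle gap_ge0 ?andbT ?(ltW t0)//.
apply/eqP => /esym gt.
(* By [gap_forward], a positive gap before [t] would persist until [t]. *)
have g0 u : 0 <= u < t -> gap i u = 0.
  move=> /andP[u0 ut]; apply/eqP; rewrite eq_le gap_ge0 ?andbT; last first.
  - by rewrite u0 (le_trans (ltW ut)).
  - exact: iN.
  rewrite leNgt; apply/negP => gp; have utT : u < t <= T by rewrite ut.
  by have := gap_forward u0 utT gp; rewrite gt ltxx.
have rE u : 0 <= u < t -> rho_ N x i u = rhobar.
  move=> ut; have uT : 0 <= u <= T by case/andP: ut => -> /ltW /le_trans ->.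
  apply/eqP; rewrite -subr_eq0 -oppr_eq0 opprB; have [_ ->] := rho_gap iN uT.
  by rewrite g0// !mulr0.
have D u : 0 < u < t -> is_derive u 1 (x i) 0.
  move=> ut; have uT : 0 < u < T by case/andP: ut => -> /lt_le_trans ->.
  have uI : ([set w | `[0, T]%classic w /\ rho_ N x i w = rhobar]°) u.
    have : u \in `]0, t[ by rewrite in_itv.
    move=> /near_in_itvoo; rewrite /interior; apply: filterS => w /=.
    rewrite !in_itv /= => /andP[w0 wt]; split; last by rewrite rE// (ltW w0).
    by rewrite (ltW w0) (le_trans (ltW wt)).
  have [H1 _] := sol_jam_C1 sol iN.
  have D1 : is_derive u 1 (x i) (vel T (x i) u).
    by apply: is_derive_deriv_in; [exact: nbhs_itv | exact: H1].
  have := sol_jam_ode sol iN uI.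
  rewrite rE; last by case/andP: ut => /ltW -> ->.
  have -> : theta rhobar = 0 by apply/(theta_eq0 nonlin) => //; exact: ltW.
  rewrite mul0r => /eqP; rewrite mulf_eq0 gt_eqF//= => /eqP vE.
  by move: D1; rewrite vE.
(* The gap vanishes at both ends of [t / 3, t / 2], while its derivative in between is the velocity
   of the vehicle ahead alone, which is positive. *)
have [|||c] := @MVT R (gap i) (vel T (x i.+1)) (t / 3) (t / 2) _ _ _.
- lra.
- move=> u; rewrite in_itv /= => ut.
  have D1 : is_derive u 1 (x i) 0 by apply: D; lra.
  have [D2 _] := mov (t := u) ltac:(lra).
  by rewrite /gap; apply: is_derive_eq; rewrite !subr0.
- apply: continuous_subspaceW (gap_cont iN).
  by move=> w /=; rewrite !in_itv /= => ?; lra.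
rewrite in_itv /= => ct; rewrite !g0; [|lra|lra].
have [_ vc] := mov (t := c) ltac:(lra).
move=> /esym/eqP; rewrite subrr mulf_eq0 gt_eqF//= subr_eq0; lra.
Qed.

(** An interior zero of the nonnegative velocity would be a minimum, where the acceleration
    vanishes; but at zero velocity the equation makes the acceleration F / eps > 0. *)
Lemma follower_moving : moving i.
Proof.
move=> t t0T.
have tT : 0 <= t <= T by case/andP: t0T => /ltW -> /ltW.
have g u : 0 < u < T -> 0 < gap i u.
  by move=> /andP[u0 uT]; apply: gap_gt0; rewrite u0 ltW.
have [D v1 D2 E] := free_derive t0T (g t t0T).
split => //; rewrite lt_neqAle v1 andbT; apply/eqP => /esym vt.
have D0 : is_derive t 1 (vel T (x i)) 0.
  apply: (@derive1_at_min R _ 0 T t (ltW T_gt0)).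
  - by move=> u; rewrite in_itv /= => uT; have [_ _ []] := free_derive uT (g u uT).
  - by rewrite in_itv.
  - by move=> u; rewrite in_itv /= vt => uT; have [_] := free_derive uT (g u uT).
have : vel T (vel T (x i)) t = 0 by have [_ <-] := D2; have [_ ->] := D0.
rewrite E vt mul0r mulr0 subr0 => /eqP; rewrite mulf_eq0 invr_eq0.
have := F_gt0 nonlin (conj (inT tT) I : strip T (t, x i t)).
by move=> Fp; rewrite !gt_eqF.
Qed.

End one_vehicle.

Lemma all_moving i : (i <= N)%N -> moving i.
Proof.
move=> iN; rewrite -(subKn iN).
elim: (N - i)%N (leq_subr i N) => [|k IH] kN.
  by rewrite subn0; exact: leader_moving.
have kN' : (N - k.+1 < N)%N by rewrite ltn_subrL.
apply: (follower_moving kN'); rewrite -subSn// subSS; apply: IH; exact: ltnW.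
Qed.

Lemma gap_pos i t : (i < N)%N -> 0 < t <= T -> 0 < gap i t.
Proof. by move=> iN tT; apply: (gap_gt0 iN (all_moving iN)). Qed.

Let free_vel_cont i t : (i < N)%N -> 0 <= t <= T -> 0 < gap i t ->
  forall e, 0 < e -> exists2 d : R, 0 < d &
    forall u, 0 <= u <= T -> `|t - u| < d -> `|vel T (x i) t - vel T (x i) u| < e.
Proof.
move=> iN tT g0 e e0; have [[_ /within_continuousP H1] _] := sol_free_C2 sol iN.
have rl : rho_ N x i t < rhobar by rewrite rho_lt_gap.
have [d d0 Hd] := H1 t (conj (inT tT) rl) e e0.
have [d' d'0 Hd'] := (within_continuousP _ _).1 (gap_cont iN) t (inT tT) _ g0.
exists (Num.min d d'); first by rewrite lt_min d0.
move=> u uT; rewrite lt_min => /andP[h1 h2]; apply: Hd => //; split; first exact: inT.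
rewrite rho_lt_gap//; have := Hd' u (inT uT) h2.
by rewrite ltr_norml => /andP[_]; lra.
Qed.

Let vel_cont_pos i t : (i <= N)%N -> 0 < t <= T ->
  forall e, 0 < e -> exists2 d : R, 0 < d &
    forall u, 0 <= u <= T -> `|t - u| < d -> `|vel T (x i) t - vel T (x i) u| < e.
Proof.
move=> iN t0T e e0; have tT : 0 <= t <= T by case/andP: t0T => /ltW -> ->.
move: iN; rewrite leq_eqVlt => /predU1P[->|iN]; last first.
  exact: free_vel_cont iN tT (gap_pos iN t0T) e e0.
have [_ /within_continuousP H1] := leader_C1 data.
have [d d0 Hd] := H1 t (inT tT) e e0.
by exists d => // u /inT uT; exact: Hd.
Qed.

(** A sum in place of the maximum in [velocity_bound]: [C0] controls the leader and the initial
    velocities, the second term the forced part. It depends neither on i nor on N. *)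
Definition speed_bound : R := C0 + Th / gam * M.

Lemma vtilde_bound i : (i < N)%N ->
  Num.max (vtilde0 rhobar N x0 v0 i)
    (sup [set theta r | r in `[0, rhobar]] / gam *
     sup [set F p | p in `[0, T] `*` `[x0 0%N, x N T]]) <= speed_bound.
Proof.
move=> iN; have TM0 : 0 <= Th / gam * M by rewrite !mulr_ge0// ?invr_ge0 ltW.
have x0N : x0 0%N <= x N T := x0_le_xN bounds.
rewrite /speed_bound ge_max; apply/andP; split.
  rewrite /vtilde0; case: asboolP => Si; first by rewrite addr_ge0// ltW.
  by rewrite (le_trans (v0_le bounds iN Si))// lerDl.
apply: (@le_trans _ _ (Th / gam * M)); last by rewrite lerDr ltW.
have t0 : theta 0 <= Th by rewrite theta_le// lexx ltW.
have ub1 : ubound [set theta r | r in `[0, rhobar]] Th.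
  by move=> _ [r /= rr <-]; apply: theta_le; move: rr; rewrite in_itv.
have ub2 : ubound [set F p | p in `[0, T] `*` `[x0 0%N, x N T]] M.
  move=> _ [[a b] /= [] + + <-]; rewrite !in_itv /= => aT /andP[b1 b2].
  by apply: F_le => //; rewrite (le_trans (s_le bounds) b1) (le_trans b2 (le_S bounds)).
have in1 : [set theta r | r in `[0, rhobar]] (theta 0).
  by exists 0 => //=; rewrite in_itv /= lexx ltW.
have in2 : [set F p | p in `[0, T] `*` `[x0 0%N, x N T]] (F (0, x0 0%N)).
  by exists (0, x0 0%N) => //=; split; rewrite /= in_itv /= lexx// ltW.
have T00 : (0 : R) <= 0 <= T by rewrite lexx ltW.
apply: ler_pM.
- apply: mulr_ge0; last by rewrite invr_ge0 ltW.
  apply: (@le_trans _ _ (theta 0)); first exact: (theta_ge0 nonlin).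
  by apply: ub_le_sup => //; exists Th.
- apply: (@le_trans _ _ (F (0, x0 0%N))).
    by apply/ltW/(F_gt0 nonlin); split => //; exact: inT.
  by apply: ub_le_sup => //; exists M.
- by rewrite ler_pM2r ?invr_gt0//; apply: ge_sup => //; exists (theta 0).
- by apply: ge_sup => //; exists (F (0, x0 0%N)).
Qed.

(** The bound is assumed almost everywhere only; if it failed at [t], continuity would make it fail
    on a whole interval around [t]. *)
Lemma vel_bound_open i t : (i <= N)%N -> 0 < t < T -> 0 < vel T (x i) t <= speed_bound.
Proof.
move=> iN t0T; have [_ ->] := all_moving iN t0T; rewrite /=.
have t0T' : 0 < t <= T by case/andP: t0T => -> /ltW.
have tT : 0 <= t <= T by case/andP: t0T => /ltW -> /ltW.
have := iN; rewrite leq_eqVlt => /predU1P[iE|iN'].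
  rewrite iE (le_trans (leader_vel_le bounds (inT tT)))// /speed_bound lerDl.
  by rewrite !mulr_ge0// ?invr_ge0 ltW.
rewrite leNgt; apply/negP => vW.
have vW0 : 0 < vel T (x i) t - speed_bound by rewrite subr_gt0.
have [d d0 Hd] := vel_cont_pos iN t0T' vW0.
have ab : Num.max 0 (t - d) < Num.min T (t + d).
  by rewrite gt_max !lt_min; case/andP: t0T => t0 t1; lra.
have [u] := ae_exists_itv ab vbound.
rewrite gt_max lt_min => /andP[/andP[u0 u1] /andP[u2 u3]].
move=> /(_ _ i iN'); rewrite /= in_itv /= u0 u2 => /(_ isT).
move=> /le_trans/(_ (vtilde_bound iN')) h.
have := Hd u; rewrite (ltW u0) (ltW u2) => /(_ isT).
have -> : `|t - u| < d by rewrite ltr_norml; lra.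
by move=> /(_ isT); rewrite ltr_norml; lra.
Qed.

Section initial_jam.
Context (i : nat) (iN : (i < N)%N) (g0 : gap i 0 = 0).

Let W0 : 0 < speed_bound.
Proof. by rewrite /speed_bound addr_gt0// !mulr_gt0// invr_gt0. Qed.

(** The follower does not move backwards, so the gap, initially 0, grows at most at the speed of the
    vehicle ahead. *)
Let gap_le t : 0 < t < T -> gap i t <= speed_bound * t.
Proof.
move=> /andP[t0 tT].
have sub : `[0, t] `<=` `[0, T].
  by move=> w /=; rewrite !in_itv /= => /andP[-> wc] /=; rewrite (le_trans wc)// ltW.
have [||c] := @MVT R (x i.+1) (vel T (x i.+1)) 0 t t0 _ _.
- move=> u; rewrite in_itv /= => /andP[u0 ut].
  by have [] := @all_moving i.+1 iN u; rewrite // u0 (lt_trans ut).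
- exact: continuous_subspaceW sub (micro_cont iN).
rewrite in_itv /= => /andP[c0 ct].
have /andP[_ vc] := @vel_bound_open i.+1 c iN ltac:(rewrite c0 (lt_trans ct)//).
have xi : x i 0 <= x i t.
  by apply: (sol_nondecreasing sol iN); rewrite ?in_itv /= ?lexx ?(ltW t0) ?(ltW tT) ?(ltW T_gt0).
have : vel T (x i.+1) c * (t - 0) <= speed_bound * t by rewrite subr0 ler_pM2r.
move=> h E; move: g0 h; rewrite -E /gap; lra.
Qed.

(** With gap <= W t, the damping v / gap dominates v / (W t): this is the singular equation of
    [singular_damping_le]. *)
Let vel_le t : 0 < t < T -> vel T (x i) t <= M / eps * t.
Proof.
have tg u : 0 < u < T -> 0 < gap i u.
  by move=> /andP[u0 uT]; rewrite gap_pos// u0 ltW.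
apply: (@singular_damping_le R (vel T (x i)) (vel T (vel T (x i))) T
  (gam / (eps * Cg * speed_bound)) (M / eps) speed_bound).
- by rewrite divr_gt0// !mulr_gt0.
- by rewrite divr_ge0// ltW.
- by move=> u /(vel_bound_open (ltnW iN)) /andP[/ltW ->].
- by move=> u uT; have [_ _ D _] := free_derive iN uT (tg u uT).
- move=> u uT; have gu := tg u uT; case/andP: (uT) => u0 _.
  rewrite (le_trans (acc_le iN uT gu))// lerB//.
  have -> : gam / (eps * Cg * speed_bound) * (vel T (x i) u / u) =
    gam / (eps * Cg) * (vel T (x i) u / (speed_bound * u)).
    by field; rewrite !gt_eqF.
  rewrite ler_pM2l ?divr_gt0 ?mulr_gt0//.
  have /andP[/ltW v1 _] := vel_bound_open (ltnW iN) uT.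
  by rewrite ler_wpM2l// lef_pV2 ?posrE ?mulr_gt0// gap_le.
Qed.

(** The velocity at 0 is the limit of the one-sided quotients (x(t) - x(0)) / t, and v = O(t) makes
    the displacement O(t^2). *)
Lemma initial_jam_vel : vel T (x i) 0 = 0.
Proof.
have disp t : 0 < t < T -> 0 <= x i t - x i 0 <= M / eps * t * t.
  move=> /andP[t0 tT].
  have sub : `[0, t] `<=` `[0, T].
    by move=> w /=; rewrite !in_itv /= => /andP[-> wc] /=; rewrite (le_trans wc)// ltW.
  have [||c] := @MVT R (x i) (vel T (x i)) 0 t t0 _ _.
  - move=> u; rewrite in_itv /= => /andP[u0 ut].
    by have [] := @all_moving i (ltnW iN) u; rewrite // u0 (lt_trans ut).
  - exact: continuous_subspaceW sub (micro_cont (ltnW iN)).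
  rewrite in_itv /= => /andP[c0 ct] ->.
  have cT : 0 < c < T by rewrite c0 (lt_trans ct).
  have /andP[v1 _] := vel_bound_open (ltnW iN) cT.
  rewrite subr0 mulr_ge0 ?(ltW v1) ?(ltW t0)//= ler_pM2r//.
  rewrite (le_trans (vel_le cT))// ler_pM2l ?divr_gt0// ltW//.
(* 0 is a limit point of [0, T]: this makes the limit defining the relative derivative unique. *)
have PF : ProperFilter (within `[0, T]%classic (0 : R)^').
  apply: Build_ProperFilter_ex => P; rewrite /within /dnbhs /within /= => /nbhs_ballP[d d0 Hd].
  have {}d0 : 0 < d := d0.
  pose t := Num.min (d / 2) (T / 2).
  have t0 : 0 < t by rewrite lt_min !divr_gt0.
  have td : t <= d / 2 by rewrite ge_min lexx.
  have tT : t <= T / 2 by rewrite ge_min lexx orbT.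
  exists t; apply: (Hd t) => /=; rewrite ?in_itv /= ?gt_eqF//; last by lra.
  by rewrite -ball_normE /= sub0r normrN gtr0_norm// (le_lt_trans td)// ltr_pdivrMr// ltr_pMr// ltr1n.
apply/cvg_lim => //; apply/cvgrPdist_lt => e e0.
rewrite /prop_near1 /= /within /dnbhs /within /=; apply/nbhs_ballP.
exists (Num.min T (e / (M / eps))) => /=; first by rewrite lt_min T_gt0 !divr_gt0.
move=> t; rewrite -ball_normE /= sub0r normrN lt_min => /andP[h1 h2] tn0.
rewrite in_itv /= => /andP[t0 tT].
have {}t0 : 0 < t by rewrite lt_neqAle eq_sym tn0.
rewrite gtr0_norm// in h1 h2.
have /andP[d1 d2] := disp t ltac:(rewrite t0//).
rewrite sub0r normrN subr0 ger0_norm; last by rewrite mulr_ge0// invr_ge0 ltW.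
rewrite mulrC ltr_pdivrMr// (le_lt_trans d2)// ltr_pM2r//.
by rewrite mulrC -ltr_pdivlMr// divr_gt0.
Qed.

Lemma initial_jam_vel_cont : forall e, 0 < e -> exists2 d : R, 0 < d &
    forall u, 0 <= u <= T -> `|0 - u| < d -> `|vel T (x i) 0 - vel T (x i) u| < e.
Proof.
move=> e e0; exists (Num.min T (e / (M / eps))).
  by rewrite lt_min T_gt0 !divr_gt0.
move=> u /andP[u0 uT]; rewrite initial_jam_vel !sub0r !normrN (ger0_norm u0) lt_min.
move=> /andP[h1 h2].
move: u0; rewrite le_eqVlt => /predU1P[<-|u0]; first by rewrite initial_jam_vel normr0.
have uT' : 0 < u < T by rewrite u0.
have /andP[v1 _] := vel_bound_open (ltnW iN) uT'.
rewrite gtr0_norm// (le_lt_trans (vel_le uT'))//.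
by rewrite mulrC -ltr_pdivlMr// divr_gt0.
Qed.

End initial_jam.

Lemma vel_cont i : (i <= N)%N -> {within `[0, T], continuous (vel T (x i))}.
Proof.
move=> iN; apply/within_continuousP => t; rewrite /= in_itv /= => tT e e0.
suff [d d0 Hd] : exists2 d : R, 0 < d & forall u, 0 <= u <= T -> `|t - u| < d ->
    `|vel T (x i) t - vel T (x i) u| < e.
  by exists d => // u; rewrite in_itv /=; exact: Hd.
case/andP: (tT) => t0 t1.
move: t0; rewrite le_eqVlt => /predU1P[tE|t0]; last first.
  by apply: vel_cont_pos => //; rewrite t0.
have := iN; rewrite leq_eqVlt => /predU1P[iE|iN'].
  have [_ /within_continuousP H1] := leader_C1 data.
  have [d d0 Hd] := H1 t (inT tT) e e0; rewrite iE.
  by exists d => // u /inT uT; exact: Hd.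
have := gap_ge0 iN' tT; rewrite le_eqVlt => /predU1P[g0|g0]; last first.
  exact: free_vel_cont.
rewrite -tE; apply: initial_jam_vel_cont => //; by rewrite [in LHS]tE.
Qed.

Lemma micro_regular :
  regular_traffic T eps gam rhobar theta F s S speed_bound N x.
Proof.
split.
- exact: micro_range.
- exact: micro_cont.
- exact: micro_lt.
- by move=> i t iN /inT tT; have [] := sol_ordered sol iN tT.
- move=> i t iN tT; rewrite rho_lt_gap ?gap_pos//.
  by case/andP: tT => /ltW -> ->.
- by move=> i t iN /(all_moving iN)[].
- exact: vel_cont.
- move=> i t iN tT; apply/andP; split.
    apply: (ge_on_closure T_gt0 (vel_cont iN)) tT => u.
    by move=> /(vel_bound_open iN) /andP[/ltW].
  apply: (le_on_closure T_gt0 (vel_cont iN)) tT => u.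
  by move=> /(vel_bound_open iN) /andP[].
- move=> i t iN tT; have g0 : 0 < gap i t.
    by rewrite gap_pos//; case/andP: tT => -> /ltW.
  by have [_ _ D <-] := free_derive iN tT g0.
Qed.

End one_solution.
End regular_traffic.
(** * Weak star compactness *)

Section sequences.
Context {R : realType}.

Lemma homo_ltn_ge (phi : nat -> nat) : {homo phi : m n / (m < n)%N} ->
  forall n, (n <= phi n)%N.
Proof. by move=> H; elim=> // n IH; rewrite (leq_ltn_trans IH)// H. Qed.

Lemma fmap_ultra (T U : Type) (f : T -> U) (G : set_system T) :
  UltraFilter G -> UltraFilter (fmap f G).
Proof.
move=> UG; have PG : ProperFilter G by exact: ultra_proper.
apply: Build_UltraFilter => H PH GH; apply/seteqP; split => A.
  move=> HA; have [//|GnA] := in_ultra_setVsetC (f @^-1` A) UG.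
  have HnA : H (~` A) by apply: GH.
  by have [x []] := filter_ex (filterI HA HnA).
exact: GH.
Qed.

(* The limits are taken along a free ultrafilter; finitely many of the sequences
   are simultaneously close to their limits at arbitrarily large ranks. *)
Lemma diagonal_extraction (I : countType) (a : I -> nat -> R) :
  (forall i, exists M : R, forall n, `|a i n| <= M) ->
  exists phi : nat -> nat, [/\ forall n, (0 < phi n)%N,
    {homo phi : m n / (m < n)%N} & forall i, cvgn (fun n => a i (phi n))].
Proof.
move=> ab.
have [G [UG GG]] := ultraFilterLemma (eventually_filter : ProperFilter \oo).
have [l Hl] : exists l : I -> R, forall i : I, (a i @ G)%classic --> l i.
  suff H (i : I) : exists x : R, (a i @ G)%classic --> x.
    by exists (fun i => sval (cid (H i))) => i; exact: svalP (cid (H i)).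
  have [M HM] := ab i.
  have : compact (`[- M, M]%classic : set R) by exact: segment_compact.
  rewrite compact_ultra => /(_ (a i @ G)%classic).
  case.
  - exact: fmap_ultra.
  - rewrite /fmap /= /nbhs /=; apply: filterS filterT => n _ /=.
    by rewrite in_itv /= -ler_norml.
  - by move=> x [_ Hx]; exists x.
have GF : ProperFilter G by exact: ultra_proper.
have E k : exists m, (k <= m)%N /\
    forall i, (pickle i <= k)%N -> `|l i - a i m| < k.+1%:R^-1.
  have k0 : 0 < k.+1%:R^-1 :> R by rewrite invr_gt0 ltr0n.
  apply: (@filter_ex _ G); apply: filterI.
    by apply: GG; exists k.
  (* Only finitely many indices have a code at most [k]; they are treated one at a time, since [G]
     is closed under finite intersections. *)
  have : forall j, G [set m | forall i, (pickle i < j)%N -> `|l i - a i m| < k.+1%:R^-1].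
    elim=> [|j IH]; first by apply: filterS filterT => m _ i.
    have [[i pi]|ni] := pselect (exists i : I, pickle i = j).
      have /cvgrPdist_lt /(_ _ k0) Hi := Hl i.
      apply: filterS2 IH Hi => m H1 H2 i'; rewrite ltnS leq_eqVlt => /predU1P[e|].
        by have -> : i' = i by apply: (pcan_inj pickleK); rewrite e pi.
      exact: H1.
    apply: filterS IH => m H1 i'; rewrite ltnS leq_eqVlt => /predU1P[e|]; last exact: H1.
    by exfalso; apply: ni; exists i'.
  by move=> /(_ k.+1).
pose e k := sval (cid (E k)).
have eP k : (k <= e k)%N /\
    forall i, (pickle i <= k)%N -> `|l i - a i (e k)| < k.+1%:R^-1.
  exact: svalP (cid (E k)).
(* [e] need not be increasing, but [k <= e k] makes this iteration strictly so; starting from [e 1]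
   keeps it positive. *)
pose phi := fix phi n := if n is n'.+1 then e (phi n').+1 else e 1%N.
have phiS n : (phi n < phi n.+1)%N by rewrite /= (leq_trans _ (eP _).1).
have phiH : {homo phi : m n / (m < n)%N} by apply: homo_ltn => //; exact: ltn_trans.
have phik n : exists2 k, (n <= k)%N & phi n = e k.
  case: n => [|n]; first by exists 1%N.
  by exists (phi n).+1 => //; rewrite ltnS homo_ltn_ge.
exists phi; split => //.
  by case=> [|n]; [rewrite /= (leq_trans _ (eP _).1)|rewrite (leq_ltn_trans _ (phiS _))].
move=> i; apply/cvg_ex; exists (l i); apply/cvgrPdist_lt => d d0.
near=> n; have [k nk ->] := phik n.
apply: (lt_le_trans ((eP k).2 i _)).
  by rewrite (leq_trans _ nk)//; near: n; exact: nbhs_infty_ge.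
apply: (@le_trans _ _ n.+1%:R^-1).
  by rewrite lef_pV2 ?posrE ?ltr0n// ler_nat.
by apply/ltW; near: n; exact: near_infty_natSinv_lt (PosNum d0).
Unshelve. all: by end_near. Qed.

Lemma cvgn_distP (u : nat -> R) (l : R) : u n @[n --> \oo] --> l <->
  forall e, 0 < e -> exists N, forall n, (N <= n)%N -> `|l - u n| < e.
Proof.
split=> [/cvgrPdist_lt H e e0|H].
  by have [N _ HN] := H e e0; exists N => n Nn; exact: HN.
by apply/cvgrPdist_lt => e e0; have [N HN] := H e e0; exists N.
Qed.

Lemma cauchy_cvgn_dist (u : nat -> R) :
  (forall e, 0 < e -> exists N, forall m n, (N <= m)%N -> (N <= n)%N ->
    `|u m - u n| < e) -> exists l : R, u n @[n --> \oo] --> l.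
Proof.
move=> H; have : cvgn u; last by move=> /cvg_ex.
apply/cauchy_cvgP/cauchy_ballP => e e0; have [N HN] := H e e0.
exists ([set u n | n in [set n | (N <= n)%N]], [set u n | n in [set n | (N <= n)%N]]).
  by split; exists N => // n Nn /=; exists n.
by move=> [_ _] /= [[m Nm <-] [n Nn <-]]; rewrite -ball_normE /=; exact: HN.
Qed.

(** The Moore-Osgood theorem: the error [r k] is uniform in n, so the limits in n and k can be
    exchanged. *)
Lemma uniform_limit_exchange (a : nat -> R) (b : nat -> nat -> R)
    (l r : nat -> R) :
  (forall k, b k n @[n --> \oo] --> l k) ->
  (forall k n, `|a n - b k n| <= r k) ->
  r k @[k --> \oo] --> (0 : R) ->
  exists2 L : R, a n @[n --> \oo] --> L & l k @[k --> \oo] --> L.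
Proof.
move=> bl abr r0.
have close k e : 0 < e -> exists N, forall n, (N <= n)%N -> `|l k - a n| < r k + e.
  move=> e0; have [N HN] := (cvgn_distP _ _).1 (bl k) e e0.
  exists N => n /HN h; have := ler_distD (b k n) (l k) (a n).
  by move=> /le_lt_trans; apply; rewrite addrC ler_ltD// distrC.
have small e : 0 < e -> exists k, r k < e.
  move=> e0; have [N HN] := (cvgn_distP _ _).1 r0 e e0.
  exists N; have := HN N (leqnn N); rewrite sub0r normrN.
  by apply: le_lt_trans; exact: ler_norm.
have [L aL] : exists L : R, a n @[n --> \oo] --> L.
  apply: cauchy_cvgn_dist => e e0; have e4 : 0 < e / 4 by rewrite divr_gt0.
  have [k rk] := small _ e4; have [N HN] := close k _ e4.
  exists N => m n /HN hm /HN hn; have := ler_distD (l k) (a m) (a n).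
  by rewrite distrC in hm; lra.
exists L => //; apply/cvgn_distP => e e0; have e3 : 0 < e / 3 by rewrite divr_gt0.
have [N HN] := (cvgn_distP _ _).1 r0 _ e3; exists N => k /HN.
rewrite sub0r normrN => /(le_lt_trans (ler_norm _)) rk.
have [N1 HN1] := close k _ e3; have [N2 HN2] := (cvgn_distP _ _).1 aL _ e3.
have := ler_distD (a (maxn N1 N2)) L (l k).
have := HN1 (maxn N1 N2) (leq_maxl _ _); have := HN2 (maxn N1 N2) (leq_maxr _ _).
by rewrite (distrC (l k)); lra.
Qed.

End sequences.
Import HBSimple.

(** * Setwise limits of uniformly dominated densities *)

Section weakstar.
Context d (T : measurableType d) {R : realType}
  (mu : {sigma_finite_measure set T -> \bar R}) (K : set T) (C : R)
  (mK : measurable K) (muK : (mu K < +oo)%E) (C0 : 0 <= C).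

Definition massK (B : set T) : R := fine (mu (K `&` B)).

Let muKB B : measurable B -> mu (K `&` B) \is a fin_num.
Proof.
move=> mB; rewrite ge0_fin_numE//; apply: le_lt_trans muK.
by apply: le_measure; rewrite ?inE//; exact: measurableI.
Qed.

Lemma integrable_cst_indic (B : set T) : measurable B ->
  mu.-integrable B (EFin \o (fun x => C * \1_K x)).
Proof.
move=> mB; apply: (integrableS measurableT) => //.
apply/integrableP; split.
  apply/measurable_EFinP; apply: measurable_funM => //.
under eq_integral => x _.
  rewrite /= ger0_norm ?mulr_ge0// EFinM.
  over.
rewrite ge0_integralZl//=; last exact/measurable_EFinP.
rewrite integral_indic// setIT lte_mul_pinfty ?lee_fin//.
Qed.

Lemma Rintegral_cst_indic (B : set T) : measurable B ->
  \int[mu]_(x in B) (C * \1_K x) = C * massK B.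
Proof.
move=> mB; rewrite /Rintegral.
under eq_integral do rewrite EFinM.
rewrite ge0_integralZl//=; last exact/measurable_EFinP.
by rewrite integral_indic// fineM// muKB.
Qed.

Lemma bounded_integrable (f : T -> R) (B : set T) : measurable B ->
  measurable_fun B f -> (forall x, B x -> `|f x| <= C * \1_K x) ->
  mu.-integrable B (EFin \o f).
Proof.
move=> mB mf fC; apply: (le_integrable mB _ _ (integrable_cst_indic mB)).
  exact/measurable_EFinP.
move=> x Bx /=; rewrite lee_fin (le_trans (fC x Bx))//.
by rewrite ger0_norm// mulr_ge0.
Qed.

Lemma massK_bigcup (F : (set T)^nat) : (forall n, measurable (F n)) ->
  trivIset setT F ->
  massK (\bigcup_k F k) - massK (\big[setU/set0]_(j < k) F j) @[k --> \oo] --> (0 : R).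
Proof.
move=> mF tF; have mU : measurable (\bigcup_k F k) by exact: bigcup_measurable.
have mUk k : measurable (\big[setU/set0]_(j < k) F j) by exact: bigsetU_measurable.
rewrite -(subrr (massK (\bigcup_k F k))); apply: cvgB; first exact: cvg_cst.
apply: fine_cvg; rewrite fineK ?muKB//.
have -> : K `&` \bigcup_k F k = \bigcup_k (K `&` \big[setU/set0]_(j < k) F j).
  rewrite -setI_bigcupr; congr (_ `&` _).
  apply/seteqP; split => [x [k _ Fx]|x [k _]].
    by exists k.+1 => //; rewrite big_ord_recr; right.
  by rewrite -bigcup_mkord => -[j _ Fx]; exists j.
apply: nondecreasing_cvg_mu => [k|| m n mn].
- exact: measurableI.
- by apply: bigcup_measurable => k _; exact: measurableI.
- by apply/subsetPset; apply: setIS; exact: subset_bigsetU.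
Qed.

Section sequence_of_functions.
Context (u : nat -> T -> R) (um : forall n, measurable_fun setT (u n))
  (u0 : forall n x, 0 <= u n x) (uC : forall n x, u n x <= C * \1_K x).

Definition intw n (B : set T) : R := \int[mu]_(x in B) u n x.

Lemma u_integrable n B : measurable B -> mu.-integrable B (EFin \o u n).
Proof.
move=> mB; apply: bounded_integrable => //; first exact: measurable_funTS.
by move=> x _; rewrite ger0_norm.
Qed.

Lemma intw_ge0 n B : 0 <= intw n B.
Proof. by apply: Rintegral_ge0 => x _. Qed.

Lemma intw_le n B : measurable B -> intw n B <= C * massK B.
Proof.
move=> mB; rewrite -Rintegral_cst_indic//; apply: le_Rintegral => //.
- exact: u_integrable.
- exact: integrable_cst_indic.
Qed.

Lemma intw_setU n A B : measurable A -> measurable B -> [disjoint A & B] ->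
  intw n (A `|` B) = intw n A + intw n B.
Proof.
move=> mA mB AB; rewrite /intw Rintegral_setU//; apply: u_integrable.
exact: measurableU.
Qed.

Lemma intw_bigsetU n (F : (set T)^nat) k : (forall n, measurable (F n)) ->
  trivIset setT F ->
  intw n (\big[setU/set0]_(j < k) F j) = \sum_(j < k) intw n (F j).
Proof.
move=> mF tF; elim: k => [|k IH].
  by rewrite !big_ord0 /intw Rintegral_set0.
rewrite !big_ord_recr /= intw_setU//; first by rewrite IH.
- exact: bigsetU_measurable.
- apply/disj_setPS; rewrite -bigcup_mkord => x [[j /= jk Fjx] Fkx].
  by have jE := tF j k I I (ex_intro _ x (conj Fjx Fkx)); rewrite jE ltnn in jk.
Qed.

(** Domination makes the tails of a disjoint union small uniformly in n. Countable additivity of the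
    limit set function rests on this. *)
Lemma intw_tail n (F : (set T)^nat) k : (forall n, measurable (F n)) ->
  trivIset setT F ->
  `|intw n (\bigcup_k F k) - \sum_(j < k) intw n (F j)| <=
  C * (massK (\bigcup_k F k) - massK (\big[setU/set0]_(j < k) F j)).
Proof.
move=> mF tF; set U := \bigcup_k F k; set Uk := \big[setU/set0]_(j < k) F j.
have mU : measurable U by exact: bigcup_measurable.
have mUk : measurable Uk by exact: bigsetU_measurable.
have sU : Uk `<=` U by rewrite /Uk -bigcup_mkord; apply: bigcup_sub => j _; exact: bigcup_sup.
have mD : measurable (U `\` Uk) by exact: measurableD.
have UE : U = Uk `|` (U `\` Uk) by rewrite setDUK.
have dis : [disjoint Uk & U `\` Uk].
  by apply/disj_setPS => x [? []].
have -> : massK U - massK Uk = massK (U `\` Uk).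
  rewrite /massK {1}UE setIUr measureU ?fineD ?muKB//; [|exact: measurableI|exact: measurableI|].
    by rewrite addrAC subrr add0r.
  by rewrite -subset0 => x [[_ ?] [_ []]].
rewrite -intw_bigsetU// -/Uk {1}UE intw_setU// addrAC subrr add0r.
by rewrite ger0_norm ?intw_ge0// intw_le.
Qed.

Lemma intw_bigcup (F : (set T)^nat) : (forall n, measurable (F n)) ->
  trivIset setT F -> (forall k, cvgn (fun n => intw n (F k))) ->
  exists2 L : R, intw n (\bigcup_k F k) @[n --> \oo] --> L &
    \sum_(j < k) limn (fun n => intw n (F j)) @[k --> \oo] --> L.
Proof.
move=> mF tF cF.
apply: (@uniform_limit_exchange R _ (fun k n => \sum_(j < k) intw n (F j)) _
  (fun k => C * (massK (\bigcup_k F k) - massK (\big[setU/set0]_(j < k) F j)))).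
- elim=> [|k IH].
    by under eq_fun do rewrite big_ord0; rewrite big_ord0; exact: cvg_cst.
  under eq_fun do rewrite big_ord_recr; rewrite big_ord_recr.
  by apply: cvgD; [exact: IH|exact: cF].
- by move=> k n; exact: intw_tail.
- by rewrite -(mulr0 C); apply: cvgM; [exact: cvg_cst|exact: massK_bigcup].
Qed.

(** The sets on which the masses converge form a Dynkin system: complements come from the total
    mass, disjoint unions from [intw_bigcup]. *)
Lemma intw_dynkin (G : set (set T)) : d.-measurable = <<s G >> -> setI_closed G ->
  cvgn (fun n => intw n setT) ->
  (forall B, G B -> cvgn (fun n => intw n B)) ->
  forall B, measurable B -> cvgn (fun n => intw n B).
Proof.
move=> GE GI cT cG B; rewrite GE => GB.
refine (dynkin_induction GE GI cT cG _ _ GB).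
- move=> S mS cS.
  have -> : (fun n => intw n (~` S)) = (fun n => intw n setT - intw n S).
    apply/funext => n; rewrite -(setUv S) intw_setU//; first lra.
      exact: measurableC.
    by apply/disj_set2P; rewrite setICr.
  exact: (is_cvgB cT cS).
- by move=> F mF tF /(intw_bigcup mF tF)[L HL _]; apply/cvg_ex; exists L.
Qed.

Section setwise_limit.
Context (cu : forall B, measurable B -> cvgn (fun n => intw n B)).

(** The value 0 off the measurable sets makes [wlim] nonnegative on every set, as the measure
    structure demands; the limits are known to exist on measurable sets only. *)
Definition wlim (B : set T) : \bar R :=
  if `[< measurable B >] then (limn (fun n => intw n B))%:E else 0%E.

Let wlimE B : measurable B -> wlim B = (limn (fun n => intw n B))%:E.
Proof. by move=> mB; rewrite /wlim; case: asboolP. Qed.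

Let wlim0 : wlim set0 = 0%E.
Proof.
rewrite wlimE// /intw; under eq_fun do rewrite Rintegral_set0.
by rewrite lim_cst.
Qed.

Let wlim_ge0 B : (0 <= wlim B)%E.
Proof.
rewrite /wlim; case: asboolP => // mB; rewrite lee_fin.
by apply: limr_ge; [exact: cu|apply: nearW => n; exact: intw_ge0].
Qed.

Let wlim_le B : measurable B -> (wlim B <= (C * massK B)%:E)%E.
Proof.
move=> mB; rewrite wlimE// lee_fin.
by apply: limr_le; [exact: cu|apply: nearW => n; exact: intw_le].
Qed.

Let wlim_sigma_additive : semi_sigma_additive wlim.
Proof.
move=> F mF tF mU; rewrite wlimE//.
have [L HL HS] := intw_bigcup mF tF (fun k => cu (mF k)).
rewrite (cvg_lim _ HL)//.
have -> : (fun n => \sum_(0 <= i < n) wlim (F i))%E =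
   EFin \o (fun k => \sum_(j < k) limn (fun n => intw n (F j))).
  apply/funext => k /=; rewrite big_mkord -sumEFin; apply: eq_bigr => i _.
  exact: wlimE.
exact: cvg_comp HS _.
Qed.

HB.instance Definition _ := isMeasure.Build _ _ _ wlim wlim0 wlim_ge0 wlim_sigma_additive.

Let wlim_fin : fin_num_fun wlim.
Proof. by move=> B mB; rewrite wlimE. Qed.

HB.instance Definition _ := @Measure_isFinite.Build _ _ _ wlim wlim_fin.

(* The limit set function is a measure dominated by C mu (K `&` _): take its
   Radon-Nikodym density. *)
Lemma setwise_density : exists f : T -> R,
  [/\ measurable_fun setT f, forall x, 0 <= f x <= C * \1_K x &
  forall B, measurable B -> intw n B @[n --> \oo] --> \int[mu]_(x in B) f x].
Proof.
pose nu : {finite_measure set T -> \bar R} := wlim.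
have dom : nu `<< mu.
  move=> N HN A mA AN; apply/eqP; rewrite eq_le wlim_ge0 andbT.
  apply: (le_trans (wlim_le mA)); rewrite lee_fin /massK.
  suff -> : mu (K `&` A) = 0%E by rewrite mulr0.
  by apply: HN; [exact: measurableI|move=> x [_ /AN]].
pose f0 := Radon_Nikodym_SigmaFinite.f nu mu.
have f0_ge0 x : (0 <= f0 x)%E by exact: Radon_Nikodym_SigmaFinite.f_ge0.
have f0_fin x : f0 x \is a fin_num by exact: Radon_Nikodym_SigmaFinite.f_fin_num.
have mf0 : measurable_fun setT f0.
  exact: (measurable_int _ (Radon_Nikodym_SigmaFinite.f_integrable dom)).
have nuE B : measurable B -> nu B = (\int[mu]_(x in B) f0 x)%E.
  exact: Radon_Nikodym_SigmaFinite.f_integral.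
pose g x : \bar R := (C * \1_K x)%:E.
have g0 x : (0 <= g x)%E by rewrite lee_fin mulr_ge0.
have gi : mu.-integrable setT g by exact: integrable_cst_indic.
have mg : measurable_fun setT g by exact: (measurable_int _ gi).
have gE B : measurable B -> (\int[mu]_(x in B) g x = (C * massK B)%:E)%E.
  move=> mB; rewrite -Rintegral_cst_indic// /Rintegral fineK//.
  by apply: integrable_fin_num => //; exact: integrable_cst_indic.
pose h x := maxe (f0 x) (g x).
have mh : measurable_fun setT h by exact: measurable_maxe.
have h0 x : (0 <= h x)%E by rewrite /h le_max f0_ge0.
pose A := [set x | (g x < f0 x)%E].
have mA : measurable A by rewrite -[A]setTI; exact: measurable_lte.
(* The inequality f0 <= g almost everywhere, in the form g = max(f0, g). The integrals over any [E]
   are compared on [A], where the maximum is [f0] and its integral is [nu], and off [A], where it is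
   [g]. *)
have ae : ae_eq mu setT g h.
  apply: integral_ae_eq => // E _ mE; apply/eqP; rewrite eq_le; apply/andP; split.
    apply: ge0_le_integral => //; [exact: measurable_funTS|exact: measurable_funTS|].
    by move=> x _; rewrite /h le_max lexx orbT.
  have mEA : measurable (E `&` A) by exact: measurableI.
  have mED : measurable (E `\` A) by exact: measurableD.
  have dEA : [disjoint E `&` A & E `\` A] by apply/disj_setPS => x [[_ ?] []].
  rewrite -(setUIDK E A) !ge0_integral_setU//; try exact: measurable_funTS.
  apply: leeD.
    rewrite (_ : (\int[mu]_(x in E `&` A) h x = nu (E `&` A))%E).
      by rewrite gE// wlim_le.
    rewrite nuE//; apply: eq_integral => x; rewrite inE => -[_ /ltW gf].
    by rewrite /h; apply/max_idPl.
  apply: ge0_le_integral => //; [exact: measurable_funTS|exact: measurable_funTS|].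
  move=> x [_ /negP]; rewrite -leNgt => fg.
  by rewrite /h ge_max fg lexx.
(* The Radon-Nikodym density satisfies the bound almost everywhere; the truncation satisfies it
   everywhere. *)
pose f x := Num.min (fine (f0 x)) (C * \1_K x).
have mf : measurable_fun setT f.
  apply: measurable_minr; first exact: measurableT_comp.
  exact: measurable_funM.
exists f; split => //.
  move=> x; rewrite /f ge_min lexx orbT andbT le_min mulr_ge0// andbT.
  exact: fine_ge0.
move=> B mB.
have -> : \int[mu]_(x in B) f x = limn (fun n => intw n B).
  apply: EFin_inj; rewrite -wlimE// -[wlim B]/(nu B) nuE// /Rintegral fineK.
    apply: ae_eq_integral => //.
    - by apply/measurable_EFinP; exact: measurable_funTS.
    - exact: measurable_funTS.
    apply: filterS ae => x /(_ I) /= Hx _.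
    have : (f0 x <= g x)%E by rewrite Hx /h le_max lexx.
    by rewrite -(fineK (f0_fin x)) lee_fin => /min_idPl; rewrite /f => ->.
  apply: integrable_fin_num => //; apply: bounded_integrable => //.
    exact: measurable_funTS.
  move=> x _; rewrite ger0_norm; first by rewrite /f ge_min lexx orbT.
  by rewrite le_min mulr_ge0// andbT; exact: fine_ge0.
exact: cu.
Qed.

End setwise_limit.

Section test_functions.
Context (f : T -> R) (mf : measurable_fun setT f)
  (f0C : forall x, 0 <= f x <= C * \1_K x)
  (uf : forall B, measurable B -> intw n B @[n --> \oo] --> \int[mu]_(x in B) f x).

Let w_bound (w h : T -> R) M x : 0 <= w x <= C * \1_K x -> `|h x| <= M ->
  `|w x * h x| <= C * M * \1_K x.
Proof.
move=> /andP[w0 wC] hM; rewrite normrM (ger0_norm w0) mulrAC.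
by rewrite ler_pM.
Qed.

Let wh_integrable (w h : T -> R) M : measurable_fun setT w ->
  (forall x, 0 <= w x <= C * \1_K x) -> measurable_fun setT h ->
  (forall x, `|h x| <= M) -> mu.-integrable setT (EFin \o (fun x => w x * h x)).
Proof.
move=> mw wC mh hM.
have M0 : 0 <= M \/ K = set0.
  have [->|/set0P[x _]] := eqVneq K set0; [by right|left].
  exact: le_trans (hM x).
case: M0 => [M0|K0]; last first.
  rewrite (_ : _ \o _ = cst 0%E); first exact: integrable0.
  apply/funext => x /=; have /andP[w1 w2] := wC x.
  have : w x <= 0 by rewrite (le_trans w2)// K0 indic0 mulr0.
  by move=> w3; rewrite (_ : w x = 0) ?mul0r//; apply/eqP; rewrite eq_le w3.
have CM : 0 <= C * M by exact: mulr_ge0.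
apply: (le_integrable measurableT (g := EFin \o (fun x => C * M * \1_K x))).
- by apply/measurable_EFinP; exact: measurable_funM.
- move=> x _ /=; rewrite lee_fin (le_trans (w_bound _ (hM x)))//.
  by rewrite ger0_norm// mulr_ge0.
have -> : EFin \o (fun x => C * M * \1_K x) =
    EFin \o (fun x => M * (C * \1_K x)).
  by apply/funext => x /=; rewrite mulrCA mulrA.
by apply: (integrableZl measurableT) (integrable_cst_indic measurableT).
Qed.

Let good (h : T -> R) := [/\ measurable_fun setT h, exists M : R, forall x, `|h x| <= M
  & \int[mu]_x (u n x * h x) @[n --> \oo] --> \int[mu]_x (f x * h x)].

Let u0C n x : 0 <= u n x <= C * \1_K x. Proof. by rewrite u0 uC. Qed.

Let good_indic (B : set T) (y : R) : measurable B -> good (fun x => y * \1_B x).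
Proof.
move=> mB.
have mi : measurable_fun setT (\1_B : T -> R) by [].
have bi x : `|(\1_B x : R)| <= 1 by rewrite indicE normr_nat; case: (_ \in _).
have E (w : T -> R) : measurable_fun setT w -> (forall x, 0 <= w x <= C * \1_K x) ->
    \int[mu]_x (w x * (y * \1_B x)) = y * \int[mu]_(x in B) w x.
  move=> mw wC.
  under eq_Rintegral do rewrite mulrCA.
  rewrite RintegralZl//; last exact: (wh_integrable mw wC mi bi).
  congr (_ * _); rewrite [RHS]Rintegral_mkcond; apply: eq_Rintegral => x _.
  by rewrite patchE indicE; case: ifPn; rewrite ?mulr1 ?mulr0.
split.
- exact: measurable_funM.
- by exists `|y| => x; rewrite normrM ler_piMr.
- rewrite E//; under eq_fun do rewrite E//.
  by apply: cvgM; [exact: cvg_cst|exact: uf].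
Qed.

Let good_add (g h : T -> R) : good g -> good h -> good (fun x => g x + h x).
Proof.
move=> [mg [Mg HMg] cg] [mh [Mh HMh] ch].
have E (w : T -> R) : measurable_fun setT w -> (forall x, 0 <= w x <= C * \1_K x) ->
    \int[mu]_x (w x * (g x + h x)) = \int[mu]_x (w x * g x) + \int[mu]_x (w x * h x).
  move=> mw wC; under eq_Rintegral do rewrite mulrDr.
  rewrite RintegralD//.
  - exact: (wh_integrable mw wC mg HMg).
  - exact: (wh_integrable mw wC mh HMh).
split.
- exact: measurable_funD.
- by exists (Mg + Mh) => x; rewrite (le_trans (ler_normD _ _))// lerD.
- by rewrite E//; under eq_fun do rewrite E//; exact: cvgD.
Qed.

Let good_sfun (h : {sfun T >-> R}) : good h.
Proof.
have -> : (h : T -> R) = (fun x =>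
    \sum_(y <- finmap.enum_fset (fset_set (range h))) y * \1_(h @^-1` [set y]) x).
  by apply/funext => x; rewrite {1}fimfunE fsbig_finite.
elim: (finmap.enum_fset _) => [|y r IH].
  rewrite (_ : (fun x => _) = (fun x => 0 * \1_setT x)); first exact: good_indic.
  by apply/funext => x; rewrite big_nil mul0r.
rewrite (_ : (fun x => _) = (fun x => y * \1_(h @^-1` [set y]) x +
   \sum_(y <- r) y * \1_(h @^-1` [set y]) x)).
  by apply: good_add => //; exact: good_indic.
by apply/funext => x; rewrite big_cons.
Qed.

(** Simple functions approximate [g] in L^1, and the error, at most C times the L^1 distance, is
    uniform in n: the situation of [uniform_limit_exchange]. *)
Lemma weakstar_L1 (g : T -> R) : mu.-integrable setT (EFin \o g) ->
  \int[mu]_x (u n x * g x) @[n --> \oo] --> \int[mu]_x (f x * g x).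
Proof.
move=> gi; have mg : measurable_fun setT g.
  by apply/measurable_EFinP; exact: (measurable_int _ gi).
have [g_ [gk_int _ gk0]] := approximation_sfun_integrable measurableT gi.
have mgk k : measurable_fun setT (g_ k) by [].
pose del k := \int[mu]_x `|g x - g_ k x|.
have diff_int k : mu.-integrable setT (EFin \o (fun x => g x - g_ k x)).
  by apply: (integrableB measurableT gi (gk_int k)).
have del_cvg : del k @[k --> \oo] --> (0 : R).
  exact: (fine_cvg gk0).
have wg_int (w h : T -> R) : measurable_fun setT w -> (forall x, 0 <= w x <= C * \1_K x) ->
    mu.-integrable setT (EFin \o h) ->
    mu.-integrable setT (EFin \o (fun x => w x * h x)).
  move=> mw wC ih.
  apply: (le_integrable measurableT (g := EFin \o (fun x => C * h x))).
  - apply/measurable_EFinP; apply: measurable_funM => //.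
    by apply/measurable_EFinP; exact: (measurable_int _ ih).
  - move=> x _ /=; rewrite lee_fin !normrM; have /andP[w0 w1] := wC x.
    rewrite ler_wpM2r// !ger0_norm// (le_trans w1)// indicE.
    by rewrite ler_piMr//; case: (_ \in _); rewrite ?ler01.
  exact: (integrableZl measurableT _ ih).
have close (w : T -> R) k : measurable_fun setT w -> (forall x, 0 <= w x <= C * \1_K x) ->
    `|\int[mu]_x (w x * g x) - \int[mu]_x (w x * g_ k x)| <= C * del k.
  move=> mw wC; rewrite -RintegralB//; [|exact: wg_int|exact: wg_int].
  have i1 : mu.-integrable setT (EFin \o (fun x => w x * (g x - g_ k x))).
    exact: wg_int.
  have i2 : mu.-integrable setT (EFin \o (fun x => `|g x - g_ k x|)).
    exact: (integrable_abse (diff_int k)).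
  under eq_Rintegral do rewrite -mulrBr.
  apply: (le_trans (le_normr_Rintegral measurableT i1)).
  rewrite /del -RintegralZl//; apply: le_Rintegral => //.
  - exact: (integrable_abse i1).
  - exact: (integrableZl measurableT _ i2).
  - move=> x _; rewrite normrM ler_wpM2r//; have /andP[w0 w1] := wC x.
    rewrite ger0_norm// (le_trans w1)// indicE.
    by rewrite ler_piMr//; case: (_ \in _); rewrite ?ler01.
have r0 : C * del k @[k --> \oo] --> (0 : R).
  by rewrite -(mulr0 C); apply: cvgM => //; exact: cvg_cst.
have gk k : \int[mu]_x (u n x * g_ k x) @[n --> \oo] --> \int[mu]_x (f x * g_ k x).
  by have [_ _] := good_sfun (g_ k).
have [L aL lL] := uniform_limit_exchange gk
  (fun k n => close (u n) k (um n) (u0C n)) r0.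
suff <- : L = \int[mu]_x (f x * g x) by exact: aL.
apply: (cvg_unique _ lL) => //.
apply/cvgn_distP => e e0; have [N HN] := (cvgn_distP _ _).1 r0 e e0.
exists N => k /HN; rewrite sub0r normrN => /(le_lt_trans (ler_norm _)).
by apply: le_lt_trans; exact: close.
Qed.

End test_functions.
End sequence_of_functions.
End weakstar.

(** * Moduli of continuity on compact sets, and generators of the Borel sets *)

Section compactness_and_measurability.
Context {R : realType}.

(** Heine's theorem by the near-covering form of compactness, the parameter being a radius that
    tends to 0 from the right. *)
Lemma compact_uniform_continuity (V : pseudoMetricNormedZmodType R) (K : set V)
    (f : V -> R) : compact K -> {within K, continuous f} ->
  forall e, 0 < e -> exists2 d : R, 0 < d &
    forall p q, K p -> K q -> `|p - q| < d -> `|f p - f q| < e.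
Proof.
move=> cK /within_continuousP fc e e0; have e2 : 0 < e / 2 by rewrite divr_gt0.
move/compact_near_coveringP : cK => /(_ R (0 : R)^'+
  (fun d p => forall q, K p -> K q -> `|p - q| < d -> `|f p - f q| < e)) H.
have {}H := H (at_right_proper_filter _).
have [d [d0 Hd]] : exists d : R, 0 < d /\ forall p, K p ->
    forall q, K p -> K q -> `|p - q| < d -> `|f p - f q| < e.
  apply: (@filter_ex _ ((0 : R)^'+)).
  apply: filterI; first exact: nbhs_right_gt.
  apply: H => x Kx; have [d d0 Hd] := fc x Kx _ e2.
  exists (ball x (d / 2), [set t : R | t < d / 2]).
    split => /=; first by apply: nbhsx_ballx; rewrite divr_gt0.
    by apply: nbhs_right_lt; rewrite divr_gt0.
  move=> [p t] /= [+ td] q Kp Kq pq; rewrite -ball_normE /= => xp.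
  have h1 : `|f x - f p| < e / 2.
    by apply: Hd => //; lra.
  have h2 : `|f x - f q| < e / 2.
    apply: Hd => //; rewrite (le_lt_trans (ler_distD p _ _))//; lra.
  by have := ler_distD (f x) (f p) (f q); rewrite (distrC (f p) (f x)); lra.
by exists d => // p q Kp Kq; exact: Hd.
Qed.

Lemma compact_bound (V : pseudoMetricNormedZmodType R) (K : set V) (f : V -> R) :
  compact K -> {within K, continuous f} ->
  exists2 M : R, 0 < M & forall p, K p -> `|f p| <= M.
Proof.
move=> cK fc; have /compact_bounded [M [_ HM]] := continuous_compact fc cK.
exists (`|M| + 1); first by rewrite ltr_wpDl.
by move=> p Kp; apply: (HM (`|M| + 1)); [rewrite (le_lt_trans (ler_norm _))// ltrDl | exists p].
Qed.

(** Beyond the distance [d] of uniform continuity, the oscillation 2 M is at most (2 M / d) |p - q|.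
    An affine modulus can be summed over cells of unequal widths, since only the total width then
    matters. *)
Lemma compact_almost_lipschitz (V : pseudoMetricNormedZmodType R) (K : set V)
    (f : V -> R) : compact K -> {within K, continuous f} ->
  forall e, 0 < e -> exists2 L : R, 0 < L &
    forall p q, K p -> K q -> `|f p - f q| <= e + L * `|p - q|.
Proof.
move=> cK fc e e0; have [M M0 HM] := compact_bound cK fc.
have [d d0 Hd] := compact_uniform_continuity cK fc e0.
have L0 : 0 < 2 * M / d by rewrite divr_gt0// mulr_gt0.
exists (2 * M / d) => // p q Kp Kq; have [pq|pq] := ltP `|p - q| d.
  by rewrite (le_trans (ltW (Hd p q Kp Kq pq)))// lerDl mulr_ge0// ltW.
have h1 : `|f p - f q| <= 2 * M.
  rewrite (le_trans (ler_normB _ _))//; have := HM p Kp; have := HM q Kq; lra.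
have h2 : 2 * M <= 2 * M / d * `|p - q|.
  by rewrite -mulrA ler_peMr ?mulr_ge0 ?(ltW M0)// ler_pdivlMl// mulr1.
by rewrite (le_trans h1)// (le_trans h2)// lerDr ltW.
Qed.

(** A countable pi-system generating the Borel sets, so that countably many limits determine all of
    them. [None] stands for the whole line and provides the total mass. *)
Definition ray (o : option rat) : set R :=
  if o is Some q then `]ratr q, +oo[%classic else setT.

Lemma measurable_ray o : measurable (ray o).
Proof. by case: o => [q|] //=; exact: measurable_itv. Qed.

Lemma ray_setI o1 o2 : exists o, ray o1 `&` ray o2 = ray o.
Proof.
case: o1 o2 => [q|] [r|] /=; rewrite ?setIT ?setTI; last by exists None.
- exists (Some (Num.max q r)); apply/seteqP; split => x /=; rewrite !in_itv /= !andbT.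
    by move=> [h1 h2]; rewrite /Num.max; case: ifP.
  have hq : (ratr q : R) <= ratr (Num.max q r) by rewrite ler_rat le_max lexx.
  have hr : (ratr r : R) <= ratr (Num.max q r) by rewrite ler_rat le_max lexx orbT.
  by move=> h; split; [exact: le_lt_trans hq h|exact: le_lt_trans hr h].
- by exists (Some q).
- by exists (Some r).
Qed.

Lemma measurable_rays : @measurable _ R = <<s range ray >>.
Proof.
apply/seteqP; split; last first.
  apply: smallest_sub; first exact: sigma_algebra_measurable.
  by move=> _ [ o _ <-]; exact: measurable_ray.
rewrite [X in X `<=` _](RGenOInfty.measurableE R).
apply: smallest_sub; first exact: smallest_sigma_algebra.
move=> _ [x ->].
have -> : `]x, +oo[%classic = \bigcup_(n : nat)
    (if (unpickle n : option rat) is Some q then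
      if x <= ratr q then ray (Some q) else set0 else set0) :> set R.
  apply/seteqP; split => y /=; rewrite in_itv /= andbT.
    move=> xy; have [q] := rat_in_itvoo xy; rewrite in_itv /= => /andP[xq qy].
    by exists (pickle q); [exact: I|rewrite pickleK (ltW xq) /= in_itv /= qy].
  move=> [n _]; case: (unpickle n) => // q; case: ifP => // xq.
  by rewrite /= in_itv /= andbT; exact: le_lt_trans.
have sG : sigma_algebra setT <<s range ray >> by exact: smallest_sigma_algebra.
have [s0 _ sU] := sG.
apply: sU => n; case: (unpickle n) => [q|] //; case: ifP => // _.
by apply: sub_sigma_algebra; exists (Some q).
Qed.

Lemma rays_setI_closed : setI_closed (range ray).
Proof. by move=> _ _ [ o1 _ <-] [ o2 _ <-]; have [ o ->] := ray_setI o1 o2; exists o. Qed.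

(** Rational boxes form a countable base, so the product sigma-algebra contains the open sets. *)
Lemma open_measurable_plane (U : set (R * R)) : open U -> measurable U.
Proof.
move=> oU.
pose box (q : rat * rat * rat * rat) : set (R * R) :=
  `]ratr q.1.1.1, ratr q.1.1.2[ `*` `]ratr q.1.2, ratr q.2[.
have -> : U = \bigcup_(n : nat)
    (if (unpickle n : option (rat * rat * rat * rat)) is Some q then
      if `[< box q `<=` U >] then box q else set0 else set0).
  apply/seteqP; split => p.
    move=> Up; have /nbhs_ballP[e e0 He] : nbhs p U by exact: open_nbhs_nbhs.
    have {}e0 : 0 < (e : R) := e0.
    have rat_near (y : R) : exists a b : rat, y - e < ratr a < y /\ y < ratr b < y + e.
      have h0 : y - e < y by rewrite ltrBlDr ltrDl.
      have [a] := rat_in_itvoo h0.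
      rewrite in_itv /= => Ha.
      have h : y < y + e by rewrite ltrDl.
      have [b] := rat_in_itvoo h; rewrite in_itv /= => Hb.
      by exists a, b.
    have [a [b [Ha Hb]]] := rat_near p.1; have [c [d [Hc Hd]]] := rat_near p.2.
    exists (pickle (a, b, c, d)); first exact: I.
    rewrite pickleK; case: asboolP => [_|nsub].
      by split => /=; rewrite in_itv /=; lra.
    exfalso; apply: nsub => r [] /=; rewrite !in_itv /= => h1 h2; apply: He.
    by split; rewrite -ball_normE /= ltr_norml; lra.
  by move=> [n _]; case: (unpickle n) => // q; case: asboolP => // + ; apply.
apply: bigcup_measurable => n _; case: (unpickle n) => // q; case: asboolP => // _.
by apply: measurableX; exact: measurable_itv.
Qed.

Lemma continuous_measurable_plane (f : R * R -> R) : continuous f ->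
  measurable_fun setT f.
Proof.
move=> fc; apply: (measurability _ (RGenOInfty.measurableE R)).
move=> _ [_ [x ->] <-]; rewrite setTI; apply: open_measurable_plane.
by apply: open_comp; [move=> p _; exact: fc|exact: interval_open].
Qed.

End compactness_and_measurability.

Section plane_measure.
Context {R : realType}.
Local Open Scope ereal_scope.

Lemma leb2E (A B : set R) : measurable A -> measurable B ->
  leb2 (A `*` B) = leb A * leb B.
Proof. by move=> mA mB; exact: product_measure1E. Qed.

Lemma leb2_sigma_finite : sigma_finite setT (@leb2 R).
Proof.
have /sigma_finiteP[F [FT ndF Foo]] := sigma_finiteT (@lebesgue_measure R).
exists (fun n => F n `*` F n).
  rewrite -setXTT FT predeqE => -[x y]; split.
    move=> [/= [n _ Fnx] [k _ Fky]]; exists (maxn n k) => //; split.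
    - by move: x Fnx; exact/subsetPset/ndF/leq_maxl.
    - by move: y Fky; exact/subsetPset/ndF/leq_maxr.
  by move=> [n _ []/= ? ?]; split; exists n.
move=> k; have [mF Fk] := Foo k; split; first exact: measurableX.
by rewrite leb2E// lte_mul_pinfty// ge0_fin_numE.
Qed.

(** The same measure as [leb2], bundled with the sigma-finiteness that Radon-Nikodym needs. *)
Definition leb2_sigma : {sigma_finite_measure set (measurableTypeR R * measurableTypeR R)%type -> \bar R} :=
  HB.pack_for {sigma_finite_measure set (measurableTypeR R * measurableTypeR R)%type -> \bar R}
  (Measure.sort (@leb2 R)) (Measure_isSigmaFinite.Build _ _ _ (@leb2 R) leb2_sigma_finite).
End plane_measure.

Section weakstar_plane.
Context {R : realType}.
Let mu := @leb2_sigma R.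
Context (K : set (R * R)) (C : R) (mK : measurable K) (muK : (mu K < +oo)%E)
  (C0 : 0 <= C) (u : nat -> R * R -> R)
  (um : forall n, measurable_fun setT (u n)) (u0 : forall n x, 0 <= u n x)
  (uC : forall n x, u n x <= C * \1_K x).

Let cv (B : set (R * R)) := measurable B /\ cvgn (fun n => intw mu u n B).

Let cv_setD A B : cv A -> cv B -> B `<=` A -> cv (A `\` B).
Proof.
move=> [mA cA] [mB cB] BA; split; first exact: measurableD.
have -> : (fun n => intw mu u n (A `\` B)) = (fun n => intw mu u n A - intw mu u n B).
  apply/funext => n.
  have {2}-> : A = B `|` (A `\` B) by rewrite setDUK.
  rewrite (@intw_setU _ _ _ mu K C mK muK C0 u um u0 uC)//; first lra.
    exact: measurableD.
  by apply/disj_setPS => x [? []].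
exact: (is_cvgB cA cB).
Qed.

Let cv_bigcup (F : (set (R * R))^nat) : trivIset setT F -> (forall n, cv (F n)) ->
  cv (\bigcup_n F n).
Proof.
move=> tF cF; split; first by apply: bigcup_measurable => n _; have [] := cF n.
have [||] := @intw_bigcup _ _ _ mu K C mK muK C0 u um u0 uC F _ tF.
- by move=> n; have [] := cF n.
- by move=> n; have [] := cF n.
by move=> L HL _; apply/cvg_ex; exists L.
Qed.

(** Three Dynkin arguments: on the first factor with a ray as second factor, then on the second
    factor, and finally from rectangles to all measurable sets. *)
Lemma intw_plane_cvg :
  (forall o1 o2, cvgn (fun n => intw mu u n (ray o1 `*` ray o2))) ->
  forall B, measurable B -> cvgn (fun n => intw mu u n B).
Proof.
move=> H0.
have H1 (A : set R) o2 : measurable A -> cv (A `*` ray o2).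
  move=> mA; have GA : <<s range ray >> A by rewrite -measurable_rays.
  have base o : cv (ray o `*` ray o2).
    by split; [apply: measurableX; exact: measurable_ray|exact: H0].
  refine (dynkin_induction (P := fun A => cv (A `*` ray o2)) measurable_rays
    rays_setI_closed (base None) _ _ _ GA).
  - by move=> _ [ o _ <-].
  - move=> S mS cS.
    have -> : (~` S) `*` (ray o2 : set R) = (setT `*` (ray o2 : set R)) `\` (S `*` (ray o2 : set R)).
      rewrite predeqE => -[a b]; split => /= [[nS rb]|[[_ rb] nS]].
        by split => // -[].
      by split => // Sa; apply: nS.
    by apply: cv_setD; [exact: (base None)|exact: cS|move=> [a b] /= []].
  - move=> F mF tF cF; rewrite setX_bigcupl; apply: cv_bigcup => //.
    by apply/trivIsetP => i j _ _ ij; rewrite -setXI; move/trivIsetP : tF => ->//; rewrite set0X.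
have H2 (A B : set R) : measurable A -> measurable B -> cv (A `*` B).
  move=> mA mB; have GB : <<s range ray >> B by rewrite -measurable_rays.
  refine (dynkin_induction (P := fun B => cv (A `*` B)) measurable_rays
    rays_setI_closed (H1 A None mA) _ _ _ GB).
  - by move=> _ [ o _ <-]; exact: H1.
  - move=> S mS cS.
    have -> : A `*` (~` S) = (A `*` setT) `\` (A `*` S).
      rewrite predeqE => -[a b]; split => /= [[rb nS]|[[rb _] nS]].
        by split => // -[].
      by split => // Sa; apply: nS.
    by apply: cv_setD; [exact: (H1 A None mA)|exact: cS|move=> [a b] /= []].
  - move=> F mF tF cF; rewrite setX_bigcupr; apply: cv_bigcup => //.
    by apply/trivIsetP => i j _ _ ij; rewrite -setXI; move/trivIsetP : tF => ->//; rewrite setX0.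
apply: (@intw_dynkin _ _ _ mu K C mK muK C0 u um u0 uC _
  (measurable_prod_measurableType R R)).
- move=> _ _ [A1 mA1 [B1 mB1 <-]] [A2 mA2 [B2 mB2 <-]].
  rewrite -setXI; exists (A1 `&` A2); first exact: measurableI.
  by exists (B1 `&` B2) => //; exact: measurableI.
- by rewrite -setXTT; have [] := H2 setT setT measurableT measurableT.
- by move=> _ [A mA [B mB <-]]; have [] := H2 A B mA mB.
Qed.

End weakstar_plane.
(** * Compactness of families with bounded mass *)

Section dyadic_code.

(* The position of the (a, b)-th dyadic cell in the Morton order. *)
Fixpoint enc (k a b : nat) : nat :=
  if k is k'.+1 then (4 * enc k' (a %/ 2) (b %/ 2) + (2 * (a %% 2) + b %% 2))%N
  else 0%N.

Fixpoint dec1 (k j : nat) : nat :=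
  if k is k'.+1 then (2 * dec1 k' (j %/ 4) + (j %% 4) %/ 2)%N else 0%N.

Fixpoint dec2 (k j : nat) : nat :=
  if k is k'.+1 then (2 * dec2 k' (j %/ 4) + (j %% 4) %% 2)%N else 0%N.

Lemma enc_lt k a b : (enc k a b < 4 ^ k)%N.
Proof.
elim: k a b => [|k IH] a b //=; rewrite expnS.
have := IH (a %/ 2)%N (b %/ 2)%N; have := ltn_pmod a (isT : (0 < 2)%N).
by have := ltn_pmod b (isT : (0 < 2)%N); lia.
Qed.

(** The reason for the Morton order: the four children of the cell of code j have the consecutive
    codes 4 j, ..., 4 j + 3, so the cumulative weights of one generation refine those of the
    previous one. *)
Lemma enc_div4 k a b : (enc k.+1 a b %/ 4 = enc k (a %/ 2) (b %/ 2))%N.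
Proof. by rewrite /=; lia. Qed.

Lemma enc_dec k a b : (a < 2 ^ k)%N -> (b < 2 ^ k)%N ->
  dec1 k (enc k a b) = a /\ dec2 k (enc k a b) = b.
Proof.
elim: k a b => [|k IH] a b; first by rewrite expn0 /= !ltnS !leqn0 => /eqP -> /eqP ->.
rewrite !expnS => ha hb.
have [e1 e2] := IH (a %/ 2)%N (b %/ 2)%N ltac:(lia) ltac:(lia).
have E : ((4 * enc k (a %/ 2) (b %/ 2) + (2 * (a %% 2) + b %% 2)) %/ 4 =
          enc k (a %/ 2) (b %/ 2))%N by lia.
have E2 : ((4 * enc k (a %/ 2) (b %/ 2) + (2 * (a %% 2) + b %% 2)) %% 4 =
          2 * (a %% 2) + b %% 2)%N by lia.
by rewrite /= E E2 e1 e2; lia.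
Qed.

Lemma dec1_lt k j : (dec1 k j < 2 ^ k)%N.
Proof.
elim: k j => // k IH j /=; rewrite expnS.
by have := IH (j %/ 4)%N; have := ltn_pmod j (isT : (0 < 4)%N); lia.
Qed.

Lemma dec2_lt k j : (dec2 k j < 2 ^ k)%N.
Proof.
elim: k j => // k IH j /=; rewrite expnS.
by have := IH (j %/ 4)%N; have := ltn_pmod j (isT : (0 < 4)%N); lia.
Qed.

Context {R : realType}.

Definition digit (k : nat) (y : R) : nat := Num.truncn (2 ^+ k * y).

Let p2 k : 0 < 2 ^+ k :> R. Proof. by rewrite exprn_gt0. Qed.

Lemma digit_itv k (y : R) : 0 <= y ->
  (digit k y)%:R <= 2 ^+ k * y < (digit k y).+1%:R.
Proof. by move=> y0; apply: truncn_itv; rewrite mulr_ge0// ltW. Qed.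

Lemma digit_eq k (y : R) n : n%:R <= 2 ^+ k * y < n.+1%:R -> digit k y = n.
Proof.
move=> h; apply/eqP; rewrite /digit truncn_eq//; case/andP: h => h _.
exact: le_trans h.
Qed.

Lemma digit_neg k (y : R) : y < 0 -> digit k y = 0%N.
Proof.
move=> y0; apply/eqP; rewrite /digit -leqn0 leqNgt truncn_gt0 -ltNge.
by rewrite (@lt_trans _ _ 0)// pmulr_rlt0.
Qed.

Lemma digit_lt k (y : R) : y < 1 -> (digit k y < 2 ^ k)%N.
Proof.
move=> y1; have [y0|y0] := leP 0 y; last by rewrite digit_neg// expn_gt0.
have /andP[h _] := digit_itv k y0; rewrite -(ltr_nat R) natrX (le_lt_trans h)//.
by rewrite gtr_pMr.
Qed.

Lemma digit_half k (y : R) : (digit k.+1 y %/ 2 = digit k y)%N.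
Proof.
have [y0|y0] := leP 0 y; last by rewrite !digit_neg.
have /andP[h1 h2] := digit_itv k.+1 y0; apply/esym/digit_eq.
set n := digit k.+1 y in h1 h2 *.
have : (n %/ 2 * 2 <= n)%N by exact: leq_trunc_div.
rewrite -(ler_nat R) natrM => h3.
have : (n.+1 <= (n %/ 2).+1 * 2)%N by rewrite ltn_ceil.
rewrite -(ler_nat R) natrM => h4.
by rewrite exprS in h1 h2; lra.
Qed.

Lemma measurable_digit k n : measurable [set y : R | digit k y = n].
Proof.
pose I : set R := [set` `[n%:R / 2 ^+ k, n.+1%:R / 2 ^+ k[].
have mI : measurable I by exact: measurable_itv.
have mN : measurable (`]-oo, 0[%classic : set R) by exact: measurable_itv.
have mP : measurable (`[0, +oo[%classic : set R) by exact: measurable_itv.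
have -> : [set y : R | digit k y = n] =
    (I `&` `[0, +oo[%classic) `|` (if n == 0%N then `]-oo, 0[%classic else set0).
  apply/seteqP; split => y /=.
    move=> yn; have [y0|y0] := leP 0 y; last first.
      by rewrite -yn digit_neg// eqxx; right; rewrite /= in_itv.
    left; split; last by rewrite /= in_itv /= y0.
    rewrite /I /= in_itv /= ler_pdivrMr// ltr_pdivlMr// mulrC -yn.
    exact: digit_itv.
  case.
    rewrite /I /= !in_itv /= andbT ler_pdivrMr// ltr_pdivlMr// mulrC => -[h _].
    exact: digit_eq.
  by case: eqP => // ->; rewrite /= in_itv /=; exact: digit_neg.
by apply: measurableU; [exact: measurableI|case: ifP].
Qed.

End dyadic_code.

(** * Dyadic cells of the box *)

Section box_code.
Context {R : realType} (T s S : R) (T0 : 0 < T) (sS : s < S).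

(** Points outside the box receive a code below 4^k too, negative coordinates being truncated to 0;
    the densities to be coded vanish there. *)
Definition box_code (k : nat) (p : R * R) : nat :=
  enc k (digit k (p.1 / T)) (digit k ((p.2 - s) / (S - s))).

(** The corner of the cell of code j with the smallest coordinates. *)
Definition corner1 (k j : nat) : R := T * ((dec1 k j)%:R / 2 ^+ k).
Definition corner2 (k j : nat) : R := s + (S - s) * ((dec2 k j)%:R / 2 ^+ k).

Let p2 k : 0 < 2 ^+ k :> R. Proof. by rewrite exprn_gt0. Qed.
Let l0 : 0 < S - s. Proof. by rewrite subr_gt0. Qed.

Lemma box_code_lt k p : (box_code k p < 4 ^ k)%N.
Proof. exact: enc_lt. Qed.

Lemma box_code_div4 k p : (box_code k.+1 p %/ 4 = box_code k p)%N.
Proof. by rewrite /box_code enc_div4 !digit_half. Qed.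

Lemma measurable_box_code k j : measurable [set p : R * R | (box_code k p < j)%N].
Proof.
have mf (c d : R) (n : nat) : measurable [set y : R | digit k ((y - c) / d) = n].
  have mg : measurable_fun setT (fun y : R => (y - c) / d).
    by apply: measurable_funM => //; exact: measurable_funB.
  by have := mg measurableT _ (measurable_digit k n); rewrite setTI.
have -> : [set p : R * R | (box_code k p < j)%N] =
  \bigcup_a \bigcup_b (if (enc k a b < j)%N then
     [set y : R | digit k ((y - 0) / T) = a] `*`
     [set y : R | digit k ((y - s) / (S - s)) = b] else set0).
  apply/seteqP; split => p /=.
    move=> h; exists (digit k (p.1 / T)) => //.
    exists (digit k ((p.2 - s) / (S - s))) => //.
    by rewrite -[X in if X then _ else _]/(box_code k p < j)%N h; split => //=; rewrite subr0.
  move=> [a _ [b _]]; case: ifP => // h [/= ha hb].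
  by move: ha hb; rewrite subr0 /box_code => -> ->.
apply: bigcup_measurable => a _; apply: bigcup_measurable => b _.
by case: ifP => // _; exact: measurableX.
Qed.

Lemma corner_dist k p : 0 <= p.1 < T -> s <= p.2 < S ->
  0 <= p.1 - corner1 k (box_code k p) <= T / 2 ^+ k /\
  0 <= p.2 - corner2 k (box_code k p) <= (S - s) / 2 ^+ k.
Proof.
move=> /andP[t0 tT] /andP[sp pS].
have a1 : 0 <= p.1 / T by rewrite divr_ge0// ltW.
have a2 : p.1 / T < 1 by rewrite ltr_pdivrMr// mul1r.
have b1 : 0 <= (p.2 - s) / (S - s) by rewrite divr_ge0// ?(ltW l0)// subr_ge0.
have b2 : (p.2 - s) / (S - s) < 1 by rewrite ltr_pdivrMr// mul1r ltrD2r.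
have [e1 e2] := enc_dec (digit_lt k a2) (digit_lt k b2).
rewrite /corner1 /corner2 /box_code e1 e2.
have /andP[h1 h2] := digit_itv k a1; have /andP[h3 h4] := digit_itv k b1.
set A := (digit k _)%:R in h1 h2 *; set B := (digit k ((p.2 - s) / (S - s)))%:R in h3 h4 *.
have key (x y c : R) : 0 < c -> x <= 2 ^+ k * (y / c) -> 2 ^+ k * (y / c) < x + 1 ->
    0 <= y - c * (x / 2 ^+ k) <= c / 2 ^+ k.
  move=> c0 hx1 hx2.
  have -> : y - c * (x / 2 ^+ k) = c / 2 ^+ k * (2 ^+ k * (y / c) - x).
    by field; rewrite !gt_eqF.
  have cp : 0 < c / 2 ^+ k by rewrite divr_gt0.
  apply/andP; split; first by apply: mulr_ge0; [exact: ltW|rewrite subr_ge0].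
  by rewrite ler_piMr ?(ltW cp)//; lra.
have {}h2 : 2 ^+ k * (p.1 / T) < A + 1 by rewrite /A natr1.
have {}h4 : 2 ^+ k * ((p.2 - s) / (S - s)) < B + 1 by rewrite /B natr1.
by rewrite opprD addrA; split; apply: key.
Qed.

(** A child's corner is the parent's, or that shifted by half the parent's side. These geometric
    increments make the corners of nested cells converge. *)
Lemma corner1_step k j : 0 <= corner1 k.+1 j - corner1 k (j %/ 4) <= T / 2 ^+ k.+1.
Proof.
rewrite /corner1 /= natrD natrM exprS; set x := (dec1 k (j %/ 4))%:R.
have d1 : (((j %% 4) %/ 2)%N%:R : R) <= 1 by rewrite -[leRHS]/(1%:R) ler_nat; lia.
set y := ((j %% 4) %/ 2)%N%:R in d1 *.
have y0 : 0 <= y by rewrite /y ler0n.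
have -> : T * ((2 * x + y) / (2 * 2 ^+ k)) - T * (x / 2 ^+ k) = T / (2 * 2 ^+ k) * y.
  by field; rewrite gt_eqF.
have c0 : 0 < T / (2 * 2 ^+ k) by rewrite divr_gt0// mulr_gt0.
by rewrite mulr_ge0 ?(ltW c0)//= ler_piMr// ltW.
Qed.

Lemma corner2_step k j :
  0 <= corner2 k.+1 j - corner2 k (j %/ 4) <= (S - s) / 2 ^+ k.+1.
Proof.
rewrite /corner2 /= natrD natrM exprS; set x := (dec2 k (j %/ 4))%:R.
have d1 : (((j %% 4) %% 2)%N%:R : R) <= 1 by rewrite -[leRHS]/(1%:R) ler_nat; lia.
set y := ((j %% 4) %% 2)%N%:R in d1 *.
have y0 : 0 <= y by rewrite /y ler0n.
have -> : s + (S - s) * ((2 * x + y) / (2 * 2 ^+ k)) - (s + (S - s) * (x / 2 ^+ k)) =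
    (S - s) / (2 * 2 ^+ k) * y.
  by field; rewrite gt_eqF.
have c0 : 0 < (S - s) / (2 * 2 ^+ k) by rewrite divr_gt0// mulr_gt0.
by rewrite mulr_ge0 ?(ltW c0)//= ler_piMr// ltW.
Qed.

Lemma corner_box k j : 0 <= corner1 k j <= T /\ s <= corner2 k j <= S.
Proof.
have h1 : ((dec1 k j)%:R : R) <= 2 ^+ k by rewrite -natrX ler_nat ltnW// dec1_lt.
have h2 : ((dec2 k j)%:R : R) <= 2 ^+ k by rewrite -natrX ler_nat ltnW// dec2_lt.
have f1 : 0 <= ((dec1 k j)%:R : R) / 2 ^+ k <= 1.
  by rewrite divr_ge0 ?(ltW (p2 k))//= ler_pdivrMr// mul1r.
have f2 : 0 <= ((dec2 k j)%:R : R) / 2 ^+ k <= 1.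
  by rewrite divr_ge0 ?(ltW (p2 k))//= ler_pdivrMr// mul1r.
rewrite /corner1 /corner2; case/andP: f1 => f1 f1'; case/andP: f2 => f2 f2'.
have m1 : 0 <= T * ((dec1 k j)%:R / 2 ^+ k) <= T.
  by rewrite mulr_ge0 ?(ltW T0)//= ler_piMr// ltW.
have m2 : 0 <= (S - s) * ((dec2 k j)%:R / 2 ^+ k) <= S - s.
  by rewrite mulr_ge0 ?(ltW l0)//= ler_piMr// ltW.
by split => //; lra.
Qed.

End box_code.
Section step_integrals.
Context d (T : measurableType d) {R : realType} (mu : {measure set T -> \bar R}).

Lemma dominated_integrable (f g : T -> R) : mu.-integrable setT (EFin \o g) ->
  measurable_fun setT f -> (forall x, `|f x| <= `|g x|) ->
  mu.-integrable setT (EFin \o f).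
Proof.
move=> gi mf fg; apply: (le_integrable measurableT _ _ gi).
  exact/measurable_EFinP.
by move=> x _ /=; rewrite lee_fin.
Qed.

Lemma scaled_integrable (g : T -> R) (c : R) : mu.-integrable setT (EFin \o g) ->
  mu.-integrable setT (EFin \o (fun x => c * g x)).
Proof. by move=> gi; exact: (integrableZl measurableT _ gi). Qed.

Lemma indic_integrable (A : set T) : measurable A -> (mu A < +oo)%E ->
  mu.-integrable setT (EFin \o (\1_A : T -> R)).
Proof.
move=> mA muA; apply/integrableP; split; first exact/measurable_EFinP.
under eq_integral => x _.
  rewrite /= ger0_norm//.
  over.
by rewrite integral_indic// setIT.
Qed.

Lemma step_integrable (g : T -> R) n (A : nat -> set T) (c : nat -> R) :
  mu.-integrable setT (EFin \o g) -> (forall j, measurable (A j)) ->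
  mu.-integrable setT (EFin \o (fun x => \sum_(j < n) c j * \1_(A j) x * g x)).
Proof.
move=> gi mA.
have one j : mu.-integrable setT (EFin \o (fun x => c j * \1_(A j) x * g x)).
  apply: (dominated_integrable (scaled_integrable (c j) gi)).
    apply: measurable_funM; first exact: measurable_funM.
    by apply/measurable_EFinP; exact: (measurable_int _ gi).
  move=> x; rewrite !normrM ler_wpM2r// ler_piMr// indicE normr_nat.
  by case: (_ \in _).
elim: n => [|n IH].
  rewrite (_ : _ \o _ = cst 0%E); first exact: integrable0.
  by apply/funext => x /=; rewrite big_ord0.
have := integrableD measurableT IH (one n); apply: eq_integrable => // x _ /=.
by rewrite big_ord_recr /= EFinD.
Qed.

Lemma Rintegral_step (g : T -> R) n (A : nat -> set T) (c : nat -> R) :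
  mu.-integrable setT (EFin \o g) -> (forall j, measurable (A j)) ->
  \int[mu]_x (\sum_(j < n) c j * \1_(A j) x * g x) =
  \sum_(j < n) c j * \int[mu]_(x in A j) g x.
Proof.
move=> gi mA; elim: n => [|n IH].
  rewrite big_ord0; under eq_Rintegral do rewrite big_ord0.
  by rewrite Rintegral_cst// mul0r.
rewrite big_ord_recr /= -IH; under eq_Rintegral do rewrite big_ord_recr /=.
rewrite RintegralD//; last 2 first.
- exact: step_integrable.
- have := @step_integrable g 1 (fun=> A n) (fun=> c n) gi (fun=> mA n).
  by apply: eq_integrable => // x _ /=; rewrite big_ord1.
congr (_ + _); under eq_Rintegral do rewrite -mulrA.
rewrite RintegralZl//; last first.
  have := @step_integrable g 1 (fun=> A n) (fun=> 1) gi (fun=> mA n).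
  by apply: eq_integrable => // x _ /=; rewrite big_ord1 mul1r.
congr (_ * _); rewrite [RHS]Rintegral_mkcond; apply: eq_Rintegral => x _.
by rewrite patchE indicE; case: ifPn; rewrite ?mul1r ?mul0r.
Qed.

End step_integrals.

Section more_sequences.
Context {R : realType}.

Lemma cvg_by_approx (a : nat -> R) (l : R) :
  (forall e, 0 < e -> exists (b : nat -> R) (l' : R), [/\ b n @[n --> \oo] --> l',
     forall n, `|a n - b n| <= e & `|l' - l| <= e]) ->
  a n @[n --> \oo] --> l.
Proof.
move=> H; apply/cvgn_distP => e e0; have e4 : 0 < e / 4 by rewrite divr_gt0.
have [b [l' [bl ab ll]]] := H _ e4; have [N HN] := (cvgn_distP _ _).1 bl _ e4.
exists N => n /HN h; have := ab n.
have := ler_distD l' l (a n); have := ler_distD (b n) l' (a n).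
by rewrite (distrC l l') (distrC (b n) (a n)); lra.
Qed.

Lemma geometric_increments (a : nat -> R) (c : R) :
  (forall k, 0 <= a k.+1 - a k <= c / 2 ^+ k.+1) ->
  exists2 l : R, a k @[k --> \oo] --> l & forall k, 0 <= l - a k <= c / 2 ^+ k.
Proof.
move=> H; have c0 : 0 <= c.
  by have /andP[h1 h2] := H 0%N; have := le_trans h1 h2; rewrite pmulr_lge0// invr_gt0 exprn_gt0.
have up k n : 0 <= a (k + n)%N - a k <= c / 2 ^+ k - c / 2 ^+ (k + n).
  elim: n => [|n IH]; first by rewrite addn0 !subrr lexx.
  have := H (k + n)%N; rewrite addnS; move: IH.
  have -> : c / 2 ^+ (k + n) = 2 * (c / 2 ^+ (k + n).+1).
    by rewrite exprS; field; rewrite expf_neq0.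
  lra.
have nd : nondecreasing_seq a.
  by apply/nondecreasing_seqP => n; have /andP[] := H n; rewrite subr_ge0.
have pos n : 0 <= c / 2 ^+ n by rewrite divr_ge0// exprn_ge0.
have ub : has_ubound (range a).
  exists (a 0%N + c); move=> _ [n _ <-]; have := up 0%N n; rewrite add0n expr0 divr1.
  by have := pos n; lra.
have al := nondecreasing_is_cvgn nd ub.
exists (limn a) => // k; apply/andP; split.
  by rewrite subr_ge0; exact: nondecreasing_cvgn_le.
rewrite lerBlDr; apply: limr_le => //; near=> n.
have kn : (k <= n)%N by near: n; exact: nbhs_infty_ge.
by have := up k (n - k)%N; rewrite subnKC//; have := pos n; lra.
Unshelve. all: by end_near. Qed.

Lemma cvg_geometric_half (c : R) : c / 2 ^+ k @[k --> \oo] --> (0 : R).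
Proof.
have -> : (fun k => c / 2 ^+ k) = geometric c (2^-1).
  by apply/funext => k; rewrite /= exprVn.
apply: cvg_geometric; rewrite ger0_norm ?invr_ge0//.
by rewrite invf_lt1// ltr1n.
Qed.

End more_sequences.

(** * Masses of the dyadic cells *)

Section measure_compactness.
Context {R : realType} (T s S M : R) (T0 : 0 < T) (sS : s < S)
  (h : nat -> R * R -> R) (mh : forall n, measurable_fun setT (h n))
  (h0 : forall n p, 0 <= h n p)
  (hD : forall n p, h n p != 0 -> 0 <= p.1 < T /\ s <= p.2 < S)
  (hi : forall n, leb2.-integrable setT (EFin \o h n))
  (hM : forall n, \int[leb2]_p h n p <= M).

Let code := @box_code R T s S.
Let below (k j : nat) : set (R * R) := [set p | (code k p < j)%N].
Let at_ (k j : nat) : set (R * R) := [set p | code k p = j].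

(** Cumulative masses rather than masses of cells: their limits are nondecreasing in j and become
    the end points of the quantile intervals. *)
Definition code_mass (n k j : nat) : R := \int[leb2]_(p in below k j) h n p.

Let mbelow k j : measurable (below k j). Proof. exact: measurable_box_code. Qed.

Let mat k j : measurable (at_ k j).
Proof.
have -> : at_ k j = below k j.+1 `\` below k j.
  by apply/seteqP; split => p /=; rewrite /at_ /below /=; lia.
exact: measurableD.
Qed.

Let hiB n B : measurable B -> leb2.-integrable B (EFin \o h n).
Proof. by move=> mB; apply: integrableS (hi n). Qed.

Lemma code_massS n k j :
  code_mass n k j.+1 - code_mass n k j = \int[leb2]_(p in at_ k j) h n p.
Proof.
rewrite /code_mass; have -> : below k j.+1 = below k j `|` at_ k j.
  by apply/seteqP; split => p; rewrite /at_ /below /=; lia.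
rewrite Rintegral_setU; first lra.
- exact: mbelow.
- exact: mat.
- by apply: hiB; apply: measurableU; [exact: mbelow|exact: mat].
- by apply/disj_setPS => p; rewrite /at_ /below /=; lia.
Qed.

Lemma code_mass0 n k : code_mass n k 0 = 0.
Proof.
rewrite /code_mass (_ : below k 0 = set0) ?Rintegral_set0//.
by apply/seteqP; split => p.
Qed.

Lemma code_mass_le n k j : code_mass n k j <= code_mass n k j.+1.
Proof. by rewrite -subr_ge0 code_massS; apply: Rintegral_ge0 => p _; exact: h0. Qed.

Lemma code_mass4 n k j : code_mass n k.+1 (4 * j) = code_mass n k j.
Proof.
rewrite /code_mass; congr (Rintegral _ _ _); apply/seteqP; split => p;
  rewrite /below /code /= -(box_code_div4 T s S k p); lia.
Qed.

Lemma code_mass_top n k : code_mass n k (4 ^ k) = \int[leb2]_p h n p.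
Proof.
rewrite /code_mass (_ : below k (4 ^ k) = setT)//.
by apply/seteqP; split => p // _; exact: box_code_lt.
Qed.

Lemma code_mass_bound n k j : 0 <= code_mass n k j <= M.
Proof.
have mono a b : (a <= b)%N -> code_mass n k a <= code_mass n k b.
  elim: b => [|b IH]; first by rewrite leqn0 => /eqP ->.
  rewrite leq_eqVlt => /predU1P[->//|ab]; rewrite (le_trans (IH _))//.
  exact: code_mass_le.
rewrite -{1}(code_mass0 n k) mono//=.
have := mono j (maxn j (4 ^ k)) (leq_maxl _ _); move=> /le_trans; apply.
suff -> : code_mass n k (maxn j (4 ^ k)) = code_mass n k (4 ^ k).
  by rewrite code_mass_top.
rewrite /code_mass; congr (Rintegral _ _ _); apply/seteqP; split => p; rewrite /below /=.
  by move=> _; exact: box_code_lt.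
by move=> _; rewrite (leq_trans (box_code_lt _ _ _ _ _))// leq_maxr.
Qed.

End measure_compactness.

(* The inverse of the code, read off the cumulative weights w of the codes: a
   random variable X on [0, P[ whose distribution has the cells as quantiles. *)
Section quantile.
Context {R : realType} (T s S : R) (T0 : 0 < T) (sS : s < S) (w : nat -> nat -> R)
  (w0 : forall k, w k 0 = 0) (w_le : forall k j, w k j <= w k j.+1)
  (w4 : forall k j, w k.+1 (4 * j)%N = w k j).

Let w_mono k a b : (a <= b)%N -> w k a <= w k b.
Proof.
elim: b => [|b IH]; first by rewrite leqn0 => /eqP ->.
rewrite leq_eqVlt => /predU1P[->//|ab]; rewrite (le_trans (IH _))//; exact: w_le.
Qed.

(** The total weight: generation 0 has a single cell. *)
Let P : R := w 0 1.

Let w_top k : w k (4 ^ k) = P.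
Proof. by elim: k => // k IH; rewrite expnS w4. Qed.

Let P0 : 0 <= P. Proof. by rewrite -(w0 0%N) w_mono. Qed.

Let I (k j : nat) : set R := [set` `[w k j, w k j.+1[].

Let mI k j : measurable (I k j). Proof. exact: measurable_itv. Qed.

Let I_uniq k i j u : I k i u -> I k j u -> i = j.
Proof.
rewrite /I /= !in_itv /= => /andP[a b] /andP[c e]; case: (ltngtP i j) => // ij.
  by have := w_mono k ij; move: (le_lt_trans c b); rewrite ltNge => /negP.
by have := w_mono k ij; move: (le_lt_trans a e); rewrite ltNge => /negP.
Qed.

Let I_ex k u : 0 <= u < P -> exists2 j, (j < 4 ^ k)%N & I k j u.
Proof.
rewrite -(w_top k) -{1}(w0 k) => /andP[]; elim: (4 ^ k)%N => [|n IH] h1 h2.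
  by move: (le_lt_trans h1 h2); rewrite ltxx.
have [un|un] := ltP u (w k n).
  by have [j jn Ij] := IH h1 un; exists j => //; exact: ltnW.
by exists n => //; rewrite /I /= in_itv /= un h2.
Qed.

Let I_in k j u : (j < 4 ^ k)%N -> I k j u -> 0 <= u < P.
Proof.
move=> jk; rewrite /I /= in_itv /= => /andP[a b].
rewrite (le_trans _ a) ?(lt_le_trans b)//; first by rewrite -(w_top k) w_mono.
by rewrite -(w0 k) w_mono.
Qed.

(** The intervals are nested as the cells are: by [w4], an interval of generation k is cut into
    those of its four children. *)
Let I_parent k j u : I k.+1 j u -> I k (j %/ 4) u.
Proof.
rewrite /I /= !in_itv /= => /andP[a b].
rewrite -(w4 k (j %/ 4)) -(w4 k (j %/ 4).+1).
by rewrite (le_trans _ a) ?(lt_le_trans b)//; apply: w_mono; lia.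
Qed.

(** At most one term is nonzero: [step c k u] is the value of [c] at the cell of generation k whose
    interval contains [u], and 0 if there is none. *)
Definition step (c : nat -> nat -> R) k u : R := \sum_(j < 4 ^ k) c k j * \1_(I k j) u.

Let step_in c k j u : (j < 4 ^ k)%N -> I k j u -> step c k u = c k j.
Proof.
move=> jk Iu; rewrite /step (bigD1 (Ordinal jk))//= indicE mem_set// mulr1.
rewrite big1 ?addr0// => i ij; rewrite indicE memNset ?mulr0// => Ii.
by move/eqP: ij; apply; apply: val_inj; exact: I_uniq Ii Iu.
Qed.

Let step_out c k u : ~ (0 <= u < P) -> step c k u = 0.
Proof.
move=> nu; rewrite /step big1// => i _; rewrite indicE memNset ?mulr0// => Ii.
by apply: nu; exact: I_in Ii.
Qed.

Let measurable_step c k : measurable_fun setT (step c k).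
Proof.
rewrite /step; apply: measurable_sum => j; apply: measurable_funM => //.
Qed.

Let step_incr (c : nat -> nat -> R) (l : R) k u : 0 <= l ->
  (forall j, 0 <= c k.+1 j - c k (j %/ 4)%N <= l / 2 ^+ k.+1) ->
  0 <= step c k.+1 u - step c k u <= l / 2 ^+ k.+1.
Proof.
move=> l0 H; have [uP|uP] := pselect (0 <= u < P); last first.
  by rewrite !step_out// subrr lexx divr_ge0// exprn_ge0.
have [j jk Iu] := I_ex k.+1 uP.
rewrite (step_in _ jk Iu) (step_in _ _ (I_parent Iu))//.
by move: jk; rewrite expnS; lia.
Qed.

Let c1 := corner1 T.
Let c2 := corner2 s S.

(** The corners of the nested cells selected by [u] move by at most T / 2^(k+1) from generation k to
    the next, so they converge; the limit stays within T / 2^k of the k-th corner. *)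
Let X1 u : R := limn (fun k => step c1 k u).
Let X2 u : R := limn (fun k => step c2 k u).

Let X1P u : step c1 k u @[k --> \oo] --> X1 u /\
  forall k, 0 <= X1 u - step c1 k u <= T / 2 ^+ k.
Proof.
have [l al Hl] := @geometric_increments R (fun k => step c1 k u) T
  (fun k => step_incr u (ltW T0) (fun j => corner1_step T0 sS k j)).
by rewrite /X1 (cvg_lim _ al).
Qed.

Let l0 : 0 < S - s. Proof. by rewrite subr_gt0. Qed.

Let X2P u : step c2 k u @[k --> \oo] --> X2 u /\
  forall k, 0 <= X2 u - step c2 k u <= (S - s) / 2 ^+ k.
Proof.
have [l al Hl] := @geometric_increments R (fun k => step c2 k u) (S - s)
  (fun k => step_incr u (ltW l0) (fun j => corner2_step T0 sS k j)).
by rewrite /X2 (cvg_lim _ al).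
Qed.

Let X u : R * R := (X1 u, X2 u).

Let mX : measurable_fun setT X.
Proof.
apply: measurable_fun_pair.
- apply: (measurable_fun_cvg (h := fun k => step c1 k)) => [k|u _].
    exact: measurable_step.
  exact: (X1P u).1.
- apply: (measurable_fun_cvg (h := fun k => step c2 k)) => [k|u _].
    exact: measurable_step.
  exact: (X2P u).1.
Qed.

Let X_out u : ~ (0 <= u < P) -> X u = (0, 0).
Proof.
move=> nu; rewrite /X /X1 /X2; congr (_, _).
  by under eq_fun do rewrite step_out//; exact: lim_cst.
by under eq_fun do rewrite step_out//; exact: lim_cst.
Qed.

Let X_near k j u : (j < 4 ^ k)%N -> I k j u ->
  0 <= X1 u - c1 k j <= T / 2 ^+ k /\ 0 <= X2 u - c2 k j <= (S - s) / 2 ^+ k.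
Proof.
move=> jk Iu; have := (X1P u).2 k; have := (X2P u).2 k.
by rewrite !(step_in _ jk Iu).
Qed.

Let X_box u : 0 <= u < P -> 0 <= X1 u <= T /\ s <= X2 u <= S.
Proof.
move=> uP; have [j jk Iu] := I_ex 0 uP.
have := X_near jk Iu; move: jk; rewrite expn0 ltnS leqn0 => /eqP ->.
by rewrite /c1 /c2 /corner1 /corner2 /= expr0 mul0r !mulr0 !divr1; lra.
Qed.

Lemma quantile_map : exists X : R -> R * R, [/\ measurable_fun setT X,
  forall u, ~ (0 <= u < w 0 1) -> X u = (0, 0),
  forall u, 0 <= u < w 0 1 -> 0 <= (X u).1 <= T /\ s <= (X u).2 <= S &
  forall k j u, (j < 4 ^ k)%N -> w k j <= u < w k j.+1 ->
    0 <= (X u).1 - corner1 T k j <= T / 2 ^+ k /\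
    0 <= (X u).2 - corner2 s S k j <= (S - s) / 2 ^+ k].
Proof.
exists X; split; [exact: mX|exact: X_out|exact: X_box|].
by move=> k j u jk Iu; apply: X_near => //; rewrite /I /= in_itv.
Qed.

Lemma quantile_cells k u : 0 <= u < w 0 1 ->
  exists2 j, (j < 4 ^ k)%N & w k j <= u < w k j.+1.
Proof. by move=> /(I_ex k)[j jk]; rewrite /I /= in_itv /=; exists j. Qed.

Lemma quantile_cell_uniq k i j u : w k i <= u < w k i.+1 ->
  w k j <= u < w k j.+1 -> i = j.
Proof. by move=> hi hj; apply: (@I_uniq k i j u); rewrite /I /= in_itv. Qed.

Lemma quantile_cell_sub k j u : (j < 4 ^ k)%N -> w k j <= u < w k j.+1 ->
  0 <= u < w 0 1.
Proof. by move=> jk Iu; apply: (I_in jk); rewrite /I /= in_itv. Qed.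

End quantile.
Lemma leb_itv_co {R : realType} (a b : R) : a <= b ->
  leb [set` `[a, b[] = (b - a)%:E.
Proof.
move=> ab; transitivity (lebesgue_measure ([set` `[a, b[] : set R)); first by [].
rewrite lebesgue_measure_itv /= lte_fin; case: ltP => [_|ba]; first by rewrite EFinB.
by rewrite (le_anti (introT andP (conj ab ba))) subrr.
Qed.

(** * Riemann sums over the dyadic cells *)

Section riemann_sums.
Context {R : realType} (T s S : R) (T0 : 0 < T) (sS : s < S).

Let box : set (R * R) := `[0, T] `*` `[s, S].

Let cbox : compact box.
Proof. by apply: compact_setX; exact: segment_compact. Qed.

Lemma measurable_at_code k j : measurable [set p : R * R | box_code T s S k p = j].
Proof.
have -> : [set p : R * R | box_code T s S k p = j] =
    [set p | (box_code T s S k p < j.+1)%N] `\` [set p | (box_code T s S k p < j)%N].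
  by apply/seteqP; split => p /=; lia.
by apply: measurableD; exact: measurable_box_code.
Qed.

Context (psi : R * R -> R) (psic : continuous psi) (e : R) (e0 : 0 < e) (k : nat)
  (osc : forall p q, box p -> box q -> `|p.1 - q.1| <= T / 2 ^+ k ->
    `|p.2 - q.2| <= (S - s) / 2 ^+ k -> `|psi p - psi q| <= e).

Let c j : R := psi (corner1 T k j, corner2 s S k j).

Let corner_in j : box (corner1 T k j, corner2 s S k j).
Proof. by have [? ?] := corner_box T0 sS k j; split; rewrite /= in_itv. Qed.

Let psi_bound : exists2 B : R, 0 < B & forall p, box p -> `|psi p| <= B.
Proof. by apply: compact_bound => //; exact: continuous_subspaceT. Qed.

Section density.
Context (M : R) (h : nat -> R * R -> R) (mh : forall n, measurable_fun setT (h n))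
  (h0 : forall n p, 0 <= h n p)
  (hD : forall n p, h n p != 0 -> 0 <= p.1 < T /\ s <= p.2 < S)
  (hi : forall n, leb2.-integrable setT (EFin \o h n))
  (hM : forall n, \int[leb2]_p h n p <= M).

(** A point where [h n] is nonzero lies in the box, hence within one cell size of the corner of its
    cell, and [psi] varies by at most [e] at that scale. Elsewhere both integrands vanish. *)
Lemma density_riemann_sum n :
  `|\int[leb2]_p (psi p * h n p) -
    \sum_(j < 4 ^ k) c j * (code_mass T s S h n k j.+1 - code_mass T s S h n k j)| <= e * M.
Proof.
have E : \sum_(j < 4 ^ k) c j * (code_mass T s S h n k j.+1 - code_mass T s S h n k j) =
    \int[leb2]_p (\sum_(j < 4 ^ k) c j * \1_[set p | box_code T s S k p = j] p * h n p).
  rewrite (Rintegral_step _ c (hi n) (measurable_at_code k)).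
  by apply: eq_bigr => j _; rewrite (code_massS T0 sS hi n k j).
have [B B0 HB] := psi_bound.
have h_in p : h n p != 0 -> box p.
  by move=> /hD[/andP[a b] /andP[a' b']]; split; rewrite /= in_itv /= ?a ?a' ltW.
have mpsi : measurable_fun setT psi by exact: continuous_measurable_plane.
have i1 : leb2.-integrable setT (EFin \o (fun p => psi p * h n p)).
  apply: (dominated_integrable (scaled_integrable B (hi n))).
    have mm : measurable_fun setT (fun p : R * R => psi p * h n p).
      exact: measurable_funM.
    exact: mm.
  move=> p; rewrite !normrM; have [->|hp] := eqVneq (h n p) 0.
    by rewrite normr0 !mulr0.
  by rewrite ler_wpM2r// (le_trans (HB p (h_in p hp)))// ler_norm.
have i2 := step_integrable (4 ^ k) c (hi n) (measurable_at_code k).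
rewrite E -RintegralB//.
have i3 := integrableB (measurableT : measurable (setT : set (measurableTypeR R * measurableTypeR R)%type)) i1 i2.
apply: (le_trans (le_normr_Rintegral _ i3)) => //.
apply: (@le_trans _ _ (\int[leb2]_p (e * h n p))); last first.
  by rewrite RintegralZl// ler_wpM2l// ltW.
apply: le_Rintegral => //.
- exact: (integrable_abse i3).
- exact: scaled_integrable.
move=> p _.
have [hp|hp] := eqVneq (h n p) 0.
  by rewrite hp !mulr0 sub0r normrN big1 ?normr0// => j _; rewrite mulr0.
have [D1 D2] := hD hp.
have jk := box_code_lt T s S k p.
rewrite (bigD1 (Ordinal jk))//= [X in c _ * X]indicE mem_set// mulr1.
rewrite big1 ?addr0; last first.
  move=> i ij; rewrite indicE memNset ?mulr0 ?mul0r//= => Ii.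
  by move/eqP: ij; apply; apply: val_inj.
rewrite -mulrBl normrM (ger0_norm (h0 n p)) ler_wpM2r//.
have [/andP[a1 a2] /andP[b1 b2]] := corner_dist T0 sS k D1 D2.
by apply: osc; [exact: h_in|exact: corner_in|rewrite ger0_norm|rewrite ger0_norm].
Qed.

End density.

Section quantiles.
Context (w : nat -> nat -> R) (w0 : forall k, w k 0 = 0)
  (w_le : forall k j, w k j <= w k j.+1)
  (w4 : forall k j, w k.+1 (4 * j)%N = w k j).

(** The length of the j-th quantile interval is the weight of the j-th cell, and on that interval
    [X] stays within one cell size of its corner. *)
Lemma quantile_riemann_sum (X : R -> R * R) : measurable_fun setT X ->
  (forall u, 0 <= u < w 0 1 -> box (X u)) ->
  (forall j u, (j < 4 ^ k)%N -> w k j <= u < w k j.+1 ->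
    0 <= (X u).1 - corner1 T k j <= T / 2 ^+ k /\
    0 <= (X u).2 - corner2 s S k j <= (S - s) / 2 ^+ k) ->
  `|\sum_(j < 4 ^ k) c j * (w k j.+1 - w k j) -
    \int[leb]_(u in `[0%R, w 0%N 1%N[%classic) psi (X u)| <= e * w 0 1.
Proof.
move=> mX Xbox Xnear; set P := w 0 1.
have P0 : 0 <= P by rewrite -(w0 0%N) w_le.
pose IP : set R := [set` `[0, P[]; have mIP : measurable IP by exact: measurable_itv.
pose I j : set R := [set` `[w k j, w k j.+1[].
have mI j : measurable (I j) by exact: measurable_itv.
have lebP : (leb IP < +oo)%E.
  by rewrite leb_itv_co// ltry.
have gi : leb.-integrable setT (EFin \o (\1_IP : R -> R)).
  exact: indic_integrable.
have mI_IP j : (j < 4 ^ k)%N -> I j `<=` IP.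
  move=> jk u; rewrite /I /IP /= !in_itv /=.
  exact: (quantile_cell_sub w0 w_le w4 jk).
have E : \sum_(j < 4 ^ k) c j * (w k j.+1 - w k j) =
    \int[leb]_u (\sum_(j < 4 ^ k) c j * \1_(I j) u * \1_IP u).
  rewrite (Rintegral_step _ c gi mI); apply: eq_bigr => j _; congr (_ * _).
  rewrite (_ : \int[leb]_(x in I j) \1_IP x = \int[leb]_(x in I j) 1); last first.
    by apply: eq_Rintegral => u; rewrite inE => /(mI_IP j (ltn_ord j)) Iu; rewrite indicE mem_set.
  rewrite Rintegral_cst; last exact: mI.
  by rewrite mul1r /I (leb_itv_co (w_le k j)).
have [B B0 HB] := psi_bound.
have mpsi : measurable_fun setT (fun u => psi (X u)).
  by apply: (measurableT_comp (continuous_measurable_plane psic)).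
have -> : \int[leb]_(u in IP) psi (X u) = \int[leb]_u (psi (X u) * \1_IP u).
  rewrite Rintegral_mkcond; apply: eq_Rintegral => u _.
  by rewrite patchE indicE; case: ifPn; rewrite ?mulr1 ?mulr0.
have i1 : leb.-integrable setT (EFin \o (fun u => psi (X u) * \1_IP u)).
  apply: (dominated_integrable (scaled_integrable B gi)).
    exact: measurable_funM.
  move=> u; rewrite !normrM indicE.
  have [uI|uI] := boolP (u \in IP); last by rewrite normr0 !mulr0.
  rewrite ler_wpM2r// (le_trans (HB _ (Xbox u _)))// ?ler_norm//.
  by move: uI; rewrite inE /IP /= in_itv.
have i2 := step_integrable (4 ^ k) c gi mI.
have i3 := integrableB (measurableT : measurable (setT : set (measurableTypeR R))) i2 i1.
rewrite E -RintegralB//.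
apply: (le_trans (le_normr_Rintegral _ i3)) => //.
apply: (@le_trans _ _ (\int[leb]_u (e * \1_IP u))); last first.
  rewrite RintegralZl// ler_wpM2l//; first exact: ltW.
  by rewrite /Rintegral integral_indic// setIT leb_itv_co//= subr0.
apply: le_Rintegral => //.
- exact: (integrable_abse i3).
- exact: scaled_integrable.
move=> u _; rewrite [\1_IP u]indicE; have [uI|uI] := boolP (u \in IP); last first.
  by rewrite !mulr0 subr0 big1 ?normr0// => j _; rewrite mulr0.
have uP : 0 <= u < P by move: uI; rewrite inE /IP /= in_itv.
have [j jk Iu] := quantile_cells w0 w4 k uP.
rewrite (bigD1 (Ordinal jk))//= [X in c _ * X]indicE mem_set; last by rewrite /I /= in_itv.
rewrite big1 ?addr0; last first.
  move=> i ij; rewrite indicE memNset ?mulr0 ?mul0r// /I /= in_itv /= => Ii.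
  by move/eqP: ij; apply; apply: val_inj; exact: (quantile_cell_uniq w_le Ii Iu).
rewrite !mulr1; have [/andP[a1 a2] /andP[b1 b2]] := Xnear j u jk Iu.
rewrite distrC; apply: osc; [exact: Xbox|exact: corner_in|by rewrite ger0_norm|by rewrite ger0_norm].
Qed.

End quantiles.
End riemann_sums.

(** * The limit measure *)

Section limit_measure.
Context {R : realType} (T s S M : R) (T0 : 0 < T) (sS : s < S)
  (h : nat -> R * R -> R) (mh : forall n, measurable_fun setT (h n))
  (h0 : forall n p, 0 <= h n p)
  (hD : forall n p, h n p != 0 -> 0 <= p.1 < T /\ s <= p.2 < S)
  (hi : forall n, leb2.-integrable setT (EFin \o h n))
  (hM : forall n, \int[leb2]_p h n p <= M)
  (cW : forall k j, cvgn (fun n => code_mass T s S h n k j)).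

Let w k j : R := limn (fun n => code_mass T s S h n k j).

Let w0 k : w k 0 = 0.
Proof. by rewrite /w; under eq_fun do rewrite code_mass0; exact: lim_cst. Qed.

Let w_le k j : w k j <= w k j.+1.
Proof.
apply: ler_lim; [exact: cW|exact: cW|apply: nearW => n].
exact: code_mass_le h0 hi n k j.
Qed.

Let w4 k j : w k.+1 (4 * j)%N = w k j.
Proof. by rewrite /w; under eq_fun do rewrite (code_mass4 T0 sS). Qed.

Let box : set (R * R) := `[0, T] `*` `[s, S].

Let cbox : compact box.
Proof. by apply: compact_setX; exact: segment_compact. Qed.

Let code_cvg (c : nat -> R) k :
  \sum_(j < 4 ^ k) c j * (code_mass T s S h n k j.+1 - code_mass T s S h n k j)
    @[n --> \oo] --> \sum_(j < 4 ^ k) c j * (w k j.+1 - w k j).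
Proof.
elim: (4 ^ k)%N => [|m IH].
  by under eq_fun do rewrite big_ord0; rewrite big_ord0; exact: cvg_cst.
under eq_fun do rewrite big_ord_recr /=; rewrite big_ord_recr /=.
apply: cvgD; first exact: IH.
by apply: cvgM; [exact: cvg_cst|apply: cvgB; exact: cW].
Qed.

(** Riemann sums of a fixed generation mediate: they involve finitely many masses, hence converge,
    and are close to both integrals uniformly in n. In the limit, mass may settle on the boundary of
    cells, so the measure of a cell need not be the limit of its masses; values of [psi] are
    compared instead. *)
Lemma measure_compactness : exists lam : @planar_measure R,
  [/\ (lam setT < +oo)%E, lam (~` (`[0, T] `*` `[s, S])) = 0%E &
  forall psi : R * R -> R, continuous psi ->
    \int[leb2]_p (psi p * h n p) @[n --> \oo] --> \int[lam]_p psi p].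
Proof.
have [X [mX Xout Xin Xnear]] := quantile_map T0 sS w0 w_le w4.
set P := w 0 1 in Xout Xin *.
have P0 : 0 <= P by rewrite -(w0 0%N) w_le.
have Xbox u : 0 <= u < P -> box (X u).
  by move=> /Xin[a b]; split; rewrite /= in_itv.
pose IP : set R := [set` `[0, P[]; have mIP : measurable IP by exact: measurable_itv.
pose m : {measure set (measurableTypeR R) -> \bar R} := mrestr leb mIP.
pose lam : @planar_measure R :=
  @measure_function_pushforward__canonical__measure_function_Measure _ _
    (measurableTypeR R) (measurableTypeR R * measurableTypeR R)%type R m X mX.
have mT : (m setT < +oo)%E.
  by rewrite /m /= /mrestr setTI leb_itv_co// ltry.
exists lam; split.
- by rewrite /lam /= /pushforward preimage_setT.
- rewrite /lam /= /pushforward /mrestr.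
  rewrite (_ : _ `&` _ = set0) ?measure0//.
  rewrite -subset0 => u [/= nb]; rewrite /IP /= in_itv /= => /Xbox Xu.
  exact: nb.
move=> psi psic.
have mpsi : measurable_fun setT psi by exact: continuous_measurable_plane.
have [B B0 HB] : exists2 B : R, 0 < B & forall p, box p -> `|psi p| <= B.
  by apply: compact_bound => //; exact: continuous_subspaceT.
have mpX : measurable_fun setT (fun u => psi (X u)) by exact: measurableT_comp mpsi mX.
have ipX : m.-integrable setT (EFin \o (fun u => psi (X u))).
  apply: measurable_bounded_integrable => //.
  exists (B + `|psi (0, 0)|); split; first exact: num_real.
  move=> y By u _ /=; rewrite (le_trans _ (ltW By))//.
  have [uP|uP] := pselect (0 <= u < P).
    by rewrite (le_trans (HB _ (Xbox u uP)))// lerDl.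
  by rewrite Xout// lerDr ltW.
have -> : \int[lam]_p psi p = \int[leb]_(u in IP) psi (X u).
  rewrite /Rintegral; congr fine.
  rewrite (@integral_pushforward _ _ (measurableTypeR R) (measurableTypeR R * measurableTypeR R)%type
    R X mX m setT (EFin \o psi)) //; last exact/measurable_EFinP.
  rewrite preimage_setT.
  rewrite (@negligible_integral _ _ _ m setT (~` IP))//; last 2 first.
  - exact: measurableC.
  - by rewrite /m /= /mrestr setICl measure0.
  rewrite setTD setCK; apply: eq_measure_integral => A mA AI.
  by rewrite /m /= /mrestr (setIidl AI).
apply: cvg_by_approx => e e0.
have Q0 : 0 < `|M| + P + 1 by rewrite ltr_wpDl// addr_ge0.
(* The two Riemann sum errors are [e' * M] and [e' * P]; this denominator brings both below [e], and
   the added 1 keeps it positive. *)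
pose e' := e / (`|M| + P + 1); have e'0 : 0 < e' by rewrite divr_gt0.
have [d d0 Hd] := compact_uniform_continuity cbox (continuous_subspaceT psic) e'0.
have small (c : R) : exists N, forall k, (N <= k)%N -> c / 2 ^+ k < d.
  have [N HN] := (cvgn_distP _ _).1 (cvg_geometric_half c) d d0.
  exists N => k /HN; rewrite sub0r normrN; apply: le_lt_trans; exact: ler_norm.
have [N1 HN1] := small T; have [N2 HN2] := small (S - s).
pose k := maxn N1 N2.
have h1 := HN1 k (leq_maxl _ _); have h2 := HN2 k (leq_maxr _ _).
have osc p q : box p -> box q -> `|p.1 - q.1| <= T / 2 ^+ k ->
    `|p.2 - q.2| <= (S - s) / 2 ^+ k -> `|psi p - psi q| <= e'.
  move=> bp bq d1 d2; apply/ltW/Hd => //.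
  by rewrite prod_normE gt_max /= (le_lt_trans d1)// (le_lt_trans d2).
have e'M : e' * M <= e.
  apply: (@le_trans _ _ (e' * (`|M| + P + 1))); last by rewrite divfK// gt_eqF.
  by rewrite ler_wpM2l ?(ltW e'0)//; have := ler_norm M; lra.
have e'P : e' * P <= e.
  apply: (@le_trans _ _ (e' * (`|M| + P + 1))); last by rewrite divfK// gt_eqF.
  by rewrite ler_wpM2l ?(ltW e'0)//; have := normr_ge0 M; lra.
exists (fun n => \sum_(j < 4 ^ k) psi (corner1 T k j, corner2 s S k j) *
  (code_mass T s S h n k j.+1 - code_mass T s S h n k j)).
exists (\sum_(j < 4 ^ k) psi (corner1 T k j, corner2 s S k j) * (w k j.+1 - w k j)).
split.
- exact: (@code_cvg (fun j => psi (corner1 T k j, corner2 s S k j)) k).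
- by move=> n; apply: le_trans e'M; exact: density_riemann_sum.
- by apply: le_trans e'P; apply: quantile_riemann_sum => // j u; exact: Xnear.
Qed.

End limit_measure.
(** * Integrals over moving cells *)

Section primitives.
Context {R : realType} (T : R) (T0 : 0 < T).
Implicit Types (f g G H : R -> R).

(** The fundamental theorem of calculus on the open interval. Integrability belongs to it because
    the integrands contain v / theta(rho), which may be singular at 0. *)
Definition primitive f G : Prop :=
  leb.-integrable `]0, T[ (EFin \o f) /\
  \int[leb]_(t in `]0, T[) f t = G T - G 0.

Lemma continuous_oo_measurable f :
  (forall t : R, 0 < t < T -> {for t, continuous f}) ->
  measurable_fun (`]0, T[ : set R) f.
Proof.
move=> fc; apply: open_continuous_measurable_fun; first exact: interval_open.
by move=> t; rewrite inE /= in_itv /= => /fc.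
Qed.

(** The usual theorem holds on [e n, T - e n]. Monotone convergence along these intervals yields the
    value of the integral and its finiteness together. *)
Lemma ge0_primitive f G : {within `[0, T], continuous G} ->
  (forall t : R, 0 < t < T -> is_derive t 1 G (f t)) ->
  (forall t : R, 0 < t < T -> {for t, continuous f}) ->
  (forall t : R, 0 < t < T -> 0 <= f t) -> primitive f G.
Proof.
move=> Gc Gd fc f0.
(* With n + 3, [e n < T / 2] already at n = 0, so that every interval [e n, T - e n] is
   nondegenerate. *)
pose e (n : nat) : R := T / (n.+3)%:R.
have e0 n : 0 < e n by rewrite divr_gt0.
have eT n : e n < T / 2.
  by rewrite ltr_pM2l// ltf_pV2 ?posrE// ltr_nat.
have ecvg : e n @[n --> \oo] --> (0 : R).
  rewrite -(mulr0 T); apply: cvgM; first exact: cvg_cst.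
  apply/cvgn_distP => d d0.
  have [N _ HN] := near_infty_natSinv_lt (PosNum d0).
  exists N => n Nn; rewrite sub0r normrN ger0_norm//.
  by apply: lt_trans (HN n Nn); rewrite ltf_pV2 ?posrE// ltr_nat.
pose I n : set R := `[e n, T - e n]%classic.
have IT n t : I n t -> 0 < t < T.
  rewrite /I /= in_itv /= => /andP[a b]; have := e0 n; lra.
have UI : \bigcup_n I n = `]0, T[%classic.
  apply/seteqP; split => t; first by move=> [n _ /IT]; rewrite /= in_itv.
  rewrite /= in_itv /= => /andP[t0 tT].
  have d0 : 0 < Num.min t (T - t) by rewrite lt_min t0 subr_gt0.
  have [N HN] := (cvgn_distP _ _).1 ecvg _ d0.
  exists N => //; have := HN N (leqnn _); rewrite sub0r normrN ger0_norm ?(ltW (e0 N))//.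
  rewrite lt_min => /andP[]; rewrite /I /= in_itv /=; lra.
have mf : measurable_fun (`]0, T[ : set R) f by exact: continuous_oo_measurable.
have IE n : (\int[leb]_(t in I n) (f t)%:E = (G (T - e n) - G (e n))%:E)%E.
  rewrite EFinB; apply: continuous_FTC2.
  - by have := eT n; lra.
  - apply: continuous_in_subspaceT => t; rewrite inE => /IT; exact: fc.
  - split.
    + move=> t; rewrite in_itv /= => /andP[a b]; have [] // := Gd t _.
      by have := e0 n; lra.
    + apply: cvg_at_right_filter; apply: is_derive_continuous; apply: Gd.
      by have := e0 n; have := eT n; lra.
    + apply: cvg_at_left_filter; apply: is_derive_continuous; apply: Gd.
      by have := e0 n; have := eT n; lra.
  - move=> t; rewrite in_itv /= => /andP[a b].
    rewrite derive1E; have [//|_ ->//] := Gd t _.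
    by have := e0 n; lra.
have GT : G (T - e n) @[n --> \oo] --> G T.
  apply/cvgn_distP => d d0; have [|r r0 Hr] := (within_continuousP _ _).1 Gc T _ d d0.
    by rewrite /= in_itv /= lexx ltW.
  have [N HN] := (cvgn_distP _ _).1 ecvg _ r0; exists N => n /HN.
  rewrite sub0r normrN => h; apply: Hr; rewrite ?/= ?in_itv /=.
    by have := e0 n; have := eT n; lra.
  by rewrite opprB addrCA subrr addr0.
have G0 : G (e n) @[n --> \oo] --> G 0.
  apply/cvgn_distP => d d0; have [|r r0 Hr] := (within_continuousP _ _).1 Gc 0 _ d d0.
    by rewrite /= in_itv /= lexx ltW.
  have [N HN] := (cvgn_distP _ _).1 ecvg _ r0; exists N => n /HN h; apply: Hr => //.
  by rewrite /= in_itv /=; have := e0 n; have := eT n; lra.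
have lim1 : ((\int[leb]_(t in I n) (f t)%:E) @[n --> \oo] --> (G T - G 0)%:E)%E.
  under eq_fun do rewrite IE.
  by apply: cvg_EFin; [exact: nearW|exact: (cvgB GT G0)].
have lim2 : (\int[leb]_(t in I n) (f t)%:E)%E @[n --> \oo] -->
    (\int[leb]_(t in `]0%R, T[) (f t)%:E)%E.
  rewrite -UI; refine (@ge0_nondecreasing_set_cvg_integral _ (measurableTypeR R) R I (EFin \o f) leb _ _ _ _).
  - move=> m n mn; apply/subsetPset => t; rewrite /I /= !in_itv /=.
    have : e n <= e m by rewrite ler_pM2l// lef_pV2 ?posrE// ler_nat !ltnS.
    by lra.
  - by move=> n; exact: measurable_itv.
  - move=> n; apply/measurable_EFinP; apply: measurable_funS mf => //.
    by move=> t /IT; rewrite /= in_itv.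
  - by move=> n t /IT tT; rewrite lee_fin f0.
have E := cvg_unique (@ereal_hausdorff R) lim2 lim1.
split; last by rewrite /Rintegral E.
apply/integrableP; split; first exact/measurable_EFinP.
rewrite (_ : (\int[leb]_(x in _) _)%E = (\int[leb]_(t in `]0%R, T[) (f t)%:E)%E).
  by rewrite E ltry.
apply: eq_integral => t; rewrite inE /= in_itv /= => /f0 ft.
by rewrite ger0_norm.
Qed.

Lemma primitive_affine f g F G H (a b : R) : primitive f F -> primitive g G ->
  (forall t, H t = a * F t + b * G t) ->
  primitive (fun t => a * f t + b * g t) H.
Proof.
move=> [fi fE] [gi gE] HE.
have mD : measurable (`]0, T[%classic : set (measurableTypeR R)) by exact: measurable_itv.
have af : leb.-integrable `]0, T[ (EFin \o (fun t => a * f t)).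
  exact: (integrableZl mD _ fi).
have bg : leb.-integrable `]0, T[ (EFin \o (fun t => b * g t)).
  exact: (integrableZl mD _ gi).
split; first exact: (integrableD mD af bg).
rewrite RintegralD ?RintegralZl// ?fE ?gE ?HE; [|exact: mD..]; lra.
Qed.

(** Adding the constant |C| reduces to the nonnegative case. A one-sided bound is what the singular
    term offers, since it has a sign. *)
Lemma bounded_below_primitive f G (C : R) : {within `[0, T], continuous G} ->
  (forall t : R, 0 < t < T -> is_derive t 1 G (f t)) ->
  (forall t : R, 0 < t < T -> {for t, continuous f}) ->
  (forall t : R, 0 < t < T -> - C <= f t) -> primitive f G.
Proof.
move=> Gc Gd fc fC.
have h1 : primitive (fun=> `|C|) (fun t => `|C| * t).
  apply: ge0_primitive => //; last by move=> *; exact: cst_continuous.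
    by apply: continuous_subspaceT => t; apply: cvgM; [exact: cvg_cst|exact: cvg_id].
  by move=> t tT; apply: is_derive_eq; rewrite [LHS]mulr1.
have h2 : primitive (fun t => f t + `|C|) (fun t => G t + `|C| * t).
  apply: ge0_primitive.
  - move=> t; apply: cvgD; first exact: Gc.
    apply: continuous_subspaceT => {}t; apply: cvgM; [exact: cvg_cst|exact: cvg_id].
  - by move=> t tT; have := Gd t tT => ?; apply: is_derive_eq; rewrite [X in _ + X]mulr1.
  - by move=> t tT; apply: cvgD; [exact: fc|exact: cvg_cst].
  - by move=> t /fC; have := ler_norm C; lra.
have := primitive_affine (H := G) (a := 1) (b := -1) h2 h1.
rewrite (_ : (fun t => _) = f); last by apply/funext => t; lra.
by apply => t; lra.
Qed.

End primitives.

(** * Averages over one cell *)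

Section cell_averages.
Context {R : realType}.
Implicit Types (a b c r v w k beta y : R) (f : R -> R).

Lemma bounded_itv_integrable f a b k : measurable_fun setT f ->
  (forall y, a <= y < b -> `|f y| <= k) ->
  leb.-integrable [set` `[a, b[] (EFin \o f).
Proof.
move=> mf fk; set D : set (measurableTypeR R) := [set` `[a, b[].
have mD : measurable D by exact: measurable_itv.
have Doo : (leb D < +oo)%E.
  have : (lebesgue_measure [set` `[a, b[] < +oo :> \bar R)%E.
    by rewrite lebesgue_measure_itv /=; case: ifP => // _; rewrite -EFinB ltry.
  exact.
apply: (measurable_bounded_integrable mD Doo).
  exact: measurable_funTS.
exists k; split; first exact: num_real.
move=> z kz y; rewrite /D /= in_itv /= => /fk fy.
by rewrite (le_trans fy)// ltW.
Qed.

Lemma Rintegral_cell_linear a b v w : a < b ->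
  \int[leb]_(y in [set` `[a, b[]) (v + (w - v) / (b - a) * (y - a)) =
  (b - a) * ((v + w) / 2).
Proof.
move=> ab; have ba0 : b - a != 0 by rewrite gt_eqF// subr_gt0.
have fc : continuous (fun y => v + (w - v) / (b - a) * (y - a)).
  move=> y; apply: cvgD; first exact: cvg_cst.
  by apply: cvgM; [exact: cvg_cst|apply: cvgB; [exact: cvg_id|exact: cvg_cst]].
have mf : measurable_fun setT (fun y => v + (w - v) / (b - a) * (y - a)).
  exact: continuous_measurable_fun.
pose P y := v * y + (w - v) / (b - a) / 2 * (y - a) ^+ 2.
have Pd y : is_derive y 1 P (v + (w - v) / (b - a) * (y - a)).
  rewrite /P; apply: is_derive_eq.
  by rewrite /GRing.scale /= mulr1; field.
transitivity (P b - P a); last by rewrite /P; field.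
have E : (\int[leb]_(y in `[a, b]) (v + (w - v) / (b - a) * (y - a))%:E)%E =
    ((P b)%:E - (P a)%:E)%E.
  apply: continuous_FTC2 => //; first exact: continuous_subspaceT.
  - have Pc y : {for y, continuous P} by exact: is_derive_continuous (Pd y).
    split; [by move=> y _; have [] := Pd y| |].
      by apply: cvg_at_right_filter; exact: Pc.
    by apply: cvg_at_left_filter; exact: Pc.
  - by move=> y _; rewrite derive1E; have [_ ->] := Pd y.
rewrite -EFinB in E.
have -> := @Rintegral_itv_bndo_bndc R (BLeft a) b (fun y => v + (w - v) / (b - a) * (y - a)).
  by rewrite /Rintegral E.
apply: (@bounded_itv_integrable _ a b (`|v| + `|w|)) => // y /andP[ay yb].
have -> : v + (w - v) / (b - a) * (y - a) =
    v * ((b - y) / (b - a)) + w * ((y - a) / (b - a)) by field.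
have le1 (z : R) : 0 <= z <= b - a -> `|z / (b - a)| <= 1.
  move=> /andP[z0 z1]; rewrite ger0_norm ?divr_ge0 ?subr_ge0 ?(ltW ab)//.
  by rewrite ler_pdivrMr ?mul1r// subr_gt0.
rewrite (le_trans (ler_normD _ _))// (normrM v) (normrM w) lerD// ler_piMr//; apply: le1; lra.
Qed.

(** The comparison function keeps the linear velocity profile, whose average is known exactly; all
    other factors are frozen in [c] and [beta], at the price [r]. *)
Lemma cell_average f a b c beta v w k r : a < b -> measurable_fun setT f ->
  (forall y, a <= y < b -> `|f y| <= k) ->
  (forall y, a <= y < b ->
    `|f y - (c + beta * (v + (w - v) / (b - a) * (y - a)))| <= r) ->
  `|(b - a)^-1 * \int[leb]_(y in [set` `[a, b[]) f y -
    (c + beta * ((v + w) / 2))| <= r.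
Proof.
move=> ab mf fk fr; set D : set (measurableTypeR R) := [set` `[a, b[].
have ba0 : 0 < b - a by rewrite subr_gt0.
have mD : measurable D by exact: measurable_itv.
have lD : fine (leb D) = b - a by rewrite /D leb_itv_co// ltW.
have -> : c + beta * ((v + w) / 2) = (b - a)^-1 * \int[leb]_(y in D)
    (c + beta * (v + (w - v) / (b - a) * (y - a))).
  have -> : (fun y => c + beta * (v + (w - v) / (b - a) * (y - a))) =
      (fun y => (c + beta * v) + ((c + beta * w) - (c + beta * v)) / (b - a) * (y - a)).
    by apply/funext => y; field; rewrite gt_eqF.
  by rewrite Rintegral_cell_linear//; field; rewrite gt_eqF.
set l := fun y => c + beta * _.
have ml : measurable_fun setT l.
  apply: continuous_measurable_fun => y; apply: cvgD; first exact: cvg_cst.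
  apply: cvgM; first exact: cvg_cst.
  apply: cvgD; first exact: cvg_cst.
  by apply: cvgM; [exact: cvg_cst|apply: cvgB; [exact: cvg_id|exact: cvg_cst]].
have fi : leb.-integrable D (EFin \o f) by exact: bounded_itv_integrable fk.
have li : leb.-integrable D (EFin \o l).
  apply: (@bounded_itv_integrable _ a b (k + r)) => // y aby.
  have -> : l y = f y - (f y - l y) by lra.
  by rewrite (le_trans (ler_normB _ _))// lerD ?fk ?fr.
rewrite -mulrBr -RintegralB// normrM gtr0_norm ?invr_gt0//.
rewrite ler_pdivrMl//.
have di : leb.-integrable D (EFin \o (fun y => f y - l y)).
  exact: (integrableB mD fi li).
apply: (le_trans (le_normr_Rintegral mD di)).
rewrite mulrC -lD -Rintegral_cst//; apply: le_Rintegral => //.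
- exact: (integrable_abse di).
- exact: (@bounded_itv_integrable _ a b `|r|).
Qed.

End cell_averages.
Section moving_cell.
Context {R : realType} (T : R) (a b : R -> R) (g : R * R -> R) (k : R -> R)
  (ac : continuous a) (bc : continuous b) (ab : forall t : R, a t < b t)
  (mg : measurable_fun setT g)
  (ki : leb.-integrable `]0, T[ (EFin \o k))
  (gk : forall t y : R, 0 < t < T -> a t <= y < b t -> `|g (t, y)| <= k t).

Definition moving_cell : set (R * R) :=
  [set p | 0 < p.1 < T /\ a p.1 <= p.2 < b p.1].

(** The factor 1 / (b - a) is N rho_i: the interpolants are N^-1 times sums of such functions, and
    the integral in y is an average of [g], whatever the width of the cell. *)
Definition cell_weight (p : R * R) : R :=
  \1_moving_cell p * ((b p.1 - a p.1)^-1 * g p).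

Let mfst (f : R -> R) : continuous f ->
  measurable_fun setT (fun p : R * R => f p.1).
Proof.
move=> fc; apply: continuous_measurable_plane => p.
by apply: (@continuous_comp _ _ _ fst f); [exact: cvg_fst|exact: fc].
Qed.

Let msnd : measurable_fun setT (fun p : R * R => p.2).
Proof. by apply: continuous_measurable_plane => p; exact: cvg_snd. Qed.

Lemma measurable_moving_cell : measurable moving_cell.
Proof.
have -> : moving_cell =
    ([set p | 0 < p.1 < T] `&` [set p | 0 <= p.2 - a p.1]) `&`
    [set p | 0 < b p.1 - p.2].
  apply/seteqP; split => p; rewrite /moving_cell /= subr_ge0 subr_gt0.
    by move=> [-> /andP[-> ->]].
  by move=> [[-> ->] ->].
apply: measurableI; first apply: measurableI.
- rewrite (_ : [set p | _] = open_strip T).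
    by apply: measurableX; [exact: measurable_itv|exact: measurableT].
  by apply/seteqP; split => p; rewrite /open_strip /= in_itv; [|case].
- rewrite -[X in measurable X]setTI (_ : [set p | _] = (fun p : R * R => p.2 - a p.1) @^-1` `[0, +oo[).
    have mm : measurable_fun setT (fun p : R * R => p.2 - a p.1).
      exact: (measurable_funB msnd (mfst ac)).
    by apply: mm => //; exact: measurable_itv.
  by apply/seteqP; split => p; rewrite /= in_itv /= andbT.
- rewrite -[X in measurable X]setTI (_ : [set p | _] = (fun p : R * R => b p.1 - p.2) @^-1` `]0, +oo[).
    have mm : measurable_fun setT (fun p : R * R => b p.1 - p.2).
      exact: (measurable_funB (mfst bc) msnd).
    by apply: mm => //; exact: measurable_itv.
  by apply/seteqP; split => p; rewrite /= in_itv /= andbT.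
Qed.

Lemma measurable_cell_weight : measurable_fun setT cell_weight.
Proof.
apply: measurable_funM; first by apply: measurable_indic; exact: measurable_moving_cell.
apply: measurable_funM => //; apply: (mfst (f := fun t => (b t - a t)^-1)) => t.
by apply: cvgV; [rewrite subr_eq0 gt_eqF|apply: cvgB; [exact: bc|exact: ac]].
Qed.

Let ab0 t : 0 < b t - a t. Proof. by rewrite subr_gt0. Qed.

Let slice t : (fun y => cell_weight (t, y)) =
  (fun y => \1_(`]0, T[ : set R) t * \1_([set` `[a t, b t[]) y * ((b t - a t)^-1 * g (t, y))).
Proof.
apply/funext => y; rewrite /cell_weight; congr (_ * _).
rewrite !indicE /moving_cell -natrM mulnb; congr ((nat_of_bool _)%:R).
apply/idP/andP; rewrite !inE /= !in_itv /=; first by case.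
by move=> [].
Qed.

Let mslice t : measurable_fun setT (fun y => cell_weight (t, y)).
Proof. exact: (@measurable_fun_pair2 _ _ _ (measurableTypeR R) (measurableTypeR R) (measurableTypeR R) _ t measurable_cell_weight). Qed.

Let kT : R -> R := k \_ `]0, T[.

Let kTE t : kT t = \1_(`]0, T[ : set R) t * k t.
Proof. by rewrite /kT patchE indicE; case: ifP; rewrite ?mul1r ?mul0r. Qed.

Let slice_le t y : `|cell_weight (t, y)| <=
  (b t - a t)^-1 * `|kT t| * \1_([set` `[a t, b t[]) y.
Proof.
have /= -> := congr1 (@^~ y) (slice t); rewrite kTE !indicE.
have i0 : 0 <= (b t - a t)^-1 by rewrite invr_ge0 ltW.
case: (boolP (t \in _)); rewrite ?inE /= ?in_itv /= => tT; last first.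
  by rewrite !mul0r normr0 mulr0 mul0r.
case: (boolP (y \in _)); rewrite ?inE /= ?in_itv /= => yT; last first.
  by rewrite mulr0 mul0r normr0 mulr0.
rewrite !mul1r mulr1 normrM ger0_norm// ler_wpM2l//.
by rewrite (le_trans (gk tT yT))// ler_norm.
Qed.

(** Tonelli: in the slice at time t the width of the cell cancels, leaving at most |k t|. The bound
    depends on t because v / theta(rho) is integrable in time but may be unbounded. *)
Lemma cell_weight_integrable : leb2.-integrable setT (EFin \o cell_weight).
Proof.
have mU := measurable_cell_weight.
apply/(@integrable12ltyP _ _ _ _ _ (@lebesgue_measure R) (@lebesgue_measure R)).
  exact/measurable_EFinP.
have kTi : lebesgue_measure.-integrable setT (EFin \o kT).
  have mD : measurable (`]0, T[%classic : set (measurableTypeR R)) by exact: measurable_itv.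
  have := (@integrable_mkcond _ _ R leb _ (EFin \o k) mD).1 ki.
  by rewrite restrict_EFin.
have /integrableP[mk] := kTi; apply: le_lt_trans.
apply: ge0_le_integral => //.
- by move=> t _; apply: integral_ge0 => y _.
- have mn : measurable_fun setT (fun p => `|cell_weight p|%:E).
    by apply/measurable_EFinP; exact: measurableT_comp.
  exact: (@measurable_fun_fubini_tonelli_F _ _ _ _ _ (@lebesgue_measure R)
    (fun p => `|cell_weight p|%:E) mn).
- exact: measurableT_comp.
move=> t _; apply: (@le_trans _ _
  (\int[lebesgue_measure]_y (((b t - a t)^-1 * `|kT t|)%:E * (\1_([set` `[a t, b t[]) y)%:E))%E).
  apply: ge0_le_integral => //.
  - by apply/measurable_EFinP; apply: measurableT_comp => //; exact: mslice.
  - apply/measurable_EFinP; apply: measurable_funM => //.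
  - by move=> y _; rewrite lee_fin slice_le.
rewrite ge0_integralZl//; last 2 first.
- by apply/measurable_EFinP.
- by rewrite lee_fin mulr_ge0// invr_ge0 ltW.
rewrite integral_indic// setIT.
rewrite [X in (_ * X)%E](_ : _ = (b t - a t)%:E); last exact: (leb_itv_co (ltW (ab t))).
by rewrite -EFinM lee_fin mulrAC mulVf ?mul1r// gt_eqF.
Qed.

Definition slice_integral t : R := \int[leb]_y cell_weight (t, y).

Let slice_integrable t : leb.-integrable setT (EFin \o (fun y => cell_weight (t, y))).
Proof.
have i1 : lebesgue_measure.-integrable setT (EFin \o (\1_([set` `[a t, b t[]) : R -> R)).
  apply: indic_integrable; first exact: measurable_itv.
  have h : (leb [set` `[a t, b t[] < +oo)%E by rewrite leb_itv_co ?ltry ?ltW.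
  exact: h.
apply: (dominated_integrable (scaled_integrable ((b t - a t)^-1 * `|kT t|) i1)).
  exact: mslice.
by move=> y; rewrite (le_trans (slice_le t y))// ler_norm.
Qed.

Lemma slice_integralE t : 0 < t < T -> slice_integral t =
  (b t - a t)^-1 * \int[leb]_(y in [set` `[a t, b t[]) g (t, y).
Proof.
move=> tT; rewrite /slice_integral slice.
have mD : measurable ([set` `[a t, b t[] : set (measurableTypeR R)) by exact: measurable_itv.
have gi : leb.-integrable [set` `[a t, b t[] (EFin \o (fun y => g (t, y))).
  apply: (@bounded_itv_integrable R _ (a t) (b t) (k t)).
    exact: (@measurable_fun_pair2 _ _ _ (measurableTypeR R) (measurableTypeR R) (measurableTypeR R) _ t mg).
  by move=> y; exact: gk.
rewrite -RintegralZl// [in RHS]Rintegral_mkcond; apply: eq_Rintegral => y _.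
rewrite patchE [X in X * _ * _]indicE mem_set ?mul1r; last by rewrite /= in_itv.
by rewrite indicE; case: ifP => _; rewrite ?mul1r ?mul0r.
Qed.

(** Fubini reduces the claim to [cell_average] at each time, integrated over ]0, T[. *)
Lemma moving_cell_average (c beta v w q r : R -> R) :
  leb.-integrable `]0, T[ (EFin \o q) -> leb.-integrable `]0, T[ (EFin \o r) ->
  (forall t : R, 0 < t < T -> q t = c t + beta t * ((v t + w t) / 2)) ->
  (forall t y : R, 0 < t < T -> a t <= y < b t ->
    `|g (t, y) - (c t + beta t * (v t + (w t - v t) / (b t - a t) * (y - a t)))| <= r t) ->
  `|\int[leb2]_p cell_weight p - \int[leb]_(t in `]0, T[) q t| <=
    \int[leb]_(t in `]0, T[) r t.
Proof.
move=> qi ri qE gr.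
have mD : measurable (`]0, T[%classic : set (measurableTypeR R)) by exact: measurable_itv.
have FE : (fubini_F (@lebesgue_measure R) (EFin \o cell_weight)) = EFin \o slice_integral.
  apply/funext => t; rewrite /= /slice_integral fineK//.
  exact: (integrable_fin_num measurableT (slice_integrable t)).
have si : leb.-integrable setT (EFin \o slice_integral).
  by rewrite -FE; exact: (@integrable_fubini_F _ _ _ _ _ (@lebesgue_measure R) (@lebesgue_measure R) _ cell_weight_integrable).
have -> : \int[leb2]_p cell_weight p = \int[leb]_(t in `]0, T[) slice_integral t.
  transitivity (\int[leb]_t slice_integral t).
    rewrite /Rintegral; congr fine.
    have := @integral12_prod_meas1 _ _ _ _ _ (@lebesgue_measure R) (@lebesgue_measure R) _ cell_weight_integrable.
    move=> E; apply: etrans (esym E) _; apply: eq_integral => t _.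
    exact: (congr1 (@^~ t) FE).
  rewrite [RHS]Rintegral_mkcond; apply: eq_Rintegral => t _.
  rewrite patchE; case: ifPn => // tT; rewrite /slice_integral slice.
  rewrite (_ : (fun y => _) = cst 0); first by rewrite /Rintegral integral0.
  by apply/funext => y; rewrite indicE (negbTE tT) !mul0r.
have si' : leb.-integrable `]0, T[ (EFin \o slice_integral).
  exact: (integrableS measurableT mD _ si).
rewrite -RintegralB//.
have di : leb.-integrable `]0, T[ (EFin \o (fun t => slice_integral t - q t)).
  exact: (integrableB mD si' qi).
apply: (le_trans (le_normr_Rintegral mD di)); apply: le_Rintegral => //.
  exact: (integrable_abse di).
move=> t; rewrite /= in_itv /= => tT; rewrite slice_integralE// qE//.
apply: (@cell_average R (fun y => g (t, y)) (a t) (b t) _ _ _ _ (k t)) => //.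
- exact: (@measurable_fun_pair2 _ _ _ (measurableTypeR R) (measurableTypeR R) (measurableTypeR R) _ t mg).
- by move=> y; exact: gk.
- by move=> y; exact: gr.
Qed.

End moving_cell.
Lemma continuous_at_distP {R : realType} (V W : pseudoMetricNormedZmodType R)
    (f : V -> W) (x : V) :
  {for x, continuous f} <-> (forall e : R, 0 < e -> exists2 d : R, 0 < d &
    forall y, `|x - y| < d -> `|f x - f y| < e).
Proof.
split=> [/cvgrPdist_lt H e /H /nbhs_ballP[d d0 Hd]|H].
  by exists d => // y xy; apply: Hd; rewrite -ball_normE.
apply/cvgrPdist_lt => e /H[d d0 Hd]; apply/nbhs_ballP; exists d => // y.
by rewrite -ball_normE; exact: Hd.
Qed.

(** * Clamping in time, and differentiation along curves *)

Section clamping.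
Context {R : realType} (T : R) (T0 : 0 <= T).

(* Velocities are controlled on [0, T] only; clamping the time makes the functions
   involved continuous on the whole plane. *)
Definition clamp (t : R) : R := Num.max 0 (Num.min t T).

Lemma clamp_range t : 0 <= clamp t <= T.
Proof. by rewrite /clamp le_max lexx /= ge_max T0 ge_min lexx orbT. Qed.

Lemma clamp_id t : 0 <= t <= T -> clamp t = t.
Proof. by move=> /andP[t0 tT]; rewrite /clamp min_l// max_r. Qed.

Lemma clamp_dist t u : `|clamp t - clamp u| <= `|t - u|.
Proof.
have T00 := T0; rewrite /clamp /Num.max /Num.min ler_norml.
have h1 := ler_norm (t - u); have := ler_norm (u - t); rewrite distrC => h2.
have h3 := normr_ge0 (t - u).
by case: (ltP t T) => ?; case: (ltP u T) => ?; case: ltP => ?; case: ltP => ?; lra.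
Qed.

Lemma clamp_continuous (V : pseudoMetricNormedZmodType R) (f : R -> V) :
  {within `[0, T], continuous f} -> continuous (f \o clamp).
Proof.
move=> /within_continuousP fc t; apply/continuous_at_distP => e e0.
have mem u : (`[0, T]%classic : set R) (clamp u) by rewrite /= in_itv /= clamp_range.
have [d d0 Hd] := fc _ (mem t) e e0.
exists d => // u tu.
by apply: Hd => //; rewrite (le_lt_trans (clamp_dist _ _)).
Qed.

Lemma clamp_strip_continuous (f : R * R -> R) :
  {within strip T, continuous f} -> continuous (fun p => f (clamp p.1, p.2)).
Proof.
move=> /within_continuousP fc p.
apply/(@continuous_at_distP R (R * R)%type R) => e e0.
have mem (q : R * R) : strip T (clamp q.1, q.2).
  by split => //=; rewrite in_itv /= clamp_range.
have [d d0 Hd] := fc _ (mem p) e e0.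
exists d => // q; rewrite prod_normE gt_max /= => /andP[h1 h2].
apply: Hd => //; rewrite prod_normE gt_max /= h2 andbT.
by rewrite (le_lt_trans (clamp_dist _ _)).
Qed.

End clamping.

Section chain_rule.
Context {R : realType}.

Lemma is_derive_epsilonP (f : R -> R) (t l : R) :
  (forall e : R, 0 < e -> exists2 d : R, 0 < d &
    forall s : R, s != t -> `|s - t| < d -> `|l - (s - t)^-1 * (f s - f t)| < e) ->
  is_derive t 1 f l.
Proof.
move=> H.
have lim : h^-1 *: (f (h *: 1 + t) - f t) @[h --> (0 : R)^'] --> l.
  apply/cvgrPdist_lt => e e0; have [d d0 Hd] := H e e0.
  rewrite /prop_near1 /=; apply/nbhs_ballP; exists d => // h.
  rewrite -ball_normE /= sub0r normrN => hd h0.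
  rewrite scaler1; have := Hd (h + t); rewrite addrK; apply => //.
  by rewrite -subr_eq0 addrK.
split; first by apply/cvg_ex; exists l; exact: lim.
exact: (cvg_lim (@Rhausdorff R) lim).
Qed.

Lemma mean_value (f df : R -> R) (a b t s : R) :
  (forall u : R, a < u < b -> is_derive u 1 f (df u)) ->
  a < t < b -> a < s < b ->
  exists2 c : R, a < c < b /\ `|c - t| <= `|s - t| & f s - f t = df c * (s - t).
Proof.
move=> fd tab sab.
have fc u v : a < u < b -> a < v < b -> {within `[u, v], continuous f}.
  move=> uab vab; apply: is_derive_within_continuous => w /=; rewrite in_itv /=.
  by move=> wuv; apply: fd; lra.
have [ts|st] := leP t s.
  have [||c cts E] := @MVT_segment R f df t s ts.
  - by move=> u; rewrite in_itv /= => tus; apply: fd; lra.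
  - exact: fc.
  exists c => //; move: cts; rewrite in_itv /= => cts; split; first lra.
  by rewrite !ger0_norm; lra.
have [||c cts E] := @MVT_segment R f df s t (ltW st).
- by move=> u; rewrite in_itv /= => tus; apply: fd; lra.
- exact: fc.
exists c; last by lra.
move: cts; rewrite in_itv /= => cts; split; first lra.
by rewrite !ler0_norm; lra.
Qed.

(** [C1_strip] gives partial derivatives only. The increment is split at phi(t, y s): the change in
    space falls under the chain rule in one variable, the change in time under the mean value
    theorem and joint continuity of [dt T phi]. *)
Lemma C1_strip_chain (T : R) (phi : R * R -> R) (y : R -> R) (dy t : R) :
  C1_strip T phi -> 0 < t < T -> is_derive t 1 y dy ->
  is_derive t 1 (fun s => phi (s, y s)) (dt T phi (t, y t) + dy * dx phi (t, y t)).
Proof.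
move=> [_ phit phix /within_continuousP dtc _] tT yd.
have inT u : 0 < u < T -> 0 <= u <= T by move=> /andP[/ltW -> /ltW ->].
have d1 : is_derive t 1 (fun s => phi (t, y s)) (dy * dx phi (t, y t)).
  have px : is_derive (y t) 1 (fun z => phi (t, z)) (dx phi (t, y t)).
    rewrite /dx derive1E; apply/derivableP; apply: (phix (t, y t)).
    by split => //=; rewrite in_itv /= inT.
  have := @is_derive1_comp _ (fun z => phi (t, z)) y t _ _ px yd.
  by move=> H; apply: is_derive_eq; rewrite /GRing.scale /= mulrC.
have d2 : is_derive t 1 (fun s => phi (s, y s) - phi (t, y s)) (dt T phi (t, y t)).
  apply: is_derive_epsilonP => e e0.
  have [|d d0 Hd] := dtc (t, y t) _ e e0.
    by split => //=; rewrite in_itv /= inT.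
  have yc := is_derive_continuous yd.
  have /cvgrPdist_lt /(_ d d0) /nbhs_ballP[d' /= d'0 Hd'] := yc.
  have m0 : 0 < Num.min (Num.min d d') (Num.min t (T - t)).
    by rewrite !lt_min d0 d'0 subr_gt0.
  exists (Num.min (Num.min d d') (Num.min t (T - t))) => // s st.
  rewrite !lt_min => /andP[/andP[sd sd'] /andP[s1 s2]].
  have sT : 0 < s < T.
    by move: s1 s2; rewrite !ltr_norml => /andP[a _] /andP[_ b]; lra.
  have [u uT|c [cT ct] ->] := @mean_value (fun u => phi (u, y s)) (fun u => dt T phi (u, y s)) 0 T t s _ tT sT.
    apply: is_derive_deriv_in; first exact: nbhs_itv.
    by apply: (phit (u, y s)); split => //=; rewrite in_itv /= inT.
  rewrite subrr subr0 mulrC mulfK ?subr_eq0//; apply: Hd.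
    by split => //=; rewrite in_itv /= inT.
  rewrite prod_normE gt_max /=; apply/andP; split.
    by rewrite distrC (le_lt_trans ct).
  by apply: Hd'; rewrite -ball_normE /= distrC.
have -> : (fun s => phi (s, y s)) = (fun s => phi (s, y s) - phi (t, y s)) + (fun s => phi (t, y s)).
  by apply/funext => s /=; rewrite !fctE subrK.
exact: is_deriveD.
Qed.

End chain_rule.
Lemma Rintegral_sum {R : realType} d (T : measurableType d)
    (mu : {measure set T -> \bar R}) n (f : nat -> T -> R) :
  (forall i, (i < n)%N -> mu.-integrable setT (EFin \o f i)) ->
  mu.-integrable setT (EFin \o (fun p => \sum_(i < n) f i p)) /\
  \int[mu]_p (\sum_(i < n) f i p) = \sum_(i < n) \int[mu]_p f i p.
Proof.
elim: n => [|n IH] fi.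
  rewrite big_ord0 (_ : (fun p => _) = cst 0).
    by split; [exact: integrable0|rewrite /Rintegral integral0].
  by apply/funext => p; rewrite big_ord0.
have [|i1 E1] := IH; first by move=> i iN; apply: fi; exact: ltnW.
rewrite big_ord_recr /= -E1 -RintegralD//; last exact: fi.
have -> : (fun p => \sum_(i < n.+1) f i p) = (fun p => \sum_(i < n) f i p + f n p).
  by apply/funext => p; rewrite big_ord_recr.
by split => //; exact: (integrableD measurableT i1 (fi n (ltnSn n))).
Qed.

(** * Estimates on the interpolants *)

Section bounded_on_itv.
Context {R : realType} (T : R).

Let mD : measurable (`]0, T[%classic : set (measurableTypeR R)).
Proof. exact: measurable_itv. Qed.

Lemma dominated_oo_integrable (f g : R -> R) :
  leb.-integrable `]0, T[ (EFin \o g) ->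
  (forall t : R, 0 < t < T -> {for t, continuous f}) ->
  (forall t : R, 0 < t < T -> `|f t| <= g t) ->
  leb.-integrable `]0, T[ (EFin \o f).
Proof.
move=> gi fc fg; apply: (le_integrable mD _ _ gi).
  by apply/measurable_EFinP; exact: continuous_oo_measurable.
move=> t; rewrite /= in_itv /= => tT; rewrite lee_fin (le_trans (fg t tT))//.
exact: ler_norm.
Qed.

Lemma cst_oo_integrable (C : R) : leb.-integrable `]0, T[ (EFin \o cst C).
Proof.
have Doo : (leb (`]0%R, T[%classic : set (measurableTypeR R)) < +oo)%E.
  have : (lebesgue_measure (`]0%R, T[%classic : set R) < +oo :> \bar R)%E.
    by rewrite lebesgue_measure_itv /=; case: ifP => // _; rewrite -EFinB ltry.
  exact.
apply: (measurable_bounded_integrable mD Doo); first exact: measurable_cst.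
by exists `|C|; split; [exact: num_real|move=> z lez t _; exact: ltW].
Qed.

Lemma bounded_oo_integrable (f : R -> R) (C : R) :
  (forall t : R, 0 < t < T -> {for t, continuous f}) ->
  (forall t : R, 0 < t < T -> `|f t| <= C) ->
  leb.-integrable `]0, T[ (EFin \o f).
Proof. by move=> fc; exact: (dominated_oo_integrable (cst_oo_integrable C)). Qed.

Lemma integrable_oo_affine (f g : R -> R) (a b : R) :
  leb.-integrable `]0, T[ (EFin \o f) -> leb.-integrable `]0, T[ (EFin \o g) ->
  leb.-integrable `]0, T[ (EFin \o (fun t => a * f t + b * g t)).
Proof.
move=> fi gi.
exact: (integrableD mD (integrableZl mD a fi) (integrableZl mD b gi)).
Qed.

Lemma Rintegral_oo_affine (f g : R -> R) (a b : R) :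
  leb.-integrable `]0, T[ (EFin \o f) -> leb.-integrable `]0, T[ (EFin \o g) ->
  \int[leb]_(t in `]0, T[) (a * f t + b * g t) =
  a * \int[leb]_(t in `]0, T[) f t + b * \int[leb]_(t in `]0, T[) g t.
Proof.
move=> fi gi; have af := integrableZl mD a fi; have bg := integrableZl mD b gi.
by rewrite RintegralD ?RintegralZl//.
Qed.

Lemma Rintegral_oo_scale (f : R -> R) (a : R) :
  leb.-integrable `]0, T[ (EFin \o f) ->
  \int[leb]_(t in `]0, T[) (a * f t) = a * \int[leb]_(t in `]0, T[) f t.
Proof. by move=> fi; rewrite RintegralZl. Qed.

Lemma le_Rintegral_oo (f g : R -> R) :
  leb.-integrable `]0, T[ (EFin \o f) -> leb.-integrable `]0, T[ (EFin \o g) ->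
  (forall t : R, 0 < t < T -> f t <= g t) ->
  \int[leb]_(t in `]0, T[) f t <= \int[leb]_(t in `]0, T[) g t.
Proof.
move=> fi gi fg; apply: le_Rintegral => // t; rewrite /= in_itv /=; exact: fg.
Qed.

Lemma Rintegral_oo_cst (C : R) : 0 < T ->
  \int[leb]_(t in `]0, T[) cst C t = C * T.
Proof.
move=> T0; rewrite Rintegral_cst//; congr (_ * _).
have : (lebesgue_measure (`]0%R, T[%classic : set R) = T%:E :> \bar R)%E.
  by rewrite lebesgue_measure_itv /= lte_fin T0 -EFinB subr0.
by move=> E; apply: (etrans (congr1 fine E)).
Qed.

End bounded_on_itv.

Section regular_estimates.
Context {R : realType} (T eps gam rhobar s S W M : R) (theta : R -> R)
  (F : R * R -> R) (N : nat) (x : nat -> R -> R)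
  (T_gt0 : 0 < T) (eps_gt0 : 0 < eps) (gam_gt0 : 0 < gam) (N_gt0 : (0 < N)%N)
  (nonlin : nonlinearity_assumptions T theta rhobar F)
  (F_le : forall t y, 0 <= t <= T -> s <= y <= S -> F (t, y) <= M)
  (rt : regular_traffic T eps gam rhobar theta F s S W N x).

Definition clamp_pos i t : R := x i (clamp T t).
Definition clamp_vel i t : R := vel T (x i) (clamp T t).
Definition clamp_force (p : R * R) : R := F (clamp T p.1, p.2).
(** The singular term: on the i-th cell e1 / theta(rho) equals rho_i times this function, so its
    integrals in time control the mass of lambda. *)
Definition relax i t : R := clamp_vel i t / theta (rho_ N x i (clamp T t)).

Let X := clamp_pos.
Let V := clamp_vel.
Let Fc := clamp_force.
Let w := relax.
Let d i t : R := X i.+1 t - X i t.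

Let T0 : 0 <= T. Proof. exact: ltW. Qed.
Let NR : 0 < N%:R :> R. Proof. by rewrite ltr0n. Qed.
Let cl t : 0 <= clamp T t <= T. Proof. exact: clamp_range. Qed.
Let oc t : 0 < t < T -> 0 <= t <= T. Proof. by move=> /andP[/ltW -> /ltW ->]. Qed.
Let cle t : 0 < t < T -> clamp T t = t. Proof. by move=> /oc; exact: clamp_id. Qed.

Lemma clamp_pos_cont i : (i <= N)%N -> continuous (X i).
Proof. by move=> iN; apply: (clamp_continuous T0); exact: (rt_cont rt). Qed.

Lemma clamp_vel_cont i : (i <= N)%N -> continuous (V i).
Proof. by move=> iN; apply: (clamp_continuous T0); exact: (rt_vel_cont rt). Qed.

Lemma clamp_force_cont : continuous Fc.
Proof. exact: (clamp_strip_continuous T0 (F_continuous nonlin)). Qed.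

Lemma clamp_range_pos i t : (i <= N)%N -> s <= X i t <= S.
Proof. by move=> iN; apply: (rt_range rt). Qed.

Lemma clamp_vel_range i t : (i <= N)%N -> 0 <= V i t <= W.
Proof. by move=> iN; apply: (rt_vel rt). Qed.

Lemma gapc_gt0 i t : (i < N)%N -> 0 < d i t.
Proof. by move=> iN; rewrite subr_gt0; apply: (rt_lt rt). Qed.

Lemma gapc_le i t : (i < N)%N -> d i t <= S - s.
Proof.
move=> iN; have := clamp_range_pos t (ltnW iN); have := clamp_range_pos t iN.
rewrite /d; lra.
Qed.

Lemma clamp_force_le t y : s <= y <= S -> 0 < Fc (t, y) <= M.
Proof.
move=> sy; rewrite F_le// andbT; apply: (F_gt0 nonlin).
by split => //=; rewrite in_itv /= cl.
Qed.

Let W0 : 0 <= W.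
Proof. by have /andP[] := clamp_vel_range 0 (leq0n N); exact: le_trans. Qed.

Let sS : s <= S.
Proof. by have /andP[] := clamp_range_pos 0 (leq0n N); exact: le_trans. Qed.

Let M0 : 0 < M.
Proof.
have /andP[a b] := clamp_force_le 0 (introT andP (conj (lexx s) sS)).
exact: lt_le_trans b.
Qed.

Lemma clamp_rho i t : rho_ N x i (clamp T t) = (N%:R * d i t)^-1.
Proof. by []. Qed.

Lemma clamp_rho_gt0 i t : (i < N)%N -> 0 < rho_ N x i (clamp T t).
Proof. by move=> iN; rewrite clamp_rho invr_gt0 mulr_gt0// gapc_gt0. Qed.

Lemma relax_theta_gt0 i t : (i < N)%N -> 0 < t < T ->
  0 < theta (rho_ N x i (clamp T t)).
Proof.
move=> iN tT; apply: (theta_gt0 nonlin); rewrite ltW ?clamp_rho_gt0//=.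
by rewrite cle//; apply: (rt_rho_lt rt) => //; case/andP: tT => -> /ltW.
Qed.

Lemma gapc_cont i : (i < N)%N -> continuous (d i).
Proof.
by move=> iN t; apply: cvgB; apply: clamp_pos_cont => //; exact: ltnW.
Qed.

Lemma clamp_rho_cont i : (i < N)%N -> continuous (fun t => rho_ N x i (clamp T t)).
Proof.
move=> iN t; apply: cvgV; first by rewrite mulf_neq0 ?gt_eqF// gapc_gt0.
by apply: cvgM; [exact: cvg_cst|exact: gapc_cont].
Qed.

Lemma theta_rho_cont i : (i < N)%N ->
  continuous (fun t => theta (rho_ N x i (clamp T t))).
Proof.
move=> iN t; apply/continuous_at_distP => e e0.
have ge0 u : (`[0, +oo[%classic : set R) (rho_ N x i (clamp T u)).
  by rewrite /= in_itv /= andbT ltW// clamp_rho_gt0.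
have [r r0 Hr] := (within_continuousP _ _).1 (theta_continuous nonlin) _ (ge0 t) e e0.
have [r' r'0 Hr'] := (@continuous_at_distP R R R (fun t => rho_ N x i (clamp T t)) t).1 (@clamp_rho_cont i iN t) r r0.
by exists r' => // u tu; apply: Hr => //; exact: Hr'.
Qed.

Lemma relax_cont i t : (i < N)%N -> 0 < t < T -> {for t, continuous (w i)}.
Proof.
move=> iN tT; apply: cvgM; first by apply: clamp_vel_cont; exact: ltnW.
by apply: cvgV; [rewrite gt_eqF// relax_theta_gt0|exact: theta_rho_cont].
Qed.

Lemma relax_ge0 i t : (i < N)%N -> 0 < t < T -> 0 <= w i t.
Proof.
move=> iN tT; apply: divr_ge0; last by rewrite ltW// relax_theta_gt0.
by have /andP[] := clamp_vel_range t (ltnW iN).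
Qed.

Lemma pos_derive i t : (i <= N)%N -> 0 < t < T -> is_derive t 1 (x i) (V i t).
Proof. by move=> iN tT; rewrite /V /clamp_vel cle//; apply: (rt_derive rt). Qed.

Lemma vel_derive i t : (i < N)%N -> 0 < t < T ->
  is_derive t 1 (vel T (x i)) ((Fc (t, X i t) - gam * w i t) / eps).
Proof.
move=> iN tT; rewrite /w /relax /V /clamp_vel /Fc /clamp_force /X /clamp_pos /= cle//.
exact: (rt_acc rt).
Qed.

Lemma pair_cont (f : R -> R) (g : R * R -> R) : continuous f -> continuous g ->
  continuous (fun t => g (t, f t)).
Proof.
move=> fc gc t; apply: (@continuous_comp _ _ _ (fun t => (t, f t)) g); last exact: gc.
apply/(@continuous_at_distP R R (R * R)%type) => e e0.
have [r r0 Hr] := (@continuous_at_distP R R R f t).1 (fc t) e e0.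
exists (Num.min r e); first by rewrite lt_min r0.
by move=> u; rewrite lt_min prod_normE gt_max /= => /andP[/Hr -> ->].
Qed.

Lemma force_cont i : (i <= N)%N -> continuous (fun t => Fc (t, X i t)).
Proof.
move=> iN; apply: pair_cont; [exact: clamp_pos_cont|exact: clamp_force_cont].
Qed.

(** The equation of motion divided by theta(rho), written as an exact derivative. It is bounded
    below by - M, as v / theta(rho) >= 0 and F <= M. *)
Lemma relax_primitive i : (i < N)%N ->
  primitive T (fun t => gam * w i t - Fc (t, X i t)) (fun t => - eps * vel T (x i) t).
Proof.
move=> iN; have iN' := ltnW iN; apply: (@bounded_below_primitive _ _ T_gt0 _ _ M).
- move=> t; apply: cvgM; [exact: cvg_cst|exact: (rt_vel_cont rt)].
- move=> t tT; have D := vel_derive iN tT.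
  apply: is_derive_eq; rewrite ?scaler0 ?addr0 ?add0r /GRing.scale /=.
  by field; rewrite gt_eqF.
- move=> t tT; apply: cvgB; last exact: force_cont.
  by apply: cvgM; [exact: cvg_cst|exact: relax_cont].
- move=> t tT; have := relax_ge0 iN tT; rewrite -(pmulr_rge0 _ gam_gt0).
  have /andP[_] := clamp_force_le t (clamp_range_pos t iN'); lra.
Qed.

Lemma force_integrable i : (i <= N)%N ->
  leb.-integrable `]0, T[ (EFin \o (fun t => Fc (t, X i t))).
Proof.
move=> iN; apply: (@bounded_oo_integrable _ _ _ M) => [t _|t _]; first exact: force_cont.
by have /andP[f0 fM] := clamp_force_le t (clamp_range_pos t iN); rewrite gtr0_norm.
Qed.

Lemma relax_integrable i : (i < N)%N -> leb.-integrable `]0, T[ (EFin \o w i).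
Proof.
move=> iN; have [fi _] := relax_primitive iN.
have := integrable_oo_affine gam^-1 gam^-1 fi (force_integrable (ltnW iN)).
congr (integrable _ _ (EFin \o _)); apply/funext => t; field.
by rewrite gt_eqF.
Qed.

(** F contributes at most [T * M], and the loss of momentum eps (v(0) - v(T)) at most [eps * W].
    Neither depends on i or N, whence a uniform bound on the mass. *)
Lemma relax_mass i : (i < N)%N ->
  gam * \int[leb]_(t in `]0, T[) w i t <= T * M + eps * W.
Proof.
move=> iN; have [fi fE] := relax_primitive iN.
have Fi := force_integrable (ltnW iN); have wi := relax_integrable iN.
have -> : gam * \int[leb]_(t in `]0, T[) w i t =
    1 * \int[leb]_(t in `]0, T[) (gam * w i t - Fc (t, X i t)) +
    1 * \int[leb]_(t in `]0, T[) Fc (t, X i t).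
  rewrite -Rintegral_oo_affine// -Rintegral_oo_scale//.
  by apply: eq_Rintegral => t _; rewrite !mul1r subrK.
rewrite fE !mul1r.
have h : \int[leb]_(t in `]0, T[) Fc (t, X i t) <= M * T.
  rewrite -Rintegral_oo_cst//; apply: le_Rintegral_oo => //; first exact: cst_oo_integrable.
  by move=> t _; have /andP[] := clamp_force_le t (clamp_range_pos t (ltnW iN)).
have h0 := rt_vel rt (ltnW iN) (t := 0); have hT := rt_vel rt (ltnW iN) (t := T).
have /andP[a _] := hT (introT andP (conj T0 (lexx _))).
have /andP[_ b] := h0 (introT andP (conj (lexx _) T0)).
have : eps * vel T (x i) 0 <= eps * W by rewrite ler_pM2l.
have : 0 <= eps * vel T (x i) T by rewrite mulr_ge0// ltW.
lra.
Qed.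

Lemma pos_integrable i : (i <= N)%N -> leb.-integrable `]0, T[ (EFin \o X i).
Proof.
move=> iN; apply: (@bounded_oo_integrable _ _ _ (`|s| + `|S|)) => [t _|t _].
  exact: clamp_pos_cont.
have /andP[a b] := clamp_range_pos t iN.
rewrite ler_norml; have := ler_norm (- s); have := ler_norm S.
by rewrite normrN; have := normr_ge0 s; have := normr_ge0 S; lra.
Qed.

Lemma vel2_integrable i : (i <= N)%N ->
  leb.-integrable `]0, T[ (EFin \o (fun t => V i t ^+ 2)).
Proof.
move=> iN; apply: (@bounded_oo_integrable _ _ _ (W ^+ 2)) => [t _|t _].
  by apply: cvgM; exact: clamp_vel_cont.
have /andP[a b] := clamp_vel_range t iN.
by rewrite ger0_norm ?sqr_ge0// lerXn2r// nnegrE.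
Qed.

Lemma relax_gap_integrable i : (i < N)%N ->
  leb.-integrable `]0, T[ (EFin \o (fun t => w i t * d i t)).
Proof.
move=> iN; have := integrable_oo_affine (S - s) 0 (relax_integrable iN) (relax_integrable iN).
move=> gi; apply: (dominated_oo_integrable gi) => t tT.
  by apply: cvgM; [exact: relax_cont|exact: gapc_cont].
have d0 := ltW (gapc_gt0 t iN).
rewrite mul0r addr0 normrM mulrC !ger0_norm ?relax_ge0//.
by rewrite ler_wpM2r ?relax_ge0// gapc_le.
Qed.

(* [v_i (v_(i+1) - v_i) <= (v_(i+1)^2 - v_i^2) / 2], which telescopes. *)
Lemma relax_gap_le i : (i < N)%N ->
  gam * \int[leb]_(t in `]0, T[) (w i t * d i t) <=
  M * (\int[leb]_(t in `]0, T[) X i.+1 t - \int[leb]_(t in `]0, T[) X i t) +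
  eps / 2 * (\int[leb]_(t in `]0, T[) V i.+1 t ^+ 2 -
             \int[leb]_(t in `]0, T[) V i t ^+ 2) +
  eps * W * (x i.+1 0 - x i 0).
Proof.
move=> iN; have iN' := ltnW iN.
pose f t := gam * (w i t * d i t) - (M * (X i.+1 t - X i t) + eps / 2 * (V i.+1 t ^+ 2 - V i t ^+ 2)).
(* Differentiating this product produces the singular term times the gap together with v_i (v_(i+1)
   - v_i), and no acceleration of vehicle i + 1, which does not exist in general when that vehicle
   is the leader. *)
pose G t := - (eps * vel T (x i) t * (x i.+1 t - x i t)).
pose g t := gam * (w i t * d i t) - Fc (t, X i t) * d i t - eps * V i t * (V i.+1 t - V i t).
have Xi := pos_integrable iN'; have Xi1 := pos_integrable iN.
have Vi := vel2_integrable iN'; have Vi1 := vel2_integrable iN.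
have wi := relax_gap_integrable iN.
have Vc := clamp_vel_cont iN; have Vc' := clamp_vel_cont iN'.
have [gi gE] : primitive T g G.
  apply: (@bounded_below_primitive _ _ T_gt0 _ _ (M * (S - s) + eps * W * W)).
  - move=> t; apply: cvgN; apply: cvgM.
      by apply: cvgM; [exact: cvg_cst|exact: (rt_vel_cont rt)].
    by apply: cvgB; exact: (rt_cont rt).
  - move=> t tT; have D := vel_derive iN tT; have D1 := pos_derive iN tT; have D2 := pos_derive iN' tT.
    apply: is_derive_eq; rewrite ?scaler0 ?addr0 ?add0r /GRing.scale /= /g.
    have -> : vel T (x i) t = V i t by rewrite /V /clamp_vel cle.
    rewrite /d /X /clamp_pos cle//; field; rewrite gt_eqF//.
  - move=> t tT; apply: cvgB; first apply: cvgB.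
    + apply: cvgM; first exact: cvg_cst.
      by apply: cvgM; [exact: relax_cont|exact: gapc_cont].
    + by apply: cvgM; [exact: force_cont|exact: gapc_cont].
    + apply: cvgM; last by apply: cvgB; [exact: Vc|exact: Vc'].
      by apply: cvgM; [exact: cvg_cst|exact: Vc'].
  - move=> t tT; have /andP[a b] := clamp_vel_range t iN; have /andP[a' b'] := clamp_vel_range t iN'.
    have g0 := gapc_gt0 t iN.
    have h1 : 0 <= gam * (w i t * d i t).
      by apply: mulr_ge0; [exact: ltW|apply: mulr_ge0; [exact: relax_ge0|exact: ltW]].
    have h2 : Fc (t, X i t) * d i t <= M * (S - s).
      have /andP[f0 fM] := clamp_force_le t (clamp_range_pos t iN').
      by apply: ler_pM => //; [exact: ltW|exact: ltW|exact: gapc_le].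
    have h3 : eps * V i t * (V i.+1 t - V i t) <= eps * W * W.
      apply: (@le_trans _ _ (eps * V i t * W)).
        rewrite ler_wpM2l ?mulr_ge0 ?(ltW eps_gt0)//; lra.
      by rewrite ler_wpM2r// ler_wpM2l// ltW.
    rewrite /g; lra.
have E1 : \int[leb]_(t in `]0, T[) f t =
    gam * \int[leb]_(t in `]0, T[) (w i t * d i t) -
    (M * (\int[leb]_(t in `]0, T[) X i.+1 t - \int[leb]_(t in `]0, T[) X i t) +
  eps / 2 * (\int[leb]_(t in `]0, T[) V i.+1 t ^+ 2 -
             \int[leb]_(t in `]0, T[) V i t ^+ 2)).
  have i1 := integrable_oo_affine 1 (- 1) Xi1 Xi.
  have i2 := integrable_oo_affine 1 (- 1) Vi1 Vi.
  have i3 := integrable_oo_affine M (eps / 2) i1 i2.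
  transitivity (gam * \int[leb]_(t in `]0, T[) (w i t * d i t) + (-1) *
    (M * (1 * \int[leb]_(t in `]0, T[) X i.+1 t + (-1) * \int[leb]_(t in `]0, T[) X i t) +
    eps / 2 * (1 * \int[leb]_(t in `]0, T[) V i.+1 t ^+ 2 +
             (-1) * \int[leb]_(t in `]0, T[) V i t ^+ 2))).
    rewrite -!Rintegral_oo_affine//; apply: eq_Rintegral => t _; rewrite /f; lra.
  by rewrite !mul1r !mulN1r.
have fi : leb.-integrable `]0, T[ (EFin \o f).
  have i1 := integrable_oo_affine 1 (- 1) Xi1 Xi.
  have i2 := integrable_oo_affine 1 (- 1) Vi1 Vi.
  have i3 := integrable_oo_affine M (eps / 2) i1 i2.
  have := integrable_oo_affine gam (-1) wi i3.
  by congr (integrable _ _ (EFin \o _)); apply/funext => t; rewrite /f; lra.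
have : \int[leb]_(t in `]0, T[) f t <= \int[leb]_(t in `]0, T[) g t.
  apply: le_Rintegral_oo => // t tT; rewrite /f /g.
  have h2 : Fc (t, X i t) * d i t <= M * (X i.+1 t - X i t).
    have /andP[f0 fM] := clamp_force_le t (clamp_range_pos t iN').
    by rewrite ler_wpM2r// ltW// gapc_gt0.
  have h3 : eps * V i t * (V i.+1 t - V i t) <= eps / 2 * (V i.+1 t ^+ 2 - V i t ^+ 2).
    rewrite -!mulrA ler_pM2l//; have := sqr_ge0 (V i.+1 t - V i t).
    nra.
  lra.
rewrite E1 gE /G.
have h0 : vel T (x i) 0 <= W by have /andP[] := rt_vel rt iN' (introT andP (conj (lexx 0) T0)).
have hT : 0 <= vel T (x i) T by have /andP[] := rt_vel rt iN' (introT andP (conj T0 (lexx T))).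
have d0 := rt_lt rt iN (introT andP (conj (lexx 0) T0)).
have dT := rt_lt rt iN (introT andP (conj T0 (lexx T))).
have : eps * vel T (x i) 0 * (x i.+1 0 - x i 0) <= eps * W * (x i.+1 0 - x i 0).
  by rewrite ler_wpM2r ?subr_ge0 ?(ltW d0)// ler_wpM2l// ltW.
have : 0 <= eps * vel T (x i) T * (x i.+1 T - x i T).
  by rewrite !mulr_ge0 ?subr_ge0 ?(ltW dT)// ltW.
lra.
Qed.

Lemma fst_cont (f : R -> R) : continuous f -> continuous (fun p : R * R => f p.1).
Proof. by move=> fc p; apply: (@continuous_comp _ _ _ fst f); [exact: cvg_fst|exact: fc]. Qed.

Definition profile i (p : R * R) : R :=
  V i p.1 + (V i.+1 p.1 - V i p.1) / d i p.1 * (p.2 - X i p.1).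

Lemma profile_range i t y : (i < N)%N -> X i t <= y < X i.+1 t ->
  0 <= profile i (t, y) <= W.
Proof.
move=> iN /andP[y1 y2]; have d0 := gapc_gt0 t iN.
have /andP[a b] := clamp_vel_range t iN; have /andP[a' b'] := clamp_vel_range t (ltnW iN).
have -> : profile i (t, y) =
    V i t + ((y - X i t) / d i t) * (V i.+1 t - V i t).
  by rewrite /profile /=; field; rewrite gt_eqF.
have q0 : 0 <= (y - X i t) / d i t by apply: divr_ge0; [rewrite subr_ge0|exact: ltW].
have q1 : (y - X i t) / d i t <= 1.
  by rewrite ler_pdivrMr// mul1r /d lerD2r ltW.
move: q0 q1; set q := (y - X i t) / d i t => q0 q1.
have -> : V i t + q * (V i.+1 t - V i t) = (1 - q) * V i t + q * V i.+1 t by lra.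
have q2 : 0 <= 1 - q by lra.
have h1 : 0 <= (1 - q) * V i t by exact: mulr_ge0.
have h2 : 0 <= q * V i.+1 t by exact: mulr_ge0.
have h3 : (1 - q) * V i t <= (1 - q) * W by exact: ler_wpM2l.
have h4 : q * V i.+1 t <= q * W by exact: ler_wpM2l.
by apply/andP; split; lra.
Qed.

Lemma profile_cont i : (i < N)%N -> continuous (profile i).
Proof.
move=> iN p; have vc := fst_cont (clamp_vel_cont (ltnW iN)).
have vc1 := fst_cont (clamp_vel_cont iN); have dc := fst_cont (gapc_cont iN).
have xc := fst_cont (clamp_pos_cont (ltnW iN)).
apply: cvgD; first exact: vc.
apply: cvgM; last by apply: cvgB; [exact: cvg_snd|exact: xc].
apply: cvgM; first by apply: cvgB; [exact: vc1|exact: vc].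
by apply: cvgV; [rewrite gt_eqF// gapc_gt0|exact: dc].
Qed.

Lemma cell_range i t y : (i < N)%N -> X i t <= y < X i.+1 t -> s <= y <= S.
Proof.
move=> iN /andP[y1 y2]; have /andP[a _] := clamp_range_pos t (ltnW iN).
have /andP[_ b] := clamp_range_pos t iN.
by rewrite (le_trans a y1) (le_trans (ltW y2) b).
Qed.

Lemma gap_int i : (i < N)%N -> \int[leb]_(t in `]0, T[) d i t =
  \int[leb]_(t in `]0, T[) X i.+1 t - \int[leb]_(t in `]0, T[) X i t.
Proof.
move=> iN; transitivity (1 * \int[leb]_(t in `]0, T[) X i.+1 t + (-1) * \int[leb]_(t in `]0, T[) X i t).
  rewrite -Rintegral_oo_affine; [|exact: pos_integrable|exact: pos_integrable (ltnW iN)].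
  by apply: eq_Rintegral => t _; rewrite mul1r mulN1r.
by rewrite mul1r mulN1r.
Qed.

Lemma gap_integrable i : (i < N)%N -> leb.-integrable `]0, T[ (EFin \o d i).
Proof.
move=> iN; have := integrable_oo_affine 1 (-1) (pos_integrable iN) (pos_integrable (ltnW iN)).
by congr (integrable _ _ (EFin \o _)); apply/funext => t; rewrite mul1r mulN1r.
Qed.

(** Cut off at the end points: continuity of [relax] rests on theta(rho) > 0, which fails at t = 0
    for an initially jammed vehicle. *)
Definition relax_oo i : R -> R := relax i \_ `]0, T[.

Lemma relax_ooE i t : 0 < t < T -> relax_oo i t = w i t.
Proof. by move=> tT; rewrite /relax_oo patchE mem_set//= in_itv. Qed.

Lemma measurable_relax_oo i : (i < N)%N ->
  measurable_fun setT (fun p : R * R => relax_oo i p.1).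
Proof.
move=> iN.
have mD : measurable (`]0, T[%classic : set R) by exact: measurable_itv.
have mw : measurable_fun setT (relax_oo i).
  apply/(measurable_restrict _ mD measurableT); rewrite setTI.
  by apply: continuous_oo_measurable => t tT; exact: relax_cont.
exact: (measurableT_comp mw measurable_fst).
Qed.

Section test_function.
Context (Phi : R * R -> R) (eta K B0 : R) (Phi_C1 : C1_strip T Phi)
  (eta0 : 0 <= eta) (K0 : 0 <= K) (B00 : 0 <= B0).

Definition clamp_test (f : R * R -> R) (p : R * R) : R := f (clamp T p.1, p.2).

Let P := clamp_test Phi.
Let A := clamp_test (dt T Phi).
Let B := clamp_test (dx Phi).

(** The modulus of [compact_almost_lipschitz] in space, uniform in time: [eta] is as small as
    desired, [K] depends on it. *)
Definition almost_lipschitz (f : R * R -> R) : Prop :=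
  forall t y z, s <= y <= S -> s <= z <= S ->
    `|f (t, y) - f (t, z)| <= eta + K * `|y - z|.

Context (mA : almost_lipschitz A) (mB : almost_lipschitz B)
  (mP : almost_lipschitz P) (mF : almost_lipschitz Fc)
  (A_le : forall t y, s <= y <= S -> `|A (t, y)| <= B0)
  (B_le : forall t y, s <= y <= S -> `|B (t, y)| <= B0)
  (P_le : forall t y, s <= y <= S -> `|P (t, y)| <= B0).

Lemma test_cont : [/\ continuous A, continuous B & continuous P].
Proof.
have [Pc _ _ Ac Bc] := Phi_C1.
by split; exact: clamp_strip_continuous.
Qed.

Let Ac : continuous A. Proof. by have [] := test_cont. Qed.
Let Bc : continuous B. Proof. by have [] := test_cont. Qed.
Let Pc : continuous P. Proof. by have [] := test_cont. Qed.

Lemma curve_derive (y : R -> R) (dy t : R) : 0 < t < T -> is_derive t 1 y dy ->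
  is_derive t 1 (fun s => Phi (s, y s)) (A (t, y t) + dy * B (t, y t)).
Proof.
move=> tT yd; rewrite /A /B /clamp_test /= cle//; exact: C1_strip_chain.
Qed.

Lemma curve_within (y : R -> R) : {within `[0, T], continuous y} ->
  {within `[0, T], continuous (fun s => Phi (s, y s))}.
Proof.
move=> /(clamp_continuous T0) yc; apply/within_continuousP => t tT e e0.
have c1 : continuous (fun t => P (t, (y \o clamp T) t)) by exact: pair_cont.
have [r r0 Hr] := (@continuous_at_distP R R R _ t).1 (c1 t) e e0.
exists r => // u uT /Hr; move: tT uT; rewrite /= !in_itv /= => tT uT.
by rewrite /P /clamp_test /= !clamp_id.
Qed.

Let modulus (f : R * R -> R) i t y z : almost_lipschitz f -> (i < N)%N ->
  X i t <= y <= X i.+1 t -> X i t <= z <= X i.+1 t ->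
  `|f (t, y) - f (t, z)| <= eta + K * d i t.
Proof.
move=> mf iN /andP[y1 y2] /andP[z1 z2].
have /andP[a _] := clamp_range_pos t (ltnW iN).
have /andP[_ b] := clamp_range_pos t iN.
rewrite (le_trans (mf t y z _ _))//.
- by rewrite (le_trans a y1) (le_trans y2 b).
- by rewrite (le_trans a z1) (le_trans z2 b).
- rewrite lerD2l ler_wpM2l// ler_norml /d; lra.
Qed.

(** The integrand of the mass equation on cell i after division by rho_i. *)
Definition mass_density i (p : R * R) : R := A p + V i p.1 * B p.

Let inc (g : R * R -> R) : continuous g -> measurable_fun setT g.
Proof. exact: continuous_measurable_plane. Qed.

Lemma mass_density_bound i t y : (i <= N)%N -> s <= y <= S ->
  `|mass_density i (t, y)| <= B0 + W * B0.
Proof.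
move=> iN sy; rewrite (le_trans (ler_normD _ _))// lerD ?A_le//= normrM.
have /andP[a b] := clamp_vel_range t iN.
by apply: ler_pM; [exact: normr_ge0|exact: normr_ge0|rewrite ger0_norm|exact: B_le].
Qed.

Lemma mass_density_cont i : (i <= N)%N -> continuous (mass_density i).
Proof.
move=> iN p; apply: cvgD; first exact: Ac.
by apply: cvgM; [apply: fst_cont; exact: clamp_vel_cont|exact: Bc].
Qed.

(** On the trajectory x_i the integrand is the derivative of phi(t, x_i(t)). Elsewhere in the cell
    it differs by at most (1 + W) (eta + K gap), the factor 1 coming from [dt] and W from v_i
    [dx]. *)
Lemma mass_cell i : (i < N)%N ->
  `|\int[leb2]_p cell_weight T (X i) (X i.+1) (mass_density i) p -
    (Phi (T, x i T) - Phi (0, x i 0))| <=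
  (1 + W) * (eta * T + K *
    (\int[leb]_(t in `]0, T[) X i.+1 t - \int[leb]_(t in `]0, T[) X i t)).
Proof.
move=> iN; have iN' := ltnW iN; pose q t := A (t, X i t) + V i t * B (t, X i t).
have vc := clamp_vel_cont iN'; have xc := clamp_pos_cont iN'.
have qle t y : s <= y <= S -> `|mass_density i (t, y)| <= B0 + W * B0.
  exact: mass_density_bound.
have gc := mass_density_cont iN'.
have qc : continuous q by exact: (pair_cont xc gc).
have [qi qE] : primitive T q (fun t => Phi (t, x i t)).
  apply: (@bounded_below_primitive _ _ T_gt0 _ _ (B0 + W * B0)).
  - by apply: curve_within; exact: (rt_cont rt).
  - move=> t tT; have D := pos_derive iN' tT.
    apply: (is_derive_eq (curve_derive tT D)); rewrite /q.
    by rewrite /X /clamp_pos cle.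
  - by move=> t _; exact: qc.
  - move=> t _; have := qle t (X i t) (clamp_range_pos t iN').
    by rewrite ler_norml => /andP[].
have di := gap_integrable iN.
have ri := integrable_oo_affine ((1 + W) * eta) ((1 + W) * K) (cst_oo_integrable T 1) di.
rewrite -qE -gap_int//.
have -> : (1 + W) * (eta * T + K * \int[leb]_(t in `]0, T[) d i t) =
    \int[leb]_(t in `]0, T[) ((1 + W) * eta * cst 1 t + (1 + W) * K * d i t).
  rewrite Rintegral_oo_affine//; last exact: cst_oo_integrable.
  by rewrite Rintegral_oo_cst// mul1r mulrDr !mulrA.
apply: (@moving_cell_average _ _ _ _ _ (fun=> B0 + W * B0) _ _ _ _ _ _ q (fun=> 0) (V i) (V i.+1)) => //.
- exact: clamp_pos_cont.
- by move=> t; have := gapc_gt0 t iN; rewrite subr_gt0.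
- exact: inc.
- exact: cst_oo_integrable.
- by move=> t y _ yc; apply: qle; exact: (cell_range iN yc).
- by move=> t _; rewrite mul0r addr0.
move=> t y tT /andP[y1 y2]; rewrite mul0r addr0 /q /mass_density /=.
have d0 := ltW (gapc_gt0 t iN).
have hx : X i t <= X i t <= X i.+1 t by rewrite lexx /=; move: d0; rewrite /d subr_ge0.
have hy : X i t <= y <= X i.+1 t by rewrite y1 ltW.
have h1 := modulus mA iN hy hx; have h2 := modulus mB iN hy hx.
have /andP[a b] := clamp_vel_range t iN'.
have -> : A (t, y) + V i t * B (t, y) - (A (t, X i t) + V i t * B (t, X i t)) =
   (A (t, y) - A (t, X i t)) + V i t * (B (t, y) - B (t, X i t)) by ring.
have -> : (1 + W) * eta * 1 + (1 + W) * K * d i t =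
  (eta + K * d i t) + W * (eta + K * d i t) by ring.
rewrite (le_trans (ler_normD _ _))// lerD// normrM ler_pM// ger0_norm//.
Qed.

(** The integrand of the momentum equation on cell i after division by rho_i, all terms on one side
    and the singular one still explicit. *)
Definition momentum_density i (p : R * R) : R :=
  eps * V i p.1 * (A p + profile i p * B p) + Fc p * P p -
  gam * relax_oo i p.1 * P p.

Lemma momentum_density_bound i t y : (i < N)%N -> 0 < t < T ->
  X i t <= y < X i.+1 t ->
  `|momentum_density i (t, y)| <= eps * W * (B0 + W * B0) + M * B0 + gam * w i t * B0.
Proof.
move=> iN tT yc; have iN' := ltnW iN.
have eps0 := ltW eps_gt0; have gam0 := ltW gam_gt0.
have sy := cell_range iN yc.
have /andP[a b] := clamp_vel_range t iN'; have /andP[l0 lW] := profile_range iN yc.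
have /andP[f0 fM] := clamp_force_le t sy.
have w0 := mulr_ge0 gam0 (relax_ge0 iN tT).
rewrite /momentum_density /= relax_ooE// (le_trans (ler_normB _ _))// lerD//; last first.
  by rewrite normrM ger0_norm// ler_wpM2l// P_le.
rewrite (le_trans (ler_normD _ _))// lerD//; last first.
  by rewrite normrM gtr0_norm// ler_pM// ?P_le// ltW.
rewrite normrM ger0_norm ?mulr_ge0//; apply: ler_pM; rewrite ?mulr_ge0//.
  by rewrite ler_wpM2l.
rewrite (le_trans (ler_normD _ _))// lerD ?A_le// normrM ger0_norm//.
by rewrite ler_pM// B_le.
Qed.

Lemma measurable_momentum_density i : (i < N)%N ->
  measurable_fun setT (momentum_density i).
Proof.
move=> iN; have vc := clamp_vel_cont (ltnW iN).
have c1 : continuous (fun p => eps * V i p.1 * (A p + profile i p * B p) + Fc p * P p).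
  move=> p; apply: cvgD; last by apply: cvgM; [exact: clamp_force_cont|exact: Pc].
  apply: cvgM; first by apply: cvgM; [exact: cvg_cst|exact: fst_cont].
  apply: cvgD; first exact: Ac.
  by apply: cvgM; [exact: profile_cont|exact: Bc].
apply: measurable_funB; first exact: inc.
apply: measurable_funM; last exact: inc.
apply: measurable_funM; last exact: measurable_relax_oo.
exact: measurable_cst.
Qed.

(* The linear velocity profile of a cell averages to the velocity of its midpoint,
   so momentum is tested along midpoints. *)
Definition midpoint i t : R := (x i t + x i.+1 t) / 2.

(** The time derivative of eps v_i phi(t, midpoint) reproduces the density up to moduli of
    continuity. The singular factor multiplies the modulus eta + K gap, which produces the integrals
    of w and of w times the gap. *)
Lemma momentum_cell i : (i < N)%N ->
  `|\int[leb2]_p cell_weight T (X i) (X i.+1) (momentum_density i) p -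
    (eps * vel T (x i) T * Phi (T, midpoint i T) -
     eps * vel T (x i) 0 * Phi (0, midpoint i 0))| <=
  (eps * W + eps * W * W + M + B0) * (eta * T + K *
    (\int[leb]_(t in `]0, T[) X i.+1 t - \int[leb]_(t in `]0, T[) X i t)) +
  gam * (eta * \int[leb]_(t in `]0, T[) w i t +
         K * \int[leb]_(t in `]0, T[) (w i t * d i t)).
Proof.
move=> iN; have iN' := ltnW iN.
have vc := clamp_vel_cont iN'; have xc := clamp_pos_cont iN'.
have vc1 := clamp_vel_cont iN; have xc1 := clamp_pos_cont iN.
have eps0 := ltW eps_gt0; have gam0 := ltW gam_gt0.
pose Y t := (X i t + X i.+1 t) / 2.
have Yc : continuous Y.
  by move=> t; apply: cvgM; [apply: cvgD; [exact: xc|exact: xc1]|exact: cvg_cst].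
have Yr t : X i t <= Y t <= X i.+1 t.
  by have := gapc_gt0 t iN; rewrite /d /Y; lra.
have Ys t : s <= Y t <= S.
  have /andP[a _] := clamp_range_pos t iN'; have /andP[_ b] := clamp_range_pos t iN.
  by have /andP[y1 y2] := Yr t; rewrite (le_trans a y1) (le_trans y2 b).
(* On the cell the density is nearly [c] plus [be] times the velocity profile: test function at the
   midpoint, force at x_i, where the equation of motion holds. Averaging the profile gives [q],
   which is exactly the derivative of [G]. *)
pose c t := eps * V i t * A (t, Y t) + (Fc (t, X i t) - gam * w i t) * P (t, Y t).
pose be t := eps * V i t * B (t, Y t).
pose q t := c t + be t * ((V i t + V i.+1 t) / 2).
pose G t := eps * vel T (x i) t * Phi (t, midpoint i t).
have Pyc := pair_cont Yc Pc; have Ayc := pair_cont Yc Ac; have Byc := pair_cont Yc Bc.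
have Fxc := force_cont iN'.
have qc t : 0 < t < T -> {for t, continuous q}.
  move=> tT; apply: cvgD; first apply: cvgD.
  - by apply: cvgM; [apply: cvgM; [exact: cvg_cst|exact: vc]|exact: Ayc].
  - apply: cvgM; last exact: Pyc.
    apply: cvgB; first exact: Fxc.
    by apply: cvgM; [exact: cvg_cst|exact: relax_cont].
  - apply: cvgM; last first.
      by apply: cvgM; [apply: cvgD; [exact: vc|exact: vc1]|exact: cvg_cst].
    by apply: cvgM; [apply: cvgM; [exact: cvg_cst|exact: vc]|exact: Byc].
have Gd t : 0 < t < T -> is_derive t 1 G (q t).
  move=> tT; have D := vel_derive iN tT.
  have D1 := pos_derive iN tT; have D2 := pos_derive iN' tT.
  have Dm : is_derive t 1 (midpoint i) ((V i t + V i.+1 t) / 2).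
    rewrite /midpoint; apply: is_derive_eq.
    by rewrite ?scaler0 ?addr0 ?add0r /GRing.scale /=; lra.
  have DP := curve_derive tT Dm.
  rewrite /G; apply: is_derive_eq.
  rewrite ?scaler0 ?addr0 ?add0r /GRing.scale /= /q /c /be.
  have -> : vel T (x i) t = V i t by rewrite /V /clamp_vel cle.
  have -> : midpoint i t = Y t by rewrite /Y /midpoint /X /clamp_pos cle.
  have -> : Phi (t, Y t) = P (t, Y t) by rewrite /P /clamp_test /= cle.
  by field; rewrite gt_eqF.
have Gc : {within `[0, T], continuous G}.
  have mc : {within `[0, T], continuous (midpoint i)}.
    move=> t; apply: cvgM; last exact: cvg_cst.
    by apply: cvgD; exact: (rt_cont rt).
  move=> t; apply: cvgM; last exact: (curve_within mc).
  by apply: cvgM; [exact: cvg_cst|exact: (rt_vel_cont rt)].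
have Ab t : `|eps * V i t * A (t, Y t)| <= eps * W * B0.
  have /andP[a b] := clamp_vel_range t iN'.
  rewrite normrM ger0_norm ?mulr_ge0//; apply: ler_pM; rewrite ?mulr_ge0//.
    by rewrite ler_wpM2l.
  exact: A_le.
have Bb t : `|be t * ((V i t + V i.+1 t) / 2)| <= eps * W * B0 * W.
  have /andP[a b] := clamp_vel_range t iN'; have /andP[a' b'] := clamp_vel_range t iN.
  rewrite normrM; apply: ler_pM => //; last by rewrite ger0_norm; lra.
  rewrite normrM ger0_norm ?mulr_ge0//; apply: ler_pM; rewrite ?mulr_ge0//.
    by rewrite ler_wpM2l.
  exact: B_le.
have [qi qE] : primitive T q G.
  (* [q] is not bounded below, since phi may have any sign in front of the singular term. Adding
     [B0] times the function of [relax_primitive], with [B0 >= |P|], makes the coefficient of that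
     term nonnegative; the addition is undone afterwards. *)
  have f12 : primitive T (fun t => q t + B0 * (gam * w i t - Fc (t, X i t)))
      (fun t => G t + B0 * (- eps * vel T (x i) t)).
    apply: (@bounded_below_primitive _ _ T_gt0 _ _ (eps * W * B0 + eps * W * B0 * W + 2 * B0 * M)).
    - move=> t; apply: cvgD; first exact: Gc.
      apply: cvgM; first exact: cvg_cst.
      by apply: cvgM; [exact: cvg_cst|exact: (rt_vel_cont rt)].
    - move=> t tT; have D := vel_derive iN tT; have D' := Gd t tT.
      apply: is_derive_eq; rewrite ?scaler0 ?addr0 ?add0r /GRing.scale /=.
      by field; rewrite gt_eqF.
    - move=> t tT; apply: cvgD; first exact: qc.
      apply: cvgM; first exact: cvg_cst.
      apply: cvgB; last exact: Fxc.
      by apply: cvgM; [exact: cvg_cst|exact: relax_cont].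
    - move=> t tT; have := P_le t (Ys t); rewrite ler_norml => /andP[p1 p2].
      have := Ab t; rewrite ler_norml => /andP[a1 _].
      have := Bb t; rewrite ler_norml => /andP[b1 _].
      have /andP[f0 fM] := clamp_force_le t (clamp_range_pos t iN').
      have w0 := mulr_ge0 gam0 (relax_ge0 iN tT).
      have h1 : 0 <= (B0 - P (t, Y t)) * (gam * w i t) by rewrite mulr_ge0// subr_ge0.
      have h2 : (B0 - P (t, Y t)) * Fc (t, X i t) <= (2 * B0) * M.
        by apply: ler_pM => //; [rewrite subr_ge0|exact: ltW|lra].
      have -> : q t + B0 * (gam * w i t - Fc (t, X i t)) =
        eps * V i t * A (t, Y t) + be t * ((V i t + V i.+1 t) / 2) +
        (B0 - P (t, Y t)) * (gam * w i t) - (B0 - P (t, Y t)) * Fc (t, X i t).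
        by rewrite /q /c; ring.
      by move: a1 b1 h1 h2; lra.
  have := @primitive_affine _ _ _ _ _ _ G 1 (- B0) f12 (relax_primitive iN).
  rewrite (_ : (fun t => 1 * _ + _) = q); last by apply/funext => t; ring.
  by apply=> t; ring.
have di := gap_integrable iN; have wi := relax_integrable iN.
have wdi := relax_gap_integrable iN; have ci := cst_oo_integrable T 1.
(* One term for each regular modulus: [dt], [dx] times the profile, phi times F, and F times phi. *)
pose C1 := eps * W + eps * W * W + M + B0.
have r1 := integrable_oo_affine eta K ci di.
have r2 := integrable_oo_affine eta K wi wdi.
have r3 := integrable_oo_affine C1 gam r1 r2.
have rE : \int[leb]_(t in `]0, T[) (C1 * (eta * cst 1 t + K * d i t) +
     gam * (eta * w i t + K * (w i t * d i t))) =
   C1 * (eta * T + K * \int[leb]_(t in `]0, T[) d i t) +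
   gam * (eta * \int[leb]_(t in `]0, T[) w i t +
          K * \int[leb]_(t in `]0, T[) (w i t * d i t)).
  by rewrite !Rintegral_oo_affine// Rintegral_oo_cst// mul1r.
rewrite -[X in `|_ - X|]qE -gap_int// -rE.
have woo t : 0 < t < T -> relax_oo i t = w i t by exact: relax_ooE.
have ki := integrable_oo_affine (eps * W * (B0 + W * B0) + M * B0) (gam * B0) ci wi.
apply: (@moving_cell_average _ _ _ _ _ (fun t => (eps * W * (B0 + W * B0) + M * B0) * cst 1 t + gam * B0 * w i t)
   _ _ _ _ _ _ c be (V i) (V i.+1)) => //.
- by move=> t; have := gapc_gt0 t iN; rewrite subr_gt0.
- exact: measurable_momentum_density.
- move=> t y tT yc; rewrite (le_trans (momentum_density_bound iN tT yc))// mulr1.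
  by rewrite [gam * B0 * _]mulrAC.
move=> t y tT yc; have sy := cell_range iN yc.
have d0 := ltW (gapc_gt0 t iN).
have hx : X i t <= X i t <= X i.+1 t by rewrite lexx /=; move: d0; rewrite /d subr_ge0.
have hy : X i t <= y <= X i.+1 t by move: yc => /andP[-> /ltW].
have hA := modulus mA iN hy (Yr t); have hB := modulus mB iN hy (Yr t).
have hP := modulus mP iN hy (Yr t); have hF := modulus mF iN hy hx.
have /andP[a b] := clamp_vel_range t iN'; have /andP[l0 lW] := profile_range iN yc.
have /andP[f0 fM] := clamp_force_le t (clamp_range_pos t iN').
have w0 := mulr_ge0 gam0 (relax_ge0 iN tT).
rewrite /momentum_density /= woo//.
set om := eta + K * d i t in hA hB hP hF.
have om0 : 0 <= om by rewrite addr_ge0// mulr_ge0.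
rewrite (_ : _ - _ =
  eps * V i t * (A (t, y) - A (t, Y t)) +
  eps * V i t * (profile i (t, y) * (B (t, y) - B (t, Y t))) +
  ((Fc (t, y) - Fc (t, X i t)) * P (t, y) + Fc (t, X i t) * (P (t, y) - P (t, Y t))) -
  gam * w i t * (P (t, y) - P (t, Y t))); last first.
  by rewrite /c /be /profile /=; ring.
rewrite mulr1 -/om (_ : C1 * om + _ =
  eps * W * om + eps * W * (W * om) + (om * B0 + M * om) + gam * w i t * om); last first.
  by rewrite /C1 /om; ring.
have nn (z u v u' : R) : 0 <= z <= u -> `|v| <= u' -> `|z * v| <= u * u'.
  by move=> /andP[z0 zu] vu; rewrite normrM ger0_norm// ler_pM.
have eV : 0 <= eps * V i t <= eps * W by rewrite mulr_ge0//= ler_wpM2l.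
rewrite (le_trans (ler_normB _ _))// lerD//; last by apply: (nn) => //; rewrite w0 lexx.
rewrite (le_trans (ler_normD _ _))// lerD//.
  rewrite (le_trans (ler_normD _ _))// lerD//; apply: (nn) => //.
  by apply: (nn) => //; rewrite l0.
rewrite (le_trans (ler_normD _ _))// lerD//.
  by rewrite normrM ler_pM// P_le.
by apply: (nn) => //; rewrite ltW.
Qed.

End test_function.

Lemma pos_le i j t : (i <= j <= N)%N -> 0 <= t <= T -> x i t <= x j t.
Proof.
move=> /andP[+ +] tT; elim: j => [|j IH]; first by rewrite leqn0 => /eqP->.
rewrite leq_eqVlt => /predU1P[->//|ij] jN.
by rewrite (le_trans (IH ij (ltnW jN)))// ltW// (rt_lt rt).
Qed.

Lemma cell_uniq i j t y : (i < N)%N -> (j < N)%N -> 0 <= t <= T ->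
  cell x i t y -> cell x j t y -> i = j.
Proof.
move=> iN jN tT; rewrite /cell /= !in_itv /= => /andP[a b] /andP[a' b'].
case: (ltngtP i j) => // ij.
- have h := pos_le (introT andP (conj ij (ltnW jN))) tT.
  by have := lt_le_trans (lt_le_trans b h) a'; rewrite ltxx.
- have h := pos_le (introT andP (conj ij (ltnW iN))) tT.
  by have := lt_le_trans (lt_le_trans b' h) a; rewrite ltxx.
Qed.

Let sum_in (f : nat -> R) i t y : (i < N)%N -> 0 <= t <= T -> cell x i t y ->
  \sum_(j < N) f j * \1_(cell x j t) y = f i.
Proof.
move=> iN tT ci; rewrite (bigD1 (Ordinal iN)) //= indicE mem_set// mulr1.
rewrite big1 ?addr0// => j ji; rewrite indicE memNset ?mulr0// => cj.
by move/eqP: ji; apply; apply/val_inj/(cell_uniq _ _ tT cj ci) => /=.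
Qed.

Let sum_out (f : nat -> R) t y : (forall i, (i < N)%N -> ~ cell x i t y) ->
  \sum_(j < N) f j * \1_(cell x j t) y = 0.
Proof.
by move=> H; apply: big1 => j _; rewrite indicE memNset ?mulr0//; exact: H.
Qed.

Lemma interpolants_in i t y : (i < N)%N -> 0 <= t <= T -> cell x i t y ->
  [/\ rhoN N x (t, y) = rho_ N x i t,
      e1N T N x (t, y) = rho_ N x i t * vel T (x i) t &
      e2N T N x (t, y) = rho_ N x i t * vel T (x i) t *
        (vel T (x i) t + (vel T (x i.+1) t - vel T (x i) t) /
          (x i.+1 t - x i t) * (y - x i t))].
Proof.
move=> iN tT c; split.
- exact: (@sum_in (fun i => rho_ N x i t)).
- exact: (@sum_in (fun i => rho_ N x i t * vel T (x i) t)).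
- exact: (@sum_in (fun i => rho_ N x i t * vel T (x i) t *
    (vel T (x i) t + (vel T (x i.+1) t - vel T (x i) t) /
          (x i.+1 t - x i t) * (y - x i t)))).
Qed.

Lemma interpolants_out t y : (forall i, (i < N)%N -> ~ cell x i t y) ->
  [/\ rhoN N x (t, y) = 0, e1N T N x (t, y) = 0 & e2N T N x (t, y) = 0].
Proof.
move=> H; split.
- exact: (@sum_out (fun i => rho_ N x i t)).
- exact: (@sum_out (fun i => rho_ N x i t * vel T (x i) t)).
- exact: (@sum_out (fun i => rho_ N x i t * vel T (x i) t *
    (vel T (x i) t + (vel T (x i.+1) t - vel T (x i) t) /
          (x i.+1 t - x i t) * (y - x i t)))).
Qed.

Let mcell i : set (R * R) := moving_cell T (X i) (X i.+1).

Lemma moving_cellE i p : mcell i p <-> 0 < p.1 < T /\ cell x i p.1 p.2.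
Proof.
rewrite /mcell /moving_cell /cell /= in_itv /=; split => -[pT c]; split => //;
  by move: c; rewrite /X /clamp_pos cle.
Qed.

(** At most one cell contains a given point, so the sum has a single nonzero term there, and N^-1 /
    (x_(i+1) - x_i) is rho_i. *)
Lemma interpolant_cut (f : R * R -> R) (g : nat -> R * R -> R) :
  (forall i p, (i < N)%N -> 0 < p.1 < T -> cell x i p.1 p.2 ->
     f p = rho_ N x i p.1 * g i p) ->
  (forall p, 0 < p.1 < T -> (forall i, (i < N)%N -> ~ cell x i p.1 p.2) -> f p = 0) ->
  f \_ (open_strip T) =
  (fun p => N%:R^-1 * \sum_(i < N) cell_weight T (X i) (X i.+1) (g i) p).
Proof.
move=> fin fout; apply/funext => p; rewrite patchE; case: ifPn => pT; last first.
  rewrite big1 ?mulr0// => i _; rewrite /cell_weight indicE memNset ?mul0r//.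
  move=> [pT' _]; move/negP: pT; apply; rewrite inE.
  by split => //=; rewrite in_itv.
have {}pT : 0 < p.1 < T by move: pT; rewrite inE => -[/=]; rewrite in_itv.
have [[i iN ci]|H] := pselect (exists2 i, (i < N)%N & cell x i p.1 p.2); last first.
  have out i : (i < N)%N -> ~ cell x i p.1 p.2 by move=> iN ci; apply: H; exists i.
  rewrite fout// big1 ?mulr0// => i _; rewrite /cell_weight indicE memNset ?mul0r//.
  by move=> /moving_cellE[_]; exact: out.
rewrite (fin i)// (bigD1 (Ordinal iN)) //= big1 ?addr0; last first.
  move=> j ji; rewrite /cell_weight indicE memNset ?mul0r// => /moving_cellE[_ cj].
  by move/eqP: ji; apply; apply/val_inj/(cell_uniq _ _ (oc pT) cj ci).
rewrite /cell_weight indicE mem_set ?mul1r; last exact/moving_cellE.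
by rewrite /rho_ /density invfM /X /clamp_pos cle// mulrA.
Qed.

Lemma rhoN_cut : rhoN N x \_ (open_strip T) =
  (fun p => N%:R^-1 * \sum_(i < N) cell_weight T (X i) (X i.+1) (fun=> 1) p).
Proof.
apply: (@interpolant_cut _ (fun _ _ => 1)) => [i [t y] iN tT c|[t y] tT c].
  by have [-> _ _] := interpolants_in iN (oc tT) c; rewrite mulr1.
by have [->] := interpolants_out c.
Qed.

Lemma e1N_cut : e1N T N x \_ (open_strip T) =
  (fun p => N%:R^-1 * \sum_(i < N) cell_weight T (X i) (X i.+1) (fun p => V i p.1) p).
Proof.
apply: (@interpolant_cut _ (fun i p => V i p.1)) => [i [t y] iN tT c|[t y] tT c].
  by have [_ -> _] := interpolants_in iN (oc tT) c; rewrite /V /clamp_vel cle.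
by have [_ ->] := interpolants_out c.
Qed.

Lemma e2N_cut : e2N T N x \_ (open_strip T) =
  (fun p => N%:R^-1 * \sum_(i < N)
     cell_weight T (X i) (X i.+1) (fun p => V i p.1 * profile i p) p).
Proof.
apply: (@interpolant_cut _ (fun i p => V i p.1 * profile i p)) => [i [t y] iN tT c|[t y] tT c].
  have [_ _ ->] := interpolants_in iN (oc tT) c.
  by rewrite /profile /d /V /clamp_vel /X /clamp_pos /= cle// mulrA.
by have [_ _ ->] := interpolants_out c.
Qed.

(** In a cell jammed at t = 0 the denominator vanishes and the quotient is 0 by convention; a single
    time is negligible. *)
Definition relaxN (p : R * R) : R := e1N T N x p / theta (rhoN N x p).

Lemma relaxN_in i t y : (i < N)%N -> 0 < t < T -> cell x i t y ->
  relaxN (t, y) = rho_ N x i t * w i t.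
Proof.
move=> iN tT c; have [r e _] := interpolants_in iN (oc tT) c.
by rewrite /relaxN r e /w /relax /V /clamp_vel cle// mulrA.
Qed.

Lemma relaxN_out t y : (forall i, (i < N)%N -> ~ cell x i t y) -> relaxN (t, y) = 0.
Proof. by move=> /interpolants_out[_ e _]; rewrite /relaxN e mul0r. Qed.

Lemma relaxN_cut : relaxN \_ (open_strip T) =
  (fun p => N%:R^-1 * \sum_(i < N)
     cell_weight T (X i) (X i.+1) (fun p => relax_oo i p.1) p).
Proof.
apply: (@interpolant_cut _ (fun i p => relax_oo i p.1)) => [i [t y] iN tT c|[t y] tT c].
  by rewrite (relaxN_in iN tT c) relax_ooE.
exact: relaxN_out.
Qed.

Lemma measurable_interpolant (g : nat -> R * R -> R) :
  (forall i, (i < N)%N -> measurable_fun setT (g i)) ->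
  measurable_fun setT (fun p => N%:R^-1 * \sum_(i < N) cell_weight T (X i) (X i.+1) (g i) p).
Proof.
move=> mg; apply: measurable_funM; first exact: measurable_cst.
have cw i : (i < N)%N -> measurable_fun setT (cell_weight T (X i) (X i.+1) (g i)).
  move=> iN; apply: measurable_cell_weight; last exact: mg.
  - by apply: clamp_pos_cont; exact: ltnW.
  - exact: clamp_pos_cont.
  - by move=> t; have := gapc_gt0 t iN; rewrite subr_gt0.
suff H n : (n <= N)%N -> measurable_fun setT
    (fun p => \sum_(i < n) cell_weight T (X i) (X i.+1) (g i) p) by exact: H.
elim: n => [|n IH] nN.
  rewrite (_ : (fun p => _) = cst 0); first exact: measurable_cst.
  by apply/funext => p; rewrite big_ord0.
rewrite (_ : (fun p => _) = (fun p => \sum_(i < n) cell_weight T (X i) (X i.+1) (g i) p +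
    cell_weight T (X n) (X n.+1) (g n) p)).
  by apply: measurable_funD; [exact: IH (ltnW nN)|exact: cw].
by apply/funext => p; rewrite big_ord_recr.
Qed.

Lemma measurable_rhoN : measurable_fun setT (rhoN N x \_ (open_strip T)).
Proof.
by rewrite rhoN_cut; apply: (@measurable_interpolant (fun _ _ => 1)) => i _; exact: measurable_cst.
Qed.

Lemma measurable_e1N : measurable_fun setT (e1N T N x \_ (open_strip T)).
Proof.
rewrite e1N_cut; apply: (@measurable_interpolant (fun i p => V i p.1)) => i iN.
by apply: continuous_measurable_plane; apply: fst_cont; exact: clamp_vel_cont (ltnW iN).
Qed.

Lemma measurable_e2N : measurable_fun setT (e2N T N x \_ (open_strip T)).
Proof.
rewrite e2N_cut; apply: (@measurable_interpolant (fun i p => V i p.1 * profile i p)) => i iN.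
apply: continuous_measurable_plane => p.
apply: cvgM; last exact: profile_cont.
by apply: fst_cont; exact: clamp_vel_cont (ltnW iN).
Qed.

Lemma measurable_relaxN : measurable_fun setT (relaxN \_ (open_strip T)).
Proof.
rewrite relaxN_cut; apply: (@measurable_interpolant (fun i p => relax_oo i p.1)) => i iN.
exact: measurable_relax_oo.
Qed.

Lemma interpolants_range t y : 0 <= t <= T ->
  [/\ 0 <= rhoN N x (t, y) <= rhobar, 0 <= e1N T N x (t, y) <= rhobar * W,
      0 <= e2N T N x (t, y) <= rhobar * W * W &
   (rhoN N x (t, y) != 0 \/ e1N T N x (t, y) != 0 \/ e2N T N x (t, y) != 0 ->
      x 0%N t <= y < x N t)].
Proof.
move=> tT; have rb := ltW (rhobar_gt0 nonlin).
have [[i iN ci]|H] := pselect (exists2 i, (i < N)%N & cell x i t y); last first.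
  have [|-> -> ->] := @interpolants_out t y.
    by move=> i iN ci; apply: H; exists i.
  rewrite !lexx rb !mulr_ge0//=; split => //.
  by rewrite eqxx; case => // -[].
have [-> -> ->] := interpolants_in iN tT ci.
have r0 : 0 <= rho_ N x i t.
  by rewrite invr_ge0 mulr_ge0// subr_ge0 ltW// (rt_lt rt).
have r1 : rho_ N x i t <= rhobar by exact: (rt_rho_le rt).
have /andP[v0 v1] := rt_vel rt (ltnW iN) tT.
have cE : clamp T t = t by exact: clamp_id.
have yc : X i t <= y < X i.+1 t.
  by move: ci; rewrite /cell /= in_itv /= /X /clamp_pos cE.
have := profile_range iN yc.
rewrite /profile /d /V /clamp_vel /X /clamp_pos /= cE => /andP[l0 l1].
split.
- by rewrite r0.
- by rewrite mulr_ge0//= ler_pM.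
- by rewrite !mulr_ge0//= ler_pM// ?mulr_ge0// ler_pM.
- move=> _; move: ci; rewrite /cell /= in_itv /= => /andP[a b].
  have h1 := pos_le (i := 0) (j := i) (introT andP (conj (leq0n i) (ltnW iN))) tT.
  have h2 := pos_le (i := i.+1) (j := N) (introT andP (conj iN (leqnn N))) tT.
  by rewrite (le_trans h1 a) (lt_le_trans b h2).
Qed.

Lemma relaxN_range t y : 0 < t < T ->
  0 <= relaxN (t, y) /\ (relaxN (t, y) != 0 -> x 0%N t <= y < x N t).
Proof.
move=> tT; have [_ /andP[e0 _] _ H] := interpolants_range y (oc tT).
split; last first.
  move=> /eqP h; apply: H; right; left; apply/eqP => e.
  by apply: h; rewrite /relaxN e mul0r.
apply: divr_ge0 => //; apply: (theta_ge0 nonlin).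
by have [/andP[]] := interpolants_range y (oc tT).
Qed.

Let cw_integrable i (g : R * R -> R) (k : R -> R) : (i < N)%N -> measurable_fun setT g ->
  leb.-integrable `]0, T[ (EFin \o k) ->
  (forall t y, 0 < t < T -> X i t <= y < X i.+1 t -> `|g (t, y)| <= k t) ->
  leb2.-integrable setT (EFin \o cell_weight T (X i) (X i.+1) g).
Proof.
move=> iN mg ki gk; apply: (cell_weight_integrable _ _ _ _ ki gk) => //.
- by apply: clamp_pos_cont; exact: ltnW.
- exact: clamp_pos_cont.
- by move=> t; have := gapc_gt0 t iN; rewrite subr_gt0.
Qed.

Lemma relaxN_integrable : leb2.-integrable setT (EFin \o (relaxN \_ (open_strip T))).
Proof.
rewrite relaxN_cut; apply: scaled_integrable.
have [|//] := @Rintegral_sum R _ _ (@leb2 R) N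
  (fun i => cell_weight T (X i) (X i.+1) (fun p => relax_oo i p.1)).
move=> i iN; apply: (cw_integrable iN (measurable_relax_oo iN) (relax_integrable iN)).
by move=> t y tT _; rewrite /= relax_ooE// ger0_norm// relax_ge0.
Qed.

(** [relax_oo] does not depend on y, so its cell averages are exact: [moving_cell_average] applies
    with zero error, and [relax_mass] bounds each cell. *)
Lemma relaxN_mass :
  gam * \int[leb2]_p (relaxN \_ (open_strip T)) p <= T * M + eps * W.
Proof.
have cwi i : (i < N)%N -> leb2.-integrable setT
    (EFin \o (cell_weight T (X i) (X i.+1) (fun p => relax_oo i p.1))).
  move=> iN; apply: (cw_integrable iN (measurable_relax_oo iN) (relax_integrable iN)).
  by move=> t y tT _; rewrite /= relax_ooE// ger0_norm// relax_ge0.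
have [si sE] := Rintegral_sum cwi.
rewrite relaxN_cut RintegralZl// sE.
rewrite mulrCA mulr_sumr ler_pdivrMl// mulr_natl -[N in _ *+ N]card_ord -sumr_const.
apply: ler_sum => i _; have iN := ltn_ord i.
apply: le_trans (relax_mass iN); rewrite ler_pM2l//.
have wi := relax_integrable iN.
have zi := integrable_oo_affine 0 0 wi wi.
have := @moving_cell_average R T (X i) (X i.+1) (fun p => relax_oo i p.1) (w i) _ _ _ _ wi _
  (w i) (fun=> 0) (V i) (V i) (w i) (fun t => 0 * w i t + 0 * w i t) wi zi.
rewrite (_ : \int[leb]_(t in `]0, T[) (0 * w i t + 0 * w i t) = 0); last first.
  by rewrite Rintegral_oo_affine// !mul0r addr0.
rewrite normr_le0 subr_eq0 => H; rewrite le_eqVlt (H _ _ _ _ _ _ _)//.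
- by apply: clamp_pos_cont; exact: ltnW.
- exact: clamp_pos_cont.
- by move=> t; have := gapc_gt0 t iN; rewrite subr_gt0.
- exact: measurable_relax_oo.
- by move=> t y tT _; rewrite /= relax_ooE// ger0_norm// relax_ge0.
- by move=> t _; rewrite mul0r addr0.
- by move=> t y tT _; rewrite /= relax_ooE// !mul0r !addr0 subrr normr0.
Qed.

(** * Defects of the interpolants in the macroscopic equations *)

Section defects.
Context (Phi : R * R -> R) (eta K B0 : R) (Phi_C1 : C1_strip T Phi)
  (eta0 : 0 <= eta) (K0 : 0 <= K) (B00 : 0 <= B0) (PhiT : forall y, Phi (T, y) = 0).

Let P := clamp_test Phi.
Let A := clamp_test (dt T Phi).
Let B := clamp_test (dx Phi).

Context (mA : almost_lipschitz eta K A) (mB : almost_lipschitz eta K B)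
  (mP : almost_lipschitz eta K P) (mF : almost_lipschitz eta K Fc)
  (A_le : forall t y, s <= y <= S -> `|A (t, y)| <= B0)
  (B_le : forall t y, s <= y <= S -> `|B (t, y)| <= B0)
  (P_le : forall t y, s <= y <= S -> `|P (t, y)| <= B0).

(** Integrated positions: their differences are the integrated gaps, whose sum telescopes to at most
    T (S - s) for every N. *)
Let del i : R := \int[leb]_(t in `]0, T[) X i t.

Let del_sum : \sum_(i < N) (del i.+1 - del i) <= T * (S - s).
Proof.
rewrite -(big_mkord predT (fun i => del i.+1 - del i)) telescope_sumr//.
have i0 := pos_integrable (leq0n N); have iN := pos_integrable (leqnn N).
have -> : del N - del 0%N = \int[leb]_(t in `]0, T[) (1 * X N t + (-1) * X 0%N t).
  by rewrite Rintegral_oo_affine// mul1r mulN1r.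
have h := @Rintegral_oo_cst R T (S - s) T_gt0; rewrite mulrC -h.
apply: le_Rintegral_oo; [exact: integrable_oo_affine|exact: cst_oo_integrable|].
move=> t _; have := clamp_range_pos t (leq0n N); have := clamp_range_pos t (leqnn N).
rewrite /=; lra.
Qed.

Let mean_le (f g : nat -> R) : (forall i, (i < N)%N -> `|f i| <= g i) ->
  `|N%:R^-1 * \sum_(i < N) f i| <= N%:R^-1 * \sum_(i < N) g i.
Proof.
move=> fg; rewrite normrM ger0_norm ?invr_ge0// ler_wpM2l ?invr_ge0//.
by rewrite (le_trans (ler_norm_sum _ _ _))//; apply: ler_sum => i _; exact: fg.
Qed.

Let mean_cst (c : R) : N%:R^-1 * \sum_(i < N) c = c.
Proof. by rewrite sumr_const card_ord -[c *+ N]mulr_natl mulKf// gt_eqF. Qed.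

Let box_mod (f : R * R -> R) i y z : almost_lipschitz eta K f -> (i < N)%N ->
  x i 0 <= y <= x i.+1 0 -> x i 0 <= z <= x i.+1 0 ->
  `|f (0, y) - f (0, z)| <= eta + K * (x i.+1 0 - x i 0).
Proof.
move=> mf iN /andP[y1 y2] /andP[z1 z2].
have t0 : 0 <= (0 : R) <= T by rewrite lexx.
have /andP[a _] := rt_range rt (ltnW iN) t0; have /andP[_ b] := rt_range rt iN t0.
rewrite (le_trans (mf 0 y z _ _))//.
- by rewrite (le_trans a y1) (le_trans y2 b).
- by rewrite (le_trans a z1) (le_trans z2 b).
- rewrite lerD2l ler_wpM2l// ler_norml; lra.
Qed.

Let clamp00 : clamp T 0 = 0.
Proof. by apply: clamp_id; rewrite lexx. Qed.

Let P0E y : P (0, y) = Phi (0, y).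
Proof. by rewrite /P /clamp_test /= clamp00. Qed.

Let init_gap : \sum_(i < N) (x i.+1 0 - x i 0) <= S - s.
Proof.
rewrite -(big_mkord predT (fun i => x i.+1 0 - x i 0)) telescope_sumr//.
have t0 : 0 <= (0 : R) <= T by rewrite lexx.
have := rt_range rt (leqnn N) t0; have := rt_range rt (leq0n N) t0; lra.
Qed.

(** Used with [a] = 1 and [z] = x_i for the density, and with [a] = v_i and [z] the midpoint for the
    momentum, to match the curves along which the equations are tested. *)
Lemma initial_average (a : nat -> R) (z : nat -> R) (f : R -> R) (C : R) : 0 <= C ->
  (forall y, f y = \sum_(i < N) rho_ N x i 0 * a i * \1_(cell x i 0) y) ->
  (forall i, (i < N)%N -> 0 <= a i <= C) ->
  (forall i, (i < N)%N -> x i 0 <= z i <= x i.+1 0) ->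
  `|\int[leb]_y (f y * Phi (0, y)) - N%:R^-1 * \sum_(i < N) a i * Phi (0, z i)| <=
  C * (eta + K * (S - s) / N%:R).
Proof.
move=> C0 fE aC zc.
have t0 : 0 <= (0 : R) <= T by rewrite lexx.
pose c i : set R := cell x i 0.
have mc i : measurable (c i) by exact: measurable_itv.
have mPhi : measurable_fun setT (fun y => Phi (0, y)).
  apply: continuous_measurable_fun => y.
  have [Pc _ _ _ _] := Phi_C1; have Pcc := clamp_strip_continuous T0 Pc.
  rewrite (_ : (fun y => _) = (fun y => P (0, y))); last by apply/funext => {}y; rewrite P0E.
  apply: (@continuous_comp _ _ _ (fun y => (0, y)) P); last exact: Pcc.
  apply/(@continuous_at_distP R R (R * R)%type) => e e0; exists e => // u yu.
  by rewrite prod_normE gt_max /= subrr normr0 e0.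
have sc i y : (i < N)%N -> x i 0 <= y < x i.+1 0 -> s <= y <= S.
  move=> iN /andP[y1 y2]; have /andP[a1 _] := rt_range rt (ltnW iN) t0.
  have /andP[_ b] := rt_range rt iN t0.
  by rewrite (le_trans a1 y1) (le_trans (ltW y2) b).
have Pb i y : (i < N)%N -> x i 0 <= y < x i.+1 0 -> `|Phi (0, y)| <= B0.
  by move=> iN yc; rewrite -P0E; apply: P_le; exact: (sc i).
pose u i y := rho_ N x i 0 * a i * (\1_(c i) y * Phi (0, y)).
have ui i : (i < N)%N -> leb.-integrable setT (EFin \o (fun y => \1_(c i) y * Phi (0, y))).
  move=> iN; have := @bounded_itv_integrable R _ (x i 0) (x i.+1 0) B0 mPhi (fun y => Pb i y iN).
  have mD : measurable (c i : set (measurableTypeR R)) by exact: mc.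
  move=> /(@integrable_mkcond _ _ R leb _ _ mD).1.
  congr (integrable _ _ _); apply/funext => y; rewrite /= patchE indicE.
  by case: ifP => _; rewrite ?mul1r ?mul0r.
have uu i : (i < N)%N -> leb.-integrable setT (EFin \o u i).
  by move=> iN; exact: (scaled_integrable _ (ui i iN)).
have -> : \int[leb]_y (f y * Phi (0, y)) = \sum_(i < N) \int[leb]_y u i y.
  have [_ <-] := Rintegral_sum uu.
  apply: eq_Rintegral => y _; rewrite fE mulr_suml; apply: eq_bigr => i _.
  by rewrite /u !mulrA.
rewrite mulr_sumr -sumrB.
have term i : (i < N)%N -> `|\int[leb]_y u i y - N%:R^-1 * (a i * Phi (0, z i))| <=
    N%:R^-1 * (C * (eta + K * (x i.+1 0 - x i 0))).
  move=> iN; have x01 := rt_lt rt iN t0.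
  have g0 : 0 < x i.+1 0 - x i 0 by rewrite subr_gt0.
  have om0 : 0 <= eta + K * (x i.+1 0 - x i 0) by rewrite addr_ge0// mulr_ge0// ltW.
  have -> : \int[leb]_y u i y = N%:R^-1 * (a i *
      ((x i.+1 0 - x i 0)^-1 * \int[leb]_(y in [set` `[x i 0, x i.+1 0[]) Phi (0, y))).
    rewrite /u RintegralZl//; last exact: ui.
    rewrite /rho_ /density invfM -!mulrA; congr (_ * _); rewrite mulrCA; congr (_ * (_ * _)).
    rewrite [RHS]Rintegral_mkcond; apply: eq_Rintegral => y _.
    by rewrite patchE indicE; case: ifP => _; rewrite ?mul1r ?mul0r.
  rewrite -mulrBr -mulrBr normrM ger0_norm ?invr_ge0// ler_wpM2l ?invr_ge0//.
  have /andP[a0 a1] := aC i iN; rewrite normrM ger0_norm//; apply: ler_pM => //.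
  have := @cell_average R (fun y => Phi (0, y)) (x i 0) (x i.+1 0) (Phi (0, z i)) 0 0 0 B0
    (eta + K * (x i.+1 0 - x i 0)) x01 mPhi (fun y => Pb i y iN).
  rewrite mul0r addr0; apply => y /andP[y1 y2]; rewrite mul0r addr0 -!P0E.
  by apply: (box_mod mP iN) => //; [rewrite y1 ltW|exact: zc].
rewrite (le_trans (ler_norm_sum _ _ _))//.
apply: (@le_trans _ _ (\sum_(i < N) N%:R^-1 * (C * (eta + K * (x i.+1 0 - x i 0))))).
  by apply: ler_sum => i _; exact: term.
rewrite -mulr_sumr -mulr_sumr big_split /= -mulr_sumr mulrCA ler_wpM2l//.
rewrite mulrDr mean_cst lerD2l mulrC ler_wpM2r ?invr_ge0// ler_wpM2l//.
Qed.

(** The size of all defects; [D] absorbs the total length S - s. *)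
Let om : R := eta + K / N%:R.
Let D : R := 1 + (S - s).

Let om0 : 0 <= om. Proof. by rewrite addr_ge0// divr_ge0. Qed.

Let om_le : eta + K * (S - s) / N%:R <= D * om.
Proof.
rewrite /D /om; have h : 0 <= K / N%:R by rewrite divr_ge0.
rewrite mulrAC; have h1 : 0 <= eta * (S - s) by rewrite mulr_ge0// subr_ge0.
nra.
Qed.

Let del_mean : N%:R^-1 * \sum_(i < N) (eta * T + K * (del i.+1 - del i)) <= T * (D * om).
Proof.
rewrite big_split /= mulrDr mean_cst -mulr_sumr.
apply: (@le_trans _ _ (T * (eta + K * (S - s) / N%:R))); last by rewrite ler_wpM2l.
rewrite mulrDr [T * eta]mulrC lerD2l.
have -> : T * (K * (S - s) / N%:R) = N%:R^-1 * (K * (T * (S - s))) by ring.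
by rewrite ler_wpM2l ?invr_ge0// ler_wpM2l.
Qed.

Let Rint_strip (f : R * R -> R) :
  \int[leb2]_(p in open_strip T) f p = \int[leb2]_p (f \_ (open_strip T)) p.
Proof. exact: Rintegral_mkcond. Qed.

Let strip_test (f : R * R -> R) t y : 0 < t < T -> clamp_test f (t, y) = f (t, y).
Proof. by move=> tT; rewrite /clamp_test /= cle. Qed.

Let mean_integral (f : R * R -> R) (g : nat -> R * R -> R) :
  (forall i p, (i < N)%N -> 0 < p.1 < T -> cell x i p.1 p.2 ->
     f p = rho_ N x i p.1 * g i p) ->
  (forall p, 0 < p.1 < T -> (forall i, (i < N)%N -> ~ cell x i p.1 p.2) -> f p = 0) ->
  (forall i, (i < N)%N -> leb2.-integrable setT (EFin \o cell_weight T (X i) (X i.+1) (g i))) ->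
  \int[leb2]_(p in open_strip T) f p =
  N%:R^-1 * \sum_(i < N) \int[leb2]_p cell_weight T (X i) (X i.+1) (g i) p.
Proof.
move=> fin fout gi; have [si <-] := Rintegral_sum gi.
by rewrite Rint_strip (interpolant_cut fin fout) RintegralZl.
Qed.

(** As phi vanishes at time T, the boundary terms of [mass_cell] leave only the values phi(0, x_i),
    whose mean is the initial integral up to [initial_average]. *)
Lemma mass_defect :
  `|\int[leb2]_(p in open_strip T)
      (rhoN N x p * dt T Phi p + e1N T N x p * dx Phi p) +
    \int[leb]_y (rhoN N x (0, y) * Phi (0, y))| <=
  (1 + (1 + W) * T) * (D * om).
Proof.
pose g i := mass_density Phi i.
have -> : \int[leb2]_(p in open_strip T)
      (rhoN N x p * dt T Phi p + e1N T N x p * dx Phi p) =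
    N%:R^-1 * \sum_(i < N) \int[leb2]_p cell_weight T (X i) (X i.+1) (g i) p.
  apply: mean_integral => [i [t y] iN tT c|[t y] tT c|i iN].
  - have [-> -> _] := interpolants_in iN (oc tT) c.
    by rewrite /g /mass_density /V /clamp_vel !strip_test//= cle// mulrDr mulrA.
  - by have [-> -> _] := interpolants_out c; rewrite !mul0r addr0.
  - apply: (@cw_integrable i (g i) (fun=> B0 + W * B0) iN).
    + by apply: continuous_measurable_plane; apply: mass_density_cont => //; exact: ltnW.
    + exact: cst_oo_integrable.
    + move=> t y _ yc; apply: mass_density_bound => //; first exact: ltnW.
      exact: (cell_range iN yc).
set I1 := _ * _.
have h1 : `|I1 - N%:R^-1 * \sum_(i < N) - Phi (0, x i 0)| <= (1 + W) * (T * (D * om)).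
  have := @mean_le (fun i => \int[leb2]_p cell_weight T (X i) (X i.+1) (g i) p - (- Phi (0, x i 0)))
    (fun i => (1 + W) * (eta * T + K * (del i.+1 - del i))).
  rewrite sumrB mulrBr => H; apply: (le_trans (H _)).
    move=> i iN; have E := mass_cell Phi_C1 K0 mA mB A_le B_le iN.
    by rewrite PhiT sub0r in E; exact: E.
  by rewrite -mulr_sumr mulrCA ler_wpM2l ?addr_ge0.
have h2 : `|\int[leb]_y (rhoN N x (0, y) * Phi (0, y)) -
    N%:R^-1 * \sum_(i < N) 1 * Phi (0, x i 0)| <= 1 * (D * om).
  apply: (le_trans (@initial_average (fun=> 1) (fun i => x i 0) (fun y => rhoN N x (0, y)) 1 _ _ _ _)) => //.
  - by move=> y; rewrite /rhoN; apply: eq_bigr => i _; rewrite mulr1.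
  - by move=> i iN; rewrite ler01 lexx.
  - by move=> i iN; rewrite lexx ltW// (rt_lt rt)// lexx.
  - by rewrite ler_wpM2l.
rewrite sumrN mulrN opprK in h1.
have -> : I1 + \int[leb]_y (rhoN N x (0, y) * Phi (0, y)) =
  (I1 + N%:R^-1 * \sum_(i < N) Phi (0, x i 0)) +
  (\int[leb]_y (rhoN N x (0, y) * Phi (0, y)) - N%:R^-1 * \sum_(i < N) 1 * Phi (0, x i 0)).
  under [X in _ = _ + (_ - _ * X)]eq_bigr do rewrite mul1r.
  by ring.
rewrite (le_trans (ler_normD _ _))// (le_trans (lerD h1 h2))//.
by rewrite [leRHS]mulrDl addrC -[X in _ <= _ + X]mulrA.
Qed.

(** The singular error has two parts: eta times a mean of masses, each bounded by [relax_mass], and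
    K / N times the sum over i of the integrals of w_i times the gap. [relax_gap_le] telescopes and
    bounds that whole sum independently of N, so the factor 1 / N survives. *)
Lemma momentum_defect :
  `|\int[leb2]_(p in open_strip T)
      (eps * (e1N T N x p * dt T Phi p + e2N T N x p * dx Phi p) +
       rhoN N x p * F p * Phi p - gam * (relaxN p * Phi p)) +
    eps * \int[leb]_y (e1N T N x (0, y) * Phi (0, y))| <=
  ((eps * W + eps * W * W + M + B0) * T + (T * M + eps * W) +
   (M * T + eps / 2 * (T * W ^+ 2) + eps * W) + eps * W) * (D * om).
Proof.
have eps0 := ltW eps_gt0; have gam0 := ltW gam_gt0.
pose g i := momentum_density Phi i.
have -> : \int[leb2]_(p in open_strip T)
      (eps * (e1N T N x p * dt T Phi p + e2N T N x p * dx Phi p) +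
       rhoN N x p * F p * Phi p - gam * (relaxN p * Phi p)) =
    N%:R^-1 * \sum_(i < N) \int[leb2]_p cell_weight T (X i) (X i.+1) (g i) p.
  apply: mean_integral => [i [t y] iN tT c|[t y] tT c|i iN].
  - have [-> -> ->] := interpolants_in iN (oc tT) c.
    rewrite (relaxN_in iN tT c) /g /momentum_density /= relax_ooE//.
    rewrite /profile /d /V /clamp_vel /X /clamp_pos /Fc /clamp_force !strip_test//= cle//.
    by ring.
  - have [-> -> ->] := interpolants_out c; rewrite relaxN_out//; ring.
  - have ki := integrable_oo_affine (eps * W * (B0 + W * B0) + M * B0) (gam * B0)
      (cst_oo_integrable T 1) (relax_integrable iN).
    apply: (@cw_integrable i (g i) _ iN _ ki).
    + by apply: measurable_momentum_density.
    + move=> t y tT yc; rewrite /= mulr1 [gam * B0 * _]mulrAC.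
      by apply: (momentum_density_bound (Phi := Phi)).
set I1 := _ * _.
pose mid i := midpoint i 0.
pose C1 := eps * W + eps * W * W + M + B0.
have C10 : 0 <= C1 by rewrite /C1 !addr_ge0 ?mulr_ge0// ltW.
pose mw i := \int[leb]_(t in `]0, T[) w i t.
pose mwd i := \int[leb]_(t in `]0, T[) (w i t * d i t).
have h1 : `|I1 - N%:R^-1 * \sum_(i < N) - (eps * (vel T (x i) 0 * Phi (0, mid i)))| <=
    N%:R^-1 * \sum_(i < N) (C1 * (eta * T + K * (del i.+1 - del i)) +
       gam * (eta * mw i + K * mwd i)).
  have := @mean_le (fun i => \int[leb2]_p cell_weight T (X i) (X i.+1) (g i) p -
       (- (eps * (vel T (x i) 0 * Phi (0, mid i)))))
    (fun i => C1 * (eta * T + K * (del i.+1 - del i)) + gam * (eta * mw i + K * mwd i)).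
  rewrite sumrB mulrBr => H; apply: H.
  move=> i iN; have E := momentum_cell Phi_C1 eta0 K0 mA mB mP mF A_le B_le P_le iN.
  by rewrite PhiT mulr0 sub0r -mulrA in E; exact: E.
have h2 : `|\int[leb]_y (e1N T N x (0, y) * Phi (0, y)) -
    N%:R^-1 * \sum_(i < N) vel T (x i) 0 * Phi (0, mid i)| <= W * (D * om).
  have t0 : 0 <= (0 : R) <= T by rewrite lexx.
  apply: (le_trans (@initial_average (fun i => vel T (x i) 0) mid (fun y => e1N T N x (0, y)) W _ _ _ _)) => //.
  - by move=> i iN; exact: (rt_vel rt (ltnW iN) t0).
  - by move=> i iN; have := rt_lt rt iN t0; rewrite /mid /midpoint; lra.
  - by rewrite ler_wpM2l.
have mw_le : N%:R^-1 * \sum_(i < N) gam * mw i <= T * M + eps * W.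
  rewrite -[leRHS]mean_cst ler_wpM2l ?invr_ge0//; apply: ler_sum => i _; exact: relax_mass.
have mwd_le : \sum_(i < N) gam * mwd i <=
    (M * T + eps / 2 * (T * W ^+ 2) + eps * W) * D.
  pose v2 i := \int[leb]_(t in `]0, T[) V i t ^+ 2.
  apply: (@le_trans _ _ (\sum_(i < N) (M * (del i.+1 - del i) +
     eps / 2 * (v2 i.+1 - v2 i) + eps * W * (x i.+1 0 - x i 0)))).
    by apply: ler_sum => i _; exact: relax_gap_le.
  rewrite !big_split /= -!mulr_sumr.
  have s1 := del_sum; have s3 := init_gap.
  have s2 : \sum_(i < N) (v2 i.+1 - v2 i) <= T * W ^+ 2.
    rewrite -(big_mkord predT (fun i => v2 i.+1 - v2 i)) telescope_sumr//.
    have v0 : 0 <= v2 0%N by apply: Rintegral_ge0 => t _; exact: sqr_ge0.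
    apply: (@le_trans _ _ (v2 N)); first by rewrite lerBlDr lerDl.
    rewrite mulrC -Rintegral_oo_cst//; apply: le_Rintegral_oo.
    - exact: vel2_integrable.
    - exact: cst_oo_integrable.
    - move=> t _; have /andP[a b] := clamp_vel_range t (leqnn N).
      by rewrite /= lerXn2r ?nnegrE.
  have SD : S - s <= D by rewrite /D lerDr.
  have D1 : 1 <= D by rewrite /D lerDl subr_ge0.
  rewrite !mulrDl lerD//; first rewrite lerD//.
  - by rewrite -mulrA ler_wpM2l ?(ltW M0)// (le_trans s1)// ler_wpM2l.
  - rewrite -[leRHS]mulrA ler_wpM2l ?divr_ge0// (le_trans s2)// ler_peMr//.
    by rewrite mulr_ge0// sqr_ge0.
  - by rewrite ler_wpM2l ?mulr_ge0// (le_trans s3).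
have h3 : N%:R^-1 * \sum_(i < N) (C1 * (eta * T + K * (del i.+1 - del i)) +
       gam * (eta * mw i + K * mwd i)) <=
    (C1 * T + (T * M + eps * W) + (M * T + eps / 2 * (T * W ^+ 2) + eps * W)) * (D * om).
  have -> : N%:R^-1 * \sum_(i < N) (C1 * (eta * T + K * (del i.+1 - del i)) +
       gam * (eta * mw i + K * mwd i)) =
    C1 * (N%:R^-1 * \sum_(i < N) (eta * T + K * (del i.+1 - del i))) +
    eta * (N%:R^-1 * \sum_(i < N) gam * mw i) + K / N%:R * \sum_(i < N) gam * mwd i.
    rewrite big_split /= -mulr_sumr mulrDr mulrCA -addrA; congr (_ + _).
    rewrite !mulr_sumr -big_split /=; apply: eq_bigr => i _.
    by rewrite /mw /mwd; ring.
  have D1 : 1 <= D by rewrite /D lerDl subr_ge0.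
  have eta_le : eta <= D * om.
    apply: (@le_trans _ _ om); first by rewrite /om lerDl divr_ge0.
    by rewrite ler_peMl.
  have KN : K / N%:R <= om by rewrite /om lerDr.
  have c2 : 0 <= M * T + eps / 2 * (T * W ^+ 2) + eps * W.
    by rewrite !addr_ge0 ?mulr_ge0 ?divr_ge0 ?sqr_ge0// ltW.
  have c1 : 0 <= T * M + eps * W by rewrite addr_ge0 ?mulr_ge0// ltW.
  rewrite [leRHS]mulrDl [X in _ <= X + _]mulrDl lerD//; first rewrite lerD//.
  - by rewrite -[leRHS]mulrA ler_wpM2l.
  - rewrite mulrC; apply: (@le_trans _ _ ((T * M + eps * W) * eta)).
      by rewrite ler_wpM2r.
    by rewrite ler_wpM2l.
  - apply: (@le_trans _ _ (K / N%:R * ((M * T + eps / 2 * (T * W ^+ 2) + eps * W) * D))).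
      by rewrite ler_wpM2l// divr_ge0.
    rewrite mulrCA ler_wpM2l// [leLHS]mulrC ler_wpM2l//.
    exact: le_trans D1.
have -> : I1 + eps * \int[leb]_y (e1N T N x (0, y) * Phi (0, y)) =
  (I1 - N%:R^-1 * \sum_(i < N) - (eps * (vel T (x i) 0 * Phi (0, mid i)))) +
  eps * (\int[leb]_y (e1N T N x (0, y) * Phi (0, y)) -
    N%:R^-1 * \sum_(i < N) vel T (x i) 0 * Phi (0, mid i)).
  by rewrite sumrN -mulr_sumr; ring.
rewrite (le_trans (ler_normD _ _))// [leRHS]mulrDl lerD ?(le_trans h1)//.
by rewrite normrM gtr0_norm// -mulrA ler_wpM2l.
Qed.

End defects.
End regular_estimates.
(** * Passage to the limit *)

Section bounded_limits.
Context {R : realType}.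

Section essential_bounds.
Context d (T : measurableType d) (mu : {measure set T -> \bar R}) (D : set T)
  (f : T -> R) (C : R) (C0 : 0 <= C) (fC : forall p, D p -> 0 <= f p <= C).

Lemma Linfty_norm_le : (Linfty_norm mu D f <= C%:E)%E.
Proof.
have fD p : `|(f \_ D) p| <= C.
  rewrite patchE; case: ifPn => [|_]; last by rewrite normr0.
  by rewrite inE => /fC /andP[f0 f1]; rewrite ger0_norm.
rewrite /Linfty_norm unlock; case: ifP => _; last by rewrite lee_fin.
exact: (@ess_sup_inf.ess_sup_ler _ _ _ _ (fun p => `|(f \_ D) p|)).
Qed.

Lemma mem_Linfty_bounded : measurable_fun D f -> mem_Linfty mu D f.
Proof. by move=> mf; split => //; exact: le_lt_trans Linfty_norm_le (ltry _). Qed.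

Lemma ae_ge0_bounded : ae_ge0 mu D f.
Proof. by apply: aeW => p /fC /andP[]. Qed.

End essential_bounds.

Lemma closed_ess_supp (T : topologicalType) (ae : set_system T) (D : set T)
    (f : T -> R) : closed (ess_supp ae D f).
Proof.
rewrite -[X in closed X]setCK; apply: open_closedC; rewrite openE => p np.
have [U [oU Up HU]] : exists U : set T, [/\ open U, U p &
    (\forall q \near ae, D q -> U q -> f q = 0)].
  apply: contrapT => H; apply: np => U oU Up HU; apply: H.
  by exists U.
apply: (filterS (P := U)); last exact: open_nbhs_nbhs.
by move=> q Uq /(_ U oU Uq).
Qed.

Lemma closed_measure_supp (lam : @planar_measure R) : closed (measure_supp lam).
Proof.
rewrite -[X in closed X]setCK; apply: open_closedC; rewrite openE => p np.
have [U [oU Up HU]] : exists U : set (R * R), [/\ open U, U p & lam U = 0%E].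
  apply: contrapT => H; apply: np => U oU Up; apply/eqP => HU; apply: H.
  by exists U.
apply: (filterS (P := U)); last exact: open_nbhs_nbhs.
by move=> q Uq /(_ U oU Uq); rewrite HU eqxx.
Qed.

End bounded_limits.

Section weakstar_limit.
Context {R : realType} d (X : measurableType d)
  (mu : {sigma_finite_measure set X -> \bar R}) (O K : set X) (C : R)
  (mO : measurable O) (mK : measurable K) (KO : K `<=` O)
  (muK : (mu K < +oo)%E) (C0 : 0 <= C) (v : nat -> X -> R)
  (vm : forall n, measurable_fun setT (v n \_ O))
  (vC : forall n p, O p -> 0 <= v n p <= C)
  (vK : forall n p, O p -> v n p != 0 -> K p).

Let u n := v n \_ O.

Lemma restrict_ge0 n p : 0 <= u n p.
Proof. by rewrite /u patchE; case: ifPn => //; rewrite inE => /(vC n)/andP[]. Qed.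

Lemma restrict_le n p : u n p <= C * \1_K p.
Proof.
rewrite /u patchE; case: ifPn => [|_]; last by rewrite mulr_ge0// indicE.
rewrite inE => Op; have /andP[_ h] := vC n Op.
have [e|ne] := eqVneq (v n p) 0; first by rewrite e mulr_ge0// indicE.
by rewrite indicE mem_set ?mulr1//; exact: vK ne.
Qed.

Lemma intw_restrict_bound n B : measurable B ->
  `|intw mu (fun n => v n \_ O) n B| <= C * massK mu K B.
Proof.
move=> mB; rewrite ger0_norm.
  exact: (intw_le mK muK C0 vm restrict_ge0 restrict_le).
exact: (intw_ge0 mu restrict_ge0).
Qed.

Lemma weakstar_limit :
  (forall B, measurable B -> cvgn (fun n => intw mu (fun n => v n \_ O) n B)) ->
  exists f : X -> R,
  [/\ measurable_fun setT f, forall p, 0 <= f p <= C * \1_K p,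
      cvg_weakstar_Linfty mu O v f &
      forall g : X -> R, mu.-integrable K (EFin \o g) ->
        \int[mu]_(p in O) (v n p * g p) @[n --> \oo] -->
        \int[mu]_(p in O) (f p * g p)].
Proof.
move=> vcvg; have [f [mf fC fcvg]] := setwise_density mK muK C0 vm restrict_ge0 restrict_le vcvg.
have fO p : 0 <= f p <= C.
  have /andP[f0 f1] := fC p; rewrite f0 (le_trans f1)// indicE ler_piMr//.
  by case: (_ \in _).
have testK (g : X -> R) : mu.-integrable K (EFin \o g) ->
    \int[mu]_(p in O) (v n p * g p) @[n --> \oo] --> \int[mu]_(p in O) (f p * g p).
  move=> gi; have gi' : mu.-integrable setT (EFin \o (g \_ K)).
    by have := (@integrable_mkcond _ _ R mu K (EFin \o g) mK).1 gi; rewrite restrict_EFin.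
  have H := weakstar_L1 mK muK C0 vm restrict_ge0 restrict_le mf fC fcvg gi'.
  have E1 n : \int[mu]_(p in O) (v n p * g p) = \int[mu]_p ((v n \_ O) p * (g \_ K) p).
    rewrite Rintegral_mkcond; apply: eq_Rintegral => p _; rewrite !patchE.
    case: ifPn => [|_]; last by rewrite mul0r.
    rewrite inE => Op; have [e|ne] := eqVneq (v n p) 0; first by rewrite e !mul0r.
    by rewrite mem_set//; exact: vK ne.
  have E2 : \int[mu]_(p in O) (f p * g p) = \int[mu]_p (f p * (g \_ K) p).
    rewrite Rintegral_mkcond; apply: eq_Rintegral => p _; rewrite !patchE.
    have [Kp|nKp] := pselect (K p); first by rewrite !mem_set//; exact: KO.
    have -> : f p = 0.
      apply/eqP; rewrite eq_le; have /andP[-> f1] := fC p.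
      by rewrite (le_trans f1)// indicE memNset// mulr0.
    by rewrite !mul0r; case: ifP.
  by under eq_fun do rewrite E1; rewrite E2.
exists f; split => //; split.
- move=> n; apply: (@mem_Linfty_bounded _ _ _ mu O (v n) C C0); first exact: vC.
  have := vm n; move/(measurable_restrict _ mO measurableT); rewrite setTI; exact.
- by apply: (@mem_Linfty_bounded _ _ _ _ _ _ C C0) => //; exact: measurable_funTS.
- by move=> g gi; apply: testK; exact: (integrableS mO mK KO gi).
Qed.

(** Testing against the indicator of K and B shows that the nonnegative [f] has zero integral over
    [B]. *)
Lemma weakstar_limit_ae0 (f : X -> R) (B : set X) (n0 : nat) : measurable B -> B `<=` O ->
  measurable_fun setT f -> (forall p, 0 <= f p <= C * \1_K p) ->
  cvg_weakstar_Linfty mu O v f ->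
  (forall n p, (n0 <= n)%N -> B p -> v n p = 0) ->
  \forall q \near almost_everywhere mu, B q -> f q = 0.
Proof.
move=> mB BO mf fC [_ _ H] v0.
have mKB : measurable (K `&` B) by exact: measurableI.
have KBoo : (mu (K `&` B) < +oo)%E.
  by apply: le_lt_trans muK; apply: le_measure; rewrite ?inE.
have gi : mu.-integrable O (EFin \o (\1_(K `&` B) : X -> R)).
  by apply: integrableS (indic_integrable mKB KBoo).
have fi : mu.-integrable B (EFin \o f).
  apply: (bounded_integrable mK muK C0 mB); first exact: measurable_funTS.
  by move=> p _; have /andP[f0 f1] := fC p; rewrite ger0_norm.
have fE : \int[mu]_(p in O) (f p * \1_(K `&` B) p) = \int[mu]_(p in B) f p.
  rewrite Rintegral_mkcond [RHS]Rintegral_mkcond; apply: eq_Rintegral => p _.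
  rewrite !patchE; have [Bp|nBp] := pselect (B p); last first.
    rewrite [in RHS]memNset//; case: ifP => // _.
    by rewrite indicE memNset ?mulr0// => -[].
  rewrite !mem_set//; last exact: BO.
  have [Kp|nKp] := pselect (K p); first by rewrite indicE mem_set ?mulr1.
  have -> : f p = 0.
    apply/eqP; rewrite eq_le; have /andP[-> f1] := fC p.
    by rewrite (le_trans f1)// indicE memNset// mulr0.
  by rewrite mul0r.
have f0 : \int[mu]_(p in B) f p = 0.
  rewrite -fE; apply: (cvg_unique (@Rhausdorff R) (H _ gi)).
  apply: (cvg_near_cst 0); exists n0 => // n /= nn.
  rewrite (_ : (fun p => v n p * _) = cst 0); last first.
    apply/funext => p /=; have [Bp|nBp] := pselect (B p); first by rewrite v0// mul0r.
    by rewrite indicE memNset ?mulr0// => -[].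
  by rewrite /Rintegral integral0.
have mfB : measurable_fun B (EFin \o f) by apply/measurable_EFinP; exact: measurable_funTS.
have : (\int[mu]_(x in B) `|(EFin \o f) x|)%E = 0%E.
  under eq_integral => p _.
    rewrite /= ger0_norm; last by have /andP[] := fC p.
    over.
  have fn := integrable_fin_num mB fi.
  by rewrite -[LHS]fineK// -[fine _]/(\int[mu]_(p in B) f p) f0.
move/(ae_eq_integral_abs _ mB mfB); apply: filterS => q /[apply] /=.
by case.
Qed.

End weakstar_limit.

(** * Limits of the first and last trajectories *)

Section curve_limits.
Context {R : realType} (T W : R) (T0 : 0 <= T) (W0 : 0 <= W).

Lemma finitely_many_ranks (P : nat -> nat -> Prop) (J : nat) :
  (forall j, exists N, forall n, (N <= n)%N -> P j n) ->
  exists N, forall j, (j < J)%N -> forall n, (N <= n)%N -> P j n.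
Proof.
move=> H; elim: J => [|J [N HN]]; first by exists 0%N.
have [N' HN'] := H J; exists (maxn N N') => j; rewrite ltnS leq_eqVlt.
move=> /predU1P[->|jJ] n; rewrite geq_max => /andP[n1 n2]; first exact: HN'.
exact: HN.
Qed.

Lemma uniform_cvg_distP (u : nat -> R -> R) (l : R -> R) :
  (forall e, 0 < e -> exists N, forall n, (N <= n)%N -> forall t, 0 <= t <= T ->
     `|l t - u n t| < e) ->
  {uniform `[0, T], u @ \oo --> l}.
Proof.
move=> H P /uniform_nbhs[E [+ EP]].
rewrite -entourage_from_ballE => -[e /= e0 He].
have [N HN] := H e e0; exists N => // n /= Nn; apply: EP => t /=.
rewrite in_itv /= => tT; apply: He; rewrite /= -ball_normE /=; exact: HN.
Qed.

Section equilipschitz.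
Context (a : nat -> R -> R)
  (alip : forall n t u, 0 <= t <= T -> 0 <= u <= T -> `|a n t - a n u| <= W * `|t - u|).

(** The Arzela-Ascoli argument: convergence at rational times and a common Lipschitz constant give a
    uniform Cauchy sequence. Clamping brings every rational into [0, T]. *)
Lemma equilipschitz_uniform_limit :
  (forall q : rat, cvgn (fun n => a n (clamp T (ratr q)))) ->
  exists l : R -> R, forall e, 0 < e -> exists N, forall n, (N <= n)%N ->
    forall t, 0 <= t <= T -> `|l t - a n t| < e.
Proof.
move=> aq.
have cauchy e : 0 < e -> exists N, forall m n, (N <= m)%N -> (N <= n)%N ->
    forall t, 0 <= t <= T -> `|a m t - a n t| < e.
  move=> e0; have W1 : 0 < W + 1 by rewrite ltr_wpDl.
  (* A grid of mesh 1 / k, over which every curve moves by less than e / 4: the comparison at [t]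
     costs two such moves and two distances to the limit at a grid point. W + 1 in place of W avoids
     a zero constant. *)
  pose k := (Num.truncn (4 * (W + 1) / e)).+1.
  have k0 : 0 < k%:R :> R by rewrite ltr0n.
  have ke : 4 * (W + 1) / e < k%:R by exact: truncnS_gt.
  have Wk : W * k%:R^-1 < e / 4.
    have : (W + 1) * k%:R^-1 < e / 4.
      by rewrite ltr_pdivrMr// mulrC -ltr_pdivrMr ?divr_gt0// invf_div mulrA [_ * 4]mulrC.
    by apply: le_lt_trans; rewrite ler_wpM2r ?invr_ge0 ?lerDl ?(ltW k0).
  pose q j : rat := (j%:R / k%:R)%R.
  have qE j : ratr (q j) = j%:R / k%:R :> R by rewrite /q fmorph_div !rmorph_nat.
  pose J := (Num.truncn (T * k%:R)).+1.
  have [N HN] := @finitely_many_ranks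
    (fun j n => `|limn (fun n => a n (clamp T (ratr (q j)))) - a n (clamp T (ratr (q j)))| < e / 4) J
    (fun j => (cvgn_distP _ _).1 (aq (q j)) (e / 4) (divr_gt0 e0 (ltr0n _ 4))).
  exists N => m n Nm Nn t tT; have /andP[t0 t1] := tT.
  pose j := Num.truncn (t * k%:R).
  have /andP[j1 j2] : j%:R <= t * k%:R < j.+1%:R.
    by apply: truncn_itv; rewrite mulr_ge0// ltW.
  have jJ : (j < J)%N by rewrite ltnS le_truncn// ler_wpM2r// ltW.
  have qt : 0 <= (ratr (q j) : R) <= t.
    by rewrite qE divr_ge0 ?ler0n ?(ltW k0)//= ler_pdivrMr.
  have cq : clamp T (ratr (q j)) = ratr (q j) :> R.
    by apply: clamp_id; move: qt; case/andP=> -> /le_trans ->.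
  have qT : 0 <= (ratr (q j) : R) <= T.
    by move: qt; case/andP=> -> /le_trans ->.
  have tq : `|t - ratr (q j)| <= k%:R^-1.
    rewrite ger0_norm; last by rewrite subr_ge0; case/andP: qt.
    by rewrite lerBlDr qE -[X in X + _]mul1r -mulrDl ler_pdivlMr// addrC natr1 ltW.
  have hm := HN j jJ m Nm; have hn := HN j jJ n Nn; rewrite !cq in hm hn.
  have lt1 u : `|a u t - a u (ratr (q j))| < e / 4.
    rewrite (le_lt_trans (alip u tT qT))// (le_lt_trans _ Wk)//.
    by rewrite ler_wpM2l.
  have l1 := lt1 m; have l2 := lt1 n; move: hm hn l1 l2.
  rewrite !ltr_norml => /andP[? ?] /andP[? ?] /andP[? ?] /andP[? ?].
  apply/andP; split; lra.
have lim t : 0 <= t <= T -> exists l : R, a n t @[n --> \oo] --> l.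
  move=> tT; apply: cauchy_cvgn_dist => e /cauchy[N HN].
  by exists N => m n Nm Nn; exact: HN.
exists (fun t => limn (fun n => a n t)) => e e0.
have e2 : 0 < e / 2 by rewrite divr_gt0.
have [N HN] := cauchy _ e2; exists N => n Nn t tT.
have [l Hl] := lim t tT; have -> : limn (fun n => a n t) = l by exact: (cvg_lim (@Rhausdorff R) Hl).
have [N' HN'] := (cvgn_distP _ _).1 Hl _ e2.
have := HN' (maxn N N') (leq_maxr _ _); have := HN _ _ (leq_maxl N N') Nn t tT.
rewrite !ltr_norml => /andP[? ?] /andP[? ?]; apply/andP; split; lra.
Qed.

End equilipschitz.

Section off_support.
Context (a b : nat -> R -> R) (l u : R -> R)
  (alip : forall n t u, 0 <= t <= T -> 0 <= u <= T -> `|a n t - a n u| <= W * `|t - u|)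
  (blip : forall n t u, 0 <= t <= T -> 0 <= u <= T -> `|b n t - b n u| <= W * `|t - u|)
  (al : forall e, 0 < e -> exists N, forall n, (N <= n)%N -> forall t, 0 <= t <= T ->
     `|l t - a n t| < e)
  (bu : forall e, 0 < e -> exists N, forall n, (N <= n)%N -> forall t, 0 <= t <= T ->
     `|u t - b n t| < e).

(** The limit curves are at positive distance from [p] in space. In a ball of radius e / (W + 1) the
    curves move by at most [e], so for large n the whole ball avoids the region between them. *)
Lemma off_support (p : R * R) :
  ~ (\bigcup_(t in `[0, T]) ([set t] `*` `[l t, u t])) p ->
  exists2 r : R, 0 < r & exists N, forall n, (N <= n)%N ->
    forall q, `|p - q| < r -> 0 <= q.1 <= T -> ~ (a n q.1 <= q.2 <= b n q.1).
Proof.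
move=> nQ; have W1 : 0 < W + 1 by rewrite ltr_wpDl.
have dist (q : R * R) r : `|p - q| < r -> `|p.1 - q.1| < r /\ `|p.2 - q.2| < r.
  by rewrite prod_normE gt_max => /andP[].
have small e : 0 < e -> 0 < e / (W + 1) /\
    forall c, c < e / (W + 1) -> 0 <= c -> W * c <= e /\ c <= e.
  move=> e0; split; first exact: divr_gt0.
  move=> c; rewrite ltr_pdivlMr// => ce c0.
  by have := mulr_ge0 W0 c0; split; nra.
have [tT|ntT] := boolP (0 <= p.1 <= T); last first.
  move: ntT; rewrite negb_and -!ltNge => /orP[h|h].
    exists (- p.1); first by rewrite oppr_gt0.
    exists 0%N => n _ q /dist[+ _] /andP[q0 _]; rewrite ltr_norml => /andP[]; lra.
  exists (p.1 - T); first by rewrite subr_gt0.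
  exists 0%N => n _ q /dist[+ _] /andP[_ q0]; rewrite ltr_norml => /andP[]; lra.
have : ~ (l p.1 <= p.2 <= u p.1).
  move=> h; apply: nQ; exists p.1; first by rewrite /= in_itv.
  by split => //=; rewrite in_itv.
move/negP; rewrite negb_and -!ltNge => /orP[h|h].
  (* Three errors of size [e] occur: the distance to the limit curve, the motion of the curve and
     that of the point. A quarter of the distance leaves room. *)
  pose e := (l p.1 - p.2) / 4.
  have e0 : 0 < e by rewrite divr_gt0// subr_gt0.
  have [d0 Hd] := small e e0; have [N HN] := al e0.
  exists (e / (W + 1)) => //; exists N => n Nn q /dist[h1 h2] qT /andP[h3 _].
  have [w1 _] := Hd _ h1 (normr_ge0 _); have [_ w2] := Hd _ h2 (normr_ge0 _).
  have := alip n tT qT; have := HN n Nn p.1 tT.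
  move: w2; rewrite ltr_norml !ler_norml => /andP[? ?] /andP[? ?] /andP[? ?].
  by have : e * 4 = l p.1 - p.2; [rewrite /e divfK|lra].
pose e := (p.2 - u p.1) / 4.
have e0 : 0 < e by rewrite divr_gt0// subr_gt0.
have [d0 Hd] := small e e0; have [N HN] := bu e0.
exists (e / (W + 1)) => //; exists N => n Nn q /dist[h1 h2] qT /andP[_ h3].
have [w1 _] := Hd _ h1 (normr_ge0 _); have [_ w2] := Hd _ h2 (normr_ge0 _).
have := blip n tT qT; have := HN n Nn p.1 tT.
move: w2; rewrite ltr_norml !ler_norml => /andP[? ?] /andP[? ?] /andP[? ?].
by have : e * 4 = p.2 - u p.1; [rewrite /e divfK|lra].
Qed.

End off_support.
End curve_limits.

(** * From the open strip to the closed strip *)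

Section null_extension.
Context d (X : measurableType d) {R : realType} (mu : {measure set X -> \bar R}).
Implicit Types (O E : set X) (f g : X -> R).

Lemma null_set_extension O E f : measurable O -> measurable E -> mu E = 0%E ->
  O `&` E = set0 -> measurable_fun (O `|` E) f -> mu.-integrable O (EFin \o f) ->
  mu.-integrable (O `|` E) (EFin \o f) /\
  \int[mu]_(p in O `|` E) f p = \int[mu]_(p in O) f p.
Proof.
move=> mO mE E0 OE mf /integrableP[_ fi]; have mOE : measurable (O `|` E) by exact: measurableU.
have i1 : mu.-integrable (O `|` E) (EFin \o f).
  apply/integrableP; split; first exact/measurable_EFinP.
  rewrite ge0_integral_setU//.
  - rewrite (@integral_abs_eq0 _ _ _ mu E)// ?adde0//.
    by apply/measurable_EFinP; apply: measurable_funS mf => //; exact: subsetUr.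
  - by apply: measurableT_comp => //; exact/measurable_EFinP.
  - by apply/disj_setPS; rewrite OE.
split => //; rewrite /Rintegral; congr fine.
rewrite (negligible_integral mE mOE i1 E0) setDUl setDv setU0.
by congr (integral _ _ _); apply/setDidPl.
Qed.

Lemma dominated_integrable_on O f g (C : R) : measurable O -> mu.-integrable O (EFin \o g) ->
  measurable_fun O f -> (forall p, O p -> `|f p| <= C * `|g p|) ->
  mu.-integrable O (EFin \o f).
Proof.
move=> mO gi mf fg; apply: (le_integrable mO _ _ (integrableZl mO C gi)).
  exact/measurable_EFinP.
move=> p Op /=; rewrite lee_fin (le_trans (fg p Op))// normrM ler_wpM2r//.
exact: ler_norm.
Qed.

End null_extension.

Section closed_strip.
Context {R : realType} (T : R) (T0 : 0 < T).
Implicit Types (f psi : R * R -> R).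

Let O : set (R * R) := open_strip T.
Let slice (c : R) : set (R * R) := [set c] `*` setT.
Let E : set (R * R) := slice 0 `|` slice T.

Lemma measurable_strip : measurable (strip T).
Proof. by apply: measurableX; [exact: measurable_itv|exact: measurableT]. Qed.

Lemma measurable_open_strip : measurable (open_strip T).
Proof. by apply: measurableX; [exact: measurable_itv|exact: measurableT]. Qed.

Let mslice c : measurable (slice c).
Proof. by apply: measurableX; [exact: measurable_set1|exact: measurableT]. Qed.

Let slice0 c : leb2 (slice c) = 0%E.
Proof.
rewrite leb2E//.
rewrite (_ : leb [set c] = 0%E) ?mul0e//.
exact: (lebesgue_measure_set1 c).
Qed.

Let mE : measurable E. Proof. by apply: measurableU; exact: mslice. Qed.

Let E0 : leb2 E = 0%E.
Proof.
apply/eqP; rewrite eq_le measure_ge0 andbT.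
have h : (leb2 (slice 0) + leb2 (slice T) <= 0)%E by rewrite !slice0 adde0.
exact: (le_trans (@measureU2 _ _ _ (@leb2 R) _ _ (mslice 0) (mslice T)) h).
Qed.

Let OE : strip T = O `|` E.
Proof.
apply/seteqP; split => -[t y]; rewrite /strip /O /open_strip /E /slice /= !in_itv /=.
  move=> [/andP[t0 tT] _]; have [e|ne0] := eqVneq t 0; first by right; left.
  have [e|neT] := eqVneq t T; first by right; right.
  by left; rewrite !lt_neqAle eq_sym ne0 neT t0.
move=> [[/andP[/ltW -> /ltW ->] _]//|[|] [-> _]]; rewrite lexx ltW//.
Qed.

Let OI : O `&` E = set0.
Proof.
rewrite -subset0 => -[t y]; rewrite /O /open_strip /E /slice /= !in_itv /=.
by move=> [[/andP[t0 tT] _] [|] [e _]]; rewrite e ltxx in t0 tT.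
Qed.

(** Measurability refers to the product sigma-algebra, not completed, so the slices t = 0 and t = T
    need an argument of their own although they are negligible. *)
Lemma strip_measurable f : measurable_fun setT (f \_ (open_strip T)) ->
  measurable_fun setT (fun y => f (0, y)) -> measurable_fun setT (fun y => f (T, y)) ->
  measurable_fun (strip T) f.
Proof.
move=> mf m0 mT; rewrite OE /E; have mO := measurable_open_strip.
have ms c : measurable_fun setT (fun y => f (c, y)) -> measurable_fun (slice c) f.
  move=> mc; apply: (@eq_measurable_fun _ _ _ _ _ (fun p => f (c, p.2))).
    by move=> [t y]; rewrite inE => -[/= -> _].
  apply: measurable_funTS; exact: (measurableT_comp mc measurable_snd).
apply/measurable_funU => //; split.
  by have := (measurable_restrict _ mO measurableT).2 mf; rewrite setTI.
by apply/measurable_funU => //; split; exact: ms.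
Qed.

Lemma strip_integral f : measurable_fun (strip T) f ->
  leb2.-integrable (open_strip T) (EFin \o f) ->
  leb2.-integrable (strip T) (EFin \o f) /\
  \int[leb2]_(p in strip T) f p = \int[leb2]_(p in open_strip T) f p.
Proof.
move=> mf fi; rewrite OE; rewrite OE in mf.
have mO := measurable_open_strip.
exact: (@null_set_extension _ _ _ (@leb2 R) O E f mO mE E0 OI mf fi).
Qed.

Lemma compact_measurable_plane (K : set (R * R)) : compact K -> measurable K.
Proof.
move=> /(compact_closed (@norm_hausdorff _ _)) cK; rewrite -(setCK K).
by apply: measurableC; apply: open_measurable_plane; exact: closed_openC.
Qed.

End closed_strip.

Section regular_slices.
Context {R : realType} (T eps gam rhobar s S W M : R) (theta : R -> R)
  (F : R * R -> R) (N : nat) (x : nat -> R -> R)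
  (T_gt0 : 0 < T) (eps_gt0 : 0 < eps) (gam_gt0 : 0 < gam) (N_gt0 : (0 < N)%N)
  (nonlin : nonlinearity_assumptions T theta rhobar F)
  (F_le : forall t y, 0 <= t <= T -> s <= y <= S -> F (t, y) <= M)
  (rt : regular_traffic T eps gam rhobar theta F s S W N x).

Lemma measurable_cells (c : nat -> R) (t : R) n :
  measurable_fun setT (fun y => \sum_(i < n) c i * \1_(cell x i t) y).
Proof.
elim: n => [|n IH].
  rewrite (_ : (fun y => _) = cst 0); first exact: measurable_cst.
  by apply/funext => y; rewrite big_ord0.
rewrite (_ : (fun y => _) = (fun y => \sum_(i < n) c i * \1_(cell x i t) y +
    c n * \1_(cell x n t) y)); last by apply/funext => y; rewrite big_ord_recr.
apply: measurable_funD => //; apply: measurable_funM; first exact: measurable_cst.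
by apply: measurable_indic; exact: measurable_itv.
Qed.

Lemma measurable_relaxN_slice t : 0 <= t <= T ->
  measurable_fun setT (fun y => relaxN T theta N x (t, y)).
Proof.
move=> tT; pose c i := rho_ N x i t * vel T (x i) t / theta (rho_ N x i t).
rewrite (_ : (fun y => _) = (fun y => \sum_(i < N) c i * \1_(cell x i t) y)).
  exact: measurable_cells.
apply/funext => y.
have [[i iN ci]|H] := pselect (exists2 i, (i < N)%N & cell x i t y); last first.
  have out i : (i < N)%N -> ~ cell x i t y by move=> iN ci; apply: H; exists i.
  rewrite relaxN_out// big1// => i _; rewrite indicE memNset ?mulr0//; exact: out.
have [r e _] := interpolants_in rt iN tT ci; rewrite /relaxN r e.
rewrite (bigD1 (Ordinal iN)) //= big1 ?addr0.
  by rewrite indicE mem_set// mulr1.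
move=> j ji; rewrite indicE memNset ?mulr0// => cj.
by move/eqP: ji; apply; apply/val_inj/(cell_uniq rt _ _ tT cj ci).
Qed.

Lemma measurable_relaxN_strip : measurable_fun (strip T) (relaxN T theta N x).
Proof.
apply: strip_measurable => //.
- exact: (measurable_relaxN T_gt0 N_gt0 nonlin rt).
- by apply: measurable_relaxN_slice; rewrite lexx ltW.
- by apply: measurable_relaxN_slice; rewrite lexx ltW.
Qed.

Lemma relaxN_test_integrable (psi : R * R -> R) (C : R) : continuous psi ->
  (forall p, strip T p -> `|psi p| <= C) ->
  leb2.-integrable (strip T) (EFin \o (fun p => psi p * relaxN T theta N x p)).
Proof.
move=> psic psiC; have mD := @measurable_strip R T; have mO := @measurable_open_strip R T.
have hi := relaxN_integrable T_gt0 eps_gt0 gam_gt0 N_gt0 nonlin F_le rt.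
have mpsi : measurable_fun setT psi by exact: continuous_measurable_plane.
have mh := measurable_relaxN_strip.
have mfull : measurable_fun (strip T) (fun p => psi p * relaxN T theta N x p).
  by apply: measurable_funM => //; exact: measurable_funTS.
have OD : open_strip T `<=` strip T.
  by move=> [t y] [/=]; rewrite /strip /= !in_itv /= => /andP[/ltW -> /ltW ->].
have hO : leb2.-integrable (open_strip T) (EFin \o relaxN T theta N x).
  apply/(@integrable_mkcond _ _ R leb2 _ (EFin \o relaxN T theta N x) mO).
  by rewrite restrict_EFin.
have [] // := @strip_integral R T T_gt0 (fun p => psi p * relaxN T theta N x p) mfull.
refine (@dominated_integrable_on _ (measurableTypeR R * measurableTypeR R)%type R (@leb2 R) _ _ _ C mO hO _ _).
  by apply: measurable_funS mfull.
by move=> p Op; rewrite normrM ler_wpM2r// psiC//; exact: OD.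
Qed.

Lemma curve_lipschitz i t u : (i <= N)%N -> 0 <= t <= T -> 0 <= u <= T ->
  `|x i t - x i u| <= W * `|t - u|.
Proof.
move=> iN; wlog tu : t u / u <= t => [H tT uT|].
  have [tu|/ltW ut] := leP u t; first exact: H.
  by rewrite distrC [`|t - u|]distrC; exact: H.
move=> tT uT.
have [c||c] := @MVT_segment R (x i) (vel T (x i)) u t tu.
- by rewrite in_itv /= => cut; apply: (rt_derive rt) => //; move: cut tT uT => /andP[? ?]; lra.
- apply: continuous_subspaceW (rt_cont rt iN) => r /=; rewrite !in_itv /=; lra.
rewrite in_itv /= => cut ->; have cT : 0 <= c <= T by lra.
have /andP[v0 v1] := rt_vel rt iN cT.
by rewrite normrM ger0_norm// ler_wpM2r.
Qed.

Lemma measurable_rhoN_slice t : measurable_fun setT (fun y => rhoN N x (t, y)).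
Proof. exact: (measurable_cells (fun i => rho_ N x i t)). Qed.

Lemma measurable_e1N_slice t : measurable_fun setT (fun y => e1N T N x (t, y)).
Proof. exact: (measurable_cells (fun i => rho_ N x i t * vel T (x i) t)). Qed.

End regular_slices.

(** * Sequences of solutions *)

Section traffic_sequence.
Context {R : realType} (T eps gam rhobar s S W M : R) (theta : R -> R)
  (F : R * R -> R) (N : nat -> nat) (z : nat -> nat -> R -> R)
  (T_gt0 : 0 < T) (eps_gt0 : 0 < eps) (gam_gt0 : 0 < gam)
  (N_gt0 : forall n, (0 < N n)%N)
  (nonlin : nonlinearity_assumptions T theta rhobar F)
  (F_le : forall t y, 0 <= t <= T -> s <= y <= S -> F (t, y) <= M)
  (rt : forall n, regular_traffic T eps gam rhobar theta F s S W (N n) (z n)).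

Let O : set (R * R) := open_strip T.
Definition traffic_box : set (R * R) := `]0, T[ `*` [set` `[s, S[].
Let K := traffic_box.
Let K1 : set R := [set` `[s, S[].
Let box : set (R * R) := `[0, T] `*` `[s, S].

Definition rho_seq n := rhoN (N n) (z n).
Definition e1_seq n := e1N T (N n) (z n).
Definition e2_seq n := e2N T (N n) (z n).
Definition relax_seq n := relaxN T theta (N n) (z n).
Definition rho0_seq n (y : R) := rhoN (N n) (z n) (0, y).
Definition e10_seq n (y : R) := e1N T (N n) (z n) (0, y).

Let T0 : 0 <= T. Proof. exact: ltW. Qed.
Let t0 : 0 <= (0 : R) <= T. Proof. by rewrite lexx. Qed.

Lemma range_lt : s < S.
Proof.
have h1 := rt_range (rt 0%N) (leq0n (N 0%N)) t0; have h2 := rt_range (rt 0%N) (N_gt0 0%N) t0.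
have := rt_lt (rt 0%N) (N_gt0 0%N) t0; lra.
Qed.

Lemma speed_ge0 : 0 <= W.
Proof. by have /andP[] := rt_vel (rt 0%N) (leq0n (N 0%N)) t0; exact: le_trans. Qed.

Let rb : 0 <= rhobar. Proof. exact: ltW (rhobar_gt0 nonlin). Qed.

Lemma measurable_traffic_box : measurable K.
Proof. by apply: measurableX; exact: measurable_itv. Qed.

Lemma traffic_box_lty : (leb2 K < +oo)%E.
Proof.
rewrite leb2E; [|exact: measurable_itv|exact: measurable_itv].
rewrite leb_itv_co ?(ltW range_lt)// (_ : leb `]0%R, T[%classic = T%:E) -?EFinM ?ltry//.
have : (lebesgue_measure (`]0%R, T[%classic : set R) = T%:E :> \bar R)%E.
  by rewrite lebesgue_measure_itv /= lte_fin T_gt0 -EFinB subr0.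
exact.
Qed.

Lemma traffic_box_sub : K `<=` O.
Proof. by move=> [t y] []. Qed.

Let measO : measurable O. Proof. exact: measurable_open_strip. Qed.

Let inO t y : O (t, y) -> 0 < t < T.
Proof. by move=> [/=]; rewrite in_itv. Qed.

Let oc t : 0 < t < T -> 0 <= t <= T. Proof. by move=> /andP[/ltW -> /ltW ->]. Qed.

Let curves_in n t y : 0 <= t <= T -> z n 0%N t <= y < z n (N n) t -> s <= y < S.
Proof.
move=> tT /andP[a b]; have /andP[c _] := rt_range (rt n) (leq0n (N n)) tT.
have /andP[_ d] := rt_range (rt n) (leqnn (N n)) tT.
by rewrite (le_trans c a) (lt_le_trans b d).
Qed.

Let in_box t y : 0 < t < T -> s <= y < S -> K (t, y).
Proof. by move=> tT sy; split => /=; rewrite in_itv. Qed.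

Lemma rho_seq_m n : measurable_fun setT (rho_seq n \_ O).
Proof. exact: measurable_rhoN T_gt0 (rt n). Qed.

Lemma e1_seq_m n : measurable_fun setT (e1_seq n \_ O).
Proof. exact: measurable_e1N T_gt0 (rt n). Qed.

Lemma e2_seq_m n : measurable_fun setT (e2_seq n \_ O).
Proof. exact: measurable_e2N T_gt0 (rt n). Qed.

Lemma relax_seq_m n : measurable_fun setT (relax_seq n \_ O).
Proof. exact: measurable_relaxN T_gt0 (N_gt0 n) nonlin (rt n). Qed.

Lemma rho_seq_C n p : O p -> 0 <= rho_seq n p <= rhobar.
Proof. by case: p => t y /inO/oc tT; have [] := interpolants_range T_gt0 nonlin (rt n) y tT. Qed.

Lemma e1_seq_C n p : O p -> 0 <= e1_seq n p <= rhobar * W.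
Proof. by case: p => t y /inO/oc tT; have [] := interpolants_range T_gt0 nonlin (rt n) y tT. Qed.

Lemma e2_seq_C n p : O p -> 0 <= e2_seq n p <= rhobar * W * W.
Proof. by case: p => t y /inO/oc tT; have [] := interpolants_range T_gt0 nonlin (rt n) y tT. Qed.

Lemma rho_seq_supp n p : O p -> rho_seq n p != 0 -> z n 0%N p.1 <= p.2 < z n (N n) p.1.
Proof.
case: p => t y /inO/oc tT ne; have [_ _ _] := interpolants_range T_gt0 nonlin (rt n) y tT.
by apply; left.
Qed.

Lemma e1_seq_supp n p : O p -> e1_seq n p != 0 -> z n 0%N p.1 <= p.2 < z n (N n) p.1.
Proof.
case: p => t y /inO/oc tT ne; have [_ _ _] := interpolants_range T_gt0 nonlin (rt n) y tT.
by apply; right; left.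
Qed.

Lemma e2_seq_supp n p : O p -> e2_seq n p != 0 -> z n 0%N p.1 <= p.2 < z n (N n) p.1.
Proof.
case: p => t y /inO/oc tT ne; have [_ _ _] := interpolants_range T_gt0 nonlin (rt n) y tT.
by apply; right; right.
Qed.

Lemma relax_seq_supp n p : O p -> relax_seq n p != 0 -> z n 0%N p.1 <= p.2 < z n (N n) p.1.
Proof.
case: p => t y /inO tT ne; have [_] := relaxN_range T_gt0 nonlin (rt n) y tT.
exact.
Qed.

Let supp_box (v : nat -> R * R -> R) :
  (forall n p, O p -> v n p != 0 -> z n 0%N p.1 <= p.2 < z n (N n) p.1) ->
  forall n p, O p -> v n p != 0 -> K p.
Proof.
move=> H n [t y] Op /(H n _ Op) /= c; have tT := inO Op.
by apply: in_box => //; apply: curves_in c; exact: oc.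
Qed.

Definition rho_seq_K := supp_box rho_seq_supp.
Definition e1_seq_K := supp_box e1_seq_supp.
Definition e2_seq_K := supp_box e2_seq_supp.
Definition relax_seq_K := supp_box relax_seq_supp.

Lemma rho0_seq_m n : measurable_fun setT (rho0_seq n \_ setT).
Proof. by rewrite patch_setT; exact: measurable_rhoN_slice. Qed.

Lemma e10_seq_m n : measurable_fun setT (e10_seq n \_ setT).
Proof. by rewrite patch_setT; exact: measurable_e1N_slice. Qed.

Lemma rho0_seq_C n y : [set: R] y -> 0 <= rho0_seq n y <= rhobar.
Proof. by move=> _; have [] := interpolants_range T_gt0 nonlin (rt n) y t0. Qed.

Lemma e10_seq_C n y : [set: R] y -> 0 <= e10_seq n y <= rhobar * W.
Proof. by move=> _; have [] := interpolants_range T_gt0 nonlin (rt n) y t0. Qed.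

Lemma rho0_seq_K n y : [set: R] y -> rho0_seq n y != 0 -> K1 y.
Proof.
move=> _ ne; have [_ _ _ H] := interpolants_range T_gt0 nonlin (rt n) y t0.
by rewrite /K1 /= in_itv /=; apply: (curves_in t0); apply: H; left.
Qed.

Lemma e10_seq_K n y : [set: R] y -> e10_seq n y != 0 -> K1 y.
Proof.
move=> _ ne; have [_ _ _ H] := interpolants_range T_gt0 nonlin (rt n) y t0.
by rewrite /K1 /= in_itv /=; apply: (curves_in t0); apply: H; right; left.
Qed.

Lemma K1_lty : (lebesgue_measure K1 < +oo)%E.
Proof.
have : (leb K1 < +oo)%E by rewrite /K1 leb_itv_co ?ltry// ltW// range_lt.
exact.
Qed.

Lemma relax_seq_ge0 n p : 0 <= (relax_seq n \_ O) p.
Proof.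
rewrite patchE; case: ifPn => //; rewrite inE; case: p => t y /inO tT.
by have [] := relaxN_range T_gt0 nonlin (rt n) y tT.
Qed.

Lemma relax_seq_D n p : (relax_seq n \_ O) p != 0 -> 0 <= p.1 < T /\ s <= p.2 < S.
Proof.
rewrite patchE; case: ifPn => [|_]; last by rewrite eqxx.
rewrite inE => Op /(relax_seq_K Op); case: p Op => t y _ [/=].
by rewrite !in_itv /= => /andP[/ltW -> ->].
Qed.

Lemma relax_seq_i n : leb2.-integrable setT (EFin \o (relax_seq n \_ O)).
Proof. exact: relaxN_integrable T_gt0 eps_gt0 gam_gt0 (N_gt0 n) nonlin F_le (rt n). Qed.

Lemma relax_seq_M n : \int[leb2]_p (relax_seq n \_ O) p <= (T * M + eps * W) / gam.
Proof.
rewrite ler_pdivlMr// mulrC.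
exact: relaxN_mass T_gt0 eps_gt0 gam_gt0 (N_gt0 n) nonlin F_le (rt n).
Qed.

Lemma seq_lipschitz0 n t u : 0 <= t <= T -> 0 <= u <= T ->
  `|z n 0%N t - z n 0%N u| <= W * `|t - u|.
Proof. by move=> tT uT; exact: (curve_lipschitz (rt n)). Qed.

Lemma seq_lipschitzN n t u : 0 <= t <= T -> 0 <= u <= T ->
  `|z n (N n) t - z n (N n) u| <= W * `|t - u|.
Proof. by move=> tT uT; exact: (curve_lipschitz (rt n)). Qed.

(** A single countable type, so that one extraction serves all the convergences: the two extreme
    curves at rational times, the two initial data on rays, the three interpolants on products of
    rays, and the code masses of the singular density. *)
Definition extraction_index : countType :=
  ((rat + rat) + (option rat + option rat) +
   ('I_3 * (option rat * option rat) + nat * nat))%type.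

Definition plane_seq (k : 'I_3) : nat -> R * R -> R :=
  if k == 0 then rho_seq else if k == 1 then e1_seq else e2_seq.

Definition extraction_seq (i : extraction_index) (n : nat) : R :=
  match i with
  | inl (inl (inl q)) => z n 0%N (clamp T (ratr q))
  | inl (inl (inr q)) => z n (N n) (clamp T (ratr q))
  | inl (inr (inl o)) => intw lebesgue_measure (fun n => rho0_seq n \_ setT) n (ray o)
  | inl (inr (inr o)) => intw lebesgue_measure (fun n => e10_seq n \_ setT) n (ray o)
  | inr (inl (k, (o1, o2))) =>
      intw leb2_sigma (fun n => plane_seq k n \_ O) n (ray o1 `*` ray o2)
  | inr (inr (k, j)) => code_mass T s S (fun n => relax_seq n \_ O) n k j
  end.

Lemma extraction_bound i : exists B, forall n, `|extraction_seq i n| <= B.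
Proof.
have rW : 0 <= rhobar * W by rewrite mulr_ge0 ?speed_ge0.
have rWW : 0 <= rhobar * W * W by rewrite mulr_ge0 ?speed_ge0.
have mK1 : measurable (K1 : set (measurableTypeR R)) by exact: measurable_itv.
have curve n j t : (j <= N n)%N -> `|z n j (clamp T t)| <= `|s| + `|S|.
  move=> jN; have /andP[a b] := rt_range (rt n) jN (clamp_range T0 t).
  rewrite ler_norml; have := ler_norm (- s); have := ler_norm S.
  by rewrite normrN; have := normr_ge0 s; have := normr_ge0 S; lra.
case: i => [[[q|q]|[q|q]]|[[k [a1 a2]]|[k j]]] /=.
- by exists (`|s| + `|S|) => n; exact: curve.
- by exists (`|s| + `|S|) => n; exact: curve.
- eexists => n; apply: (intw_restrict_bound mK1 K1_lty rb rho0_seq_m rho0_seq_C rho0_seq_K).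
  exact: measurable_ray.
- eexists => n; apply: (intw_restrict_bound mK1 K1_lty rW e10_seq_m e10_seq_C e10_seq_K).
  exact: measurable_ray.
- have mr : measurable (ray a1 `*` ray a2 : set (R * R)).
    by apply: measurableX; exact: measurable_ray.
  rewrite /plane_seq; case: ifP => _; last case: ifP => _; eexists => n.
  + exact: (@intw_restrict_bound _ _ _ (@leb2_sigma R) O K rhobar measurable_traffic_box
      traffic_box_lty rb rho_seq rho_seq_m rho_seq_C rho_seq_K n _ mr).
  + exact: (@intw_restrict_bound _ _ _ (@leb2_sigma R) O K _ measurable_traffic_box
      traffic_box_lty rW e1_seq e1_seq_m e1_seq_C e1_seq_K n _ mr).
  + exact: (@intw_restrict_bound _ _ _ (@leb2_sigma R) O K _ measurable_traffic_box
      traffic_box_lty rWW e2_seq e2_seq_m e2_seq_C e2_seq_K n _ mr).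
- exists ((T * M + eps * W) / gam) => n.
  have /andP[a b] := code_mass_bound T_gt0 range_lt relax_seq_ge0 relax_seq_i relax_seq_M n k j.
  by rewrite ger0_norm.
Qed.

Lemma test_integrable (v g : R * R -> R) (C B : R) :
  measurable_fun setT (v \_ O) -> (forall p, O p -> 0 <= v p <= C) ->
  (forall p, O p -> v p != 0 -> K p) ->
  continuous (clamp_test T g) -> (forall p, K p -> `|g p| <= B) ->
  leb2.-integrable O (EFin \o (fun p => v p * g p)).
Proof.
move=> mv vC vK gc gB; have mK := measurable_traffic_box.
have gE p : O p -> clamp_test T g p = g p.
  by case: p => t y /inO tT; rewrite /clamp_test /= clamp_id// oc.
apply/(@integrable_mkcond _ _ R leb2 _ (EFin \o (fun p => v p * g p)) measO).
rewrite restrict_EFin.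
have iK := @indic_integrable _ (measurableTypeR R * measurableTypeR R)%type R (@leb2 R) K mK traffic_box_lty.
apply: (dominated_integrable (scaled_integrable (`|C| * `|B|) iK)).
  rewrite (_ : _ \_ _ = (fun p => (v \_ O) p * clamp_test T g p)).
    by apply: measurable_funM => //; exact: continuous_measurable_plane.
  by apply/funext => p; rewrite !patchE; case: ifPn; rewrite ?mul0r// inE => /gE ->.
move=> p; rewrite patchE; case: ifPn => [|_]; last by rewrite normr0.
rewrite inE => Op; have [e|ne] := eqVneq (v p) 0; first by rewrite e mul0r normr0.
have Kp := vK p Op ne; rewrite indicE mem_set// mulr1 !normrM !normr_id.
apply: ler_pM => //.
  by have /andP[a b] := vC p Op; rewrite !ger0_norm// (le_trans a b).
by rewrite (le_trans (gB p Kp))// ler_norm.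
Qed.

Context (Hc : forall i, cvgn (extraction_seq i)) (N_ge : forall n, (n <= N n)%N).

Let rW : 0 <= rhobar * W. Proof. by rewrite mulr_ge0 ?speed_ge0. Qed.
Let rWW : 0 <= rhobar * W * W. Proof. by rewrite mulr_ge0 ?speed_ge0. Qed.

Let cpt_box : compact box.
Proof. by apply: compact_setX; exact: segment_compact. Qed.

Let K_box : K `<=` box.
Proof.
move=> [t y] [] /=; rewrite !in_itv /= => /andP[/ltW t1 /ltW t2] /andP[s1 /ltW s2].
by split => /=; rewrite in_itv /= ?t1 ?t2 ?s1 ?s2.
Qed.

Lemma plane_limit (k : 'I_3) (C : R) : 0 <= C ->
  (forall n, measurable_fun setT (plane_seq k n \_ O)) ->
  (forall n p, O p -> 0 <= plane_seq k n p <= C) ->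
  (forall n p, O p -> plane_seq k n p != 0 -> K p) ->
  exists f : R * R -> R,
  [/\ measurable_fun setT f, forall p, 0 <= f p <= C * \1_K p,
      cvg_weakstar_Linfty leb2 O (plane_seq k) f &
      forall g : R * R -> R, leb2.-integrable K (EFin \o g) ->
        \int[leb2]_(p in O) (plane_seq k n p * g p) @[n --> \oo] -->
        \int[leb2]_(p in O) (f p * g p)].
Proof.
move=> C0 mk kC kK.
have cB := @intw_plane_cvg R K C measurable_traffic_box traffic_box_lty C0
  (fun n => plane_seq k n \_ O) mk (@restrict_ge0 R _ _ O C (plane_seq k) kC)
  (@restrict_le R _ _ O K C C0 (plane_seq k) kC kK)
  (fun o1 o2 => @Hc (inr (inl (k, (o1, o2))))).
exact: (@weakstar_limit R _ _ (@leb2_sigma R) O K C measO measurable_traffic_box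
  traffic_box_sub traffic_box_lty C0 (plane_seq k) mk kC kK cB).
Qed.

Lemma line_limit (v : nat -> R -> R) (C : R) : 0 <= C ->
  (forall n, measurable_fun setT (v n \_ setT)) ->
  (forall n y, [set: R] y -> 0 <= v n y <= C) ->
  (forall n y, [set: R] y -> v n y != 0 -> K1 y) ->
  (forall o, cvgn (fun n => intw lebesgue_measure (fun n => v n \_ setT) n (ray o))) ->
  exists f : R -> R,
  [/\ measurable_fun setT f, forall y, 0 <= f y <= C * \1_K1 y,
      cvg_weakstar_Linfty leb setT v f &
      forall g : R -> R, leb.-integrable K1 (EFin \o g) ->
        \int[leb]_y (v n y * g y) @[n --> \oo] --> \int[leb]_y (f y * g y)].
Proof.
move=> C0 mv vC vK vr.
have mK1 : measurable (K1 : set (measurableTypeR R)) by exact: measurable_itv.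
have mT : measurable (setT : set (measurableTypeR R)) by exact: measurableT.
have cB := @intw_dynkin _ _ _ lebesgue_measure K1 C mK1 K1_lty C0
  (fun n => v n \_ setT) mv (@restrict_ge0 R _ _ setT C v vC)
  (@restrict_le R _ _ setT K1 C C0 v vC vK) _ measurable_rays rays_setI_closed
  (vr None) (fun B Br => let: ex_intro2 o _ oB := Br in
     eq_ind (ray o) (fun B => cvgn (fun n => intw lebesgue_measure (fun n => v n \_ setT) n B)) (vr o) B oB).
exact: (@weakstar_limit R _ _ lebesgue_measure setT K1 C mT mK1 (@subsetT _ _)
  K1_lty C0 v mv vC vK cB).
Qed.

Lemma relax_limit : exists lam : @planar_measure R,
  [/\ (lam setT < +oo)%E, lam (~` box) = 0%E &
  forall psi : R * R -> R, continuous psi ->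
    \int[leb2]_p (psi p * (relax_seq n \_ O) p) @[n --> \oo] --> \int[lam]_p psi p].
Proof.
exact: (measure_compactness T_gt0 range_lt relax_seq_m relax_seq_ge0 relax_seq_D
  relax_seq_i relax_seq_M (fun k j => @Hc (inr (inr (k, j))))).
Qed.

Lemma curve_limits : exists xlow xup : R -> R,
  (forall e, 0 < e -> exists n0, forall n, (n0 <= n)%N -> forall t, 0 <= t <= T ->
     `|xlow t - z n 0%N t| < e) /\
  (forall e, 0 < e -> exists n0, forall n, (n0 <= n)%N -> forall t, 0 <= t <= T ->
     `|xup t - z n (N n) t| < e).
Proof.
have [l Hl] := equilipschitz_uniform_limit speed_ge0 seq_lipschitz0
  (fun q => @Hc (inl (inl (inl q)))).
have [u Hu] := equilipschitz_uniform_limit speed_ge0 seq_lipschitzN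
  (fun q => @Hc (inl (inl (inr q)))).
by exists l, u.
Qed.

(** * Supports of the limits *)

Section limit_supports.
Context (xlow xup : R -> R)
  (low_cvg : forall e, 0 < e -> exists n0, forall n, (n0 <= n)%N -> forall t, 0 <= t <= T ->
     `|xlow t - z n 0%N t| < e)
  (up_cvg : forall e, 0 < e -> exists n0, forall n, (n0 <= n)%N -> forall t, 0 <= t <= T ->
     `|xup t - z n (N n) t| < e).

Definition traffic_region : set (R * R) :=
  \bigcup_(t in `[0, T]) ([set t] `*` `[xlow t, xup t]).

Lemma traffic_region_box : traffic_region `<=` box.
Proof.
move=> [t y] [u uT [/= -> ]]; rewrite in_itv /= => /andP[a b].
have tT : 0 <= u <= T by move: uT; rewrite /= in_itv.
split => /=; first by rewrite in_itv.
rewrite in_itv /=; apply/andP; split; rewrite leNgt; apply/negP => h.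
  have e0 : 0 < s - xlow u by rewrite subr_gt0 (le_lt_trans a).
  have [n0 H] := low_cvg e0; have := H n0 (leqnn _) u tT.
  have /andP[c _] := rt_range (rt n0) (leq0n (N n0)) tT.
  rewrite ltr_norml => /andP[]; lra.
have e0 : 0 < xup u - S by rewrite subr_gt0 (lt_le_trans h).
have [n0 H] := up_cvg e0; have := H n0 (leqnn _) u tT.
have /andP[_ c] := rt_range (rt n0) (leqnn (N n0)) tT.
rewrite ltr_norml => /andP[]; lra.
Qed.

Lemma off_region p : ~ traffic_region p ->
  exists2 r : R, 0 < r & exists n0, forall n, (n0 <= n)%N -> forall q, `|p - q| < r ->
    0 <= q.1 <= T -> ~ (z n 0%N q.1 <= q.2 <= z n (N n) q.1).
Proof.
exact: (off_support speed_ge0 seq_lipschitz0 seq_lipschitzN low_cvg up_cvg).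
Qed.

(** Around a point off the region, the functions of large rank vanish on a fixed neighbourhood, and
    [weakstar_limit_ae0] hands this to the limit. *)
Lemma plane_limit_supp (v : nat -> R * R -> R) (f : R * R -> R) (C : R) : 0 <= C ->
  (forall n p, O p -> v n p != 0 -> z n 0%N p.1 <= p.2 < z n (N n) p.1) ->
  measurable_fun setT f -> (forall p, 0 <= f p <= C * \1_K p) ->
  cvg_weakstar_Linfty leb2 O v f -> supp_on T f `<=` traffic_region.
Proof.
move=> C0 vsupp mf fC fcvg p fp; apply: contrapT => /off_region[r r0 [n0 Hn]].
apply: (fp (ball p r)°); first exact: open_interior.
  by apply: nbhsx_ballx.
have mB : measurable (O `&` (ball p r)°).
  by apply: measurableI => //; apply: open_measurable_plane; exact: open_interior.
have v0 n q : (n0 <= n)%N -> (O `&` (ball p r)°) q -> v n q = 0.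
  move=> nn [Oq Uq]; apply: contrapT => /eqP vq.
  have := vsupp n q Oq vq; case: q Oq Uq {vq} => t y Oq Uq.
  move=> /andP[a /ltW b]; apply: (Hn n nn (t, y)).
  - by have := @interior_subset _ (ball p r) _ Uq; rewrite -ball_normE.
  - exact: oc (inO Oq).
  - by rewrite /= a b.
have H := @weakstar_limit_ae0 R _ _ (@leb2_sigma R) O K C measO measurable_traffic_box
  traffic_box_lty C0 v f _ n0 mB (@subIsetl _ _ _) mf fC fcvg v0.
by apply: filterS H => q Hq Oq Uq; apply: Hq.
Qed.

Lemma compact_in_region (A : set (R * R)) : closed A -> A `<=` traffic_region -> compact A.
Proof.
move=> cA AQ; apply: (subclosed_compact cA cpt_box) => p /AQ; exact: traffic_region_box.
Qed.

Lemma relax_limit_supp (lam : @planar_measure R) : (lam setT < +oo)%E ->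
  (forall psi : R * R -> R, continuous psi ->
    \int[leb2]_p (psi p * (relax_seq n \_ O) p) @[n --> \oo] --> \int[lam]_p psi p) ->
  measure_supp lam `<=` traffic_region.
Proof.
move=> lamT lamc p lp; apply: contrapT => /off_region[r r0 [n0 Hn]].
(* A continuous bump, positive exactly on the ball around [p]. Its integral against [lam] is the
   limit of a sequence eventually zero, so the ball is null. *)
pose psi (q : R * R) := Num.max 0 (r - `|p - q|).
have psi0 q : 0 <= psi q by rewrite /psi le_max lexx.
have psic : continuous psi.
  move=> q; apply/(@continuous_at_distP R (R * R)%type R) => e e0; exists e => // q' qq.
  apply: le_lt_trans qq.
  have E : (p - q) - (p - q') = q' - q by rewrite opprB addrC addrA subrK.
  have := ler_dist_dist (p - q) (p - q'); rewrite E (distrC q').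
  rewrite /psi /Num.max; set a := `|p - q|; set b := `|p - q'|; set c := `|q - q'|.
  rewrite !ler_norml => /andP[? ?].
  by case: ltP => ?; case: ltP => ?; apply/andP; split; lra.
have mpsi : measurable_fun setT psi by exact: continuous_measurable_plane.
have I0 : \int[lam]_q psi q = 0.
  apply: (cvg_unique (@Rhausdorff R) (lamc psi psic)); apply: (cvg_near_cst 0).
  exists n0 => // n /= nn; rewrite (_ : (fun q => _) = cst 0).
    by rewrite /Rintegral integral0.
  apply/funext => q; rewrite patchE; case: ifPn => [|_]; last by rewrite mulr0.
  rewrite inE => Oq; have [qr|qr] := ltP `|p - q| r; last first.
    by rewrite /psi max_l ?mul0r// subr_le0.
  have [->|ne] := eqVneq (relax_seq n q) 0; first by rewrite mulr0.
  have /andP[a /ltW b] := relax_seq_supp Oq ne; case: q Oq qr {ne} a b => t y Oq qr a b.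
  by exfalso; apply: (Hn n nn (t, y) qr (oc (inO Oq))); rewrite a b.
have ipsi : lam.-integrable setT (EFin \o psi).
  apply: measurable_bounded_integrable => //.
  exists r; split; first exact: num_real.
  move=> c rc q _ /=; rewrite ger0_norm// (le_trans _ (ltW rc))// /psi ge_max (ltW r0)/=.
  by rewrite lerBlDr lerDl.
have mT : measurable (setT : set (measurableTypeR R * measurableTypeR R)) by exact: measurableT.
have mE : measurable_fun setT (EFin \o psi) by apply/measurable_EFinP.
have A0 : (\int[lam]_(q in setT) `|(EFin \o psi) q|)%E = 0%E.
  under eq_integral => q _ do rewrite /= ger0_norm//.
  have fn := integrable_fin_num mT ipsi.
  by rewrite -[LHS]fineK// -[fine _]/(\int[lam]_q psi q) I0.
have [A [mA lA HA]] := (ae_eq_integral_abs lam mT mE).1 A0.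
have oU : open ((ball p r)° : set (R * R)) by exact: open_interior.
have /eqP := lp _ oU (nbhsx_ballx p _ r0); apply.
apply/eqP; rewrite eq_le measure_ge0 andbT -lA.
apply: le_measure; rewrite ?inE//; first exact: open_measurable_plane.
move=> q Uq; apply: HA => /=.
have := @interior_subset _ (ball p r) _ Uq; rewrite -ball_normE /= => pq.
move=> /(_ I) [] e; move: pq; rewrite -subr_gt0 => pq.
by move: e; rewrite /psi max_r ?(ltW pq)// => e; rewrite e ltxx in pq.
Qed.

End limit_supports.
Lemma box_integrable (g : R * R -> R) (B : R) :
  continuous (clamp_test T g) -> (forall p, K p -> `|g p| <= B) ->
  leb2.-integrable K (EFin \o g).
Proof.
move=> gc gB; have gE p : K p -> clamp_test T g p = g p.
  by case: p => t y [/= +] _; rewrite in_itv /= => tT; rewrite /clamp_test /= clamp_id// oc.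
have mg : measurable_fun setT (clamp_test T g) by exact: continuous_measurable_plane.
have mgK : measurable_fun K g.
  apply: (@eq_measurable_fun _ _ _ _ K (clamp_test T g)).
    by move=> p; rewrite inE => Kp; rewrite gE.
  exact: measurable_funTS.
have mK : measurable (K : set (measurableTypeR R * measurableTypeR R)).
  exact: measurable_traffic_box.
have Koo : (leb2 K < +oo)%E by exact: traffic_box_lty.
apply: (measurable_bounded_integrable mK Koo mgK).
exists B; split; first exact: num_real.
by move=> c Bc p Kp /=; rewrite (le_trans (gB p Kp))// ltW.
Qed.

Lemma test_modulus (f : R * R -> R) : {within strip T, continuous f} ->
  (exists2 B : R, 0 < B & forall t y, s <= y <= S -> `|clamp_test T f (t, y)| <= B) /\
  forall eta, 0 < eta -> exists2 L : R, 0 < L & almost_lipschitz s S eta L (clamp_test T f).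
Proof.
move=> fc; have fb : {within box, continuous f}.
  by apply: continuous_subspaceW fc => -[t y] [tT _].
have inb t y : s <= y <= S -> box (clamp T t, y).
  by move=> sy; split => /=; rewrite in_itv //= clamp_range.
split.
  have [B B0 HB] := compact_bound cpt_box fb.
  by exists B => // t y sy; apply: HB; exact: inb.
move=> eta eta0; have [L L0 HL] := compact_almost_lipschitz cpt_box fb eta0.
exists L => // t y y' sy sy'; have := HL _ _ (inb t y sy) (inb t y' sy').
by rewrite prod_normE /= subrr normr0 max_r.
Qed.

Lemma almost_lipschitz_le (f : R * R -> R) (eta L L' : R) : L <= L' ->
  almost_lipschitz s S eta L f -> almost_lipschitz s S eta L' f.
Proof.
move=> LL fL t y y' sy sy'; rewrite (le_trans (fL t y y' sy sy'))// lerD2l.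
by rewrite ler_wpM2r.
Qed.

(** The order of choices: [eta] from the target [e], then [L] from [eta], then n beyond L / eta,
    where [N n >= n] makes the second term smaller than [eta]. *)
Lemma defect_cvg0 (d : nat -> R) (C : R) :
  (forall eta, 0 < eta -> exists2 L : R, 0 < L &
     forall n, `|d n| <= C * (eta + L / (N n)%:R)) ->
  d n @[n --> \oo] --> (0 : R).
Proof.
move=> H; apply/cvgn_distP => e e0.
have C1 : 0 < `|C| + 1 by rewrite ltr_wpDl.
have eta0 : 0 < e / (`|C| + 1) / 2 by rewrite !divr_gt0.
have [L L0 HL] := H _ eta0; set eta := e / (`|C| + 1) / 2 in eta0 HL.
exists (Num.truncn (L / eta)).+1 => n nn; rewrite sub0r normrN.
have NR : 0 < (N n)%:R :> R by rewrite ltr0n.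
have LN : L / (N n)%:R < eta.
  rewrite ltr_pdivrMr// mulrC -ltr_pdivrMr//.
  by rewrite (lt_le_trans (truncnS_gt _))// ler_nat (leq_trans nn).
have pos : 0 <= eta + L / (N n)%:R by rewrite addr_ge0 ?(ltW eta0)// divr_ge0// ltW.
apply: (le_lt_trans (HL n)); apply: (@le_lt_trans _ _ (`|C| * (eta + L / (N n)%:R))).
  by rewrite ler_wpM2r// ler_norm.
apply: (@le_lt_trans _ _ (`|C| * (2 * eta))).
  by rewrite ler_wpM2l//; lra.
have -> : 2 * eta = e / (`|C| + 1) by rewrite /eta mulrC divfK ?pnatr_eq0.
by rewrite mulrA ltr_pdivrMr// mulrDr mulr1 [e * _]mulrC ltrDl.
Qed.

(** * The limit equations *)

Section limit_equations.
Context (Phi : R * R -> R) (Phi_C1 : C1_strip T Phi) (PhiT : forall y, Phi (T, y) = 0).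

Lemma test_constants : exists B : R, [/\ 0 < B,
  forall t y, s <= y <= S -> `|clamp_test T (dt T Phi) (t, y)| <= B,
  forall t y, s <= y <= S -> `|clamp_test T (dx Phi) (t, y)| <= B &
  forall t y, s <= y <= S -> `|clamp_test T Phi (t, y)| <= B].
Proof.
have [Pc _ _ Ac Bc] := Phi_C1.
have [[B1 B10 H1] _] := test_modulus Ac; have [[B2 B20 H2] _] := test_modulus Bc.
have [[B3 B30 H3] _] := test_modulus Pc.
exists (B1 + B2 + B3); split; first by rewrite !addr_gt0.
- by move=> t y /(H1 t) h; rewrite (le_trans h)// -addrA lerDl addr_ge0// ltW.
- by move=> t y /(H2 t) h; rewrite (le_trans h)// addrAC lerDr addr_ge0// ltW.
- by move=> t y /(H3 t) h; rewrite (le_trans h)// lerDr addr_ge0// ltW.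
Qed.

Lemma test_moduli (eta : R) : 0 < eta -> exists2 L : R, 0 < L &
  [/\ almost_lipschitz s S eta L (clamp_test T (dt T Phi)),
      almost_lipschitz s S eta L (clamp_test T (dx Phi)),
      almost_lipschitz s S eta L (clamp_test T Phi) &
      almost_lipschitz s S eta L (clamp_force T F)].
Proof.
move=> eta0; have [Pc _ _ Ac Bc] := Phi_C1.
have [_ /(_ _ eta0)[L1 L10 H1]] := test_modulus Ac.
have [_ /(_ _ eta0)[L2 L20 H2]] := test_modulus Bc.
have [_ /(_ _ eta0)[L3 L30 H3]] := test_modulus Pc.
have [_ /(_ _ eta0)[L4 L40 H4]] := test_modulus (F_continuous nonlin).
exists (L1 + L2 + L3 + L4); first by rewrite !addr_gt0.
split.
- by apply: almost_lipschitz_le H1; rewrite -!addrA lerDl !addr_ge0// ltW.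
- by apply: almost_lipschitz_le H2; rewrite -addrA addrAC lerDr !addr_ge0// ltW.
- by apply: almost_lipschitz_le H3; rewrite addrAC lerDr !addr_ge0// ltW.
- by apply: almost_lipschitz_le H4; rewrite lerDr !addr_ge0// ltW.
Qed.

Let test_cts : [/\ continuous (clamp_test T (dt T Phi)),
  continuous (clamp_test T (dx Phi)) & continuous (clamp_test T Phi)].
Proof. exact: test_cont. Qed.

Let KtestE (f : R * R -> R) p : K p -> f p = clamp_test T f (p.1, p.2).
Proof.
case: p => t y [/= +] _; rewrite in_itv /= => tT.
by rewrite /clamp_test /= clamp_id// oc.
Qed.

Let Krange p : K p -> s <= p.2 <= S.
Proof. by move=> /K_box[_] /=; rewrite in_itv. Qed.

Let test_K (f : R * R -> R) (B : R) :
  (forall t y, s <= y <= S -> `|clamp_test T f (t, y)| <= B) ->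
  forall p, K p -> `|f p| <= B.
Proof. by move=> H p Kp; rewrite KtestE//; apply: H; exact: Krange. Qed.

Let limit_C (f : R * R -> R) (C : R) : 0 <= C -> (forall p, 0 <= f p <= C * \1_K p) ->
  forall p, O p -> 0 <= f p <= C.
Proof.
move=> C0 fC p _; have /andP[-> h] := fC p; rewrite (le_trans h)// indicE ler_piMr//.
by case: (_ \in _).
Qed.

Let limit_K (f : R * R -> R) (C : R) : (forall p, 0 <= f p <= C * \1_K p) ->
  forall p, O p -> f p != 0 -> K p.
Proof.
move=> fC p _ ne; apply: contrapT => nK; have := fC p.
by rewrite indicE memNset// mulr0 -eq_le eq_sym (negbTE ne).
Qed.

Let limit_m (f : R * R -> R) : measurable_fun setT f -> measurable_fun setT (f \_ O).
Proof.
move=> mf; apply/(measurable_restrict _ measO measurableT); rewrite setTI.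
exact: measurable_funTS.
Qed.

Let line_test : leb.-integrable K1 (EFin \o (fun y => Phi (0, y))).
Proof.
have [B [_ _ _ HB]] := test_constants; have [_ _ Pc] := test_cts.
have c0 : clamp T 0 = 0 by exact: clamp_id.
apply: (@bounded_itv_integrable R _ s S B).
  apply: continuous_measurable_fun => y.
  rewrite (_ : (fun y => _) = (fun y => clamp_test T Phi (0, y))); last first.
    by apply/funext => y'; rewrite /clamp_test /= c0.
  apply: (@continuous_comp _ _ _ (fun y => (0, y)) (clamp_test T Phi)); last exact: Pc.
  apply/(@continuous_at_distP R R (R * R)%type) => e e0; exists e => // u yu.
  by rewrite prod_normE gt_max /= subrr normr0 e0.
move=> y /andP[a /ltW b]; have := HB 0 y; rewrite /clamp_test /= c0; apply.
by rewrite a b.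
Qed.

Let IntD (f g : R * R -> R) : leb2.-integrable O (EFin \o f) ->
  leb2.-integrable O (EFin \o g) ->
  leb2.-integrable O (EFin \o (fun p => f p + g p)) /\
  \int[leb2]_(p in O) (f p + g p) = \int[leb2]_(p in O) f p + \int[leb2]_(p in O) g p.
Proof.
have mO : measurable (O : set (measurableTypeR R * measurableTypeR R)) by exact: measO.
move=> fi gi; split; first exact: (integrableD mO fi gi).
by rewrite RintegralD.
Qed.

Let IntZ (f : R * R -> R) c : leb2.-integrable O (EFin \o f) ->
  leb2.-integrable O (EFin \o (fun p => c * f p)) /\
  \int[leb2]_(p in O) (c * f p) = c * \int[leb2]_(p in O) f p.
Proof.
have mO : measurable (O : set (measurableTypeR R * measurableTypeR R)) by exact: measO.
move=> fi; split; first exact: (integrableZl mO c fi).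
by rewrite RintegralZl.
Qed.

(** Each term of the approximate equation converges by weak star convergence, and their sum tends to
    0 by [mass_defect]; limits are unique. *)
Lemma limit_mass (rho e1 : R * R -> R) (rho0 : R -> R) :
  measurable_fun setT rho -> (forall p, 0 <= rho p <= rhobar * \1_K p) ->
  measurable_fun setT e1 -> (forall p, 0 <= e1 p <= rhobar * W * \1_K p) ->
  (forall g, leb2.-integrable K (EFin \o g) ->
     \int[leb2]_(p in O) (rho_seq n p * g p) @[n --> \oo] --> \int[leb2]_(p in O) (rho p * g p)) ->
  (forall g, leb2.-integrable K (EFin \o g) ->
     \int[leb2]_(p in O) (e1_seq n p * g p) @[n --> \oo] --> \int[leb2]_(p in O) (e1 p * g p)) ->
  (forall g, leb.-integrable K1 (EFin \o g) ->
     \int[leb]_y (rho0_seq n y * g y) @[n --> \oo] --> \int[leb]_y (rho0 y * g y)) ->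
  \int[leb2]_(p in O) (rho p * dt T Phi p + e1 p * dx Phi p) =
  - \int[leb]_y (rho0 y * Phi (0, y)).
Proof.
move=> mrho rhoC me1 e1C rho_cvg e1_cvg rho0_cvg.
have [B [B0 HA HB HP]] := test_constants; have [Ac Bc Pc] := test_cts.
have KA := test_K HA; have KB := test_K HB.
have [_ ->] := IntD (test_integrable (limit_m mrho) (limit_C rb rhoC) (limit_K rhoC) Ac KA)
  (test_integrable (limit_m me1) (limit_C rW e1C) (limit_K e1C) Bc KB).
apply/eqP; rewrite -subr_eq0 opprK; apply/eqP.
have lim : \int[leb2]_(p in O) (rho_seq n p * dt T Phi p) +
      \int[leb2]_(p in O) (e1_seq n p * dx Phi p) +
      \int[leb]_y (rho0_seq n y * Phi (0, y)) @[n --> \oo] -->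
    \int[leb2]_(p in O) (rho p * dt T Phi p) + \int[leb2]_(p in O) (e1 p * dx Phi p) +
      \int[leb]_y (rho0 y * Phi (0, y)).
  apply: cvgD; last exact: (rho0_cvg _ line_test).
  by apply: cvgD; [exact: (rho_cvg _ (box_integrable Ac KA))|exact: (e1_cvg _ (box_integrable Bc KB))].
apply: (cvg_unique (@Rhausdorff R) lim).
apply: (@defect_cvg0 _ ((1 + (1 + W) * T) * (1 + (S - s)))) => eta eta0.
have [L L0 [mA mB mP mF]] := test_moduli eta0; exists L => // n.
have [_ <-] := IntD
  (test_integrable (rho_seq_m n) (@rho_seq_C n) (@rho_seq_K n) Ac KA)
  (test_integrable (e1_seq_m n) (@e1_seq_C n) (@e1_seq_K n) Bc KB).
rewrite -mulrA; exact: (mass_defect T_gt0 (N_gt0 n) (rt n) Phi_C1 (ltW eta0) (ltW L0)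
  PhiT mA mB mP HA HB HP).
Qed.

(** Five terms converge separately: the force by testing rho against F phi, the singular one by
    testing against phi clamped in time, a continuous function on the plane. Their combination tends
    to 0 by [momentum_defect]. *)
Lemma limit_momentum (rho e1 e2 : R * R -> R) (e10 : R -> R) (lam : @planar_measure R) :
  measurable_fun setT rho -> (forall p, 0 <= rho p <= rhobar * \1_K p) ->
  measurable_fun setT e1 -> (forall p, 0 <= e1 p <= rhobar * W * \1_K p) ->
  measurable_fun setT e2 -> (forall p, 0 <= e2 p <= rhobar * W * W * \1_K p) ->
  (forall g, leb2.-integrable K (EFin \o g) ->
     \int[leb2]_(p in O) (rho_seq n p * g p) @[n --> \oo] --> \int[leb2]_(p in O) (rho p * g p)) ->
  (forall g, leb2.-integrable K (EFin \o g) ->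
     \int[leb2]_(p in O) (e1_seq n p * g p) @[n --> \oo] --> \int[leb2]_(p in O) (e1 p * g p)) ->
  (forall g, leb2.-integrable K (EFin \o g) ->
     \int[leb2]_(p in O) (e2_seq n p * g p) @[n --> \oo] --> \int[leb2]_(p in O) (e2 p * g p)) ->
  (forall g, leb.-integrable K1 (EFin \o g) ->
     \int[leb]_y (e10_seq n y * g y) @[n --> \oo] --> \int[leb]_y (e10 y * g y)) ->
  (forall psi : R * R -> R, continuous psi ->
    \int[leb2]_p (psi p * (relax_seq n \_ O) p) @[n --> \oo] --> \int[lam]_p psi p) ->
  eps * \int[leb2]_(p in O) (e1 p * dt T Phi p + e2 p * dx Phi p)
    - gam * \int[lam]_p clamp_test T Phi p =
  - (eps * \int[leb]_y (e10 y * Phi (0, y))) - \int[leb2]_(p in O) (rho p * F p * Phi p).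
Proof.
move=> mrho rhoC me1 e1C me2 e2C rho_cvg e1_cvg e2_cvg e10_cvg lam_cvg.
have [B [B0 HA HB HP]] := test_constants; have [Ac Bc Pc] := test_cts.
have KA := test_K HA; have KB := test_K HB; have KP := test_K HP.
pose FP p := F p * Phi p.
have FPc : continuous (clamp_test T FP).
  by move=> p; apply: cvgM; [exact: (clamp_force_cont T_gt0 nonlin)|exact: Pc].
have KFP p : K p -> `|FP p| <= M * B.
  move=> Kp; rewrite normrM; apply: ler_pM => //; last exact: KP.
  have /K_box[] := Kp; rewrite /= !in_itv /= => tT sy.
  have := F_le tT sy; case: p tT sy {Kp} => t y /= tT sy.
  by rewrite gtr0_norm//; apply: (F_gt0 nonlin); split => //=; rewrite in_itv.
have [i1 E1] := IntD (test_integrable (limit_m me1) (limit_C rW e1C) (limit_K e1C) Ac KA)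
  (test_integrable (limit_m me2) (limit_C rWW e2C) (limit_K e2C) Bc KB).
rewrite E1; have -> : (fun p => rho p * F p * Phi p) = (fun p => rho p * FP p).
  by apply/funext => p; rewrite /FP mulrA.
have lim : eps * (\int[leb2]_(p in O) (e1_seq n p * dt T Phi p) +
       \int[leb2]_(p in O) (e2_seq n p * dx Phi p)) +
     \int[leb2]_(p in O) (rho_seq n p * FP p) -
     gam * \int[leb2]_p (clamp_test T Phi p * (relax_seq n \_ O) p) +
     eps * \int[leb]_y (e10_seq n y * Phi (0, y)) @[n --> \oo] -->
   eps * (\int[leb2]_(p in O) (e1 p * dt T Phi p) + \int[leb2]_(p in O) (e2 p * dx Phi p)) +
     \int[leb2]_(p in O) (rho p * FP p) - gam * \int[lam]_p clamp_test T Phi p +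
     eps * \int[leb]_y (e10 y * Phi (0, y)).
  apply: cvgD; last by apply: cvgM; [exact: cvg_cst|exact: (e10_cvg _ line_test)].
  apply: cvgB; last by apply: cvgM; [exact: cvg_cst|exact: lam_cvg].
  apply: cvgD; last exact: (rho_cvg _ (box_integrable FPc KFP)).
  apply: cvgM; first exact: cvg_cst.
  by apply: cvgD; [exact: (e1_cvg _ (box_integrable Ac KA))|exact: (e2_cvg _ (box_integrable Bc KB))].
suff L0 : eps * (\int[leb2]_(p in O) (e1 p * dt T Phi p) + \int[leb2]_(p in O) (e2 p * dx Phi p)) +
     \int[leb2]_(p in O) (rho p * FP p) - gam * \int[lam]_p clamp_test T Phi p +
     eps * \int[leb]_y (e10 y * Phi (0, y)) = 0.
  have ar (a b c d : R) : a + b - c + d = 0 -> a - c = - d - b.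
    by move=> h; apply/eqP; rewrite -subr_eq0 -[X in _ == X]h; apply/eqP; ring.
  exact: ar.
apply: (cvg_unique (@Rhausdorff R) lim).
pose C1 := (eps * W + eps * W * W + M + B) * T + (T * M + eps * W) +
   (M * T + eps / 2 * (T * W ^+ 2) + eps * W) + eps * W.
apply: (@defect_cvg0 _ (C1 * (1 + (S - s)))) => eta eta0.
have [L L0 [mA mB mP mF]] := test_moduli eta0; exists L => // n.
have := momentum_defect T_gt0 eps_gt0 gam_gt0 (N_gt0 n) nonlin F_le (rt n) Phi_C1
  (ltW eta0) (ltW L0) (ltW B0) PhiT mA mB mP mF HA HB HP.
rewrite mulrA -/C1.
have [j1 F1] := IntD (test_integrable (e1_seq_m n) (@e1_seq_C n) (@e1_seq_K n) Ac KA)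
  (test_integrable (e2_seq_m n) (@e2_seq_C n) (@e2_seq_K n) Bc KB).
have [j2 F2] := IntZ eps j1.
have j3 := test_integrable (rho_seq_m n) (@rho_seq_C n) (@rho_seq_K n) FPc KFP.
have [j4 F4] := IntD j2 j3.
have mO : measurable (O : set (measurableTypeR R * measurableTypeR R)) by exact: measO.
have OE t y : O (t, y) -> clamp_test T Phi (t, y) = Phi (t, y).
  by move=> /inO tT; rewrite /clamp_test /= clamp_id// oc.
have j5 : leb2.-integrable O (EFin \o (fun p => relax_seq n p * Phi p)).
  have hO : leb2.-integrable O (EFin \o relax_seq n).
    apply/(@integrable_mkcond _ _ R leb2 _ (EFin \o relax_seq n) measO).
    by rewrite restrict_EFin; exact: relax_seq_i.
  refine (@dominated_integrable_on _ (measurableTypeR R * measurableTypeR R)%type R (@leb2 R) _ _ _ B mO hO _ _).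
    apply: (@eq_measurable_fun _ _ _ _ _ (fun p => (relax_seq n \_ O) p * clamp_test T Phi p)).
      by move=> [t y]; rewrite inE => Op; rewrite patchE mem_set// OE.
    apply: measurable_funTS; apply: measurable_funM; first exact: relax_seq_m.
    exact: continuous_measurable_plane.
  move=> p Op; have [->|ne] := eqVneq (relax_seq n p) 0; first by rewrite mul0r normr0 mulr0.
  by rewrite normrM mulrC ler_wpM2r// KP//; exact: relax_seq_K ne.
have [j6 F6] := IntZ (- gam) j5.
have [_ F7] := IntD j4 j6.
have E6 : \int[leb2]_(p in O) (relax_seq n p * Phi p) =
    \int[leb2]_p (clamp_test T Phi p * (relax_seq n \_ O) p).
  rewrite Rintegral_mkcond; apply: eq_Rintegral => -[t y] _; rewrite !patchE.
  by case: ifPn => [|_]; [rewrite inE => Op; rewrite OE// mulrC|rewrite mulr0].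
rewrite E6 in F6; rewrite F6 F4 F2 F1 in F7.
have -> : \int[leb2]_(p in open_strip T)
      (eps * (e1N T (N n) (z n) p * dt T Phi p + e2N T (N n) (z n) p * dx Phi p) +
       rhoN (N n) (z n) p * F p * Phi p - gam * (relaxN T theta (N n) (z n) p * Phi p)) =
   eps * (\int[leb2]_(p in O) (e1_seq n p * dt T Phi p) +
       \int[leb2]_(p in O) (e2_seq n p * dx Phi p)) +
     \int[leb2]_(p in O) (rho_seq n p * FP p) +
     - gam * \int[leb2]_p (clamp_test T Phi p * (relax_seq n \_ O) p).
  rewrite -F7; apply: eq_Rintegral => p _.
  by rewrite mulNr /FP [rho_seq n p * _]mulrA.
by rewrite mulNr.
Qed.

End limit_equations.
Lemma lam_strip_integral (lam : @planar_measure R) (psi : R * R -> R) :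
  lam (~` box) = 0%E -> continuous (clamp_test T psi) ->
  \int[lam]_p clamp_test T psi p = \int[lam]_(p in strip T) psi p.
Proof.
move=> lam0 pc; have mS := @measurable_strip R T.
have mpc : measurable_fun setT (clamp_test T psi) by exact: continuous_measurable_plane.
transitivity (\int[lam]_(p in strip T) clamp_test T psi p); last first.
  apply: eq_Rintegral => -[t y]; rewrite inE => -[/= tT _].
  by rewrite /clamp_test /= clamp_id//; move: tT; rewrite in_itv.
rewrite [RHS]Rintegral_mkcond /Rintegral; congr fine.
apply: ae_eq_integral => //.
- exact/measurable_EFinP.
- apply/measurable_EFinP; apply/(measurable_restrict _ mS measurableT).
  by rewrite setTI; exact: measurable_funTS.
exists (~` box); split => //.
  by apply: measurableC; apply: compact_measurable_plane; exact: cpt_box.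
move=> p /=; apply: contra_not => bp _; rewrite patchE mem_set//.
by case: p bp => t y [].
Qed.

(** Clamping in time extends a test function on the strip to a continuous one on the plane. The
    slices t = 0 and t = T are negligible for the densities but not a priori for [lam], whose
    integral keeps the closed strip. *)
Lemma relax_weakstar (lam : @planar_measure R) : (lam setT < +oo)%E ->
  lam (~` box) = 0%E ->
  (forall psi : R * R -> R, continuous psi ->
    \int[leb2]_p (psi p * (relax_seq n \_ O) p) @[n --> \oo] --> \int[lam]_p psi p) ->
  cvg_weakstar_density (strip T) relax_seq lam.
Proof.
move=> lamT lam0 lamc; have mS := @measurable_strip R T.
have mbox : measurable box by apply: compact_measurable_plane; exact: cpt_box.
split.
- move=> n A cA AS.
  have c1 : continuous (fun _ : R * R => 1 : R) by move=> p; exact: cvg_cst.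
  have n1 : `|1 : R| <= 1 by rewrite normr1.
  have := relaxN_test_integrable T_gt0 eps_gt0 gam_gt0 (N_gt0 n) nonlin F_le (rt n) c1
    (fun p _ => n1).
  rewrite (_ : (fun p => 1 * _) = relax_seq n); last by apply/funext => p; rewrite mul1r.
  have mA := compact_measurable_plane cA.
  exact: (@integrableS _ _ _ (@leb2 R) _ _ _ mS mA AS).
- split.
    apply/eqP; rewrite eq_le measure_ge0 andbT -lam0.
    apply: le_measure; rewrite ?inE; [exact: measurableC|exact: measurableC|].
    by apply: subsetC => -[t y] [].
  move=> A cA; apply: le_lt_trans lamT; apply: le_measure; rewrite ?inE//.
  exact: compact_measurable_plane.
move=> psi psic [A [cA AS psi0]].
have pc : continuous (clamp_test T psi) by exact: clamp_strip_continuous.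
have [B B0 HB] : exists2 B, 0 < B & forall p, strip T p -> `|psi p| <= B.
  have [B B0 HB] := compact_bound cA (continuous_subspaceW AS psic).
  exists B => // p Sp; have [Ap|nAp] := pselect (A p); first exact: HB.
  by rewrite psi0// normr0 ltW.
have cS p : strip T (clamp T p.1, p.2) by split => //=; rewrite in_itv /= clamp_range.
rewrite -lam_strip_integral//.
rewrite (_ : (fun n => _) =
  (fun n => \int[leb2]_p (clamp_test T psi p * (relax_seq n \_ O) p))); first exact: lamc.
apply/funext => n.
have pE p : strip T p -> clamp_test T psi p = psi p.
  by case: p => t y [/= tT _]; rewrite /clamp_test /= clamp_id//; move: tT; rewrite in_itv.
have OS p : O p -> strip T p.
  by case: p => t y /inO/oc tT; split => //=; rewrite in_itv.
have i1 := relaxN_test_integrable T_gt0 eps_gt0 gam_gt0 (N_gt0 n) nonlin F_le (rt n) pc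
  (fun p _ => HB _ (cS p)).
transitivity (\int[leb2]_(p in strip T) (clamp_test T psi p * relax_seq n p)).
  by apply: eq_Rintegral => p; rewrite inE => Sp; rewrite pE.
have mf : measurable_fun (strip T) (fun p => clamp_test T psi p * relax_seq n p).
  by apply/measurable_EFinP; exact: (measurable_int _ i1).
have iO : leb2.-integrable (open_strip T) (EFin \o (fun p => clamp_test T psi p * relax_seq n p)).
  exact: (@integrableS _ _ _ (@leb2 R) _ _ _ mS measO OS i1).
have [_ ->] := strip_integral T_gt0 mf iO.
rewrite Rintegral_mkcond; apply: eq_Rintegral => p _.
by rewrite !patchE; case: ifP => _ //; rewrite mulr0.
Qed.

Lemma line_supp (f : R -> R) (C : R) : (forall y, 0 <= f y <= C * \1_K1 y) ->
  compact (ess_supp (almost_everywhere leb) setT f).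
Proof.
move=> fC; apply: (@subclosed_compact _ _ `[s, S]%classic).
- exact: closed_ess_supp.
- exact: segment_compact.
move=> y fy; apply: contrapT => ny.
have oU : open (~` `[s, S]%classic : set R) by apply: closed_openC; exact: interval_closed.
apply: (fy _ oU ny); apply: aeW => y' _ ny'; apply/eqP; rewrite eq_le.
have /andP[-> h] := fC y'; rewrite andbT (le_trans h)// indicE memNset ?mulr0//.
by move=> h'; apply: ny'; move: h'; rewrite /K1 /= !in_itv /= => /andP[-> /ltW].
Qed.

Let K1_C (f : R -> R) (C : R) : 0 <= C -> (forall y, 0 <= f y <= C * \1_K1 y) ->
  forall y, [set: R] y -> 0 <= f y <= C.
Proof.
move=> C0 fC y _; have /andP[-> h] := fC y; rewrite (le_trans h)// indicE ler_piMr//.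
by case: (_ \in _).
Qed.

Let K_C (f : R * R -> R) (C : R) : 0 <= C -> (forall p, 0 <= f p <= C * \1_K p) ->
  forall p, O p -> 0 <= f p <= C.
Proof.
move=> C0 fC p _; have /andP[-> h] := fC p; rewrite (le_trans h)// indicE ler_piMr//.
by case: (_ \in _).
Qed.

Lemma traffic_limit : exists (xlow xup : R -> R) (rho0 e10 : R -> R)
    (rho e1 e2 : R * R -> R) (lam : @planar_measure R),
  ({uniform `[0, T], (fun n => z n 0%N) @ \oo --> xlow} /\
   {uniform `[0, T], (fun n => z n (N n)) @ \oo --> xup}) /\
  (cvg_weakstar_Linfty leb setT rho0_seq rho0 /\
   cvg_weakstar_Linfty leb setT e10_seq e10) /\
  (cvg_weakstar_Linfty leb2 (open_strip T) rho_seq rho /\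
   cvg_weakstar_Linfty leb2 (open_strip T) e1_seq e1 /\
   cvg_weakstar_Linfty leb2 (open_strip T) e2_seq e2) /\
  cvg_weakstar_density (strip T) relax_seq lam /\
  (macroscopic_data rho0 e10 /\ (Linfty_norm leb setT rho0 <= rhobar%:E)%E) /\
  measure_solution T eps gam rhobar F rho0 e10 rho e1 e2 lam /\
  (let Q := \bigcup_(t in `[0, T]) ([set t] `*` `[xlow t, xup t]) in
   [/\ supp_on T rho `<=` Q, supp_on T e1 `<=` Q,
       supp_on T e2 `<=` Q & measure_supp lam `<=` Q]).
Proof.
have [xlow [xup [low_cvg up_cvg]]] := curve_limits.
have [rho [mrho rhoC rho_cvg rho_test]] :=
  @plane_limit 0 rhobar rb rho_seq_m rho_seq_C rho_seq_K.
have [e1 [me1 e1C e1_cvg e1_test]] :=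
  @plane_limit 1 (rhobar * W) rW e1_seq_m e1_seq_C e1_seq_K.
have [e2 [me2 e2C e2_cvg e2_test]] :=
  @plane_limit 2 (rhobar * W * W) rWW e2_seq_m e2_seq_C e2_seq_K.
have [rho0 [mrho0 rho0C rho0_cvg rho0_test]] :=
  line_limit rb rho0_seq_m rho0_seq_C rho0_seq_K (fun o => @Hc (inl (inr (inl o)))).
have [e10 [me10 e10C e10_cvg e10_test]] :=
  line_limit rW e10_seq_m e10_seq_C e10_seq_K (fun o => @Hc (inl (inr (inr o)))).
have [lam [lamT lam0 lam_cvg]] := relax_limit.
have rhoQ := plane_limit_supp low_cvg up_cvg rb rho_seq_supp mrho rhoC rho_cvg.
have e1Q := plane_limit_supp low_cvg up_cvg rW e1_seq_supp me1 e1C e1_cvg.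
have e2Q := plane_limit_supp low_cvg up_cvg rWW e2_seq_supp me2 e2C e2_cvg.
have lamQ := relax_limit_supp low_cvg up_cvg lamT lam_cvg.
have lamw := relax_weakstar lamT lam0 lam_cvg.
have cpt := compact_in_region low_cvg up_cvg.
exists xlow, xup, rho0, e10, rho, e1, e2, lam.
split; first by split; exact: uniform_cvg_distP.
do 3 (split; first by []).
split.
  split; last exact: (@Linfty_norm_le _ _ _ leb setT rho0 rhobar rb (K1_C rb rho0C)).
  split.
  - split; [by have [_ h _] := rho0_cvg|by have [_ h _] := e10_cvg].
  - by split; apply: ae_ge0_bounded; [exact: K1_C rb rho0C|exact: K1_C rW e10C].
  - exact: line_supp rho0C.
  - exact: line_supp e10C.
split; last by split.
split.
- by have [_ ? _] := rho_cvg.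
- by have [_ ? _] := e1_cvg.
- by have [_ ? _] := e2_cvg.
- exact: (@ae_ge0_bounded _ _ _ leb2 O rho rhobar (K_C rb rhoC)).
- exact: (@ae_ge0_bounded _ _ _ leb2 O e1 _ (K_C rW e1C)).
- exact: (@ae_ge0_bounded _ _ _ leb2 O e2 _ (K_C rWW e2C)).
- by have [_ ? _] := lamw.
- exact: (@Linfty_norm_le _ _ _ leb2 O rho rhobar rb (K_C rb rhoC)).
- by apply: cpt rhoQ; exact: closed_ess_supp.
- by apply: cpt e1Q; exact: closed_ess_supp.
- by apply: cpt e2Q; exact: closed_ess_supp.
- by apply: cpt lamQ; exact: closed_measure_supp.
- by move=> phi phiC1 phiT; apply: limit_mass.
- move=> phi phiC1 phiT; rewrite -(lam_strip_integral lam0).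
      exact: (limit_momentum phiC1 phiT mrho rhoC me1 e1C me2 e2C rho_test e1_test e2_test e10_test lam_cvg).
    by have [_ _] := test_cont T_gt0 phiC1.
Qed.

End traffic_sequence.

Theorem theorem2p11 (R : realType) (T eps gam rhobar s S C0 : R)
    (theta : R -> R) (F : R * R -> R)
    (x0 v0 : nat -> nat -> R) (x : nat -> nat -> R -> R)
    (T_gt0 : 0 < T) (eps_gt0 : 0 < eps) (gam_gt0 : 0 < gam)
    (s_gt0 : 0 < s) (S_gt0 : 0 < S) (C0_gt0 : 0 < C0)
    (nonlin : nonlinearity_assumptions T theta rhobar F)
    (data : forall N, (0 < N)%N ->
      data_assumptions T rhobar N (x0 N) (v0 N) (x N N))
    (bounds : forall N, (0 < N)%N ->
      data_bounds T rhobar s S C0 N (x0 N) (v0 N) (x N N))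
    (sol : forall N, (0 < N)%N ->
      microscopic_solution T eps gam theta rhobar F N (x0 N) (v0 N) (x N))
    (vbound : forall N, (0 < N)%N ->
      velocity_bound T gam theta rhobar F N (x0 N) (v0 N) (x N)) :
  exists phi : nat -> nat,
    (forall n, (0 < phi n)%N) /\ {homo phi : m n / (m < n)%N} /\
  exists (xlow xup : R -> R) (rho0 e10 : R -> R) (rho e1 e2 : R * R -> R)
      (lam : @planar_measure R),
    (* convergences (a)-(d) *)
    ({uniform `[0, T], (fun n => x (phi n) 0%N) @ \oo --> xlow} /\
     {uniform `[0, T], (fun n => x (phi n) (phi n)) @ \oo --> xup}) /\
    (cvg_weakstar_Linfty leb setT
       (fun n y => rhoN (phi n) (x (phi n)) (0, y)) rho0 /\
     cvg_weakstar_Linfty leb setT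
       (fun n y => e1N T (phi n) (x (phi n)) (0, y)) e10) /\
    (cvg_weakstar_Linfty leb2 (open_strip T)
       (fun n => rhoN (phi n) (x (phi n))) rho /\
     cvg_weakstar_Linfty leb2 (open_strip T)
       (fun n => e1N T (phi n) (x (phi n))) e1 /\
     cvg_weakstar_Linfty leb2 (open_strip T)
       (fun n => e2N T (phi n) (x (phi n))) e2) /\
    cvg_weakstar_density (strip T)
      (fun n p => e1N T (phi n) (x (phi n)) p /
                  theta (rhoN (phi n) (x (phi n)) p)) lam /\
    (* properties of the limits *)
    (macroscopic_data rho0 e10 /\
     (Linfty_norm leb setT rho0 <= rhobar%:E)%E) /\
    measure_solution T eps gam rhobar F rho0 e10 rho e1 e2 lam /\
    (let Q := \bigcup_(t in `[0, T]) ([set t] `*` `[xlow t, xup t]) in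
     [/\ supp_on T rho `<=` Q, supp_on T e1 `<=` Q,
         supp_on T e2 `<=` Q & measure_supp lam `<=` Q]).
Proof.
have [Th Th0 theta_le] := theta_bounded nonlin.
have [L L0 theta_lin] := theta_linear_bound nonlin.
have [M M0 F_le] := F_bounded nonlin s S (ltW T_gt0).
have rt N : (0 < N)%N ->
    regular_traffic T eps gam rhobar theta F s S (speed_bound gam C0 M Th) N (x N).
  move=> N0; exact: (micro_regular T_gt0 eps_gt0 gam_gt0 C0_gt0 M0 Th0 L0 N0 nonlin F_le
    theta_le theta_lin (data N N0) (bounds N N0) (sol N N0) (vbound N N0)).
(* The extraction runs over the shifted family n + 1, as the hypotheses concern N > 0; hence the
   successor in [phi]. *)
have [phi0 [_ phi_homo phi_cvg]] := diagonal_extraction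
  (extraction_bound T_gt0 eps_gt0 gam_gt0 (fun n => ltn0Sn n) nonlin F_le
     (fun n => rt n.+1 (ltn0Sn n))).
pose phi n := (phi0 n).+1; exists phi.
have phi_gt0 n : (0 < phi n)%N by [].
split; first exact: phi_gt0.
split; first by move=> m n mn; rewrite ltnS; exact: phi_homo.
apply: (traffic_limit T_gt0 eps_gt0 gam_gt0 phi_gt0 nonlin F_le (fun n => rt _ (phi_gt0 n))).
  case=> [[[q|q]|[q|q]]|[[k [a b]]|[k j]]].
  - exact: (phi_cvg (inl (inl (inl q)))).
  - exact: (phi_cvg (inl (inl (inr q)))).
  - exact: (phi_cvg (inl (inr (inl q)))).
  - exact: (phi_cvg (inl (inr (inr q)))).
  (* Which interpolant is meant depends on the variable [k], so the two sequences agree only after a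
     case analysis. *)
  - have E n : plane_seq T phi (fun n => x (phi n)) k n =
        plane_seq T succn (fun n => x n.+1) k (phi0 n).
      by rewrite /plane_seq; case: ifP => // _; case: ifP.
    suff -> : extraction_seq T s S theta phi (fun n => x (phi n)) (inr (inl (k, (a, b)))) =
        (fun n => extraction_seq T s S theta succn (fun n => x n.+1)
                    (inr (inl (k, (a, b)))) (phi0 n)) by exact: phi_cvg.
    by apply/funext => n; rewrite /extraction_seq /intw E.
  - exact: (phi_cvg (inr (inr (k, j)))).
by move=> n; rewrite (leq_trans (homo_ltn_ge phi_homo n)).
Qed.
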